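(* Let $K$ be a finitely generated abelian group and $R$ a finitely generated, integral, normal $\mathbb{K}$-algebra with an effective, factorial $K$-grading of complexity one and only constant invertible homogeneous elements. Then $R$ is isomorphic, as a graded algebra, to one of the $K_0$-graded $\mathbb{K}$-algebras $R(A,P_0)$ (of Type 1 or Type 2) defined in the context.
   Context: $\mathbb{K}$ is an algebraically closed field of characteristic zero. Construction of $R(A,P_0)$. Fix integers $r,n>0$, $m\ge 0$ and a partition $n=n_\iota+\ldots+n_r$ into positive integers, starting at $\iota\in\{0,1\}$. For each $\iota\le i\le r$ fix a tuple $l_i=(l_{i1},\ldots,l_{in_i})\in\mathbb{Z}_{>0}^{n_i}$ and define the monomial $T_i^{l_i}:=T_{i1}^{l_{i1}}\cdots T_{in_i}^{l_{in_i}}$ in the polynomial ring $\mathbb{K}[T_{ij},S_k]=\mathbb{K}[T_{ij},S_k;\ \iota\le i\le r,\ 1\le j\le n_i,\ 1\le k\le m]$. Type 1: $\iota=1$. Let $A=(a_1,\ldots,a_r)$ be a list of pairwise different elements of $\mathbb{K}$. Set $I:=\{1,\ldots,r-1\}$ and $g_i:=T_i^{l_i}-T_{i+1}^{l_{i+1}}-(a_{i+1}-a_i)$ for $i\in I$. Let $P_0$ be the $r\times(n+m)$ integer matrix whose $i$-th row ($1\le i\le r$) has $l_i$ in the $n_i$ positions corresponding to $T_{i1},\ldots,T_{in_i}$ and zeros elsewhere (in particular the last $m$ columns, corresponding to $S_1,\ldots,S_m$, are zero). Type 2: $\iota=0$. Let $A=(a_0,\ldots,a_r)$ be a $2\times(r+1)$-matrix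 over $\mathbb{K}$ with pairwise linearly independent columns $a_i\in\mathbb{K}^2$. Set $I:=\{0,\ldots,r-2\}$ and, for $i\in I$, let $g_i$ be the determinant of the $3\times3$ matrix with columns $(T_i^{l_i},a_i),(T_{i+1}^{l_{i+1}},a_{i+1}),(T_{i+2}^{l_{i+2}},a_{i+2})$ (first row the monomials, below it the vectors $a_i,a_{i+1},a_{i+2}$). Let $P_0$ be the $r\times(n+m)$ integer matrix whose $i$-th row ($1\le i\le r$) has $-l_0$ in the positions of $T_{01},\ldots,T_{0n_0}$, $l_i$ in the positions of $T_{i1},\ldots,T_{in_i}$, and zeros elsewhere. In both types let $P_0^*$ be the transpose of $P_0$, $K_0:=\mathbb{Z}^{n+m}/\mathrm{im}(P_0^* )$, and $Q\colon\mathbb{Z}^{n+m}\to K_0$ the projection. Let $\deg(T_{ij}):=Q(e_{ij})$, $\deg(S_k):=Q(e_k)$ with the canonical basis vectors $e_{ij},e_k\in\mathbb{Z}^{n+m}$ corresponding to the variables. The $g_i$ are homogeneous, and $R(A,P_0):=\mathbb{K}[T_{ij},S_k]/\langle g_i;\ i\in I\rangle$ is a $K_0$-graded algebra. Terminology. For a $K$-graded integral $\mathbb{K}$-algebra $R=\bigoplus_{w\in K}R_w$: the grading is effective if the $w\in K$ with $R_w\ne0$ generate $K$ as a group; it is of complexity one if $\dim_{\mathbb{Q}}(K\otimes\mathbb{Q})=\dim(R)-1$; a $K$-prime is a homogeneous non-zero non-unit which, whenever it divides a product of homogeneous elements, divides one of the factors; the grading is factorial if there is unique factorization in the multiplicative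 monoid of non-zero homogeneous elements, i.e. every non-zero homogeneous non-unit is a product of $K$-primes. ''Only constant invertible homogeneous elements'' means every homogeneous unit lies in $\mathbb{K}^*$. An isomorphism of a $K$-graded algebra $R$ with a $K_0$-graded algebra $R'$ is a $\mathbb{K}$-algebra isomorphism $\psi\colon R\to R'$ together with a group isomorphism $\tilde\psi\colon K\to K_0$ such that $\psi(R_w)=R'_{\tilde\psi(w)}$ for all $w\in K$. *)

(* Defs.v *)
From HB Require Import structures.
From mathcomp Require Import all_boot all_order all_algebra.
From mathcomp Require Import mpoly ring.
From mathcomp Require boolp.

Set Implicit Arguments.
Unset Strict Implicit.
Unset Printing Implicit Defensive.

Import GRing.Theory.
Local Open Scope ring_scope.
Local Open Scope quotient_scope.

#[short(type="idomainAlgType")]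
HB.structure Definition IntegralAlgebra (k : nzRingType) :=
  {R of GRing.ComUnitAlgebra k R & GRing.IntegralDomain R}.

Section QuotientAlgebra.

Variables (k : comNzRingType) (A : comAlgType k) (I : idealr A).
Local Notation Q := {ideal_quot I}.

Definition quot_scale (c : k) : Q -> Q := fun x => \pi_Q c%:A * x.

Lemma quot_scaleA a b x : quot_scale a (quot_scale b x) = quot_scale (a * b) x.
Proof. by rewrite /quot_scale mulrA -rmorphM -scalerAl mul1r scalerA. Qed.

Lemma quot_scale1 : left_id 1 quot_scale.
Proof. by move=> x; rewrite /quot_scale scale1r rmorph1 mul1r. Qed.

Lemma quot_scaleDr : right_distributive quot_scale +%R.
Proof. by move=> c x y; rewrite /quot_scale mulrDr. Qed.

Lemma quot_scaleDl x : {morph quot_scale^~ x : a b / a + b}.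
Proof. by move=> a b; rewrite /quot_scale scalerDl rmorphD mulrDl. Qed.

HB.instance Definition _ := GRing.Zmodule_isLmodule.Build k Q
  quot_scaleA quot_scale1 quot_scaleDr quot_scaleDl.

Lemma quot_scaleAl (c : k) (x y : Q) : c *: (x * y) = c *: x * y.
Proof. by rewrite /GRing.scale /= /quot_scale mulrA. Qed.

HB.instance Definition _ := GRing.Lmodule_isLalgebra.Build k Q quot_scaleAl.

Lemma quot_scaleAr (c : k) (x y : Q) : c *: (x * y) = x * (c *: y).
Proof. by rewrite mulrC quot_scaleAl mulrC. Qed.

HB.instance Definition _ := GRing.Lalgebra_isAlgebra.Build k Q quot_scaleAr.

End QuotientAlgebra.

Section GeneratedIdeal.

Variables (A : comNzRingType) (I : finType) (g : I -> A).

(* [asbool] makes membership boolean, as [idealr] requires. *)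
Definition gen_ideal : {pred A} :=
  fun f => boolp.asbool (exists c : I -> A, f = \sum_i c i * g i).

Lemma gen_ideal_closed : 1 \notin gen_ideal -> idealr_closed gen_ideal.
Proof.
move=> one_notin; split => //.
  apply/boolp.asboolP; exists (fun=> 0).
  by rewrite big1 // => i _; rewrite mul0r.
move=> a x y /boolp.asboolP[c ->] /boolp.asboolP[d ->]; apply/boolp.asboolP.
exists (fun i => a * c i + d i); rewrite mulr_sumr -big_split /=.
by apply: eq_bigr => i _; rewrite mulrDl mulrA.
Qed.

Lemma gen_ideal_proper (B : nzRingType) (f : {rmorphism A -> B}) :
  (forall i, f (g i) = 0) -> 1 \notin gen_ideal.
Proof.
move=> fg0; apply/boolp.asboolP => -[c /(congr1 f)].
rewrite rmorph1 rmorph_sum big1 => [|i _]; last by rewrite rmorphM fg0 mulr0.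
by move/eqP; rewrite oner_eq0.
Qed.

End GeneratedIdeal.

Section IntegerMatrixCokernel.

Variables (r N : nat) (P : 'M[int]_(r, N)).

Definition im_tr : {pred 'cV[int]_N} :=
  fun v => boolp.asbool (exists u : 'cV[int]_r, v = P^T *m u).

Lemma im_tr_zmod_closed : zmod_closed im_tr.
Proof.
split; first by apply/boolp.asboolP; exists 0; rewrite mulmx0.
move=> x y /boolp.asboolP[u ->] /boolp.asboolP[v ->]; apply/boolp.asboolP.
by exists (u - v); rewrite mulmxBr.
Qed.

HB.instance Definition _ := GRing.isZmodClosed.Build _ im_tr im_tr_zmod_closed.

Definition K0 : zmodType := Quotient.quot im_tr.

Definition Q : 'cV[int]_N -> K0 := \pi_K0.

Definition mdegK (t : 'X_{1..N}) : K0 := \sum_i Q (delta_mx i 0) *+ t i.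

Definition mhomog (k : nzRingType) (w : K0) (f : {mpoly k[N]}) : Prop :=
  forall t, t \in msupp f -> mdegK t = w.

End IntegerMatrixCokernel.

Section Blocks.

(* The polynomial ring K[T_ij, S_k] is {mpoly k[n + m]} where n is the sum of *)
(* the block sizes: the T_ij come first, ordered lexicographically by (i, j), *)
(* followed by the S_k. [lrow i] is the row of length n + m with the tuple l_i *)
(* in the positions of T_i1, ..., T_in_i and zeros elsewhere. *)
Variables (q : nat) (n_ : 'I_q -> nat) (l : forall i, 'I_(n_ i) -> nat).
Variable (m : nat).
Local Notation n := (\sum_i n_ i)%N.

Definition Tpos i (j : 'I_(n_ i)) : 'I_(n + m) := lshift m (tagnat.Rank i j).

Definition Tmon (k : nzRingType) i : {mpoly k[n + m]} :=
  \prod_(j < n_ i) 'X_(Tpos j) ^+ l j.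

Definition lrow i : 'rV[int]_(n + m) :=
  \row_c \sum_(j < n_ i) (l j)%:Z *+ (c == Tpos j).

Lemma meval_Tmon (k : comNzRingType) (v : 'I_(n + m) -> k) i :
  meval v (Tmon k i) = \prod_(j < n_ i) v (Tpos j) ^+ l j.
Proof.
by rewrite rmorph_prod; apply: eq_bigr => j _; rewrite rmorphXn /= mevalXU.
Qed.

End Blocks.

(* The number r of the construction is [r'.+1]. The blocks i = 1, ..., r of *)
(* Type 1 are shifted to 0, ..., r - 1. *)
Record type1 (k : closedFieldType) := Type1 {
  r1' : nat;
  n1 : 'I_r1'.+1 -> nat;
  n1_gt0 : forall i, (0 < n1 i)%N;
  l1 : forall i, 'I_(n1 i) -> nat;
  l1_gt0 : forall i (j : 'I_(n1 i)), (0 < l1 j)%N;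
  m1 : nat;
  A1 : 'I_r1'.+1 -> k;
  A1_inj : injective A1
}.

Record type2 (k : closedFieldType) := Type2 {
  r2' : nat;
  n2 : 'I_r2'.+2 -> nat;
  n2_gt0 : forall i, (0 < n2 i)%N;
  l2 : forall i, 'I_(n2 i) -> nat;
  l2_gt0 : forall i (j : 'I_(n2 i)), (0 < l2 j)%N;
  m2 : nat;
  A2 : 'M[k]_(2, r2'.+2);
  A2_free : forall i j, i != j -> free [:: col i A2; col j A2]
}.

Arguments r1' {k} t.
Arguments n1 {k} t i.
Arguments m1 {k} t.
Arguments l1 {k} t i j.
Arguments A1 {k} t i.
Arguments r2' {k} t.
Arguments n2 {k} t i.
Arguments m2 {k} t.
Arguments l2 {k} t i j.
Arguments A2 {k} t.

Section TypeOne.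

Variables (k : closedFieldType) (D : type1 k).
Local Notation r' := (r1' D).
Local Notation N := (\sum_i n1 D i + m1 D)%N.
Local Notation T := (Tmon (l1 D) (m1 D) k).

Definition g1 (i : 'I_r') : {mpoly k[N]} :=
  T (inord i) - T (inord i.+1) - (A1 D (inord i.+1) - A1 D (inord i))%:MP.

Definition P01 : 'M[int]_(r'.+1, N) :=
  \matrix_(i < r'.+1) lrow (l1 D) (m1 D) i.

Lemma g1_proper : 1 \notin gen_ideal g1.
Proof.
pose j0 i := Ordinal (n1_gt0 (t := D) i).
have root_ex i : exists y : k, y ^+ l1 D i (j0 i) = - A1 D i.
  have lgt0 := l1_gt0 (j0 i).
  have [y yP] :=
    solve_monicpoly (fun d => if d == 0%N then - A1 D i else 0) lgt0.
  exists y; rewrite yP; case: (l1 D i (j0 i)) lgt0 => // d _.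
  by rewrite big_ord_recl /= mulr1 big1 ?addr0 // => e _; rewrite mul0r.
have [y yP] := fin_all_exists root_ex.
pose v (c : 'I_N) := match split c with
  | inl s => let t := tagnat.sig s in
             if tagged t == j0 (tag t) then y (tag t) else 1
  | inr _ => 0 end.
have vT i : meval v (T i) = - A1 D i.
  have vE j : v (Tpos (m1 D) j) = if j == j0 i then y i else 1.
    by rewrite /v /Tpos (unsplitK (inl _)) tagnat.rankK.
  rewrite meval_Tmon (bigD1 (j0 i)) //= vE eqxx yP big1 ?mulr1 // => j jN.
  by rewrite vE (negPf jN) expr1n.
apply: (@gen_ideal_proper _ _ _ _ (meval v)) => i.
by rewrite /g1 !rmorphB /= !vT !mevalC; ring.
Qed.

Definition ideal1 := gen_ideal g1.

HB.instance Definition _ :=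
  isIdealr.Build _ ideal1 (gen_ideal_closed g1_proper).

Definition RAP1 : comAlgType k := {ideal_quot ideal1}.

Definition RAP1_homog (w : K0 P01) (x : RAP1) : Prop :=
  exists2 f : {mpoly k[N]}, mhomog w f & x = \pi f.

End TypeOne.

Section TypeTwo.

Variables (k : closedFieldType) (D : type2 k).
Local Notation r' := (r2' D).
Local Notation N := (\sum_i n2 D i + m2 D)%N.
Local Notation T := (Tmon (l2 D) (m2 D) k).

Definition g2 (i : 'I_r') : {mpoly k[N]} :=
  let idx (c : 'I_3) : 'I_r'.+2 := inord (i + c) in
  \det (col_mx (\row_c T (idx c))
               (map_mx (@mpolyC N k) (colsub idx (A2 D))) : 'M_3).

(* Row i stands for the row i + 1 of the matrix P_0, rows being numbered from 1. *)
Definition P02 : 'M[int]_(r'.+1, N) :=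
  \matrix_(i < r'.+1) (lrow (l2 D) (m2 D) (lift ord0 i)
                       - lrow (l2 D) (m2 D) ord0).

Lemma g2_proper : 1 \notin gen_ideal g2.
Proof.
have T0 i : meval (fun=> 0) (T i) = 0.
  rewrite meval_Tmon (bigD1 (Ordinal (n2_gt0 (t := D) i))) //=.
  by rewrite expr0n eqn0Ngt l2_gt0 mul0r.
apply: (@gen_ideal_proper _ _ _ _ (meval (fun=> 0))) => i.
rewrite /g2 -det_map_mx (expand_det_row _ ord0) big1 // => c _.
by rewrite !mxE; case: splitP => // j _; rewrite mxE [X in X * _]T0 mul0r.
Qed.

Definition ideal2 := gen_ideal g2.

HB.instance Definition _ :=
  isIdealr.Build _ ideal2 (gen_ideal_closed g2_proper).

Definition RAP2 : comAlgType k := {ideal_quot ideal2}.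

Definition RAP2_homog (w : K0 P02) (x : RAP2) : Prop :=
  exists2 f : {mpoly k[N]}, mhomog w f & x = \pi f.

End TypeTwo.

Definition generates (G : zmodType) (S : G -> Prop) : Prop :=
  forall H : G -> Prop, H 0 -> (forall x y, H x -> H y -> H (x - y)) ->
    (forall x, S x -> H x) -> forall x, H x.

Definition fg_group (G : zmodType) : Prop :=
  exists s : seq G, generates (fun x => x \in s).

Definition fg_algebra (k : comNzRingType) (R : comAlgType k) : Prop :=
  exists (N : nat) (x : 'I_N -> R),
    forall f, exists p : {mpoly k[N]}, f = mmap (in_alg R) x p.

Definition normal_domain (R : idomainType) : Prop :=
  forall x : {fraction R}, integralOver (@tofrac R) x ->
    exists a, x = tofrac a.

Definition prime_chain (R : comNzRingType) (d : nat) : Prop :=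
  exists p : 'I_d.+1 -> prime_idealr R, forall i j : 'I_d.+1, (i < j)%N ->
    {subset p i <= p j} /\ ~ {subset p j <= p i}.

Definition krull_dim (R : comNzRingType) (d : nat) : Prop :=
  prime_chain R d /\ ~ prime_chain R d.+1.

(* [(V, j)] is the rational vector space obtained from G by extension of *)
(* scalars, that is, G (x) QQ with the canonical map g |-> g (x) 1. *)
Definition is_tensor_rat (G : zmodType) (V : vectType rat)
    (j : {additive G -> V}) : Prop :=
  forall (W : lmodType rat) (f : {additive G -> W}),
    exists2 h : {linear V -> W}, (forall x, h (j x) = f x) &
      forall h' : {linear V -> W}, (forall x, h' (j x) = f x) -> h' =1 h.

Section Gradings.

Variables (k : closedFieldType) (G : zmodType) (R : idomainAlgType k).
Variable (Rw : G -> R -> Prop).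

Definition is_grading : Prop :=
  [/\ forall w, Rw w 0 /\ (forall c x y, Rw w x -> Rw w y -> Rw w (c *: x + y)),
      forall v w x y, Rw v x -> Rw w y -> Rw (v + w) (x * y),
      forall x, exists (s : seq G) (c : G -> R),
        (forall w, Rw w (c w)) /\ x = \sum_(w <- s) c w
    & forall (s : seq G) (c : G -> R), uniq s -> (forall w, Rw w (c w)) ->
        \sum_(w <- s) c w = 0 -> forall w, w \in s -> c w = 0].

Definition homogeneous (x : R) : Prop := exists w, Rw w x.

Definition effective_grading : Prop :=
  generates (fun w => exists2 x, Rw w x & x != 0).

Definition complexity_one : Prop :=
  exists (V : vectType rat) (j : {additive G -> V}),
    is_tensor_rat j /\ krull_dim R (\dim {:V}).+1.

Definition divides (x y : R) : Prop := exists z, y = z * x.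

Definition graded_prime (p : R) : Prop :=
  [/\ homogeneous p, p != 0, p \isn't a GRing.unit
    & forall x y, homogeneous x -> homogeneous y ->
        divides p (x * y) -> divides p x \/ divides p y].

Definition factorial_grading : Prop :=
  forall x, homogeneous x -> x != 0 -> x \isn't a GRing.unit ->
    exists s : seq R, (forall p, p \in s -> graded_prime p) /\
      x = \prod_(p <- s) p.

Definition only_constant_homog_units : Prop :=
  forall x, homogeneous x -> x \is a GRing.unit -> exists c : k, x = c%:A.

Definition graded_iso (G' : zmodType) (R' : algType k)
    (Rw' : G' -> R' -> Prop) : Prop :=
  exists (psi : {lrmorphism R -> R'}) (tpsi : {additive G -> G'}),
    [/\ bijective psi, bijective tpsi
      & forall w y, Rw' (tpsi w) y <-> exists2 x, Rw w x & psi x = y].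

End Gradings.

(* Main.v *)
(** Let F be the field of degree zero homogeneous fractions of R. Counting dimensions of spaces of
monomials shows that some degree w carries two linearly independent elements, and complexity one
forces F to have transcendence degree one over k.

Some pair of non-associated graded primes p, p' of equal degree satisfies F = k(p'/p). By factoriality it
suffices that no non-constant element of R_0 is integral over k[p'/p]. If R_0 = k any two primes of
a pencil in a minimal two-dimensional degree do. Otherwise R is defined over a finitely generated
field, so an automorphism of infinite order of k acts semilinearly on R, fixing the generators.
Since finitely many valuation rings of F lie over infinity, a power rho of it fixes each of them;
for a prime p the fraction rho(p)/p is then a unit at each of them, and any integral element of R_0
is constant.

The members of the pencil spanned by f = p' and g = p (or, if some member is a unit, by p and 1) are
pairwise coprime. Factoring those members that are divisible by one of finitely many prime
generators of R yields the variables T_ij and the exponents l_ij, the remaining generators are the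
S_k, and the linear relations between the members are the g_i. The degree relations and the ideal of
relations follow from unique factorization and from the transcendence of f/g. *)

Require Import Defs.
From HB Require Import structures.
From mathcomp Require Import all_boot all_order all_fingroup all_algebra.
From mathcomp Require Import mpoly ring zify.
From mathcomp Require boolp classical_sets.

Set Implicit Arguments.
Unset Strict Implicit.
Unset Printing Implicit Defensive.

Import GRing.Theory.
Local Open Scope ring_scope.

(** An element integral over k[p'/p] is finite wherever p'/p is, so p'/p has to be finite at every
    place where R_0 has poles. Taking p' = rho(p), with rho semilinear and trivial on monomials,
    gives p' the degree of p and the same values at infinity. Such a rho must move k, and must have
    infinite order, because only an uncontrolled power of it fixes the places at infinity and that
    power still has to move a constant. To find it, take a subfield E of k that contains a square
    root of -1 and is maximal among those missing some theta with theta^2 in E: k is algebraic over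
    E, and every extension of theta -> -theta over E has infinite order. Such a theta exists because
    a homomorphism v to the integers with v(2) non-zero, carried from the rationals to finitely
    generated fields by norms, limits how often a square root of 2 can be taken. The Krull dimension
    is used in both directions: prime chains yield independent elements by a direct choice, while
    independent fractions yield prime chains by going up from a polynomial ring. *)

Lemma zorn_above (T : Type) (A0 : T -> Prop) (P : (T -> Prop) -> Prop) :
  P A0 ->
  (forall C : (T -> Prop) -> Prop, (exists X, C X) ->
     (forall X, C X -> P X) ->
     (forall X Y, C X -> C Y ->
        (forall t, X t -> Y t) \/ (forall t, Y t -> X t)) ->
     P (fun t => exists2 X, C X & X t)) ->
  exists A, [/\ P A, forall t, A0 t -> A t &
    forall B, P B -> (forall t, A t -> B t) -> forall t, B t -> A t].
Proof.
move=> PA0 chainP.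
(* The union with [A0] turns the empty chain, whose union is empty, into the case [P A0]; hence the
   chain condition need only cover non-empty chains. *)
pose P' (X : T -> Prop) := P (fun t => A0 t \/ X t).
have [C CP' Ctot|A [PA maxA]] := @classical_sets.Zorn_bigcup T P'.
  have [[X0 CX0]|C0] := boolp.EM (exists X, C X); last first.
    rewrite /P'; have -> : (fun t => A0 t \/ classical_sets.bigcup C id t) = A0.
      apply: boolp.funext => t; apply: boolp.propext; split; last by left.
      by case=> // -[X CX _]; case: C0; exists X.
    by [].
  pose C' Y := exists2 X, C X & Y = (fun t => A0 t \/ X t).
  have -> : P' (classical_sets.bigcup C id) =
            P (fun t => exists2 Y, C' Y & Y t).
    congr (P _); apply: boolp.funext => t; apply: boolp.propext; split.
      case=> [A0t|[X CX Xt]]; first by exists (fun t => A0 t \/ X0 t); [exists X0|left].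
      by exists (fun t => A0 t \/ X t); [exists X|right].
    by case=> _ [X CX ->] [] Xt; [left|right; exists X].
  apply: chainP.
  - by exists (fun t => A0 t \/ X0 t), X0.
  - by move=> _ [X CX ->]; apply: CP'.
  - move=> _ _ [X CX ->] [Y CY ->].
    by case: (Ctot X Y CX CY) => XY; [left|right] => t [] ?; [left|right; apply: XY|left|right; apply: XY].
exists (fun t => A0 t \/ A t); split=> //; first by left.
move=> B PB AB t Bt; apply: boolp.contrapT => nAt.
apply: (maxA B).
  split; first by move=> s As; apply: AB; right.
  by move/(_ t Bt) => At; apply: nAt; right.
rewrite /P'; have -> // : (fun t => A0 t \/ B t) = B.
apply: boolp.funext => s; apply: boolp.propext; split; last by right.
by case=> // A0s; apply: AB; left.
Qed.

(** * Prime ideals of subrings and going up *)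

Section PrimeIdeals.

Variable (A : comNzRingType).

(** Predicates on one ambient ring instead of bundled structures: the subrings and ideals below vary
    inside a fixed field and are produced by Zorn's lemma. *)
Record subring (D : A -> Prop) : Prop := Subring {
  subring1 : D 1;
  subringB : forall x y, D x -> D y -> D (x - y);
  subringM : forall x y, D x -> D y -> D (x * y) }.

Record ideal_of (D I : A -> Prop) : Prop := IdealOf {
  ideal_sub : forall x, I x -> D x;
  ideal0 : I 0;
  idealD : forall x y, I x -> I y -> I (x + y);
  idealM : forall a x, D a -> I x -> I (a * x) }.

Record prime_of (D I : A -> Prop) : Prop := PrimeOf {
  prime_ideal : ideal_of D I;
  prime1 : ~ I 1;
  primeM : forall x y, D x -> D y -> I (x * y) -> I x \/ I y }.

Variable (D : A -> Prop).
Hypothesis (Dring : subring D).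

Lemma subring0 : D 0. Proof. by rewrite -(subrr 1); apply: (subringB Dring); apply: (subring1 Dring). Qed.
Lemma subringN x : D x -> D (- x).
Proof. by rewrite -sub0r; apply: (subringB Dring); apply: subring0. Qed.
Lemma subringD x y : D x -> D y -> D (x + y).
Proof. by move=> Dx /subringN Dy; rewrite -[y]opprK; apply: (subringB Dring). Qed.
Lemma subringX x n : D x -> D (x ^+ n).
Proof.
by move=> Dx; elim: n => [|n IH]; rewrite ?expr0 ?exprS; [apply: (subring1 Dring)|apply: (subringM Dring)].
Qed.

Lemma idealN (I : A -> Prop) x : ideal_of D I -> I x -> I (- x).
Proof. 
by move=> Iid Ix; rewrite -mulN1r; apply: (idealM Iid) => //; apply/subringN/(subring1 Dring).
Qed.

Lemma idealB (I : A -> Prop) x y : ideal_of D I -> I x -> I y -> I (x - y).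
Proof. by move=> Iid Ix Iy; apply: (idealD Iid) => //; apply: idealN. Qed.

Lemma primeX (I : A -> Prop) x n : prime_of D I -> D x -> I (x ^+ n) -> I x.
Proof.
move=> Ipr Dx; elim: n => [|n IH]; first by rewrite expr0 => /(prime1 Ipr).
by rewrite exprS => /(primeM Ipr Dx (subringX n Dx)) [].
Qed.

(* Krull: an ideal maximal among those avoiding a multiplicative set is prime. *)
Lemma exists_prime_avoiding (I S : A -> Prop) :
  ideal_of D I -> (forall x, S x -> D x) -> S 1 ->
  (forall x y, S x -> S y -> S (x * y)) -> (forall x, I x -> ~ S x) ->
  exists Q, [/\ prime_of D Q, forall x, I x -> Q x & forall x, Q x -> ~ S x].
Proof.
move=> Iid SD S1 SM IS.
have [||Q [[Qid QS] IQ Qmax]] :=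
    zorn_above (A0 := I) (P := fun J => ideal_of D J /\ forall x, J x -> ~ S x).
- by [].
- move=> C [X0 CX0] CP Ctot; split; last by move=> x [X /CP[_]]; apply.
  split.
  + by move=> x [X /CP[Xid _] Xx]; apply: (ideal_sub Xid).
  + by exists X0 => //; case: (CP _ CX0) => Xid _; apply: (ideal0 Xid).
  + move=> x y [X CX Xx] [Y CY Yy].
    have [Xid _] := CP _ CX; have [Yid _] := CP _ CY.
    case: (Ctot X Y CX CY) => XY; [exists Y|exists X] => //.
      exact: (idealD Yid) (XY _ Xx) Yy.
    exact: (idealD Xid) Xx (XY _ Yy).
  + by move=> a x Da [X CX Xx]; exists X => //; case: (CP _ CX) => Xid _; apply: (idealM Xid).
exists Q; split=> //.
have adj x : D x -> ~ Q x -> exists q a, [/\ Q q, D a & S (q + a * x)].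
  move=> Dx nQx; apply: boolp.contrapT => H; apply: nQx.
  apply: (Qmax (fun z => exists q a, [/\ Q q, D a & z = q + a * x])).
  - split; first split.
    + move=> _ [q [a [Qq Da ->]]]; apply: subringD; first exact: (ideal_sub Qid).
      exact: (subringM Dring).
    + by exists 0, 0; rewrite mul0r addr0; split; [apply: (ideal0 Qid)|apply: subring0|].
    + move=> _ _ [q [a [Qq Da ->]]] [q' [a' [Qq' Da' ->]]].
      exists (q + q'), (a + a'); split; [exact: (idealD Qid)|exact: subringD|by ring].
    + move=> c _ Dc [q [a [Qq Da ->]]]; exists (c * q), (c * a).
      by split; [apply: (idealM Qid)|apply: (subringM Dring)|ring].
    + by move=> _ [q [a [Qq Da ->]]] Sz; apply: H; exists q, a.
  - by move=> t Qt; exists t, 0; rewrite mul0r addr0; split=> //; apply: subring0.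
  - by exists 0, 1; rewrite mul1r add0r; split; [apply: (ideal0 Qid)|apply: (subring1 Dring)|].
split=> // [/QS //|x y Dx Dy Qxy].
apply: boolp.contrapT => /boolp.not_orP[/(adj x Dx)[q [a [Qq Da Sx]]] /(adj y Dy)[q' [a' [Qq' Da' Sy]]]].
apply: (QS ((q + a * x) * (q' + a' * y))); last exact: SM.
have -> : (q + a * x) * (q' + a' * y) = (q' + a' * y) * q + (a * x) * q' + (a * a') * (x * y) by ring.
apply: (idealD Qid); first apply: (idealD Qid).
- apply: (idealM Qid) => //; apply: subringD; first exact: (ideal_sub Qid).
  exact: (subringM Dring).
- by apply: (idealM Qid) => //; apply: (subringM Dring).
- by apply: (idealM Qid) => //; apply: (subringM Dring).
Qed.

End PrimeIdeals.

Lemma subring_all (A : comNzRingType) : subring (fun _ : A => True).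
Proof. by []. Qed.

(** Multiplying the equation of [g], of degree n + 1, by the n-th power of its leading coefficient a
    makes it monic in a g; the i-th lower coefficient acquires the factor a^(n - i). *)
Lemma integral_lead (B : idomainType) (E : fieldType) (phi : {rmorphism B -> E})
  (p : {poly B}) (g : E) : injective phi -> p != 0 -> root (map_poly phi p) g ->
  integralOver phi (phi (lead_coef p) * g).
Proof.
move=> phi_inj p0 /rootP pg0.
have sp : size (map_poly phi p) = size p by apply: size_map_inj_poly; rewrite ?rmorph0.
case Dn: (size p) => [|[|n]]; first by move/eqP: Dn; rewrite size_poly_eq0 (negPf p0).
  move/eqP/size_poly1P: Dn => [c c0 Dp]; move: pg0; rewrite Dp map_polyC hornerC.
  by move/eqP; rewrite -(rmorph0 phi) (inj_eq phi_inj) (negPf c0).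
set a := lead_coef p.
pose q : {poly B} := ('X^(n.+1) + \poly_(i < n.+1) (p`_i * a ^+ (n - i)))%R.
exists q.
  by apply/monicP; rewrite lead_coefDl ?lead_coefXn // size_polyXn ltnS size_poly.
apply/rootP; rewrite rmorphD /= map_polyXn hornerD hornerXn.
rewrite (_ : map_poly phi (\poly_(i < n.+1) _) =
   \poly_(i < n.+1) (phi (p`_i * a ^+ (n - i)))); last first.
  by apply/polyP => i; rewrite coef_map /= !coef_poly; case: ifP => // _; apply: rmorph0.
rewrite horner_poly.
have E0 : phi a ^+ n * (map_poly phi p).[g] = 0 by rewrite pg0 mulr0.
rewrite -[RHS]E0 horner_coef sp Dn [in RHS]big_ord_recr /= coef_map /= mulrDr [RHS]addrC.
congr (_ + _).
  by rewrite /a lead_coefE Dn exprMn exprSr; ring.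
rewrite mulr_sumr; apply: eq_bigr => i _; rewrite coef_map /= rmorphM rmorphXn.
have -> : phi a ^+ n = phi a ^+ (n - i) * phi a ^+ i.
  by rewrite -exprD subnK // -ltnS.
by rewrite exprMn; ring.
Qed.

Section GoingUp.

Variables (B : idomainType) (E : fieldType) (phi : {rmorphism B -> E}).
Variables (D : E -> Prop) (h : B).
Hypothesis (Dring : subring D) (phiD : forall x, D (phi x)).
Hypothesis (D_int : forall z, D z -> exists M, integralOver phi (phi h ^+ M * z)).

Definition contracts (Q : E -> Prop) (P : B -> Prop) := forall x, Q (phi x) <-> P x.

(** The ideal Q + pi D misses the image of the complement of P', so [exists_prime_avoiding] provides
    Q'. Indeed, if q + pi z = s, the integral equation of h^M z, rescaled by pi^n, is an equation of
    pi h^M z, which is congruent to h^M s modulo Q. Read in B and modulo P', it puts (h^M s)^n in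
    P'. *)
Lemma going_up (P P' : B -> Prop) (Q : E -> Prop) (pi : B) :
  prime_of (fun _ => True) P -> prime_of (fun _ => True) P' ->
  (forall x, P' x <-> exists y z, P y /\ x = y + pi * z) -> ~ P' h ->
  prime_of D Q -> contracts Q P ->
  exists Q', [/\ prime_of D Q', contracts Q' P' & forall x, Q x -> Q' x].
Proof.
move=> Ppr P'pr P'E nP'h Qpr QP.
have PP' x : P x -> P' x by move=> Px; apply/P'E; exists x, 0; rewrite mulr0 addr0.
have P'id := prime_ideal P'pr; have Qid := prime_ideal Qpr.
have Ppi : P' pi by apply/P'E; exists 0, 1; rewrite mulr1 add0r; split=> //; apply: (ideal0 (prime_ideal Ppr)).
pose I x := exists q z, [/\ Q q, D z & x = q + phi pi * z].
pose S x := exists2 s, ~ P' s & x = phi s.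
have [||||x [q [z [Qq Dz ->]]] [s nP's Es]|Q' [Q'pr IQ' Q'S]] := @exists_prime_avoiding _ _ Dring I S.
- split.
  + move=> _ [q [z [Qq Dz ->]]]; apply: (subringD Dring); first exact: (ideal_sub Qid).
    exact: (subringM Dring).
  + by exists 0, 0; rewrite mulr0 addr0; split; [apply: (ideal0 Qid)|apply: (subring0 Dring)|].
  + move=> _ _ [q [z [Qq Dz ->]]] [q' [z' [Qq' Dz' ->]]].
    by exists (q + q'), (z + z'); split; [apply: (idealD Qid)|apply: (subringD Dring)|ring].
  + move=> a _ Da [q [z [Qq Dz ->]]].
    by exists (a * q), (a * z); split; [apply: (idealM Qid)|apply: (subringM Dring)|ring].
- by move=> _ [s _ ->].
- by exists 1; [apply: (prime1 P'pr)|rewrite rmorph1].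
- move=> _ _ [s nP's ->] [t nP't ->]; exists (s * t); last by rewrite rmorphM.
  by move/(primeM P'pr Logic.I Logic.I) => [].
- have [M [p pmon /rootP pz]] := D_int Dz.
  pose n := (size p).-1.
  have np : size p = n.+1 by rewrite /n prednK // size_poly_gt0 monic_neq0.
  pose xi := \sum_(i < n.+1) p`_i * pi ^+ (n - i) * (h ^+ M * s) ^+ i.
  pose w := phi pi * (phi h ^+ M * z).
  have Dh : D (phi h ^+ M) by apply: (subringX Dring).
  have Dw : D w by do 2!apply: (subringM Dring) => //.
  have Q1 : Q (phi (h ^+ M * s) - w).
    rewrite rmorphM rmorphXn -Es /w.
    have -> : phi h ^+ M * (q + phi pi * z) - phi pi * (phi h ^+ M * z) = phi h ^+ M * q by ring.
    exact: (idealM Qid).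
  have QX i : Q (phi (h ^+ M * s) ^+ i - w ^+ i).
    rewrite subrXX mulrC; apply: (idealM Qid) => //.
    elim/big_ind: _ => [|u v|j _]; [exact: (subring0 Dring)|exact: (subringD Dring)|].
    by apply: (subringM Dring); apply: (subringX Dring).
  have Qxi : Q (phi xi).
    have -> : phi xi = \sum_(i < n.+1) phi (p`_i * pi ^+ (n - i)) * (phi (h ^+ M * s) ^+ i - w ^+ i).
      have E0 : phi pi ^+ n * (map_poly phi p).[phi h ^+ M * z] = 0 by rewrite pz mulr0.
      rewrite -[LHS]subr0 -[in LHS]E0 rmorph_sum.
      rewrite (@horner_coef_wide _ n.+1); last by rewrite -np size_poly.
      rewrite mulr_sumr -sumrB; apply: eq_bigr => i _.
      rewrite coef_map /= [phi (_ * (h ^+ M * s) ^+ i)]rmorphM rmorphXn /= mulrBr; congr (_ - _).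
      have -> : phi pi ^+ n = phi pi ^+ (n - i) * phi pi ^+ i.
        by rewrite -exprD subnK // -ltnS.
      by rewrite /w !rmorphM !rmorphXn /= [(phi pi * _) ^+ _]exprMn; ring.
    elim/big_ind: _ => [|u v|j _]; [exact: (ideal0 Qid)|exact: (idealD Qid)|].
    exact: (idealM Qid).
  move/QP/PP': Qxi; rewrite /xi big_ord_recr /= subnn expr0 mulr1.
  have -> : p`_n = 1 by apply/eqP; move/monicP: pmon; rewrite lead_coefE np /= => ->.
  rewrite mul1r => P'xi.
  have P'sum : P' (\sum_(i < n) p`_i * pi ^+ (n - i) * (h ^+ M * s) ^+ i).
    elim/big_ind: _ => [|u v|j _]; [exact: (ideal0 P'id)|exact: (idealD P'id)|].
    rewrite mulrAC -[(n - j)%N]prednK ?subn_gt0 // exprSr mulrA.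
    exact: (idealM P'id).
  have : P' ((h ^+ M * s) ^+ n).
    by have := idealB (subring_all B) P'id P'xi P'sum; rewrite addrC addrK.
  move/(primeX (subring_all B) P'pr Logic.I)/(primeM P'pr Logic.I Logic.I) => [|//].
  by move/(primeX (subring_all B) P'pr Logic.I).
exists Q'; split=> //.
  move=> x; split=> [Q'x|/P'E[y [z [Py ->]]]].
    by apply: boolp.contrapT => nP'x; apply: (Q'S _ Q'x); exists x.
  by apply: IQ'; exists (phi y), (phi z); rewrite rmorphD rmorphM; split=> //; apply/QP.
by move=> x Qx; apply: IQ'; exists x, 0; rewrite mulr0 addr0; split=> //; apply: (subring0 Dring).
Qed.

Lemma going_up_chain t (P : nat -> B -> Prop) (pi : nat -> B) :
  injective phi -> (forall x, P 0%N x <-> x = 0) ->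
  (forall i, (i <= t)%N -> prime_of (fun _ => True) (P i)) ->
  (forall i x, (i < t)%N -> (P i.+1 x <-> exists y z, P i y /\ x = y + pi i * z)) ->
  (forall i, (i <= t)%N -> ~ P i h) ->
  exists Q : nat -> E -> Prop,
    (forall i, (i <= t)%N -> prime_of D (Q i) /\ contracts (Q i) (P i)) /\
    (forall i x, (i < t)%N -> Q i x -> Q i.+1 x).
Proof.
move=> phi_inj P0; elim: t => [|t IH] Ppr PE Ph.
  exists (fun _ x => x = 0); split=> // i; rewrite leqn0 => /eqP ->; split.
    split.
    - split=> [_ -> | // | x y -> ->|a x _ ->]; rewrite ?addr0 ?mulr0 //.
      exact: (subring0 Dring).
    - by move/eqP; rewrite oner_eq0.
    - by move=> x y _ _ /eqP; rewrite mulf_eq0 => /orP[] /eqP; [left|right].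
  by move=> x; rewrite P0 -(rmorph0 phi); split=> [/phi_inj|->].
have [|||Q [Qpr Qsub]] := IH.
- by move=> i it; apply/Ppr/leqW.
- by move=> i x it; apply/PE/leqW.
- by move=> i it; apply/Ph/leqW.
have [Qt QPt] := Qpr t (leqnn t).
have [Q' [Q'pr Q'P QQ']] := going_up (Ppr t (leqnSn t)) (Ppr t.+1 (leqnn _))
  (fun x => PE t x (leqnn _)) (Ph t.+1 (leqnn _)) Qt QPt.
exists (fun i => if (i <= t)%N then Q i else Q'); split=> i.
  case: (leqP i t) => [it _|ti it]; first exact: Qpr.
  by have -> : i = t.+1 by apply/eqP; rewrite eqn_leq it.
move=> x; rewrite ltnS => it; rewrite [(i <= t)%N]it; case: (ltnP i t) => [lt|ti]; first exact: Qsub.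
have -> : i = t by apply/eqP; rewrite eqn_leq it.
exact: QQ'.
Qed.

End GoingUp.

(** * Polynomial rings, prime chains and algebraic independence *)

Fixpoint iterpoly (k : idomainType) (t : nat) : idomainType :=
  if t is t'.+1 then {poly iterpoly k t'} else k.

Fixpoint iterC (k : idomainType) (t : nat) : {rmorphism k -> iterpoly k t} :=
  if t is t'.+1 return {rmorphism k -> iterpoly k t} then @polyC (iterpoly k t') \o iterC k t'
  else idfun.

Section IterPoly.

Variable (k : idomainType).
Hypothesis (k_char0 : [pchar k] =i pred0).

(** In characteristic zero the natural numbers stay distinct in k, and [size p] of them cannot all
    be roots. *)
Lemma nonroot (t : nat) (p : {poly iterpoly k t}) : p != 0 ->
  exists c : k, p.[iterC k t c] != 0.
Proof.
move=> p0; apply: boolp.contrapT => H.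
have Hr c : root p (iterC k t c).
  by apply/rootP/eqP; case: (boolP (_ == _)) => // nr; case: H; exists c.
pose s := [seq iterC k t i%:R | i <- iota 0 (size p)].
have inj : injective (fun i : nat => iterC k t i%:R).
  have iterC_inj : injective (iterC k t).
    elim: {p p0 H Hr s} t => [//|t IH] x y /= /polyC_inj; exact: IH.
  move=> i j /iterC_inj; wlog lij : i j / (i <= j)%N.
    by move=> W; case/orP: (leq_total i j) => [/W|/W H' /esym/H' ->].
  move/eqP; rewrite eq_sym -subr_eq0 -natrB // ((pcharf0P k).1 k_char0) subn_eq0 => ji.
  by apply/eqP; rewrite eqn_leq lij.
have us : uniq s by rewrite map_inj_uniq // iota_uniq.
have rs : all (root p) s by apply/allP => _ /mapP[i _ ->]; apply: Hr.
by have := max_poly_roots p0 rs us; rewrite size_map size_iota ltnn.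
Qed.

(** Fix c in k with h(c) non-zero. The zero ideal, followed by the preimages under evaluation at c
    of a chain that avoids h(c), is a chain one step longer. Each member is generated by its
    predecessor and one element, which is the form needed for [going_up]. *)
Lemma iterpoly_chain t (h : iterpoly k t) : h != 0 ->
  exists (P : nat -> iterpoly k t -> Prop) (pi : nat -> iterpoly k t),
    [/\ forall x, P 0%N x <-> x = 0,
        forall i, (i <= t)%N -> prime_of (fun _ => True) (P i),
        forall i x, (i < t)%N -> (P i.+1 x <-> exists y z, P i y /\ x = y + pi i * z),
        forall i, (i < t)%N -> ~ P i (pi i)
      & forall i, (i <= t)%N -> ~ P i h].
Proof.
elim: t h => [|t IH] h h0.
  exists (fun _ x => x = 0), (fun _ => 0); split=> // [i _|i _]; last exact/eqP.
  split; first by split=> // [x y -> ->|a x _ ->]; rewrite ?addr0 ?mulr0.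
    by move/eqP; rewrite oner_eq0.
  by move=> x y _ _ /eqP; rewrite mulf_eq0 => /orP[] /eqP; [left|right].
have [c hc] := nonroot h0.
have [P [pi [P0 Ppr PE Ppi Ph]]] := IH _ hc.
pose ev (x : {poly iterpoly k t}) := x.[iterC k t c].
exists (fun i x => if i is i'.+1 then P i' (ev x) else x = 0).
exists (fun i => if i is i'.+1 then (pi i')%:P else 'X - (iterC k t c)%:P); split.
- by [].
- case=> [_|i it].
    split; first by split=> // [x y -> ->|a x _ ->]; rewrite ?addr0 ?mulr0.
      by move/eqP; rewrite oner_eq0.
    by move=> x y _ _ /eqP; rewrite mulf_eq0 => /orP[] /eqP; [left|right].
  have Pi := Ppr i it; have Pid := prime_ideal Pi; split.
  + split=> //; rewrite /ev.
    * by rewrite horner0; apply: (ideal0 Pid).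
    * by move=> x y; rewrite hornerD; apply: (idealD Pid).
    * by move=> a x _; rewrite hornerM; apply: (idealM Pid).
  + by rewrite /ev hornerC; apply: (prime1 Pi).
  + by move=> x y _ _; rewrite /ev hornerM; apply: (primeM Pi).
- case=> [|i] x it.
    rewrite P0 /ev; split=> [/rootP/factor_theorem[q ->]|[y [z [-> ->]]]].
      by exists 0, q; rewrite add0r mulrC.
    by rewrite add0r hornerM hornerXsubC subrr mul0r.
  rewrite (PE i _ it); split=> [[y [z [Py Ex]]]|[y [z [Py ->]]]].
    exists (x - (pi i)%:P * z%:P), z%:P; rewrite subrK; split=> //.
    by rewrite /ev hornerD hornerN hornerM !hornerC -/(ev x) Ex addrK.
  by exists (ev y), (ev z); rewrite /ev hornerD hornerM hornerC.
- case=> [_|i it]; first by apply/eqP; rewrite polyXsubC_eq0.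
  by rewrite /ev hornerC; apply: Ppi.
- case=> [_|i it]; [exact/eqP|exact: Ph].
Qed.

Lemma integral_algebraic_tower (E : fieldType) (B B' : nzRingType) (j : {rmorphism B -> B'})
    (phi : {rmorphism B -> E}) (phi' : {rmorphism B' -> E}) z :
  phi' \o j =1 phi -> integralOver phi z -> integralOver phi' z.
Proof.
move=> Ej [p pmon pz]; exists (map_poly j p); first exact: monic_map.
by rewrite -map_poly_comp (eq_map_poly Ej).
Qed.

(* A transcendence basis is extracted greedily from the generators. *)
Lemma extend_basis (E : fieldType) (iota : {rmorphism k -> E}) t
    (phi : {rmorphism iterpoly k t -> E}) (D : E -> Prop) (gs : seq E) :
  injective phi -> phi \o iterC k t =1 iota ->
  subring D -> (forall x, D (phi x)) -> (forall g, g \in gs -> D g) ->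
  exists t' (phi' : {rmorphism iterpoly k t' -> E}) (h : iterpoly k t'),
    [/\ (t <= t')%N, injective phi' /\ phi' \o iterC k t' =1 iota,
        forall x, D (phi' x), h != 0 &
        forall g, g \in gs -> integralOver phi' (phi' h * g)].
Proof.
move=> phi_inj phi_k Dring Dphi; elim: gs => [_|g gs IH Dgs].
  by exists t, phi, 1; split=> //; rewrite oner_eq0.
have [x xgs|t' [phi' [h [tt' [inj' k'] D' h0 int']]]] := IH.
  by apply: Dgs; rewrite inE xgs orbT.
have comm : commr_rmorph phi' g by move=> x; apply: mulrC.
pose psi : {rmorphism {poly iterpoly k t'} -> E} := horner_morph comm.
have psiC x : psi x%:P = phi' x by apply: horner_morphC.
have [psi_inj|] := boolp.EM (forall p, psi p = 0 -> p = 0).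
  exists t'.+1, psi, h%:P; split.
  - exact: leqW.
  - split; last by move=> x; rewrite -k'; apply: psiC.
    by move=> x y /eqP; rewrite -subr_eq0 -rmorphB => /eqP/psi_inj/eqP; rewrite subr_eq0 => /eqP.
  - have Dg : D g by apply: Dgs; rewrite inE eqxx.
    elim/poly_ind => [|p c Dp]; first by rewrite rmorph0; apply: (subring0 Dring).
    rewrite rmorphD rmorphM /= psiC (_ : psi 'X = g); last exact: horner_morphX.
    by apply: (subringD Dring) => //; apply: (subringM Dring).
  - by rewrite polyC_eq0.
  - have tow := @integral_algebraic_tower E _ _ (@polyC (iterpoly k t')) phi' psi.
    move=> x; rewrite inE => /orP[/eqP -> {x}|xs].
      have psiX : psi 'X = g by apply: horner_morphX.
      by rewrite -[g in _ * g]psiX -rmorphM; apply: (integral_id psi).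
    by rewrite psiC; apply: tow; [exact: psiC|exact: int'].
move/boolp.existsNP => [p /boolp.not_implyP[pg /eqP p0]].
(* Here [g] is algebraic over the elements chosen so far; the leading coefficient of its equation
   joins the denominator [h]. *)
exists t', phi', (h * lead_coef p); split=> //.
  by rewrite mulf_neq0 // lead_coef_eq0.
move=> x; rewrite inE => /orP[/eqP -> {x}|xs]; rewrite rmorphM.
  rewrite -mulrA; apply: integral_mul; first exact: integral_id.
  by apply: integral_lead => //; apply/rootP.
rewrite mulrAC; apply: integral_mul; last exact: integral_id.
exact: int'.
Qed.

End IterPoly.

Section AlmostIntegral.

Variables (B : comNzRingType) (E : fieldType) (phi : {rmorphism B -> E}) (h : B).

(** Integrality over the localisation B[1/h], stated without forming it. *)
Definition almost_integral z := exists M, integralOver phi (phi h ^+ M * z).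

Lemma integral_exp z n : integralOver phi z -> integralOver phi (z ^+ n).
Proof.
move=> intz; elim: n => [|n IH]; first by rewrite expr0; apply: integral1.
by rewrite exprS; apply: integral_mul.
Qed.

Lemma almost_integral_id x : almost_integral (phi x).
Proof. by exists 0%N; rewrite expr0 mul1r; apply: integral_id. Qed.

Lemma almost_integralD y z : almost_integral y -> almost_integral z -> almost_integral (y + z).
Proof.
move=> [M inty] [N intz]; exists (M + N)%N; rewrite exprD mulrDr.
apply: integral_add; first rewrite mulrAC; last rewrite -mulrA.
  by apply: integral_mul => //; apply: integral_exp; apply: integral_id.
by apply: integral_mul => //; apply: integral_exp; apply: integral_id.
Qed.

Lemma almost_integralM y z : almost_integral y -> almost_integral z -> almost_integral (y * z).
Proof.
move=> [M inty] [N intz]; exists (M + N)%N; rewrite exprD mulrACA.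
exact: integral_mul.
Qed.

Lemma almost_integralX y n : almost_integral y -> almost_integral (y ^+ n).
Proof.
move=> ay; elim: n => [|n IH]; last by rewrite exprS; apply: almost_integralM.
by rewrite expr0 -(rmorph1 phi); apply: almost_integral_id.
Qed.

End AlmostIntegral.

Lemma frac_repr (A : idomainType) (x : {fraction A}) :
  exists n d : A, d != 0 /\ x = tofrac n / tofrac d.
Proof.
elim/quotW: x => r; exists r.1, r.2; split; first exact: denom_ratioP.
have d0 : tofrac r.2 != 0 :> {fraction A} by rewrite tofrac_eq0 denom_ratioP.
apply: (mulIf d0); rewrite divfK //.
unlock FracField.tofrac; rewrite -[LHS]FracField.pi_mul.
apply/eqmodP; rewrite /= FracField.equivfE /FracField.mulf.
by rewrite !numden_Ratio ?mulf_neq0 ?oner_eq0 ?denom_ratioP // !mulr1 mulrC.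
Qed.

(** The variables of [iterpoly] are added one at a time, so inductions on t stay univariate;
    injectivity of [phi] is algebraic independence of the images of the variables. *)
Definition indep (k : idomainType) (E : nzRingType) (iota : k -> E) (t : nat) : Prop :=
  exists2 phi : {rmorphism iterpoly k t -> E}, injective phi & phi \o iterC k t =1 iota.

Section PrimeChains.

Variables (k : closedFieldType) (R : idomainAlgType k).
Hypothesis (k_char0 : [pchar k] =i pred0).

Variables (L : fieldType) (j : {rmorphism R -> L}).
Hypotheses (j_inj : injective j) (j_frac : forall x, exists n d, d != 0 /\ x = j n / j d).

Definition fracC : {rmorphism k -> L} := j \o in_alg R.

Lemma j_eq0 x : (j x == 0) = (x == 0). Proof. exact: raddf_eq0. Qed.

Lemma add_frac_common (E : fieldType) (r n r' b d : E) M M' : b != 0 -> d != 0 ->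
  r / (b * d) ^+ M * (n / d) + r' / b ^+ M' =
  (r * n * b * (b * d) ^+ M' + r' * d ^+ M' * (b * d) ^+ M.+1) / (b * d) ^+ (M.+1 + M').
Proof.
move=> b0 d0; rewrite exprD exprS [in LHS](exprMn M b d) [(b * d) ^+ M']exprMn.
rewrite [in RHS](exprMn M b d).
have := expf_neq0 M b0; have := expf_neq0 M d0.
have := expf_neq0 M' b0; have := expf_neq0 M' d0.
move: (b ^+ M) (d ^+ M) (b ^+ M') (d ^+ M') => x y z w *.
by field; rewrite ?b0 ?d0 /=; repeat (apply/andP; split => //).
Qed.

Lemma common_denominator t (phi : {rmorphism iterpoly k t -> L}) :
  phi \o iterC k t =1 fracC ->
  exists2 b : R, b != 0 & forall x, exists M r, phi x = j r / j b ^+ M.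
Proof.
elim: t phi => [|t IH] phi phik.
  exists 1; rewrite ?oner_eq0 // => x; exists 0%N, (in_alg R x).
  by rewrite expr0 divr1 -[RHS]phik.
have [b b0 Hb] := IH (phi \o @polyC (iterpoly k t)) phik.
pose psi : {rmorphism {poly iterpoly k t} -> L} := phi.
have [n [d [d0 Eq]]] := j_frac (psi 'X).
have tb : j b != 0  by rewrite j_eq0.
have td : j d != 0  by rewrite j_eq0.
exists (b * d); first exact: mulf_neq0.
rewrite -/psi; elim/poly_ind => [|p c [M [r Er]]].
  by exists 0%N, 0; rewrite !rmorph0 mul0r.
have [M' [r' Er']] := Hb c.
have -> : psi (p * 'X + c%:P) = psi p * psi 'X + psi c%:P by rewrite rmorphD rmorphM.
rewrite Eq Er [psi c%:P]Er'.
exists (M.+1 + M')%N, (r * n * b * (b * d) ^+ M' + r' * d ^+ M' * (b * d) ^+ M.+1).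
have Ebd : j (b * d) = j b * j d  by apply: rmorphM.
rewrite Ebd (add_frac_common _ _ _ _ _ tb td); congr (_ / _).
by rewrite !(rmorphD, rmorphM, rmorphXn).
Qed.

(** Bounds the Krull dimension from below. The independent fractions lie in some D = R[1/b] and
    extend, by generators of D, to a transcendence basis over which D is integral after inverting
    some h. The chain of [iterpoly_chain] that avoids h lifts to D by going up and is contracted to
    R. *)
Lemma chain_of_indep t : fg_algebra R -> indep fracC t -> prime_chain R t.
Proof.
move=> [N [x xgen]] [phi0 inj0 phi0k].
have [b b0 Hb0] := common_denominator phi0k.

pose D z := exists M r, z = j r / j b ^+ M.
have tb M : j b ^+ M != 0  by rewrite expf_neq0 // j_eq0.
have Dring : subring D.
  split.
  - by exists 0%N, 1; rewrite expr0 divr1 rmorph1.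
  - move=> _ _ [M [r ->]] [M' [r' ->]].
    exists (M + M')%N, (r * b ^+ M' - r' * b ^+ M).
    rewrite rmorphB !rmorphM !rmorphXn /= exprD -[- (_ / _)]mulNr addf_div //.
    by rewrite mulNr.
  - move=> _ _ [M [r ->]] [M' [r' ->]].
    by exists (M + M')%N, (r * r'); rewrite rmorphM exprD mulf_div.
have Dj r : D (j r) by exists 0%N, r; rewrite expr0 divr1.
have Dvb : D (j b)^-1 by exists 1%N, 1; rewrite rmorph1 div1r expr1.
have [|t' [phi [h [tt' [phi_inj phik] Dphi h0 int]]]] := @extend_basis k _ fracC t phi0
  D ((j b)^-1 :: [seq j (x i) | i <- enum 'I_N]) inj0 phi0k Dring Hb0.
  by move=> g; rewrite inE => /orP[/eqP ->|/mapP[i _ ->]].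
have Dint z : D z -> almost_integral phi h z.
  have gen g : g \in (j b)^-1 :: [seq j (x i) | i <- enum 'I_N] -> almost_integral phi h g.
    by move=> /int; exists 1%N; rewrite expr1.
  move=> [M [r ->]]; apply: almost_integralM; last first.
    by rewrite -exprVn; apply/almost_integralX/gen; rewrite inE eqxx.
  have [p ->] := xgen r; rewrite /mmap rmorph_sum.
  elim/big_ind: _ => [|u v|m _].
  - by rewrite -(rmorph0 phi); apply: almost_integral_id.
  - exact: almost_integralD.
  - rewrite rmorphM; apply: almost_integralM.
      rewrite [X in almost_integral _ _ X](_ : _ = phi (iterC k t' p@_m)); last exact/esym/phik.
      exact: almost_integral_id.
    rewrite /mmap1 rmorph_prod; elim/big_ind: _ => [|u v|i _].
    + by rewrite -(rmorph1 phi); apply: almost_integral_id.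
    + exact: almost_integralM.
    + rewrite rmorphXn; apply/almost_integralX/gen; rewrite inE; apply/orP; right.
      by apply: map_f; rewrite mem_enum.
have [P [pi [P0 Ppr PE Ppi Ph]]] := iterpoly_chain k_char0 h0.
have [Q [QP Qsub]] := going_up_chain Dring Dphi Dint phi_inj P0 Ppr PE Ph.
have QprD i : (i <= t')%N -> prime_of D (Q i) by case/QP.
pose q i : {pred R} := fun r => boolp.asbool (Q i (j r)).
have qid i : (i <= t')%N -> idealr_closed (q i).
  move=> it; have Qid := prime_ideal (QprD i it); split.
  - by apply/boolp.asboolP; rewrite rmorph0; apply: (ideal0 Qid).
  - by apply/boolp.asboolP; rewrite rmorph1; apply: (prime1 (QprD i it)).
  - move=> a u v /boolp.asboolP Qu /boolp.asboolP Qv; apply/boolp.asboolP.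
    by rewrite rmorphD rmorphM; apply: (idealD Qid) => //; apply: (idealM Qid) (Dj a) Qu.
have qpr i : (i <= t')%N -> prime_idealr_closed (q i).
  move=> it u v /boolp.asboolP; rewrite rmorphM => /(primeM (QprD i it) (Dj _) (Dj _)).
  by case=> /boolp.asboolP H; rewrite ![_ \in q i]unfold_in H ?orbT.
have it' (i : 'I_t.+1) : (i <= t')%N by apply: leq_trans tt'; rewrite -ltnS.
pose pr (i : 'I_t.+1) : prime_idealr R :=
  HB.pack (q i) (isIdealr.Build R (q i) (qid i (it' i)))
          (isPrimeIdealrClosed.Build R (q i) (qpr i (it' i))).
exists pr => i l ij.
have sub (i0 : nat) n z : (i0 + n <= t')%N -> Q i0 z -> Q (i0 + n)%N z.
  elim: n => [|n IH]; first by rewrite addn0.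
  by rewrite addnS => il Qz; apply: Qsub => //; apply: IH => //; apply: ltnW.
have prE (m : 'I_t.+1) r : (r \in pr m) = boolp.asbool (Q m (j r)) by [].
have subQ (i0 l0 : nat) z : (i0 <= l0)%N -> (l0 <= t')%N -> Q i0 z -> Q l0 z.
  by move=> il lt; have := @sub i0 (l0 - i0)%N z; rewrite subnKC //; apply.
split=> [r|li].
  rewrite !prE => /boolp.asboolP Qr; apply/boolp.asboolP.
  exact: subQ (ltnW ij) (it' l) Qr.
have i_lt : (i < t')%N by apply: leq_trans ij _.
have Qpi : Q i.+1 (phi (pi i)).
  apply/(QP i.+1 i_lt).2/(PE i _ i_lt); exists 0, 1; rewrite mulr1 add0r; split=> //.
  exact: (ideal0 (prime_ideal (Ppr i (it' i)))).
(* The inclusion stays strict after contraction: [pi i] separates the two primes in D, and a power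
   of b clears its denominator. *)
have [M [r Er]] := Dphi (pi i).
have Ql : Q l (j r).
  have -> : j r = j b ^+ M * phi (pi i) by rewrite Er mulrC divfK.
  apply: (idealM (prime_ideal (QprD l (it' l)))).
    by rewrite -rmorphXn.
  exact: subQ ij (it' l) Qpi.
have Qi : Q i (phi (pi i)).
  have /boolp.asboolP Qr : boolp.asbool (Q i (j r)).
    by rewrite -prE; apply: li; rewrite prE; apply/boolp.asboolP.
  rewrite Er mulrC -exprVn; apply: (idealM (prime_ideal (QprD i (it' i)))) => //.
  exact: (subringX Dring).
by move/(QP i (it' i)).2: Qi; apply: Ppi.
Qed.

(* Choosing y_i in the i-th prime but not in the previous one. *)
Lemma indep_of_chain (p : nat -> R -> Prop) t :
  (forall i, (i <= t)%N -> prime_of (fun _ => True) (p i)) ->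
  (forall i, (i < t)%N -> (forall x, p i x -> p i.+1 x) /\ exists2 y, p i.+1 y & ~ p i y) ->
  exists2 phi : {rmorphism iterpoly k t -> R},
     phi \o iterC k t =1 in_alg R & forall x, x != 0 -> ~ p 0%N (phi x).
Proof.
elim: t p => [|t IH] p ppr psub.
  exists (in_alg R) => // x x0 px; apply: (prime1 (ppr 0%N (leqnn _))).
  have -> : 1 = in_alg R x^-1 * in_alg R x :> R by rewrite -rmorphM mulVf // rmorph1.
  exact: (idealM (prime_ideal (ppr 0%N (leqnn _)))).
have [||phi phik phip] := IH (fun i => p i.+1).
- by move=> i it; apply: ppr.
- by move=> i it; apply: psub.
have [p01 [y p1y np0y]] := psub 0%N (ltn0Sn t).
have p0pr := ppr 0%N (leq0n _); have p1pr := ppr 1%N (ltn0Sn t).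
have comm : commr_rmorph phi y by move=> x; apply: mulrC.
pose psi : {rmorphism {poly iterpoly k t} -> R} := horner_morph comm.
have psiC x : psi x%:P = phi x by apply: horner_morphC.
have psiX : psi 'X = y by apply: horner_morphX.
exists psi; first by move=> x; rewrite -[RHS]phik; apply: psiC.
(* Induction on the size of x: a non-zero constant term avoids the next prime, which contains y, and
   so does the whole value; if the constant term is zero, y is factored out, being outside the prime
   [p 0]. *)
have main (x : {poly iterpoly k t}) n : (size x <= n)%N -> x != 0 -> ~ p 0%N (psi x).
  elim: n x => [|n IHn] x; first by rewrite leqn0 size_poly_eq0 => /eqP-> /eqP.
  elim/poly_ind: x => [_ /eqP //|x c _] sx x0.
  have [c0|c0] := eqVneq c 0.
    move: sx x0; rewrite c0 addr0 => sx x0; rewrite rmorphM psiX.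
    have x0' : x != 0 by apply: contraNneq x0 => ->; rewrite mul0r.
    move/(primeM p0pr Logic.I Logic.I) => [|//]; apply: IHn => //.
    by move: sx; rewrite size_mulX.
  move/p01; rewrite rmorphD rmorphM psiX psiC => H.
  apply: (phip c c0).
  have := idealB (subring_all R) (prime_ideal p1pr) H
     (idealM (prime_ideal p1pr) Logic.I p1y : p 1%N (psi x * y)).
  by rewrite addrC addrA addNr add0r.
by move=> x; apply: (main x (size x)).
Qed.

End PrimeChains.

(** * Linear dependence and growth of filtered algebras *)

Lemma linear_dependence (k : fieldType) (V : lmodType k) n d (v : 'I_n -> V) (e : 'I_d -> V) :
  (d < n)%N -> (forall i, exists a : 'I_d -> k, v i = \sum_j a j *: e j) ->
  exists2 c : 'rV[k]_n, c != 0 & \sum_i c 0 i *: v i = 0.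
Proof.
move=> dn /fin_all_exists[a va].
pose M := \matrix_(i, j) a i j.
have : kermx M != 0.
  rewrite kermx_eq0 /row_free; apply: contraL (rank_leq_col M) => /eqP ->.
  by rewrite -ltnNge.
case/rowV0Pn => c /sub_kermxP cM c0; exists c => //.
under eq_bigr => i _ do rewrite va scaler_sumr.
rewrite exchange_big big1 //= => j _.
transitivity ((c *m M) 0 j *: e j); last by rewrite cM mxE scale0r.
by rewrite mxE scaler_suml; apply: eq_bigr => i _; rewrite scalerA !mxE.
Qed.

Section GrowthBound.

Variables (k : closedFieldType) (R : comAlgType k) (W : nat -> R -> Prop).
Hypotheses (W_const : forall c, W 0%N (in_alg R c))
  (W_mono : forall a b r, (a <= b)%N -> W a r -> W b r)
  (W_mul : forall a b r s, W a r -> W b s -> W (a + b)%N (r * s))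
  (W_exh : forall r, exists a, W a r).

Let W1 : W 0%N 1. Proof. by have := W_const 1; rewrite rmorph1. Qed.

(** The N^e monomials with all exponents below N in e independent variables lie in level a N, where
    a is the sum of the levels of the variables. *)
Lemma growth_box e (phi : {rmorphism iterpoly k e -> R}) :
  phi \o iterC k e =1 in_alg R ->
  exists a, forall N, exists (T : finType) (v : T -> iterpoly k e),
    [/\ #|T| = (N ^ e)%N,
        forall c : T -> k, \sum_t iterC k e (c t) * v t = 0 -> forall t, c t = 0
      & forall t, W (a * N) (phi (v t))].
Proof.
elim: e phi => [|e IH] phi phik.
  exists 0%N => N; exists unit, (fun _ => 1); split.
  - by rewrite card_unit.
  - by move=> c + [] /=; rewrite (bigD1 tt) //= big1 => [|[]//]; rewrite mulr1 addr0.
  - by move=> _; rewrite mul0n rmorph1.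
pose psi : {rmorphism {poly iterpoly k e} -> R} := phi.
have [a Ha] := IH (psi \o @polyC (iterpoly k e)) phik.
have [b Wb] := W_exh (psi 'X).
exists (a + b)%N => N; have [T [v [cT vfree vW]]] := Ha N.
exists ('I_N * T)%type, (fun it : 'I_N * T => (v it.2)%:P * 'X^(it.1)); split.
- by rewrite card_prod card_ord cT expnS.
- move=> c Hc [i t]; apply: (vfree (fun t => c (i, t))).
  have := congr1 (fun p : {poly iterpoly k e} => p`_i) Hc; rewrite coef0 => H0; rewrite -[RHS]H0.
  transitivity (\sum_(i0 < N) \sum_t0
      ((iterC k e (c (i0, t0)))%:P * ((v t0)%:P * 'X^i0))`_i); last first.
    by rewrite pair_bigA coef_sum; apply: eq_bigr => -[].
  rewrite (bigD1 i) //= [X in _ = _ + X]big1 ?addr0 => [|i0 ne].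
    by apply: eq_bigr => t0 _; rewrite mulrA -polyCM coefCM coefXn eqxx mulr1.
  rewrite big1 // => t0 _; rewrite mulrA -polyCM coefCM coefXn.
  by rewrite (inj_eq val_inj) eq_sym (negPf ne) mulr0.
- move=> [i t]; rewrite -/psi rmorphM rmorphXn mulnDl; apply: W_mul; first exact: vW.
  apply: (@W_mono (b * i)); first by rewrite leq_mul2l ltnW ?orbT.
  elim: (i : nat) => [|n IHn]; first by rewrite muln0 expr0.
  by rewrite mulnS exprS; apply: W_mul.
Qed.

Lemma growth_bound_indep C d :
  (forall a, exists v : 'I_(C * a.+1 ^ d) -> R,
     forall r, W a r -> exists c : 'I_(C * a.+1 ^ d) -> k, r = \sum_j c j *: v j) ->
  forall phi : {rmorphism iterpoly k d.+1 -> R},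
  phi \o iterC k d.+1 =1 in_alg R -> ~ injective phi.
Proof.
move=> Wspan phi phik phi_inj; have [a Ha] := growth_box phik.
(* N exceeds C (a + 1)^d and a N + 1 <= (a + 1) N, hence C (a N + 1)^d < N^(d + 1): the box is too
   large for its level. *)
pose N := (C * a.+1 ^ d).+1.
have [T [v [cT vfree vW]]] := Ha N; have [e eW] := Wspan (a * N)%N.
have lt : (C * (a * N).+1 ^ d < #|T|)%N.
  rewrite cT expnS; apply: (@leq_ltn_trans (C * (a.+1 ^ d * N ^ d))).
    rewrite leq_mul2l -expnMn; apply/orP; right.
    have leqX m n l : (m <= n)%N -> (m ^ l <= n ^ l)%N.
      by move=> mn; elim: l => // l IH; rewrite !expnS leq_mul.
    by apply: leqX; rewrite /N mulSn addSn ltnS leq_addl.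
  by rewrite mulnA ltn_pmul2r ?expn_gt0.
have [|c c0 sc] := @linear_dependence k R _ _ (fun i => phi (v (enum_val i))) e lt.
  by move=> i; apply/eW/vW.
case/eqP: c0; apply/rowP => i; rewrite mxE.
have := vfree (fun t => c 0 (enum_rank t)) _ (enum_val i); rewrite enum_valK; apply.
apply: phi_inj; rewrite rmorph0 rmorph_sum -[RHS]sc.
rewrite (reindex _ (onW_bij _ (@enum_val_bij T))) /=; apply: eq_bigr => l _.
rewrite enum_valK rmorphM -mulr_algl; congr (_ * _); exact: phik.
Qed.

End GrowthBound.

(** * Valuation rings of a function field of one variable *)

Section ValuationRings.

Variables (k : closedFieldType) (F : fieldType) (iota : {rmorphism k -> F}).
Implicit Type O : F -> Prop.

Lemma comm_iota (f : F) : commr_rmorph iota f. Proof. by move=> x; apply: mulrC. Qed.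
Definition evalat (f : F) : {rmorphism {poly k} -> F} := horner_morph (comm_iota f).

Lemma evalatC f c : evalat f c%:P = iota c. Proof. exact: horner_morphC. Qed.
Lemma evalatX f : evalat f 'X = f. Proof. exact: horner_morphX. Qed.
Lemma evalatE f p : evalat f p = \sum_(i < size p) iota p`_i * f ^+ i.
Proof.
rewrite /evalat /= /horner_morph horner_coef size_map_poly.
by apply: eq_bigr => i _; rewrite coef_map.
Qed.

(** Over the algebraically closed k, being non-constant already means being transcendental: a
    polynomial splits into linear factors, none of which vanishes at f. *)
Definition transc f := forall c, f <> iota c.

Lemma evalat_inj f : transc f -> injective (evalat f).
Proof.
move=> tf p q /eqP; rewrite -subr_eq0 -rmorphB => /eqP E0; apply/eqP; rewrite -subr_eq0.
apply: contra_eqT E0 => r0; move: (p - q) r0 => r r0.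
have [s Dr] := closed_field_poly_normal r.
rewrite Dr -mul_polyC rmorphM evalatC mulf_neq0 ?fmorph_eq0 ?lead_coef_eq0 //.
rewrite rmorph_prod prodf_seq_neq0; apply/allP => c _ /=.
rewrite rmorphB evalatX evalatC subr_eq0; apply/eqP; exact: tf.
Qed.

Definition algover f h :=
  exists2 Q : {poly {poly k}}, Q != 0 & root (map_poly (evalat f) Q) h.

Record valring O : Prop := Valring {
  valring_ring : subring O;
  valring_const : forall c, O (iota c);
  valring_total : forall x, x != 0 -> O x \/ O x^-1 }.

Definition vunit O x := [/\ x != 0, O x & O x^-1].

(** Chevalley's argument: O is maximal among the rings that contain k and t = 1/f but not f.
    Maximality makes every 1 - t b invertible and shows that x outside O satisfies p(x) = 1 for some
    p with coefficients in t O. If x and 1/x were both outside, the longer of their two equations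
    could always be shortened. *)
Lemma exists_valring f : transc f -> exists2 O, valring O & ~ O f.
Proof.
move=> tf; have f0 : f != 0 by apply/eqP; rewrite -(rmorph0 iota); apply: tf.
set t := f^-1; have ft : f * t = 1 by rewrite mulfV.
have tt : transc t.
  by move=> c tc; apply: (tf c^-1); rewrite fmorphV -tc invrK.
pose P O := [/\ subring O, forall c, O (iota c), O t & ~ O f].
have [||O [[Oring Oc Ot nOf] _ Omax]] := zorn_above (A0 := fun z => exists p, z = evalat t p) (P := P).
- split.
  + split; first by exists 1; rewrite rmorph1.
    * by move=> _ _ [p ->] [q ->]; exists (p - q); rewrite rmorphB.
    * by move=> _ _ [p ->] [q ->]; exists (p * q); rewrite rmorphM.
  + by move=> c; exists c%:P; rewrite evalatC.
  + by exists 'X; rewrite evalatX.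
  + case=> p Ef; have : evalat t ('X * p) = evalat t 1.
      by rewrite rmorphM evalatX -Ef mulrC ft rmorph1.
    move/(evalat_inj tt) => /(congr1 (fun q : {poly k} => q.[0])).
    by rewrite hornerM hornerX mul0r hornerC => /eqP; rewrite eq_sym oner_eq0.
- move=> C [X0 CX0] CP Ctot; split.
  + have tot2 x y X Y : C X -> C Y -> X x -> Y y -> exists Z, [/\ C Z, Z x & Z y].
      move=> CX CY Xx Yy; case: (Ctot X Y CX CY) => XY; [exists Y|exists X]; split=> //; exact: XY.
    split.
    * by exists X0 => //; have [Xr _ _ _] := CP _ CX0; apply: (subring1 Xr).
    * move=> x y [X CX Xx] [Y CY Yy]; have [Z [CZ Zx Zy]] := tot2 _ _ _ _ CX CY Xx Yy.
      by exists Z => //; have [Xr _ _ _] := CP _ CZ; apply: (subringB Xr).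
    * move=> x y [X CX Xx] [Y CY Yy]; have [Z [CZ Zx Zy]] := tot2 _ _ _ _ CX CY Xx Yy.
      by exists Z => //; have [Xr _ _ _] := CP _ CZ; apply: (subringM Xr).
  + by move=> c; exists X0 => //; have [_ Xc _ _] := CP _ CX0.
  + by exists X0 => //; have [_ _ Xt _] := CP _ CX0.
  + by case=> X CX Xf; have [_ _ _] := CP _ CX; apply.
have O0 := subring0 Oring; have O1 := subring1 Oring.
have OM x y := @subringM _ _ Oring x y; have OB x y := @subringB _ _ Oring x y.
have OD x y := @subringD _ _ Oring x y.
have nt b : O b -> t * b <> 1.
  by move=> Ob tb; apply: nOf; rewrite -[f]mulr1 -tb mulrA ft mul1r.
have unit1 b : O b -> O (1 - t * b)^-1.
  move=> Ob; set e := 1 - t * b.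
  have e0 : e != 0 by rewrite subr_eq0; apply/eqP => /esym; apply: nt.
  have Oe : O e by apply: OB => //; apply: OM.
  pose O' z := exists M, O (e ^+ M * z).
  have sub z : O z -> O' z by exists 0%N; rewrite mul1r.
  have OXe M : O (e ^+ M) by apply: subringX.
  (* If f enters the ring after inverting e, then e^M f is in O for some M; as e^M = 1 - t c and t f
     = 1, so is f = e^M f + c. *)
  have [O'f|nO'f] := boolp.EM (O' f).
    have [M OMf] := O'f.
    have [c Oc' Ec] : exists2 c, O c & e ^+ M = 1 - t * c.
      elim: M {OMf} => [|M [c Oc' Ec]]; first by exists 0; rewrite ?mulr0 ?subr0.
      exists (c + b - t * b * c); last by rewrite exprS Ec /e; ring.
      by apply: OB; [apply: OD|apply: (OM) => //; apply: (OM)].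
    case: (@nt (e ^+ M * f + c)); first exact: OD.
    by rewrite mulrDr mulrCA [t * f]mulrC ft mulr1 Ec; ring.
  apply: (Omax O'); [split=> //|by []|].
  - split; first exact: sub.
    + move=> x y [M OMx] [N ONy]; exists (M + N)%N; rewrite mulrBr exprD.
      by apply: OB; [rewrite mulrAC mulrC|rewrite -mulrA]; apply: OM.
    + by move=> x y [M OMx] [N ONy]; exists (M + N)%N; rewrite exprD mulrACA; apply: OM.
  - by move=> c; apply: sub.
  - exact: sub.
  - by exists 1%N; rewrite expr1 mulfV.
pose small (p : {poly F}) := forall i, exists2 b, O b & p`_i = t * b.
have small_coef (p : {poly F}) : (forall i, O p`_i) -> small (t *: p).
  by move=> Op i; exists p`_i => //; rewrite coefZ.
have adj x : ~ O x -> exists2 p, small p & p.[x] = 1.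
  move=> nOx; pose O' z := exists2 p : {poly F}, (forall i, O p`_i) & z = p.[x].
  have sub z : O z -> O' z.
    by move=> Oz; exists z%:P; rewrite ?hornerC // => i; rewrite coefC; case: ifP.
  have [[p Op Ef]|nO'f] := boolp.EM (O' f).
    by exists (t *: p); [exact: small_coef|rewrite hornerZ -Ef mulrC ft].
  case: nOx; apply: (Omax O'); [split=> //|by []|].
  - split; first exact: sub.
    + move=> _ _ [p Op ->] [q Oq ->]; exists (p - q); last by rewrite hornerD hornerN.
      by move=> i; rewrite coefB; apply: OB.
    + move=> _ _ [p Op ->] [q Oq ->]; exists (p * q); last by rewrite hornerM.
      move=> i; rewrite coefM; elim/big_ind: _ => [//|u v|l _]; [exact: OD|exact: OM].
  - by move=> c; apply: sub.
  - exact: sub.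
  - by exists 'X; rewrite ?hornerX // => i; rewrite coefX; case: eqP.
have key n x p q : x != 0 -> small p -> small q -> p.[x] = 1 -> q.[x^-1] = 1 ->
    (size p + size q <= n)%N -> False.
  elim: n x p q => [|n IH] x p q x0 sp sq px qx.
    rewrite leqn0 addn_eq0 size_poly_eq0 => /andP[/eqP p0 _].
    by move/eqP: px; rewrite p0 horner0 eq_sym oner_eq0.
  wlog qp : x p q x0 sp sq px qx / (size q <= size p)%N.
    move=> W; case/orP: (leq_total (size q) (size p)) => [qp|pq]; first exact: (W x p q).
    by rewrite addnC; apply: (W x^-1 q p) => //; rewrite ?invr_eq0 ?invrK.
  case Dm: (size p) => [|m].
    by move/eqP: Dm; rewrite size_poly_eq0 => /eqP p0; move/eqP: px; rewrite p0 horner0 eq_sym oner_eq0.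
  have [b0 Ob0 Eq0] := sq 0%N; have [bm Obm Epm] := sp m.
  have Oe := unit1 _ Ob0; set e := 1 - t * b0 in Oe.
  have e0 : e != 0 by rewrite subr_eq0; apply/eqP => /esym; apply: nt.
  (* The equation q(1/x) = 1 times x^m expresses e x^m through lower powers of x; substituting this
     for the leading term of p lowers its size. *)
  pose s : {poly F} := \poly_(i < m) q`_(m - i).
  have sx : s.[x] = x ^+ m * e.
    rewrite horner_poly; have -> : e = q.[x^-1] - q`_0 by rewrite qx Eq0.
    rewrite (@horner_coef_wide _ m.+1) -?Dm // Dm big_ord_recl /= expr0 mulr1 addrC addKr.
    rewrite mulr_sumr (reindex_inj rev_ord_inj) /=; apply: eq_bigr => i _.
    rewrite /bump /= add1n subKn; last exact: ltn_ord.
    rewrite mulrCA; congr (_ * _); rewrite exprVn.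
    have -> : x ^+ m = x ^+ (m - i.+1) * x ^+ i.+1 by rewrite -exprD subnK.
    by rewrite mulfK // expf_neq0.
  pose p' := \poly_(i < m) (p`_i + p`_m / e * s`_i).
  have szp' : (size p' <= m)%N by apply: size_poly.
  move=> sz; apply: (IH x p' q) => //.
  - move=> i; rewrite coef_poly; case: ifP => _; last by exists 0; rewrite ?mulr0.
    have [bi Obi ->] := sp i; rewrite Epm coef_poly.
    have [c Oc' ->] : exists2 c, O c & (if (i < m)%N then q`_(m - i) else 0) = t * c.
      by case: ifP => _; [exact: sq|exists 0; rewrite ?mulr0].
    exists (bi + bm / e * (t * c)); last by rewrite mulrDr !mulrA.
    by apply: OD => //; apply: (OM); [apply: (OM)|apply: (OM)].
  - rewrite horner_poly; under eq_bigr => i _ do rewrite mulrDl.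
    rewrite big_split /= -px (@horner_coef_wide _ m.+1) ?Dm // big_ord_recr /=; congr (_ + _).
    transitivity (p`_m / e * s.[x]); last by rewrite sx; field.
    rewrite (@horner_coef_wide _ m) ?size_poly // mulr_sumr.
    by apply: eq_bigr => i _; rewrite mulrA.
  - by move: sz; rewrite addSn ltnS; apply: leq_trans; rewrite leq_add2r.
exists O => //; split=> // x x0; apply: boolp.contrapT => /boolp.not_orP[nOx nOxV].
have [p sp px] := adj x nOx; have [q sq qx] := adj x^-1 nOxV.
exact: (key (size p + size q)%N x p q).
Qed.

Section OneRing.

Variable (O : F -> Prop).
Hypothesis (Oval : valring O).
Let Oring := valring_ring Oval.
Let O0 : O 0 := subring0 Oring.
Let O1 : O 1 := subring1 Oring.
Let OM x y := @subringM _ _ Oring x y.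
Let OB x y := @subringB _ _ Oring x y.
Let OD x y := @subringD _ _ Oring x y.
Let OX x n := @subringX _ _ Oring x n.

Lemma vunitM x y : vunit O x -> vunit O y -> vunit O (x * y).
Proof.
move=> [x0 Ox Ovx] [y0 Oy Ovy].
by split; rewrite ?mulf_neq0 ?invfM //; apply: (OM).
Qed.

Lemma vunitV x : vunit O x -> vunit O x^-1.
Proof. by move=> [x0 Ox Ovx]; split; rewrite ?invr_eq0 ?invrK. Qed.

Lemma valring_root x n : (0 < n)%N -> x != 0 -> O (x ^+ n) -> O x.
Proof.
case: n => // n _ x0 Oxn; case: (valring_total Oval x0) => // Ovx.
have -> : x = x ^+ n.+1 * x^-1 ^+ n by rewrite exprS exprVn mulfK // expf_neq0.
by apply: (OM) => //; apply: (OX).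
Qed.

Lemma vunit_root x n : (0 < n)%N -> vunit O (x ^+ n) -> vunit O x.
Proof.
move=> n0 [xn0 Oxn Ovxn]; have x0 : x != 0 by move: xn0; rewrite expf_eq0 n0.
split=> //; first exact: valring_root Oxn.
by apply: (@valring_root _ n); rewrite ?invr_eq0 ?exprVn.
Qed.

(** If h were outside O, dividing its monic equation by h^(n - 1) would write h as a polynomial in
    1/h with coefficients in O. *)
Lemma valring_integral u h : O u -> integralOver (evalat u) h -> O h.
Proof.
move=> Ou [p pmon /rootP ph]; have [->//|h0] := eqVneq h 0.
case: (valring_total Oval h0) => // Ovh.
have Oev q : O (evalat u q).
  rewrite evalatE; elim/big_ind: _ => [//|x y|i _]; first exact: (OD).
  by apply: (OM); [exact: (valring_const Oval)|exact: (OX)].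
have sp : size p = (size p).-1.+1 by rewrite prednK // size_poly_gt0 monic_neq0.
move: ph; rewrite (@horner_coef_wide _ (size p)) ?size_poly // sp big_ord_recr /=.
set n := (size p).-1; rewrite !coef_map /=.
have -> : p`_n = 1 by apply/eqP; move/monicP: pmon; rewrite lead_coefE => ->.
rewrite rmorph1 mul1r => /eqP; rewrite addrC addr_eq0 => /eqP Ehn.
have [n0|n0] := posnP n.
  have := Ehn; rewrite n0 expr0 big_ord0 oppr0 => /eqP; by rewrite oner_eq0.
have -> : h = h ^+ n * h^-1 ^+ n.-1.
  by rewrite -{1}(prednK n0) exprS exprVn mulfK // expf_neq0.
rewrite Ehn mulNr; apply: (subringN Oring); rewrite mulr_suml.
elim/big_ind: _ => [//|x y|i _]; first exact: (OD).
rewrite coef_map -mulrA; apply: (OM); first exact: Oev.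
have -> : h ^+ i * h^-1 ^+ n.-1 = h^-1 ^+ (n.-1 - i).
  have -> : (n.-1 = (n.-1 - i) + i)%N by rewrite subnK // -ltnS prednK.
  by rewrite addnK exprD mulrCA -exprMn mulfV // expr1n mulr1.
exact: (OX).
Qed.

Lemma nonunitD x y : O x -> O y -> ~ vunit O x -> ~ vunit O y -> ~ vunit O (x + y).
Proof.
wlog: x y / y != 0 /\ O (x / y).
  move=> W Ox Oy nx ny; have [x0|x0] := eqVneq x 0; first by rewrite x0 add0r.
  have [y0|y0] := eqVneq y 0; first by rewrite y0 addr0.
  have xy0 : x / y != 0 by rewrite mulf_neq0 ?invr_eq0.
  case: (valring_total Oval xy0) => H; first by apply: W.
  by rewrite addrC; apply: W => //; rewrite invfM invrK mulrC in H.
move=> [y0 Oxy] Ox Oy nx ny [xy0 Oxy' Ovxy]; apply: ny; split=> //.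
have -> : y^-1 = (1 + x / y) * (x + y)^-1.
  by field; apply/andP; split.
by apply: (OM) => //; apply: (OD).
Qed.

(* In a vanishing sum some two non-zero terms have the same value. *)
Lemma vanishing_sum (I : eqType) (s : seq I) (t : I -> F) :
  uniq s -> (forall i, i \in s -> t i != 0) -> s != [::] -> \sum_(i <- s) t i = 0 ->
  exists i j, [/\ i \in s, j \in s, i != j & vunit O (t i / t j)].
Proof.
move=> us t0 s0 sum0; apply: boolp.contrapT => H.
(* [t j] is a term of least value. If no other term had the same value, dividing by [t j] would
   write -1 as a sum of non-units. *)
have [j js jmax] : exists2 j, j \in s & forall i, i \in s -> O (t i / t j).
  elim: s t0 s0 {us sum0 H} => [//|i s IH] t0 _.
  have [->|s0] := eqVneq s [::].
    by exists i => [|l]; rewrite ?mem_seq1 // => /eqP ->; rewrite divff // t0 ?inE ?eqxx.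
  have [l ls|//|j js jmax] := IH; first by apply: t0; rewrite inE ls orbT.
  have ti : t i != 0 by rewrite t0 // inE eqxx.
  have tj : t j != 0 by rewrite t0 // inE js orbT.
  have [|Oij|Oji] := valring_total Oval (x := t i / t j); first by rewrite mulf_neq0 ?invr_eq0.
    exists j; first by rewrite inE js orbT.
    by move=> l; rewrite inE => /orP[/eqP ->|/jmax].
  exists i; first by rewrite inE eqxx.
  move=> l; rewrite inE => /orP[/eqP ->|/jmax Olj]; first by rewrite divff.
  have -> : t l / t i = (t l / t j) * (t i / t j)^-1 by field; rewrite ti tj.
  exact: (OM).
have tj := t0 j js.
move: sum0; rewrite (bigD1_seq j) //= => /(congr1 (fun x => x / t j)).
rewrite mul0r mulrDl divff // mulr_suml => /eqP; rewrite addr_eq0 => /eqP E1.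
have U1 : vunit O 1 by split; rewrite ?oner_eq0 ?invr1.
have [OS] : O (\sum_(i <- s | i != j) t i / t j) /\ ~ vunit O (\sum_(i <- s | i != j) t i / t j).
  rewrite big_seq_cond; elim/big_ind: _ => [|x y [Ox nx] [Oy ny]|i /andP[is_ ij]].
  - by split=> // -[]; rewrite eqxx.
  - by split; [exact: (OD)|exact: nonunitD].
  - by split; [exact: jmax|move=> u; apply: H; exists i, j].
apply; rewrite -[X in vunit O X]opprK -E1; split; rewrite ?oppr_eq0 ?oner_eq0 ?invrN ?invr1 //.
  exact: (subringN Oring).
exact: (subringN Oring).
Qed.

Variable (f : F).
Hypothesis (nOf : ~ O f).

Lemma f_neq0 : f != 0. Proof. by apply/eqP => f0; apply: nOf; rewrite f0. Qed.
Lemma OVf : O f^-1. Proof. by case: (valring_total Oval f_neq0). Qed.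

(** A pole of f makes 1/f a non-unit of O, so the constant c dominates the sum. *)
Lemma vunit_const_add (c : k) b : c != 0 -> O b -> vunit O (iota c + f^-1 * b).
Proof.
move=> c0 Ob; set z := _ + _.
have f0 := f_neq0; have ic0 : iota c != 0 by rewrite fmorph_eq0.
have Ovc : O (iota c)^-1 by rewrite -fmorphV; apply: (valring_const Oval).
have nic : forall d, O d -> iota c <> f^-1 * d.
  move=> d Od E; apply: nOf; have Ed : d = f * iota c by rewrite E mulrA mulfV // mul1r.
  by rewrite -[f](mulfK ic0) -Ed; apply: (OM).
have z0 : z != 0.
  rewrite /z addr_eq0 -mulrN; apply/eqP; apply: nic; exact: (subringN Oring).
have Oz : O z by apply: (OD); [exact: (valring_const Oval)|apply: (OM) => //; exact: OVf].
split=> //; have zf0 : z * f != 0 by rewrite mulf_neq0.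
case: (valring_total Oval zf0) => [Ozf|]; last first.
  rewrite invfM => H.
  have -> : z^-1 = (iota c)^-1 * (1 - (z^-1 / f) * b).
    have Ec : z * (1 - z^-1 / f * b) = iota c.
      by transitivity (z - f^-1 * b); [field; apply/andP; split|rewrite /z addrK].
    by apply: (mulfI z0); rewrite mulfV // mulrCA Ec mulVf.
  apply: (OM) => //; apply: (OB) => //; exact: (OM).
case: (nic (z * f - b)); first exact: (OB).
by rewrite /z; field.
Qed.

End OneRing.

End ValuationRings.

Section ValuationsAtInfinity.

Variables (k : closedFieldType) (F : fieldType) (iota : {rmorphism k -> F}).
Hypothesis (k_char0 : [pchar k] =i pred0).
Implicit Type O : F -> Prop.
Local Notation valring := (valring iota).
Local Notation evalat := (evalat iota).
Local Notation algover := (algover iota).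

Lemma evalat_wide f (p : {poly k}) n : (size p <= n)%N ->
  evalat f p = \sum_(i < n) iota p`_i * f ^+ i.
Proof.
move=> sp; have -> : evalat f p = (map_poly iota p).[f] by [].
rewrite (@horner_coef_wide _ n) ?size_map_poly //.
by apply: eq_bigr => i _; rewrite coef_map.
Qed.

(** At a pole of f the leading term dominates: the value of p(f) is deg p times the value of f. *)
Lemma vunit_evalat O f (p : {poly k}) : valring O -> ~ O f -> p != 0 ->
  vunit O (evalat f p / f ^+ (size p).-1).
Proof.
move=> Oval nOf p0; have Oring := valring_ring Oval.
have f0 := f_neq0 Oval nOf; have Ovf := OVf Oval nOf.
have -> : evalat f p / f ^+ (size p).-1 = iota (lead_coef p) +
   f^-1 * \sum_(i < (size p).-1) iota p`_i * f^-1 ^+ ((size p).-2 - i).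
  have sp : size p = (size p).-1.+1 by rewrite prednK // size_poly_gt0.
  rewrite (evalat_wide f (leqSpred (size p))) big_ord_recr /= -lead_coefE mulrDl mulfK ?expf_neq0 // addrC.
  congr (_ + _); rewrite mulr_suml mulr_sumr; apply: eq_bigr => i _.
  rewrite -mulrA [RHS]mulrCA; congr (_ * _); rewrite -exprS -subSn; last first.
    by rewrite -ltnS; case: (size p).-1 i => // -[].
  have -> : (size p).-2.+1 = (size p).-1 by case: (size p).-1 i => // -[].
  have -> : f ^+ (size p).-1 = f ^+ ((size p).-1 - i) * f ^+ i.
    by rewrite -exprD subnK // ltnW.
  by rewrite exprVn invfM mulrCA mulfV ?expf_neq0 // mulr1.
apply: (vunit_const_add Oval) => //; first by rewrite lead_coef_eq0.
elim/big_ind: _ => [|x y|i _]; [exact: (subring0 Oring)|exact: (subringD Oring)|].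
by apply: (subringM Oring); [exact: (valring_const Oval)|exact: (subringX Oring)].
Qed.

(** Two terms in the equation of x have the same value, and the values of its coefficients are
    multiples of that of f. Hence a positive multiple of the value of x is an integral multiple of
    the value of f. *)
Lemma value_torsion O f x : valring O -> ~ O f -> x != 0 -> algover f x ->
  exists e a b, (0 < e)%N /\ vunit O (x ^+ e * (f ^+ a / f ^+ b)).
Proof.
move=> Oval nOf x0 [Q Q0 /rootP Qx]; have f0 := f_neq0 Oval nOf.
pose s := [seq i <- index_iota 0 (size Q) | Q`_i != 0].
pose t i := evalat f Q`_i * x ^+ i.
have ev0 p : p != 0 -> evalat f p != 0.
  by move=> p0; have [] := vunit_evalat Oval nOf p0; rewrite mulf_eq0 negb_or => /andP[].
have tn0 i : i \in s -> t i != 0.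
  by rewrite mem_filter => /andP[Qi _]; rewrite mulf_neq0 ?ev0 ?expf_neq0.
have [||i [j [i_s j_s ij Uij]]] := vanishing_sum Oval (filter_uniq _ (iota_uniq 0 _)) tn0.
- apply/eqP => s0; have : (size Q).-1 \in s.
    rewrite mem_filter -lead_coefE lead_coef_eq0 Q0 mem_index_iota /=.
    by rewrite prednK ?leqnn // size_poly_gt0.
  by rewrite /s s0.
- rewrite big_filter big_mkord -[RHS]Qx (@horner_coef_wide _ (size Q)) ?size_poly //.
  rewrite [LHS]big_mkcond; apply: eq_bigr => i _; rewrite coef_map /t.
  by case: eqP => //= ->; rewrite rmorph0 mul0r.
have : exists a b, vunit O (x ^+ i / x ^+ j * (f ^+ a / f ^+ b)).
  move: i_s j_s; rewrite !mem_filter => /andP[Qi _] /andP[Qj _].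
  have Ui := vunit_evalat Oval nOf Qi; have Uj := vunit_evalat Oval nOf Qj.
  exists (size Q`_i).-1, (size Q`_j).-1.
  have := vunitM Oval (vunitM Oval Uij (vunitV Ui)) Uj; congr (vunit O _).
  have := ev0 _ Qi; have := ev0 _ Qj.
  have := expf_neq0 i x0; have := expf_neq0 j x0.
  have := expf_neq0 (size Q`_i).-1 f0; have := expf_neq0 (size Q`_j).-1 f0.
  rewrite /t; move: (evalat _ _) (evalat _ _) (x ^+ i) (x ^+ j) (f ^+ _) (f ^+ _).
  by move=> u v w y z r *; field; repeat (apply/andP; split => //).
move=> [a [b U]]; move: ij U; wlog ij : i j a b {i_s j_s Uij} / (i < j)%N.
  move=> W ij U; move: ij (ij); rewrite {1}neq_ltn => /orP[lij|lji] ij.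
    exact: (W i j a b).
  apply: (W j i b a) => //; first by rewrite eq_sym.
  have := vunitV U; congr (vunit O _).
  have := expf_neq0 i x0; have := expf_neq0 j x0.
  have := expf_neq0 a f0; have := expf_neq0 b f0.
  move: (f ^+ a) (f ^+ b) (x ^+ i) (x ^+ j) => u v w z *.
  by field; repeat (apply/andP; split => //).
move=> _ U; exists (j - i)%N, b, a; rewrite subn_gt0; split=> //.
have := vunitV U; congr (vunit O _).
have -> : x ^+ j = x ^+ (j - i) * x ^+ i by rewrite -exprD subnK // ltnW.
have := expf_neq0 i x0; have := expf_neq0 (j - i) x0.
have := expf_neq0 a f0; have := expf_neq0 b f0.
move: (f ^+ a) (f ^+ b) (x ^+ _) (x ^+ _) => u v w z *.
by field; repeat (apply/andP; split => //).
Qed.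

(** All values are commensurable with that of f: if x were in O' but not in O, a positive power of f
    would be a power of x times a unit of O, and f would lie in O'. *)
Lemma valring_sub_eq O O' f : valring O -> valring O' -> ~ O f -> ~ O' f ->
  (forall x, algover f x) -> (forall x, O x -> O' x) -> forall x, O' x -> O x.
Proof.
move=> Oval Oval' nOf nO'f algF OO' x O'x; apply: boolp.contrapT => nOx.
have Oring := valring_ring Oval; have Oring' := valring_ring Oval'.
have f0 := f_neq0 Oval nOf.
have x0 : x != 0 by apply/eqP => x0; apply: nOx; rewrite x0; apply: (subring0 Oring).
have [e [a [b [e0 U]]]] := value_torsion Oval nOf x0 (algF x).
have [w0 Ow Ovw] := U.
have [ba|ab] := leqP b a.
  apply: nOx; apply: (valring_root Oval e0 x0).
  have -> : x ^+ e = (x ^+ e * (f ^+ a / f ^+ b)) * f^-1 ^+ (a - b).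
    have -> : f ^+ a = f ^+ (a - b) * f ^+ b by rewrite -exprD subnK.
    by rewrite mulfK ?expf_neq0 // exprVn mulfK // expf_neq0.
  by apply: (subringM Oring) => //; apply: (subringX Oring); apply: (OVf Oval).
apply: nO'f; apply: (valring_root Oval' (n := b - a)) => //; first by rewrite subn_gt0.
have -> : f ^+ (b - a) = x ^+ e * (x ^+ e * (f ^+ a / f ^+ b))^-1.
  rewrite expfB //.
  have := expf_neq0 a f0; have := expf_neq0 b f0; have := expf_neq0 e x0.
  move: (x ^+ e) (f ^+ a) (f ^+ b) => u v w *.
  by field; repeat (apply/andP; split => //).
by apply: (subringM Oring'); [apply: (subringX Oring')|apply: OO'].
Qed.

(** Some u = h^e f^a / f^b is a unit of O, and so is rho(u)/u, which equals (rho(h)/h)^e because f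
    is fixed. *)
Lemma vunit_ratio O f (rho : {rmorphism F -> F}) h : valring O -> ~ O f ->
  (forall x, O (rho x) <-> O x) -> rho f = f -> h != 0 -> algover f h ->
  vunit O (rho h / h).
Proof.
move=> Oval nOf rhoO rhof h0 algh.
have [e [a [b [e0 U]]]] := value_torsion Oval nOf h0 algh.
have U' : vunit O (rho (h ^+ e * (f ^+ a / f ^+ b))).
  have [w0 Ow Ovw] := U; split; [by rewrite fmorph_eq0|exact/rhoO|].
  by rewrite -fmorphV; apply/rhoO.
apply: (vunit_root Oval e0); have := vunitM Oval U' (vunitV U); congr (vunit O _).
have f0 := f_neq0 Oval nOf.
rewrite !rmorphM fmorphV !rmorphXn /= rhof [RHS]exprMn exprVn.
have := expf_neq0 a f0; have := expf_neq0 b f0; have := expf_neq0 e h0.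
move: (f ^+ a) (f ^+ b) (h ^+ e) (rho h ^+ e) => u v w z *.
by field; repeat (apply/andP; split => //).
Qed.

Section Finiteness.

Variable (f : F).
Hypothesis (algF : forall x, algover f x).
Let t := f^-1.

Lemma separate O O' : valring O -> valring O' -> ~ O f -> ~ O' f -> O <> O' ->
  exists x, [/\ O x, ~ vunit O x & ~ O' x].
Proof.
move=> Oval Oval' nOf nO'f OO'.
have Oring := valring_ring Oval; have Oring' := valring_ring Oval'.
have diff O1 O2 : valring O1 -> valring O2 -> ~ O1 f -> ~ O2 f -> O1 <> O2 ->
    exists2 x, O1 x & ~ O2 x.
  move=> v1 v2 n1 n2 ne; apply: boolp.contrapT => H; apply: ne.
  have sub x : O1 x -> O2 x.
    by move=> O1x; apply: boolp.contrapT => nO2x; apply: H; exists x.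
  apply: boolp.funext => x; apply: boolp.propext; split; first exact: sub.
  exact: (valring_sub_eq v1 v2 n1 n2 algF sub).
have [x Ox nO'x] := diff _ _ Oval Oval' nOf nO'f OO'.
have [y O'y nOy] := diff _ _ Oval' Oval nO'f nOf (fun E => OO' (esym E)).
have y0 : y != 0 by apply/eqP => y0; apply: nOy; rewrite y0; apply: (subring0 Oring).
have x0 : x != 0 by apply/eqP => x0; apply: nO'x; rewrite x0; apply: (subring0 Oring').
have [//|Oyv] := valring_total Oval y0.
exists (x / y); split.
- exact: (subringM Oring).
- move=> [_ _]; rewrite invfM invrK mulrC => H; apply: nOy.
  by rewrite -[y](mulfVK x0); apply: (subringM Oring).
- move=> H; apply: nO'x; rewrite -[x](mulfVK y0); exact: (subringM Oring').
Qed.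

(** If x is finite at O_i and has a pole at O_j, then 1/(1 + c x) is a unit at O_i, a non-unit at
    O_j and, for generic c, finite at every ring of the family. The product of such elements over
    all j serves for i. *)
Lemma separating_family m (Os : 'I_m -> F -> Prop) :
  injective Os -> (forall i, valring (Os i) /\ ~ Os i f) ->
  exists e : 'I_m -> F, forall i, vunit (Os i) (e i) /\
     forall j, j != i -> Os j (e i) /\ ~ vunit (Os j) (e i).
Proof.
move=> Osinj OsP.
have pair i j : exists e, i != j -> [/\ vunit (Os i) e, Os j e, ~ vunit (Os j) e & forall l, Os l e].
  have [->|ij] := eqVneq i j; first by exists 0.
  have [Vi ni] := OsP i; have [Vj nj] := OsP j.
  have [|x [Oix nUix nOjx]] := separate Vi Vj ni nj; first by move/Osinj/eqP; apply/negP.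
  (* Each ring excludes at most one c: if 1 + b x and 1 + c x were both non-units, so would be their
     difference (c - b) x, then x, and finally 1. *)
  have bad l : exists b : k, Os l x -> forall c, ~ vunit (Os l) (1 + iota c * x) -> Os l (1 + iota c * x) -> c = b.
    have [[b [Olx nb]]|H] := boolp.EM (exists b, Os l x /\ ~ vunit (Os l) (1 + iota b * x)); last first.
      by exists 0 => Olx c nc; case: H; exists c.
    have Vl := (OsP l).1; have Rl := valring_ring Vl.
    exists b => _ c nc Olc; apply/eqP/negPn/negP => cb.
    have cb0 : iota c - iota b != 0 by rewrite -rmorphB fmorph_eq0 subr_eq0.
    have Olb : Os l (1 + iota b * x).
      by apply: (subringD Rl); [exact: (subring1 Rl)|apply: (subringM Rl) => //; exact: (valring_const Vl)].
    have nx : ~ vunit (Os l) x.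
      move=> Ux.
      have Ucb : vunit (Os l) (iota c - iota b).
        rewrite -rmorphB in cb0 *; split=> //; first exact: (valring_const Vl).
        by rewrite -fmorphV; apply: (valring_const Vl).
      have := vunitM Vl Ucb Ux.
      have -> : (iota c - iota b) * x = (1 + iota c * x) + - (1 + iota b * x) by ring.
      apply: (nonunitD Vl) => //; first exact: (subringN Rl).
      by move=> [H1 H2]; rewrite invrN => H3; apply: nb; split=> //;
        [move: H1; rewrite oppr_eq0|rewrite -[_^-1]opprK; apply: (subringN Rl)].
    have U1 : vunit (Os l) 1 by split; rewrite ?oner_eq0 ?invr1 //; exact: (subring1 Rl).
    move: U1; rewrite -[1](addrK (iota b * x)).
    apply: (nonunitD Vl) => //; first by apply: (subringN Rl); apply: (subringM Rl) => //; exact: (valring_const Vl).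
    move=> [H1 H2 H3]; apply: nx; split.
    - by move: H1; rewrite oppr_eq0 mulf_eq0 negb_or => /andP[].
    - by [].
    - have b0 : iota b != 0 by move: H1; rewrite oppr_eq0 mulf_eq0 negb_or => /andP[].
      have x0 : x != 0 by move: H1; rewrite oppr_eq0 mulf_eq0 negb_or => /andP[].
      have -> : x^-1 = - (iota b) * (- (iota b * x))^-1 by rewrite invrN mulrNN invfM mulrA mulfV // mul1r.
      by apply: (subringM Rl) => //; apply: (subringN Rl); exact: (valring_const Vl).
  have [b bP] := fin_all_exists bad.
  have prod0 : 'X * \prod_l ('X - (b l)%:P) != 0 :> {poly k}.
    by rewrite mulf_neq0 ?polyX_eq0 //; apply/prodf_neq0 => l _; rewrite polyXsubC_eq0.
  have [c] := @nonroot k k_char0 0 _ prod0.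
  rewrite hornerM hornerX mulf_eq0 negb_or horner_prod => /andP[/= c0 /prodf_neq0 cb].
  have x0 : x != 0 by apply/eqP => x0; apply: nOjx; rewrite x0; apply: (subring0 (valring_ring Vj)).
  have ic0 : iota c != 0 by rewrite fmorph_eq0.
  have good l : Os l x -> vunit (Os l) (1 + iota c * x).
    move=> Olx; apply: boolp.contrapT => nu; have Vl := (OsP l).1; have Rl := valring_ring Vl.
    have : c = b l.
      apply: (bP l Olx c nu); apply: (subringD Rl); first exact: (subring1 Rl).
      by apply: (subringM Rl) => //; exact: (valring_const Vl).
    by move=> E; have := cb l isT; rewrite hornerXsubC E subrr eqxx.
  have n0 : 1 + iota c * x != 0 by have [] := good i Oix.
  have bad' l : ~ Os l x -> Os l (1 + iota c * x)^-1 /\ ~ Os l (1 + iota c * x).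
    move=> nx; have Vl := (OsP l).1; have Rl := valring_ring Vl.
    have nn : ~ Os l (1 + iota c * x).
      move=> H; apply: nx; have -> : x = (iota c)^-1 * ((1 + iota c * x) - 1) by field.
      apply: (subringM Rl); first by rewrite -fmorphV; exact: (valring_const Vl).
      by apply: (subringB Rl) => //; exact: (subring1 Rl).
    by split=> //; case: (valring_total Vl n0).
  have [Ovj nOj] := bad' j nOjx.
  exists (1 + iota c * x)^-1 => _; split=> //.
  - exact/vunitV/good.
  - by move/vunitV; rewrite invrK => -[].
  - move=> l; have [/good[]//|/bad'[]//] := boolp.EM (Os l x).
have [e0 e0P] := fin_all_exists (fun ij : 'I_m * 'I_m => pair ij.1 ij.2).
exists (fun i => \prod_(j | i != j) e0 (i, j)) => i; have Vi := (OsP i).1; split.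
  elim/big_ind: _ => [|x y|j ij]; last by have [] := e0P (i, j) ij.
    by split; rewrite ?oner_eq0 ?invr1 //; exact: (subring1 (valring_ring Vi)).
  exact: (vunitM Vi).
move=> j ji; have Vj := (OsP j).1; have Rj := valring_ring Vj.
have ij : i != j by rewrite eq_sym.
have Oother (P : pred 'I_m) : Os j (\prod_(l | (i != l) && P l) e0 (i, l)).
  elim/big_ind: _ => [|x y|l /andP[il _]]; [exact: (subring1 Rj)|exact: (subringM Rj)|].
  by have [_ _ _] := e0P (i, l) il; apply.
have [_ Oj nUj _] := e0P (i, j) ij; rewrite (bigD1 j) //=.
split; first exact: (subringM Rj).
move=> [H1 _ H3]; apply: nUj; have e00 : e0 (i, j) != 0.
  by move: H1; rewrite mulf_eq0 negb_or => /andP[].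
split=> //; set P := (X in _ * X) in H1 H3.
have P0 : P != 0 by move: H1; rewrite mulf_eq0 negb_or => /andP[].
have -> : (e0 (i, j))^-1 = (e0 (i, j) * P)^-1 * P by rewrite invfM -mulrA mulVf // mulr1.
exact: (subringM Rj) H3 (Oother _).
Qed.

Definition findim D := forall m (e : 'I_m -> F), (D < m)%N ->
  exists2 c : 'I_m -> {poly k}, (exists i, c i != 0) & \sum_i evalat t (c i) * e i = 0.

(** Once common factors t are divided out, some coefficient c_i has a non-zero constant term. Then
    its value at t times e_i is a unit of O_i, while the other terms are non-units there. *)
Lemma separating_family_free m (Os : 'I_m -> F -> Prop) (e : 'I_m -> F) :
  (forall i, valring (Os i) /\ ~ Os i f) ->
  (forall i, vunit (Os i) (e i) /\ forall j, j != i -> Os j (e i) /\ ~ vunit (Os j) (e i)) ->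
  forall c : 'I_m -> {poly k}, \sum_i evalat t (c i) * e i = 0 -> forall i, c i = 0.
Proof.
move=> OsP eP.
have main n (c : 'I_m -> {poly k}) : (\sum_i size (c i) <= n)%N ->
    \sum_i evalat t (c i) * e i = 0 -> forall i, c i = 0.
  elim: n c => [|n IH] c.
    by rewrite leqn0 sum_nat_eq0 => /forallP H _ i; apply/eqP; rewrite -size_poly_eq0; apply: H.
  move=> sc sum0.
  have [[i ci]|H] := boolp.EM (exists i, (c i).[0] != 0); last first.
    have cX i : exists q, c i = q * 'X.
      have /factor_theorem[q ->] : root (c i) 0.
        by apply/rootP/eqP/negPn/negP => n0; apply: H; exists i.
      by exists q; rewrite subr0.
    have [q qP] := fin_all_exists cX.
    have [[i ci]|H'] := boolp.EM (exists i, c i != 0); last first.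
      by move=> i; apply/eqP/negPn/negP => n0; apply: H'; exists i.
    have t0 : t != 0 by rewrite invr_eq0 (f_neq0 (OsP i).1 (OsP i).2).
    have q0 : forall i, q i = 0.
      apply: IH.
        rewrite -ltnS; apply: leq_trans sc.
        rewrite (bigD1 i) //= [X in (_ < X)%N](bigD1 i) //= -addSn; apply: leq_add.
          have qi : q i != 0 by apply: contraNneq ci; rewrite qP => ->; rewrite mul0r.
          by rewrite qP size_mulX.
        apply: leq_sum => l _; rewrite qP.
        by have [->|ql] := eqVneq (q l) 0; rewrite ?size_poly0 // size_mulX.
      apply: (mulIf t0); rewrite mul0r -[RHS]sum0 mulr_suml; apply: eq_bigr => l _.
      by rewrite qP rmorphM /= evalatX mulrAC.
    by move=> l; rewrite qP q0 mul0r.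
  have [Vi ni] := OsP i; have Ri := valring_ring Vi; have [Ui eo] := eP i.
  have Ot : Os i t := OVf Vi ni.
  have Oev p : Os i (evalat t p).
    rewrite evalatE; elim/big_ind: _ => [|x y|l _]; [exact: (subring0 Ri)|exact: (subringD Ri)|].
    by apply: (subringM Ri); [exact: (valring_const Vi)|exact: (subringX Ri)].
  have Uc : vunit (Os i) (evalat t (c i)).
    have [q Eq] : exists q, c i = (c i).[0]%:P + 'X * q.
      have /factor_theorem[q] : root (c i - (c i).[0]%:P) 0.
        by rewrite /root hornerD hornerN hornerC subrr.
      by rewrite subr0 => Eq; exists q; rewrite mulrC -Eq addrC subrK.
    rewrite Eq rmorphD rmorphM /= evalatX evalatC.
    exact: (vunit_const_add Vi ni ci (Oev q)).
  move: sum0; rewrite (bigD1 i) //= => /eqP; rewrite addr_eq0 => /eqP E.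
  have := vunitM Vi Uc Ui; rewrite E => -[H1 H2 H3]; exfalso.
  have : ~ vunit (Os i) (\sum_(l | l != i) evalat t (c l) * e l).
    have : Os i (\sum_(l | l != i) evalat t (c l) * e l) /\ ~ vunit (Os i) (\sum_(l | l != i) evalat t (c l) * e l).
      elim/big_ind: _ => [|x y [Ox nx] [Oy ny]|l li].
      - by split; [exact: (subring0 Ri)|case; rewrite eqxx].
      - by split; [exact: (subringD Ri)|exact: (nonunitD Vi)].
      - have il : i != l by rewrite eq_sym.
        have [Oel nel] := (eP l).2 i il.
        split; first exact: (subringM Ri).
        move=> [G1 _ G3]; apply: nel; move: (G1); rewrite mulf_eq0 negb_or => /andP[a0 b0].
        split=> //; have -> : (e l)^-1 = (evalat t (c l) * e l)^-1 * evalat t (c l).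
          by rewrite invfM mulrC mulrA mulfV // mul1r.
        exact: (subringM Ri).
    by case.
  apply; rewrite oppr_eq0 in H1; split=> //; first by rewrite -[X in Os i X]opprK; apply: (subringN Ri).
  by rewrite -[X in Os i X]opprK -invrN; apply: (subringN Ri).
move=> c; exact: (main _ c (leqnn _)).
Qed.

(** A separating family is free, so at most D valuation rings have f as a pole. Pulling back along
    sigma maps this finite set to itself, injectively since sigma is onto; n is the order of the
    resulting permutation. *)
Lemma valrings_permuted D (sigma : {rmorphism F -> F}) :
  findim D -> (forall y, exists x, sigma x = y) ->
  (forall c, exists d, sigma (iota c) = iota d) -> sigma f = f ->
  exists2 n, (0 < n)%N & forall O, valring O -> ~ O f ->
    forall x, O (iter n sigma x) <-> O x.
Proof.
move=> fd sig_surj sig_const sigf.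
pose fam m (Os : 'I_m -> F -> Prop) := injective Os /\ forall i, valring (Os i) /\ ~ Os i f.
pose P m := boolp.asbool (exists Os, @fam m Os).
have P0 : exists m, P m.
  by exists 0%N; apply/boolp.asboolP; exists (fun _ _ => True); split; case.
have Pbound m : P m -> (m <= D)%N.
  move=> /boolp.asboolP[Os [Osinj OsP]]; rewrite leqNgt; apply/negP => Dm.
  have [e eP] := separating_family Osinj OsP.
  have [c [i ci] sum0] := fd m e Dm.
  by case/eqP: ci; apply: separating_family_free sum0 i.
case: (ex_maxnP P0 Pbound) => m /boolp.asboolP[Os [Osinj OsP]] mmax.
have allO O : valring O -> ~ O f -> exists i, Os i = O.
  move=> Vo no; apply: boolp.contrapT => H.
  have : P m.+1; last by move/mmax; rewrite ltnn.
  apply/boolp.asboolP; exists (fun i => if unlift ord_max i is Some l then Os l else O); split.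
    move=> i l; case: unliftP => [i' ->|->]; case: unliftP => [l' ->|->] //.
    - by move/Osinj ->.
    - by move=> E; case: H; exists i'.
    - by move=> E; case: H; exists l'.
  by move=> i; case: unlift => [l|].
have pullback O : valring O -> ~ O f -> valring (fun x => O (sigma x)) /\ ~ O (sigma f).
  move=> Vo no; have Ro := valring_ring Vo; rewrite sigf; split=> //; split.
  - split; first by rewrite rmorph1; apply: (subring1 Ro).
      by move=> x y; rewrite rmorphB; apply: (subringB Ro).
    by move=> x y; rewrite rmorphM; apply: (subringM Ro).
  - by move=> c; have [d ->] := sig_const c; apply: (valring_const Vo).
  - by move=> x x0; rewrite fmorphV; apply: (valring_total Vo); rewrite fmorph_eq0.
have step i : exists l, Os l = (fun x => Os i (sigma x)).
  by have [Vi ni] := OsP i; have [V' n'] := pullback _ Vi ni; apply: allO.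
have [s sP] := fin_all_exists step.
have s_inj : injective s.
  move=> i l E; apply: Osinj; have := sP i; rewrite E sP => E'.
  apply: boolp.funext => y; have [x <-] := sig_surj y.
  by have := congr1 (fun O => O x) E'.
pose p := perm s_inj.
exists #[p]%g; first exact: order_gt0.
have iterO n i : (fun x => Os i (iter n sigma x)) = Os ((p ^+ n)%g i).
  elim: n i => [|n IH] i; first by rewrite expg0 perm1.
  rewrite expgSr permM permE sP -IH.
  by apply: boolp.funext => x; rewrite iterSr.
move=> O Vo no x; have [i <-] := allO O Vo no.
by have := congr1 (fun O' => O' x) (iterO #[p]%g i); rewrite expg_order perm1 => ->.
Qed.

End Finiteness.

End ValuationsAtInfinity.

(** * Subfields, simple extensions and norms *)

Record subfield (L : fieldType) (S : L -> Prop) : Prop := Subfield {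
  subfield_ring : subring S;
  subfieldV : forall x, S x -> S x^-1 }.

Section SubfieldType.

Variables (L : fieldType) (S : L -> Prop) (S_field : subfield S).

(* The unused proof argument keeps [S_field] inferable from the type. *)
Definition subfield_pred (_ : subfield S) : {pred L} := fun x => boolp.asbool (S x).

Lemma subfield_divring : divring_closed (subfield_pred S_field).
Proof.
have R := subfield_ring S_field; split.
- by apply/boolp.asboolP; apply: (subring1 R).
- by move=> x y /boolp.asboolP Sx /boolp.asboolP Sy; apply/boolp.asboolP; apply: (subringB R).
- move=> x y /boolp.asboolP Sx /boolp.asboolP Sy; apply/boolp.asboolP; apply: (subringM R) => //.
  exact: (subfieldV S_field).
Qed.

HB.instance Definition _ := GRing.isDivringClosed.Build L (subfield_pred S_field) subfield_divring.

Record subfield_type := SubfieldType {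
  subfield_val :> L; _ : subfield_val \in subfield_pred S_field }.

HB.instance Definition _ := [isSub for subfield_val].
HB.instance Definition _ := [Choice of subfield_type by <:].
HB.instance Definition _ := [SubChoice_isSubIntegralDomain of subfield_type by <:].
HB.instance Definition _ := [SubIntegralDomain_isSubField of subfield_type by <:].

Definition subfield_inj : {rmorphism subfield_type -> L} := val.

Lemma subfield_injP x : S (subfield_inj x).
Proof. by have /boolp.asboolP := valP x. Qed.

Lemma subfield_injE x : S x -> exists y, x = subfield_inj y.
Proof. by move=> /boolp.asboolP Sx; exists (SubfieldType Sx). Qed.

End SubfieldType.

Arguments subfield_inj {L S} S_field.

Lemma frac_lift (A : idomainType) (L K : fieldType) (j : {rmorphism A -> L})
  (g : {rmorphism A -> K}) :
  injective j -> (forall x, exists n d, d != 0 /\ x = j n / j d) -> injective g ->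
  exists h : {rmorphism L -> K}, forall a, h (j a) = g a.
Proof.
move=> j_inj frac g_inj.
have [x|h0 h0P] := @boolp.choice L K (fun x y => exists n d,
    [/\ d != 0, x = j n / j d & y = g n / g d]).
  by have [n [d [d0 ->]]] := frac x; exists (g n / g d), n, d.
have j0 x : (j x == 0) = (x == 0) by apply: raddf_eq0.
have g0 x : (g x == 0) = (x == 0) by apply: raddf_eq0.
have hE x n d : d != 0 -> x = j n / j d -> h0 x = g n / g d.
  move=> d0 Ex; have [n' [d' [d'0 Ex' ->]]] := h0P x.
  have : j (n' * d) = j (n * d').
    rewrite !rmorphM; apply/eqP; rewrite -eqr_div ?j0 //; apply/eqP; by rewrite -Ex -Ex'.
  move/j_inj => E; apply/eqP; rewrite eqr_div ?g0 // -!rmorphM; exact/eqP/congr1.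
have hadd : zmod_morphism h0.
  move=> x y; have [n [d [d0 Ex ->]]] := h0P x; have [n' [d' [d'0 Ey ->]]] := h0P y.
  rewrite (hE _ (n * d' - n' * d) (d * d')) ?mulf_neq0 //.
    by rewrite rmorphB !rmorphM -[- (_ / _)]mulNr addf_div ?g0 // mulNr.
  by rewrite Ex Ey rmorphB !rmorphM -[- (_ / _)]mulNr addf_div ?j0 // mulNr.
have hmul : monoid_morphism h0.
  split; first by rewrite (hE _ 1 1) ?oner_eq0 // !rmorph1 divff ?oner_eq0.
  move=> x y; have [n [d [d0 Ex ->]]] := h0P x; have [n' [d' [d'0 Ey ->]]] := h0P y.
  rewrite (hE _ (n * n') (d * d')) ?mulf_neq0 //.
    by rewrite !rmorphM mulf_div.
  by rewrite Ex Ey !rmorphM mulf_div.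
pose hA := GRing.isZmodMorphism.Build L K h0 hadd.
pose hM := GRing.isMonoidMorphism.Build L K h0 hmul.
pose h : {rmorphism L -> K} := HB.pack h0 hA hM.
exists h => a; rewrite -[h _]/(h0 _) (hE _ a 1) ?oner_eq0 // !rmorph1 divr1 //.
Qed.

Section SimpleExtension.

Variables (E L : fieldType) (iota : {rmorphism E -> L}) (b : L).
Local Notation "p ^i" := (map_poly iota p) (at level 2).

Lemma minimal_polynomial (p0 : {poly E}) : p0 != 0 -> root p0^i b ->
  exists mu : {poly E}, [/\ mu \is monic, (1 < size mu)%N, root mu^i b,
    forall p, root p^i b -> exists s, p = mu * s &
    forall p, ~~ root p^i b -> exists s r, p * s + mu * r = 1].
Proof.
move=> p00 p0b.
pose P n := boolp.asbool (exists p : {poly E}, [/\ p != 0, root p^i b & size p = n]).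
have exP : exists n, P n by exists (size p0); apply/boolp.asboolP; exists p0.
case: (ex_minnP exP) => n /boolp.asboolP[mu [mu0 mub sz]] nmin.
have minmu p : p != 0 -> root p^i b -> (size mu <= size p)%N.
  by move=> pn0 pb; rewrite sz; apply: nmin; apply/boolp.asboolP; exists p.
have l0 : lead_coef mu != 0 by rewrite lead_coef_eq0.
have rootZ c p : root p^i b -> root (c *: p)^i b.
  by rewrite /root map_polyZ hornerZ => /eqP ->; rewrite mulr0.
have dvd p : root p^i b -> exists s, p = mu * s.
  move=> pb; have pmod : root (p %% mu)^i b.
    have -> : p %% mu = p - p %/ mu * mu by rewrite {2}(divp_eq p mu) addrC addKr.
    rewrite /root rmorphB rmorphM /= hornerD hornerN hornerM.
    by rewrite (rootP pb) (rootP mub) mulr0 subr0.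
  exists (p %/ mu); rewrite {1}(divp_eq p mu) mulrC.
  have [->|r0] := eqVneq (p %% mu) 0; first by rewrite addr0.
  by have := minmu _ r0 pmod; rewrite leqNgt ltn_modp mu0.
have dvdZ c : c != 0 -> forall p, (exists s, p = mu * s) -> exists s, p = (c *: mu) * s.
  by move=> c0 p [s ->]; exists (c^-1 *: s); rewrite -scalerAl -scalerAr scalerA mulfV // scale1r.
exists ((lead_coef mu)^-1 *: mu); split.
- by apply/monicP; rewrite lead_coefZ mulVf.
- rewrite size_scale ?invr_eq0 // ltnNge; apply/negP => s1.
  move: mub mu0; rewrite (size1_polyC s1) /root map_polyC hornerC fmorph_eq0 => /eqP ->.
  by rewrite eqxx.
- exact: rootZ.
- by move=> p pb; apply: dvdZ; [rewrite invr_eq0|exact: dvd].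
- move=> p npb.
  have : coprimep p mu.
    apply: contraR npb; rewrite /coprimep => sd.
    have d0 : gcdp p mu != 0 by rewrite gcdp_eq0 negb_and mu0 orbT.
    have /dvdpP[q Eq] := dvdp_gcdr p mu.
    have q0 : q != 0 by apply: contraNneq mu0 => q0; rewrite Eq q0 mul0r.
    have : root mu^i b := mub; rewrite {1}Eq rmorphM rootM => /orP[qb|db].
      have := minmu _ q0 qb; rewrite {1}Eq size_mul // -subn1 leq_subLR.
      have d1 : (1 < size (gcdp p mu))%N.
        by rewrite ltn_neqAle eq_sym sd lt0n size_poly_eq0.
      by move: (size q) (size _) d1 => u w; lia.
    have /dvdpP[q' ->] : mu %| p.
      have [s ds] := dvd _ db.
      by apply: dvdp_trans (dvdp_gcdl p mu); rewrite ds dvdp_mulr.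
    by rewrite /root rmorphM hornerM (rootP mub) mulr0.
  move/Bezout_eq1_coprimepP => [[u w] /= Euw].
  exists u, (lead_coef mu *: w).
  by rewrite -scalerAl -scalerAr scalerA mulVf // scale1r -Euw; ring.
Qed.

(* The norm of the simple extension E(b), or the leading coefficient if b is transcendental. *)
Lemma multiplicative_norm : exists (N : {poly E} -> E) (e : nat),
  [/\ (0 < e)%N, forall p q, N (p * q) = N p * N q, forall c, N c%:P = c ^+ e,
      forall p, ~~ root p^i b -> N p != 0
    & forall p q, p^i.[b] = q^i.[b] -> N p = N q].
Proof.
have [[p0 [p00 p0b]]|H] := boolp.EM (exists p0, p0 != 0 /\ root p0^i b); last first.
  exists lead_coef, 1%N; split=> //.
  - exact: lead_coefM.
  - exact: lead_coefC.
  - by move=> p; apply: contraNneq => /eqP; rewrite lead_coef_eq0 => /eqP ->; rewrite rmorph0 root0.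
  - move=> p q Epq; congr lead_coef; apply/eqP; rewrite -subr_eq0; apply/negPn/negP => pq0.
    by apply: H; exists (p - q); rewrite /root rmorphB hornerD hornerN Epq subrr.
have [mu [mon s1 mub dvd cop]] := minimal_polynomial p00 p0b.
(* The companion matrix of mu represents multiplication by b, so the determinant of p(C) is the norm
   of p(b). *)
have [n [C EC]] : exists n (C : 'M[E]_n.+1), char_poly C = mu.
  move: (companionmx mu) (companionmxK mon) s1; case: (size mu) => [|[|n]] // C EC _.
  by exists n, C.
have CH : horner_mx C mu = 0 by rewrite -EC Cayley_Hamilton.
exists (fun p => \det (horner_mx C p)), n.+1; split=> //.
- by move=> p q; rewrite rmorphM det_mulmx.
- by move=> c; rewrite horner_mx_C det_scalar.
- move=> p /cop[s [r /(congr1 (horner_mx C))]].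
  rewrite rmorphD !rmorphM rmorph1 /= CH mul0r addr0.
  move/(congr1 determinant); rewrite det_mulmx det1 => E1; apply/eqP => d0.
  by move/eqP: E1; rewrite d0 mul0r eq_sym oner_eq0.
- move=> p q Epq; congr (\det _); apply/eqP; rewrite -subr_eq0 -rmorphB.
  have [|s ->] := dvd (p - q); first by rewrite /root rmorphB hornerD hornerN Epq subrr.
  by rewrite rmorphM /= CH mul0r.
Qed.

End SimpleExtension.

Section Adjoin.

Variables (L : fieldType) (S : L -> Prop) (S_field : subfield S) (b : L).
Let iota := subfield_inj S_field.

Definition adjoin (x : L) := exists p q : {poly subfield_type S_field},
  (map_poly iota q).[b] != 0 /\ x = (map_poly iota p).[b] / (map_poly iota q).[b].

Lemma adjoin_field : subfield adjoin.
Proof.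
split.
  split.
  - by exists 1, 1; rewrite rmorph1 hornerC divff ?oner_eq0.
  - move=> _ _ [p [q [q0 ->]]] [p' [q' [q'0 ->]]]; exists (p * q' - p' * q), (q * q').
    rewrite rmorphB !rmorphM hornerD hornerN !hornerM mulf_neq0 //; split=> //.
    by rewrite -[- (_ / _)]mulNr addf_div // mulNr.
  - move=> _ _ [p [q [q0 ->]]] [p' [q' [q'0 ->]]]; exists (p * p'), (q * q').
    by rewrite !rmorphM !hornerM mulf_neq0 // mulf_div.
move=> _ [p [q [q0 ->]]]; have [p0|p0] := eqVneq (map_poly iota p).[b] 0.
  by exists 0, 1; rewrite p0 mul0r invr0 rmorph0 rmorph1 horner0 hornerC mul0r oner_eq0.
by exists q, p; rewrite invfM invrK mulrC.
Qed.

Lemma adjoin_base x : S x -> adjoin x.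
Proof.
move=> /(subfield_injE S_field)[y ->]; exists y%:P, 1.
by rewrite rmorph1 map_polyC !hornerC divr1 oner_eq0.
Qed.

Lemma adjoin_gen : adjoin b.
Proof. by exists 'X, 1; rewrite rmorph1 map_polyX hornerX hornerC divr1 oner_eq0. Qed.

End Adjoin.

(** A homomorphism from the units of S to the integers, without an ultrametric inequality: it is
    enough to obstruct iterated square roots, and it passes to S(b) through the norm. *)
Definition multiplicative_val (L : fieldType) (S : L -> Prop) (v : L -> int) :=
  forall x y, S x -> S y -> x != 0 -> y != 0 -> v (x * y) = v x + v y.

Lemma multiplicative_valX (L : fieldType) (S : L -> Prop) v x n : subfield S ->
  multiplicative_val S v -> S x -> x != 0 -> v (x ^+ n) = v x *+ n.
Proof.
move=> Sf vM Sx x0; have R := subfield_ring Sf; elim: n => [|n IH].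
  have := vM 1 1 (subring1 R) (subring1 R) (oner_neq0 _) (oner_neq0 _).
  by rewrite mulr1 expr0 => /eqP; rewrite -subr_eq0 opprD addrA subrr sub0r oppr_eq0 => /eqP.
by rewrite exprS mulrS vM ?IH // ?expf_neq0 //; apply: (subringX R).
Qed.

(** v composed with the norm of the extension, taken on fractions p(b)/q(b); the norm of 2 is 2^e,
    so the value at 2 is multiplied by e > 0. *)
Lemma extend_val (L : fieldType) (S : L -> Prop) (S_field : subfield S) v (b : L) :
  (2%:R : L) != 0 -> multiplicative_val S v -> v 2%:R != 0 ->
  exists v', multiplicative_val (adjoin S_field b) v' /\ v' 2%:R != 0.
Proof.
move=> two0 vM v2; pose iota := subfield_inj S_field.
have [N [e [e0 NM NC N0 Neq]]] := multiplicative_norm iota b.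
pose w p := v (iota (N p)).
have [x|v' v'P] := @boolp.choice L int (fun x n => forall p q, x != 0 ->
    (map_poly iota q).[b] != 0 -> x = (map_poly iota p).[b] / (map_poly iota q).[b] -> n = w p - w q).
  have [[p [q [q0 Ex]]]|H] := boolp.EM (adjoin S_field b x); last first.
    by exists 0 => p q _ q0 Ex; case: H; exists p, q.
  exists (w p - w q) => p' q' x0 q'0 Ex'.
  have p0 : (map_poly iota p).[b] != 0.
    by apply: contraNneq x0 => p0; rewrite Ex p0 mul0r.
  have p'0 : (map_poly iota p').[b] != 0.
    by apply: contraNneq x0 => p'0; rewrite Ex' p'0 mul0r.
  have : N (p * q') = N (p' * q).
    apply: Neq; rewrite !rmorphM !hornerM; apply/eqP; rewrite -eqr_div //.
    by rewrite -Ex -Ex'.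
  move/(congr1 (fun y => v (iota y))); rewrite !NM !rmorphM.
  rewrite !vM ?fmorph_eq0 ?N0 //; try exact: subfield_injP.
  by rewrite -/(w p) -/(w q') -/(w p') -/(w q) => E; apply/eqP; rewrite subr_eq addrAC -E addrK.
exists v'; split.
  move=> x y [p [q [q0 Ex]]] [p' [q' [q'0 Ey]]] x0 y0.
  have p0 : (map_poly iota p).[b] != 0.
    by apply: contraNneq x0 => p0; rewrite Ex p0 mul0r.
  have p'0 : (map_poly iota p').[b] != 0.
    by apply: contraNneq y0 => p'0; rewrite Ey p'0 mul0r.
  rewrite (v'P x p q) // (v'P y p' q') // (v'P (x * y) (p * p') (q * q')) ?mulf_neq0 //.
  - rewrite /w !NM !rmorphM !vM ?fmorph_eq0 ?N0 //; try exact: subfield_injP.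
    by rewrite opprD addrACA.
  - by rewrite rmorphM hornerM mulf_neq0.
  - by rewrite !rmorphM !hornerM Ex Ey mulf_div.
have i1 : iota 1 = 1 := rmorph1 iota.
have i2 : iota 2%:R = 2%:R := rmorph_nat iota 2.
have e1 : (map_poly iota 1%:P).[b] = 1 by rewrite map_polyC hornerC; apply: i1.
have e2 : (map_poly iota (2%:R)%:P).[b] = 2%:R by rewrite map_polyC hornerC; apply: i2.
rewrite (v'P 2%:R (2%:R)%:P 1%:P) ?e1 ?oner_eq0 ?e2 ?divr1 //.
have -> : w (2%:R)%:P = v (2%:R ^+ e) by rewrite /w NC rmorphXn; congr (v (_ ^+ _)); exact: i2.
have -> : w 1%:P = v 1 by rewrite /w NC expr1n; congr (v _); exact: i1.
have R := subfield_ring S_field.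
have S2 : S 2%:R by rewrite -i2; apply: subfield_injP.
rewrite (multiplicative_valX _ S_field) //.
have := multiplicative_valX 0 S_field vM S2 two0; rewrite expr0 mulr0n => ->.
by rewrite subr0 Num.Theory.mulrn_eq0 negb_or -lt0n e0.
Qed.

(** * Automorphisms of k of infinite order that fix a finite set *)

Section FixedAutomorphism.

Variable (k : closedFieldType).
Hypothesis (k_char0 : [pchar k] =i pred0).

Lemma natr_neq0 n : (0 < n)%N -> n%:R != 0 :> k.
Proof. by move=> n0; rewrite ((pcharf0P k).1 k_char0) -lt0n. Qed.

Lemma intr_eq0_char0 (a : int) : (a%:~R == 0 :> k) = (a == 0).
Proof.
case: a => n; first by rewrite -pmulrn ((pcharf0P k).1 k_char0).
by rewrite NegzE mulrNz oppr_eq0 -pmulrn ((pcharf0P k).1 k_char0).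
Qed.

Definition prime_subfield (x : k) := exists a b : int, b != 0 /\ x = a%:~R / b%:~R.

Lemma prime_subfield_field : subfield prime_subfield.
Proof.
split; first split.
- by exists 1, 1; rewrite divff ?oner_eq0.
- move=> _ _ [a [b [b0 ->]]] [a' [b' [b'0 ->]]]; exists (a * b' - a' * b), (b * b').
  rewrite mulf_neq0 // rmorphB !rmorphM -[- (_ / _)]mulNr addf_div ?intr_eq0_char0 //.
  by rewrite mulNr.
- move=> _ _ [a [b [b0 ->]]] [a' [b' [b'0 ->]]]; exists (a * a'), (b * b').
  by rewrite mulf_neq0 // !rmorphM mulf_div.
move=> _ [a [b [b0 ->]]]; have [->|a0] := eqVneq a 0.
  by exists 0, 1; rewrite !mul0r invr0.
by exists b, a; rewrite invfM invrK mulrC.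
Qed.

Lemma prime_subfield_val :
  exists v : k -> int, multiplicative_val prime_subfield v /\ v 2%:R != 0.
Proof.
pose w (a : int) : int := (logn 2 `|a|%N)%:Z.
have wM a b : a != 0 -> b != 0 -> w (a * b) = w a + w b.
  by move=> a0 b0; rewrite /w abszM lognM ?absz_gt0.
have [x|v vP] := @boolp.choice k int (fun x n => forall a b : int, x != 0 ->
    b != 0 -> x = a%:~R / b%:~R -> n = w a - w b).
  have [[a [b [b0 Ex]]]|H] := boolp.EM (prime_subfield x); last first.
    by exists 0 => a b _ b0 Ex; case: H; exists a, b.
  exists (w a - w b) => a' b' x0 b'0 Ex'.
  have a0 : a != 0 by apply: contraNneq x0 => a0; rewrite Ex a0 mul0r.
  have a'0 : a' != 0 by apply: contraNneq x0 => a'0; rewrite Ex' a'0 mul0r.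
  have : a * b' = a' * b.
    apply/eqP; rewrite -subr_eq0 -intr_eq0_char0 rmorphB !rmorphM subr_eq0 /=.
    by rewrite -eqr_div ?intr_eq0_char0 // -Ex -Ex'.
  move/(congr1 w); rewrite !wM // => E; apply/eqP; rewrite subr_eq addrAC -E addrK //.
exists v; split.
  move=> x y [a [b [b0 Ex]]] [a' [b' [b'0 Ey]]] x0 y0.
  have a0 : a != 0 by apply: contraNneq x0 => a0; rewrite Ex a0 mul0r.
  have a'0 : a' != 0 by apply: contraNneq y0 => a'0; rewrite Ey a'0 mul0r.
  rewrite (vP x a b) // (vP y a' b') // (vP (x * y) (a * a') (b * b')) ?mulf_neq0 //.
    by rewrite !wM // opprD addrACA.
  by rewrite Ex Ey !rmorphM mulf_div.
by rewrite (vP 2%:R 2 1) ?natr_neq0 // divr1.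
Qed.

Lemma fg_subfield_val (Phi : seq k) : exists S : k -> Prop,
  [/\ subfield S, forall c, c \in Phi -> S c &
      exists v : k -> int, multiplicative_val S v /\ v 2%:R != 0].
Proof.
elim: Phi => [|b Phi [S [Sf SPhi [v [vM v2]]]]].
  by exists prime_subfield; split=> //; [exact: prime_subfield_field|exact: prime_subfield_val].
exists (adjoin Sf b); split; [exact: adjoin_field| |].
  move=> c; rewrite inE => /orP[/eqP ->|/SPhi]; first exact: adjoin_gen.
  exact: adjoin_base.
by apply: extend_val vM v2; apply: natr_neq0.
Qed.

Lemma exists_root2 (x : k) : exists y : k, y ^+ 2 = x.
Proof.
have [y yP] := solve_monicpoly (fun d => if d == 0%N then x else 0) (isT : (0 < 2)%N).
by exists y; rewrite yP !big_ord_recl big_ord0 /= mul0r !addr0 mulr1.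
Qed.

(** If S were closed under square roots in k, then 2 would have a 2^m-th root in S for every m, and
    2^m would divide v(2); this fails for m = |v(2)|. *)
Lemma nonsquare (Phi : seq k) : exists S theta,
  [/\ subfield S, forall c, c \in Phi -> S c, S (theta ^+ 2) & ~ S theta].
Proof.
have [S [Sf SPhi [v [vM v2]]]] := fg_subfield_val Phi.
have [H|/boolp.existsNP[theta /boolp.not_implyP[St nSt]]] :=
  boolp.EM (forall theta, S (theta ^+ 2) -> S theta); last by exists S, theta.
have R := subfield_ring Sf.
have two0 : 2%:R != 0 :> k by apply: natr_neq0.
have S2 : S 2%:R by rewrite mulr2n; apply: (subringD R); apply: (subring1 R).
have root m : exists y, [/\ S y, y != 0 & v 2%:R = v y *+ 2 ^ m].
  elim: m => [|m [y [Sy y0 Ev]]]; first by exists 2%:R; rewrite mulr1n.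
  have [z zy] := exists_root2 y; have z0 : z != 0.
    by apply: contraNneq y0 => z0; rewrite -zy z0 expr0n.
  have Sz : S z by apply: H; rewrite zy.
  by exists z; split=> //; rewrite Ev -zy (multiplicative_valX _ Sf vM) // -mulrnA expnS.
have [y [_ _ Ev]] := root `|v 2%:R|%N.
have := congr1 absz Ev; rewrite -[v y *+ _]mulr_natr abszM natz absz_nat => E.
have lt : (`|v 2%:R| < 2 ^ `|v 2%:R|)%N by apply: ltn_expl.
have y0 : (0 < `|v y|)%N.
  by rewrite lt0n; apply: contraNneq v2 => y0; rewrite -absz_eq0 E y0 mul0n.
by move: lt; rewrite {1}E ltnNge leq_pmull.
Qed.

(** E is maximal among the subfields that contain S but not theta. If y were transcendental over E,
    then theta would be a fraction p(y)/q(y), and the leading coefficients in p^2 = theta^2 q^2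
    would put theta in E. *)
Lemma maximal_subfield (Phi : seq k) : exists (E : k -> Prop) theta,
  [/\ subfield E, forall c, c \in Phi -> E c, E (theta ^+ 2), ~ E theta &
    forall (Ef : subfield E) y, exists2 p : {poly subfield_type Ef}, p != 0 &
      root (map_poly (subfield_inj Ef) p) y].
Proof.
have [S [theta [Sf SPhi S2 nS]]] := nonsquare Phi.
have [||E [[Ef nE] SE Emax]] := zorn_above (A0 := S) (P := fun X => subfield X /\ ~ X theta).
- by [].
- move=> C [X0 CX0] CP Ctot; split; last by case=> X CX; have [_] := CP _ CX.
  have tot2 x y X Y : C X -> C Y -> X x -> Y y -> exists Z, [/\ C Z, Z x & Z y].
    move=> CX CY Xx Yy; case: (Ctot X Y CX CY) => XY; [exists Y|exists X]; split=> //; exact: XY.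
  split; last by move=> x [X CX Xx]; exists X => //; have [Xf _] := CP _ CX; apply: (subfieldV Xf).
  split.
  + by exists X0 => //; have [Xf _] := CP _ CX0; apply: (subring1 (subfield_ring Xf)).
  + move=> x y [X CX Xx] [Y CY Yy]; have [Z [CZ Zx Zy]] := tot2 _ _ _ _ CX CY Xx Yy.
    by exists Z => //; have [Xf _] := CP _ CZ; apply: (subringB (subfield_ring Xf)).
  + move=> x y [X CX Xx] [Y CY Yy]; have [Z [CZ Zx Zy]] := tot2 _ _ _ _ CX CY Xx Yy.
    by exists Z => //; have [Xf _] := CP _ CZ; apply: (subringM (subfield_ring Xf)).
exists E, theta; split=> //; [by move=> c /SPhi/SE|exact: SE|].
move=> {}Ef y; pose iota := subfield_inj Ef.
apply: boolp.contrapT => H.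
have trans (p : {poly subfield_type Ef}) : (map_poly iota p).[y] = 0 -> p = 0.
  by move=> py; apply/eqP/negPn/negP => p0; apply: H; exists p => //; apply/rootP.
have [At|nAt] := boolp.EM (adjoin Ef y theta); last first.
  have Ey : E y.
    apply: (Emax (adjoin Ef y)); last exact: adjoin_gen.
      by split=> //; apply: adjoin_field.
    exact: adjoin_base.
  have [z zy] := subfield_injE Ef Ey.
  have := trans ('X - z%:P); rewrite zy horner_map hornerXsubC subrr => /(_ (rmorph0 _))/eqP.
  by rewrite polyXsubC_eq0.
have [p [q [q0 Et]]] := At.
have [d Ed] := subfield_injE Ef (SE _ S2).
have comm : commr_rmorph iota y by move=> ?; apply: mulrC.
pose ev : {rmorphism {poly subfield_type Ef} -> k} := horner_morph comm.
have evC c : ev c%:P = iota c by apply: horner_morphC.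
have q0' : ev q != 0 by exact: q0.
have Et' : theta = ev p / ev q by exact: Et.
have Epq : p ^+ 2 = d%:P * q ^+ 2.
  apply/eqP; rewrite -subr_eq0; apply/eqP/trans; rewrite -[LHS]/(ev _).
  rewrite rmorphB rmorphXn rmorphM rmorphXn evC -[iota d]Ed Et'.
  by rewrite exprMn exprVn mulfVK ?expf_neq0 // subrr.
have lq : lead_coef q != 0.
  by rewrite lead_coef_eq0; apply: contraNneq q0 => ->; rewrite rmorph0 horner0.
have := congr1 (fun r => iota (lead_coef r)) Epq.
rewrite lead_coef_exp lead_coefM lead_coefC lead_coef_exp rmorphXn rmorphM rmorphXn -[iota d]Ed => E2.
have ilq : iota (lead_coef q) != 0 by rewrite fmorph_eq0.
have : (iota (lead_coef p) / iota (lead_coef q)) ^+ 2 = theta ^+ 2.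
  by rewrite exprMn exprVn E2 mulfK // expf_neq0.
rewrite -fmorphV -rmorphM => /eqP; rewrite eqf_sqr => /orP[] /eqP Eth.
  by apply: nE; rewrite -Eth; apply: subfield_injP.
apply: nE; rewrite -[theta]opprK -Eth; apply: (subringN (subfield_ring Ef)).
exact: subfield_injP.
Qed.

End FixedAutomorphism.

Section PartialIsomorphisms.

Variable (k : closedFieldType).
Hypothesis (k_char0 : [pchar k] =i pred0).

(** Graphs of isomorphisms between subfields of k: extension is inclusion of graphs, so the union of
    a chain needs no gluing. *)
Record partial_iso (G : k * k -> Prop) : Prop := PartialIso {
  piso1 : G (1, 1);
  pisoB : forall x y x' y', G (x, y) -> G (x', y') -> G (x - x', y - y');
  pisoM : forall x y x' y', G (x, y) -> G (x', y') -> G (x * x', y * y');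
  pisoV : forall x y, G (x, y) -> G (x^-1, y^-1);
  piso_fun : forall y, G (0, y) -> y = 0;
  piso_inj : forall x, G (x, 0) -> x = 0 }.

Lemma piso_dom_field G : partial_iso G -> subfield (fun x => exists y, G (x, y)).
Proof.
move=> pG; split; first split.
- by exists 1; apply: (piso1 pG).
- by move=> x x' [y Gy] [y' Gy']; exists (y - y'); apply: (pisoB pG).
- by move=> x x' [y Gy] [y' Gy']; exists (y * y'); apply: (pisoM pG).
- by move=> x [y Gy]; exists y^-1; apply: (pisoV pG).
Qed.

Lemma piso_morphism G (pG : partial_iso G) (Df := piso_dom_field pG) :
  exists g : {rmorphism subfield_type Df -> k}, forall x, G (subfield_inj Df x, g x).
Proof.
have [g0 g0P] : {g : subfield_type Df -> k & forall x, G (subfield_inj Df x, g x)}.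
  apply: (@boolp.choice _ _ (fun x y => G (subfield_inj Df x, y))) => x.
  exact: (subfield_injP (S_field := Df) x).
have uniqG x y y' : G (x, y) -> G (x, y') -> y = y'.
  move=> H H'; apply/eqP; rewrite -subr_eq0; apply/eqP/(piso_fun pG).
  by have := pisoB pG H H'; rewrite subrr.
have gadd : zmod_morphism g0.
  by move=> x y; apply: (uniqG _ _ _ (g0P _)); rewrite rmorphB; apply: (pisoB pG).
have gmul : monoid_morphism g0.
  split; first by apply: (uniqG _ _ _ (g0P _)); rewrite rmorph1; apply: (piso1 pG).
  by move=> x y; apply: (uniqG _ _ _ (g0P _)); rewrite rmorphM; apply: (pisoM pG).
pose hA := GRing.isZmodMorphism.Build _ k g0 gadd.
pose hM := GRing.isMonoidMorphism.Build _ k g0 gmul.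
pose g : {rmorphism subfield_type Df -> k} := HB.pack g0 hA hM.
by exists g.
Qed.

Lemma subfield_mono_poly (S S' : k -> Prop) (Sf : subfield S) (S'f : subfield S')
  (p : {poly subfield_type Sf}) : (forall x, S x -> S' x) ->
  exists p' : {poly subfield_type S'f},
    map_poly (subfield_inj S'f) p' = map_poly (subfield_inj Sf) p.
Proof.
move=> SS'; have [h hP] : {h : subfield_type Sf -> subfield_type S'f &
    forall x, subfield_inj S'f (h x) = subfield_inj Sf x}.
  apply: (@boolp.choice _ _ (fun x y => subfield_inj S'f y = subfield_inj Sf x)) => x.
  have [y Ey] := subfield_injE S'f (SS' _ (subfield_injP x)).
  by exists y.
exists (map_poly h p); apply/polyP => i; rewrite !coef_map /=.
have h0 : h 0 = 0.
  by apply: (fmorph_inj (subfield_inj S'f)); rewrite hP !rmorph0.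
by rewrite coef_map_id0 // -[LHS]/(subfield_inj S'f _) hP.
Qed.

(** y0 is sent to a root in k of the image of its minimal polynomial under the given isomorphism. *)
Lemma piso_extend G (pG : partial_iso G) (Df := piso_dom_field pG) (y0 : k)
    (p0 : {poly subfield_type Df}) :
  p0 != 0 -> root (map_poly (subfield_inj Df) p0) y0 ->
  exists G', [/\ partial_iso G', forall z, G z -> G' z & exists z, G' (y0, z)].
Proof.
move=> p00 p0y; pose iota := subfield_inj Df.
have [g gP] := piso_morphism pG.
have [mu [mon s1 muy dvd cop]] := minimal_polynomial p00 p0y.
have [z0 z0P] : exists z, root (map_poly g mu) z.
  by apply/closed_rootP; rewrite size_map_poly; case: (size mu) s1 => [|[]].
have c1 : commr_rmorph iota y0 by move=> ?; apply: mulrC.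
have c2 : commr_rmorph g z0 by move=> ?; apply: mulrC.
pose e1 : {rmorphism {poly subfield_type Df} -> k} := horner_morph c1.
pose e2 : {rmorphism {poly subfield_type Df} -> k} := horner_morph c2.
have e2mu : e2 mu = 0 by apply/rootP.
have cop' p : e1 p != 0 -> exists s, e1 p * e1 s = 1 /\ e2 p * e2 s = 1.
  move=> /cop[s [r E]]; exists s; split.
    have := congr1 e1 E; rewrite rmorphD !rmorphM rmorph1.
    by have -> : e1 mu = 0 by [apply/rootP]; rewrite mul0r addr0.
  by have := congr1 e2 E; rewrite rmorphD !rmorphM rmorph1 e2mu mul0r addr0.
pose G' xy := exists p, xy = (e1 p, e2 p).
have inj1 p : e1 p = 0 -> e2 p = 0.
  by move=> /rootP/dvd[s ->]; rewrite rmorphM e2mu mul0r.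
have inj2 p : e2 p = 0 -> e1 p = 0.
  move=> E; apply/eqP/negPn/negP => /cop'[s [_]]; rewrite E mul0r.
  by move/eqP; rewrite eq_sym oner_eq0.
exists G'; split.
- split.
  + by exists 1; rewrite !rmorph1.
  + by move=> x y x' y' [p [-> ->]] [q [-> ->]]; exists (p - q); rewrite !rmorphB.
  + by move=> x y x' y' [p [-> ->]] [q [-> ->]]; exists (p * q); rewrite !rmorphM.
  + move=> x y [p [-> ->]]; have [E|ne] := eqVneq (e1 p) 0.
      by exists 0; rewrite (inj1 _ E) E !invr0 !rmorph0.
    have [s [E1 E2]] := cop' _ ne; exists s.
    have ne2 : e2 p != 0 by apply: contraNneq ne => /inj2 ->.
    by congr pair; [apply: (mulfI ne)|apply: (mulfI ne2)]; rewrite mulfV ?E1 ?E2.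
  + by move=> y [p [/esym/inj1 -> ->]].
  + by move=> x [p [-> /esym/inj2 ->]].
- move=> [x y] Gxy; have [x' Ex] := subfield_injE Df (ex_intro _ y Gxy : exists y, G (x, y)).
  have EC1 : e1 x'%:P = x by rewrite [RHS]Ex; apply: horner_morphC.
  have EC2 : e2 x'%:P = g x' by apply: horner_morphC.
  exists x'%:P; rewrite EC1 EC2; congr pair.
  apply/eqP; rewrite -subr_eq0; apply/eqP/(piso_fun pG).
  have Gx' : G (x, g x') by rewrite Ex; apply: gP.
  by have := pisoB pG Gxy Gx'; rewrite subrr.
- by exists z0, 'X; congr pair; apply/esym/horner_morphX.
Qed.

Lemma quadratic_piso (E : k -> Prop) theta : subfield E -> E (theta ^+ 2) -> ~ E theta ->
  exists G, [/\ partial_iso G, forall x, E x -> G (x, x) & G (theta, - theta)].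
Proof.
move=> Ef E2 nE; have R := subfield_ring Ef.
have E0 : E 0 := subring0 R; have E1 : E 1 := subring1 R.
have indep a b : E a -> E b -> a + b * theta = 0 -> a = 0 /\ b = 0.
  move=> Ea Eb /eqP; rewrite addr_eq0 => /eqP H.
  have [b0|b0] := eqVneq b 0; first by rewrite H b0 mul0r oppr0.
  case: nE; have -> : theta = - a * b^-1 by rewrite H opprK mulrC mulKf.
  by apply: (subringM R); [exact: (subringN R)|exact: (subfieldV Ef)].
have indepN a b : E a -> E b -> a - b * theta = 0 -> a = 0 /\ b = 0.
  move=> Ea Eb; rewrite -mulNr => /(indep _ _ Ea (subringN R Eb))[-> /eqP].
  by rewrite oppr_eq0 => /eqP.
exists (fun xy => exists a b, [/\ E a, E b & xy = (a + b * theta, a - b * theta)]); split.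
- split.
  + by exists 1, 0; rewrite mul0r addr0 subr0.
  + move=> x y x' y' [a [b [Ea Eb [-> ->]]]] [a' [b' [Ea' Eb' [-> ->]]]].
    by exists (a - a'), (b - b'); split; [exact: (subringB R)|exact: (subringB R)|congr pair; ring].
  + move=> x y x' y' [a [b [Ea Eb [-> ->]]]] [a' [b' [Ea' Eb' [-> ->]]]].
    exists (a * a' + b * b' * theta ^+ 2), (a * b' + b * a'); split; last by congr pair; ring.
      by apply: (subringD R); [exact: (subringM R)|apply: (subringM R) => //; exact: (subringM R)].
    by apply: (subringD R); apply: (subringM R).
  + move=> x y [a [b [Ea Eb [-> ->]]]].
    have [H|H] := eqVneq (a + b * theta) 0.
      have [-> ->] := indep a b Ea Eb H.
      by exists 0, 0; rewrite !mul0r addr0 subr0 invr0.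
    have H' : a - b * theta != 0.
      by apply: contraNneq H => /(indepN _ _ Ea Eb)[-> ->]; rewrite mul0r addr0.
    pose n := (a + b * theta) * (a - b * theta).
    have En : E n.
      have -> : n = a * a - b * b * theta ^+ 2 by rewrite /n; ring.
      by apply: (subringB R); [exact: (subringM R)|apply: (subringM R) => //; exact: (subringM R)].
    have Env : E n^-1 := subfieldV Ef En.
    exists (a / n), (- b / n); split; [exact: (subringM R)|apply: (subringM R) => //; exact: (subringN R)|].
    by rewrite /n; congr pair; field; rewrite ?H ?H'.
  + move=> y [a [b [Ea Eb [/esym/(indep _ _ Ea Eb)[-> ->] ->]]]].
    by rewrite mul0r subr0.
  + move=> x [a [b [Ea Eb [-> /esym/(indepN _ _ Ea Eb)[-> ->]]]]].
    by rewrite mul0r addr0.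
- by move=> x Ex; exists x, 0; rewrite mul0r addr0 subr0.
- by exists 0, 1; rewrite mul1r add0r sub0r.
Qed.

(** sigma maps the finite set of roots of a polynomial over E injectively into itself, hence onto
    itself. *)
Lemma bijective_algebraic_morphism (E : k -> Prop) (Ef : subfield E)
    (sigma : {rmorphism k -> k}) :
  (forall x, E x -> sigma x = x) ->
  (forall y, exists2 p : {poly subfield_type Ef}, p != 0 &
     root (map_poly (subfield_inj Ef) p) y) ->
  forall y, exists x, sigma x = y.
Proof.
move=> fixE alg y; have [p p0 py] := alg y; set q := map_poly _ p in py.
have q0 : q != 0 by rewrite map_poly_eq0.
have [s Dq] := closed_field_poly_normal q.
have rootE x : root q x = (x \in undup s).
  by rewrite mem_undup Dq rootZ ?lead_coef_eq0 // root_prod_XsubC.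
have sq : map_poly sigma q = q.
  apply/polyP => i; rewrite !coef_map /=; apply: fixE; exact: subfield_injP.
have sub : {subset map sigma (undup s) <= undup s}.
  move=> _ /mapP[x xs ->]; rewrite -rootE -sq fmorph_root rootE //.
have us : uniq (map sigma (undup s)) by rewrite map_inj_uniq ?undup_uniq //; apply: fmorph_inj.
have [_ eqs] := uniq_min_size us sub (eq_leq (esym (size_map _ _))).
by move: py; rewrite rootE -eqs => /mapP[x _ ->]; exists x.
Qed.

(* A square root of -1 is fixed, so sigma^(2^m) is never the identity. *)
Lemma infinite_order (sigma : {rmorphism k -> k}) (i theta : k) :
  i ^+ 2 = -1 -> sigma i = i -> theta != 0 -> sigma theta = - theta ->
  forall n, (0 < n)%N -> exists c, iter n sigma c <> c.
Proof.
move=> i2 si t0 st n n0.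
have iterM m x y : iter m sigma (x * y) = iter m sigma x * iter m sigma y.
  by elim: m => //= m ->; rewrite rmorphM.
have iterN m x : iter m sigma (- x) = - iter m sigma x.
  by elim: m => //= m ->; rewrite rmorphN.
have iteri m : iter m sigma i = i by elim: m => //= m ->.
(* If a^2 = b, then sigma^(2^m) maps a to i a or to -i a; since i is fixed, applying it twice
   multiplies a by i^2 = -1. *)
have step m : exists2 b, b != 0 & iter (2 ^ m) sigma b = - b.
  elim: m => [|m [b b0 Eb]]; first by exists theta.
  have [a Ea] := exists_root2 b; have a0 : a != 0.
    by apply: contraNneq b0 => a0; rewrite -Ea a0 expr0n.
  exists a => //.
  have : (iter (2 ^ m) sigma a) ^+ 2 = (i * a) ^+ 2.
    by rewrite exprMn i2 mulN1r Ea expr2 -iterM -expr2 Ea.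
  have -> : (2 ^ m.+1 = 2 ^ m + 2 ^ m)%N by rewrite expnS mul2n addnn.
  rewrite iterD; move/eqP; rewrite eqf_sqr => /orP[] /eqP E.
    by rewrite E iterM iteri E mulrA -expr2 i2 mulN1r.
  by rewrite E iterN iterM iteri E mulrN opprK mulrA -expr2 i2 mulN1r.
(* n is an odd q times a power of 2, so sigma^n maps the b of that power to (-1)^q b = -b. *)
have [q cq En] := pfactor_coprime (isT : prime 2) n0; rewrite coprime2n in cq.
have [b b0 Eb] := step (logn 2 n); exists b => H.
have iterq l : iter (l * 2 ^ logn 2 n) sigma b = (-1) ^+ l * b.
  elim: l => [|l IH]; first by rewrite mul0n expr0 mul1r.
  by rewrite mulSn addnC iterD Eb iterN IH exprS mulN1r mulNr.
have := H; rewrite En iterq -signr_odd cq expr1 mulN1r => /eqP.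
rewrite eq_sym -addr_eq0 -mulr2n -mulr_natr mulf_eq0 (negPf b0) /=.
by rewrite (negPf (natr_neq0 k_char0 _)).
Qed.

(** The conjugation of E(theta) extends to a maximal partial isomorphism, which is defined on all of
    k because k is algebraic over E. A square root i of -1 is added to Phi so that it lies in E and
    is fixed. *)
Theorem exists_automorphism (Phi : seq k) : exists sigma : {rmorphism k -> k},
  [/\ forall y, exists x, sigma x = y, forall c, c \in Phi -> sigma c = c &
      forall n, (0 < n)%N -> exists c, iter n sigma c <> c].
Proof.
have [i i2] := exists_root2 (-1 : k).
have [E [theta [Ef EPhi E2 nE alg]]] := maximal_subfield k_char0 (i :: Phi).
have [G0 [pG0 G0E G0t]] := quadratic_piso Ef E2 nE.
have [||G [pG GG Gmax]] := zorn_above (A0 := G0) (P := fun X => partial_iso X).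
- by [].
- move=> C [X0 CX0] CP Ctot.
  have tot2 x y X Y : C X -> C Y -> X x -> Y y -> exists Z, [/\ C Z, Z x & Z y].
    move=> CX CY Xx Yy; case: (Ctot X Y CX CY) => XY; [exists Y|exists X]; split=> //; exact: XY.
  split.
  + by exists X0 => //; apply: (piso1 (CP _ CX0)).
  + move=> x y x' y' [X CX Xx] [Y CY Yy]; have [Z [CZ Zx Zy]] := tot2 _ _ _ _ CX CY Xx Yy.
    by exists Z => //; apply: (pisoB (CP _ CZ)).
  + move=> x y x' y' [X CX Xx] [Y CY Yy]; have [Z [CZ Zx Zy]] := tot2 _ _ _ _ CX CY Xx Yy.
    by exists Z => //; apply: (pisoM (CP _ CZ)).
  + by move=> x y [X CX Xx]; exists X => //; apply: (pisoV (CP _ CX)).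
  + by move=> y [X CX Xx]; apply: (piso_fun (CP _ CX) Xx).
  + by move=> x [X CX Xx]; apply: (piso_inj (CP _ CX) Xx).
pose Df := piso_dom_field pG.
have dom y : exists z, G (y, z).
  have [p p0 py] := alg Ef y.
  have [p' Ep'] := @subfield_mono_poly E _ Ef Df p (fun x Ex => ex_intro _ x (GG _ (G0E x Ex))).
  have p'0 : p' != 0 by rewrite -(map_poly_eq0 (subfield_inj Df)) Ep' map_poly_eq0.
  have [|G' [pG' GG' [z G'z]]] := piso_extend (pG := pG) (y0 := y) p'0; first by rewrite Ep'.
  by exists z; apply: (Gmax G').
have [g gP] := piso_morphism pG.
have [h hP] : {h : k -> subfield_type Df & forall x, subfield_inj Df (h x) = x}.
  apply: (@boolp.choice _ _ (fun x y => subfield_inj Df y = x)) => x.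
  by have [y Ey] := subfield_injE Df (dom x); exists y.
have hadd : zmod_morphism h.
  by move=> x y; apply: (fmorph_inj (subfield_inj Df)); rewrite rmorphB !hP.
have hmul : monoid_morphism h.
  split; first by apply: (fmorph_inj (subfield_inj Df)); rewrite rmorph1 hP.
  by move=> x y; apply: (fmorph_inj (subfield_inj Df)); rewrite rmorphM !hP.
pose hA := GRing.isZmodMorphism.Build k _ h hadd.
pose hM := GRing.isMonoidMorphism.Build k _ h hmul.
pose h' : {rmorphism k -> subfield_type Df} := HB.pack h hA hM.
pose sigma : {rmorphism k -> k} := g \o h'.
have sP x : G (x, sigma x) by rewrite -{1}(hP x); apply: gP.
have uniqG x y y' : G (x, y) -> G (x, y') -> y = y'.
  move=> H H'; apply/eqP; rewrite -subr_eq0; apply/eqP/(piso_fun pG).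
  by have := pisoB pG H H'; rewrite subrr.
have fixE x : E x -> sigma x = x by move=> Ex; apply: uniqG (sP x) (GG _ (G0E x Ex)).
exists sigma; split.
- exact: bijective_algebraic_morphism fixE (alg Ef).
- by move=> c cPhi; apply/fixE/EPhi; rewrite inE cPhi orbT.
- apply: (@infinite_order sigma i theta) => //.
  + by apply/fixE/EPhi; rewrite inE eqxx.
  + by apply/eqP => t0; apply: nE; rewrite t0; apply: (subring0 (subfield_ring Ef)).
  + exact: uniqG (sP theta) (GG _ G0t).
Qed.

End PartialIsomorphisms.

(** * Dickson's lemma and finite generation *)

Lemma dickson_coord (T : eqType) (c : T -> nat -> nat) N (A : T -> Prop) :
  exists s : seq T, (forall m, m \in s -> A m) /\
    forall a, A a -> exists2 m, m \in s & forall i, (i < N)%N -> (c m i <= c a i)%N.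
Proof.
elim: N A => [|N IH] A.
  have [[a Aa]|nA] := boolp.EM (exists a, A a); last first.
    by exists [::]; split=> // a Aa; case: nA; exists a.
  by exists [:: a]; split=> [m|b _]; [rewrite inE => /eqP ->|exists a; rewrite ?inE].
have [s [sA sP]] := IH A.
(* An element whose coordinate N is at least B dominates a member of s there too; otherwise that
   coordinate takes one of B values, and the induction hypothesis is applied to each level set. *)
pose B := \max_(m <- s) c m N.
have [sv svP] := boolp.choice (fun v => IH (fun a => A a /\ c a N = v)).
exists (s ++ flatten [seq sv v | v <- iota 0 B]); split=> [m|a Aa].
  rewrite mem_cat => /orP[/sA //|/flattenP[_ /mapP[v _ ->]]].
  by case: (svP v) => H _ /H [].
have [Ba|aB] := leqP B (c a N).
  have [m ms mle] := sP a Aa; exists m; first by rewrite mem_cat ms.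
  move=> i; rewrite ltnS leq_eqVlt => /orP[/eqP ->|]; last exact: mle.
  apply: leq_trans Ba; rewrite {}/B; elim: s ms {sA sP mle} => // x s IHs.
  by rewrite inE big_cons => /orP[/eqP ->|/IHs]; rewrite leq_max ?leqnn // => ->; rewrite orbT.
have [_ H] := svP (c a N); have [m ms mle] := H a (conj Aa erefl).
exists m.
  rewrite mem_cat; apply/orP; right; apply/flattenP; exists (sv (c a N)) => //.
  by apply: map_f; rewrite mem_iota add0n.
move=> i; rewrite ltnS leq_eqVlt => /orP[/eqP ->|]; last exact: mle.
by case: (svP (c a N)) => /(_ m ms) [_ ->].
Qed.

Lemma dickson N (A : 'X_{1..N} -> Prop) :
  exists s : seq 'X_{1..N}, (forall m, m \in s -> A m) /\
    forall a, A a -> exists2 m, m \in s & (m <= a)%MM.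
Proof.
have [s [sA sP]] := dickson_coord (fun (m : 'X_{1..N}) i => nth 0%N m i) N A.
exists s; split=> // a /sP[m ms mle]; exists m => //; apply/mnm_lepP => i.
by have := mle i (ltn_ord i); rewrite -!(mnm_nth 0%N).
Qed.

Section WeightedMonomials.

Variables (G : zmodType) (N : nat) (w : 'I_N -> G).

Definition wdeg (m : 'X_{1..N}) : G := \sum_i w i *+ m i.

Lemma wdeg0 : wdeg 0%MM = 0.
Proof. by rewrite /wdeg big1 // => i _; rewrite mnm0E mulr0n. Qed.

Lemma wdegD m n : wdeg (m + n)%MM = wdeg m + wdeg n.
Proof. by rewrite /wdeg -big_split; apply: eq_bigr => i _; rewrite mnmDE mulrnDr. Qed.

Lemma wdegB m n : (n <= m)%MM -> wdeg (m - n)%MM = wdeg m - wdeg n.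
Proof. by move=> nm; rewrite -{2}(submK nm) wdegD addrK. Qed.

Lemma zero_monoid_fg : exists s : seq 'X_{1..N},
  (forall m, m \in s -> wdeg m = 0 /\ m != 0%MM) /\
  forall P : 'X_{1..N} -> Prop, P 0%MM ->
    (forall m n, m \in s -> wdeg n = 0 -> P n -> P (m + n)%MM) ->
    forall n, wdeg n = 0 -> P n.
Proof.
have [s [sA sP]] := dickson (fun m : 'X_{1..N} => wdeg m = 0 /\ m != 0%MM).
exists s; split=> // P P0 PD n; elim: {n}(mdeg n) {-2}n (leqnn (mdeg n)) => [|d IH] n.
  by rewrite leqn0 mdeg_eq0 => /eqP ->.
move=> nd wn; have [->//|n0] := eqVneq n 0%MM.
have [m ms mn] := sP n (conj wn n0); have [wm m0] := sA m ms.
have wnm : wdeg (n - m)%MM = 0 by rewrite wdegB // wn wm subrr.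
have -> : n = (m + (n - m))%MM by rewrite addmC submK.
apply: PD => //; apply: IH => //; rewrite -ltnS; apply: leq_trans nd.
by rewrite -{2}(submK mn) mdegD -[X in (X < _)%N]addn0 ltn_add2l lt0n mdeg_eq0.
Qed.

End WeightedMonomials.

(** The Groebner basis argument: Dickson's lemma selects finitely many elements of I whose leading
    monomials divide that of every non-zero element, and reduction by them terminates. *)
Lemma hilbert_basis (k : fieldType) N (I : {mpoly k[N]} -> Prop) :
  I 0 -> (forall f g, I f -> I g -> I (f + g)) -> (forall c f, I f -> I (c * f)) ->
  exists hs : seq {mpoly k[N]}, (forall h, h \in hs -> I h) /\
    forall f, I f -> exists c : nat -> {mpoly k[N]}, f = \sum_(i < size hs) c i * hs`_i.
Proof.
move=> I0 ID IM.
have IN f : I f -> I (- f) by move=> If; rewrite -mulN1r; apply: IM.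
have [s [sA sP]] := dickson (fun m => exists f, [/\ I f, f != 0 & mlead f = m]).
have [h hP] : {h : 'X_{1..N} -> {mpoly k[N]} & forall m, m \in s -> [/\ I (h m), h m != 0 & mlead (h m) = m]}.
  apply: (@boolp.choice _ _ (fun m f => m \in s -> [/\ I f, f != 0 & mlead f = m])) => m.
  have [/sA[f H]|ns] := boolP (m \in s); first by exists f.
  by exists 0.
exists (map h s); split=> [_ /mapP[m ms ->]|]; first by case: (hP m ms).
elim/mleadrect => f IH If; have [->|f0] := eqVneq f 0.
  by exists (fun=> 0); rewrite big1 // => i _; rewrite mul0r.
have [m ms mf] := sP (mlead f) (ex_intro _ f (And3 If f0 erefl)).
have [Ih h0 lh] := hP m ms.
pose c : {mpoly k[N]} := (mleadc f / mleadc (h m)) *: 'X_[mlead f - m].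
have c0 : c != 0.
  rewrite -mleadc_eq0 /c mleadcZE mleadXm mcoeffX eqxx mulr1.
  by rewrite mulf_neq0 ?invr_eq0 ?mleadc_eq0.
have lc : mlead (c * h m) = mlead f.
  by rewrite mleadM // lh /c mleadZ ?mleadXm ?submK // mulf_neq0 ?invr_eq0 ?mleadc_eq0.
have If' : I (f - c * h m) by apply: ID => //; apply/IN/IM.
have [f'0|f'0] := eqVneq (f - c * h m) 0.
  exists (fun i => if i == index m s then c else 0).
  have ims : (index m s < size (map h s))%N by rewrite size_map index_mem.
  rewrite (bigD1 (Ordinal ims)) //= eqxx big1 => [|i /negPf ne]; last first.
    by rewrite -(inj_eq val_inj) /= in ne; rewrite ne mul0r.
  rewrite addr0 (nth_map 0%MM) ?index_mem // nth_index //.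
  by apply/eqP; rewrite -subr_eq0 f'0.
have [|c' Ec'] := IH (f - c * h m) _ If'.
  rewrite Order.POrderTheory.lt_neqAle; apply/andP; split.
    apply: contraTneq f'0 => E; rewrite negbK -mleadc_eq0 E mcoeffB.
    have Ech : (c * h m)@_(mlead c + mlead (h m))%MM = mleadc f.
      rewrite mleadcM /c mleadcZE mleadXm mcoeffX eqxx mulr1.
      by rewrite mulfVK ?mleadc_eq0.
    by move: Ech; rewrite -mleadM // lc => ->; rewrite subrr.
  apply: Order.POrderTheory.le_trans (mleadB_le _ _) _.
  by rewrite lc Order.JoinTheory.joinxx.
exists (fun i => c' i + if i == index m s then c else 0).
under eq_bigr => i _ do rewrite mulrDl.
rewrite big_split /= -Ec'.
have ims : (index m s < size (map h s))%N by rewrite size_map index_mem.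
rewrite (bigD1 (Ordinal ims)) //= eqxx big1 => [|i /negPf ne]; last first.
  by rewrite -(inj_eq val_inj) /= in ne; rewrite ne mul0r.
by rewrite addr0 (nth_map 0%MM) ?index_mem // nth_index // subrK.
Qed.

(** * Rational rank of a finitely generated abelian group *)

Section RationalRank.

Variable (K : zmodType).

Record partial_char (H : K * rat -> Prop) : Prop := PartialChar {
  pchar0 : H (0, 0);
  pcharB : forall x y x' y', H (x, y) -> H (x', y') -> H (x - x', y - y');
  pchar_fun : forall y, H (0, y) -> y = 0 }.

Lemma pcharZ H x y (m : int) : partial_char H -> H (x, y) -> H (x *~ m, y *~ m).
Proof.
move=> pH Hxy.
have HN x' y' : H (x', y') -> H (- x', - y').
  by move=> H'; have := pcharB pH (pchar0 pH) H'; rewrite !sub0r.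
have Hn n : H (x *+ n, y *+ n).
  elim: n => [|n IH]; first exact: (pchar0 pH).
  by have := pcharB pH Hxy (HN _ _ IH); rewrite !opprK !mulrS.
case: m => n; first by rewrite -!pmulrn; apply: Hn.
by rewrite NegzE !mulrNz -!pmulrn; apply/HN/Hn.
Qed.

(** The target is divisible: the value at g is forced when a positive multiple of g lies in the
    domain, and is set to 0 otherwise. *)
Lemma partial_char_extend H g : partial_char H ->
  exists H', [/\ partial_char H', forall z, H z -> H' z & exists q, H' (g, q)].
Proof.
move=> pH.
have [q qP] : exists q : rat, forall m y, H (g *~ m, y) -> y = q *~ m.
  have [[n [n0 [y0 Hny]]]|no] := boolp.EM (exists n : nat, (0 < n)%N /\ exists y, H (g *+ n, y)).
    exists (y0 / n%:R) => m y Hy.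
    have := pcharB pH (pcharZ n%:Z pH Hy) (pcharZ m pH Hny).
    rewrite pmulrn -!mulrzA [n%:Z * m]mulrC subrr => /(pchar_fun pH)/eqP.
    rewrite subr_eq0 => /eqP E; have nn0 : n%:R != 0 :> rat by rewrite Num.Theory.pnatr_eq0 -lt0n.
    apply: (mulIf nn0); rewrite mulrzAl divfK // -E -pmulrn mulr_natr //.
  exists 0 => m y Hy; rewrite mul0rz.
  have [m0|m0] := eqVneq m 0; first by move: Hy; rewrite m0 mulr0z => /(pchar_fun pH).
  case: no; exists `|m|%N; rewrite absz_gt0 m0; split=> //.
  case: m m0 Hy => n _ Hy; first by exists y; rewrite absz_nat pmulrn.
  exists (- y); rewrite NegzE abszN absz_nat pmulrn -[n.+1%:Z]opprK mulrNz.
  by have := pcharB pH (pchar0 pH) Hy; rewrite !sub0r NegzE.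
exists (fun z => exists x y m, H (x, y) /\ z = (x + g *~ m, y + q *~ m)); split.
- split.
  + by exists 0, 0, 0; rewrite !mulr0z !addr0; split=> //; apply: (pchar0 pH).
  + move=> x y x' y' [a [b [m [Hab [-> ->]]]]] [a' [b' [m' [Hab' [-> ->]]]]].
    exists (a - a'), (b - b'), (m - m'); split; first exact: (pcharB pH).
    by rewrite !mulrzBr !opprD !addrA; congr pair; rewrite -!addrA; congr (_ + _); rewrite addrCA.
  + move=> y [a [b [m [Hab [/esym/eqP]]]]]; rewrite addr_eq0 => /eqP Ea ->.
    have := qP (- m) b; rewrite !mulrNz -Ea => /(_ Hab) ->; exact: addNr.
- by move=> [x y] Hxy; exists x, y, 0; rewrite !mulr0z !addr0.
- by exists q, 0, 0, 1; rewrite !mulr1z !add0r; split=> //; apply: (pchar0 pH).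
Qed.

Lemma character_nontorsion (x0 : K) : fg_group K -> (forall n, (0 < n)%N -> x0 *+ n != 0) ->
  exists f : {additive K -> rat^o}, f x0 = 1.
Proof.
move=> [s sgen] nt.
pose H0 (z : K * rat) := exists m : int, z = (x0 *~ m, 1 *~ m).
have pH0 : partial_char H0.
  split.
  - by exists 0; rewrite !mulr0z.
  - by move=> x y x' y' [m [-> ->]] [m' [-> ->]]; exists (m - m'); rewrite !mulrzBr.
  - move=> y [m [E ->]]; have [->|m0] := eqVneq m 0; first by rewrite mulr0z.
    have := nt `|m|%N; rewrite absz_gt0 m0 => /(_ isT)/eqP[].
    case: m m0 E => n _ E; first by rewrite absz_nat pmulrn -E.
    by apply/eqP; rewrite NegzE abszN absz_nat -oppr_eq0 pmulrn -mulrNz -NegzE -E.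
have [H [pH HH0 Hs]] : exists H, [/\ partial_char H, forall z, H0 z -> H z &
    forall g, g \in s -> exists q, H (g, q)].
  elim: s {sgen} => [|g s [H [pH HH0 Hs]]]; first by exists H0.
  have [H' [pH' HH' [q Hq]]] := partial_char_extend g pH.
  exists H'; split=> // [z /HH0/HH' //|g']; rewrite inE => /orP[/eqP ->|/Hs[q' /HH']].
    by exists q.
  by exists q'.
have dom x : exists y, H (x, y).
  apply: (sgen (fun x => exists y, H (x, y))) => //; first by exists 0; apply: (pchar0 pH).
  by move=> a b [y Hy] [y' Hy']; exists (y - y'); apply: (pcharB pH).
have [f fP] := boolp.choice dom.
have uniqH x y y' : H (x, y) -> H (x, y') -> y = y'.
  move=> h h'; apply/eqP; rewrite -subr_eq0; apply/eqP/(pchar_fun pH).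
  by have := pcharB pH h h'; rewrite subrr.
have fadd : zmod_morphism (f : K -> rat^o).
  by move=> x y; apply: (uniqH _ _ _ (fP _)); apply: (pcharB pH).
pose fA := GRing.isZmodMorphism.Build K rat^o f fadd.
pose f' : {additive K -> rat^o} := HB.pack (f : K -> rat^o) fA.
exists f'; apply: (uniqH _ _ _ (fP _)); apply: HH0; exists 1; by rewrite !mulr1z.
Qed.

Variables (V : vectType rat) (j : {additive K -> V}).
Hypotheses (K_fg : fg_group K) (tens : is_tensor_rat j).

(** A character with value 1 at a non-torsion x factors through j, so j x cannot vanish. *)
Lemma tensor_kernel_torsion x : j x = 0 -> exists2 n, (0 < n)%N & x *+ n = 0.
Proof.
move=> jx; apply: boolp.contrapT => H.
have [|f fx] := character_nontorsion (x0 := x) K_fg.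
  by move=> n n0; apply/eqP => xn; apply: H; exists n.
have [h hj _] := tens f; have := hj x; rewrite jx fx linear0.
by move/eqP; rewrite eq_sym oner_eq0.
Qed.

(** The identity and the projection to U agree on the image of j, so the uniqueness part of the
    universal property makes them equal. *)
Lemma tensor_span (U : {vspace V}) : (forall x, j x \in U) -> U = fullv.
Proof.
move=> jU; apply/eqP; rewrite eqEsubv subvf; apply/subvP => v _.
have [h hj huniq] := tens j.
have -> : v = projv U v.
  rewrite [LHS](huniq (idfun : {linear V -> V}) (fun=> erefl)).
  by rewrite (huniq (projv U) (fun x => projv_id (jU x))).
exact: memv_proj.
Qed.

Lemma exists_free_generators (s : seq V) : exists t : seq V,
  [/\ {subset t <= s}, free t & (<<s>> <= <<t>>)%VS].
Proof.
elim: s => [|x s [t [ts ft st]]]; first by exists [::]; rewrite nil_free subvv.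
have [xt|xt] := boolP (x \in <<t>>%VS).
  exists t; split=> // [y yt|]; first by rewrite inE ts ?orbT.
  by rewrite span_cons subv_add -memvE xt.
exists (x :: t); split.
- by move=> y; rewrite !inE => /orP[->//|/ts ->]; rewrite orbT.
- by rewrite free_cons xt.
- by rewrite !span_cons; apply: addvS.
Qed.

(** The v l are lifts of a basis of V. A common denominator d clears the coordinates of j x, and the
    remaining discrepancy is torsion by [tensor_kernel_torsion]. *)
Lemma rational_basis : exists v : 'I_(\dim {:V}) -> K, forall x,
  exists n (M : 'I_(\dim {:V}) -> int), (0 < n)%N /\ x *+ n = \sum_l v l *~ M l.
Proof.
have [s sgen] := K_fg.
have [t [ts ft st]] := exists_free_generators (map j s).
have tfull : <<t>>%VS = fullv.
  apply: tensor_span => x; apply: (sgen (fun x => j x \in <<t>>%VS)).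
  - by rewrite raddf0 mem0v.
  - by move=> a b ja jb; rewrite raddfB memvB.
  - by move=> y ys; apply: (subvP st); apply/memv_span/map_f.
have size_t : size t = \dim {:V} by rewrite -tfull; apply/esym/eqP.
have sel (l : 'I_(\dim {:V})) : exists y, j y = t`_l.
  have /ts/mapP[y _ ->] : t`_l \in t by apply: mem_nth; rewrite size_t.
  by exists y.
have [v vP] := fin_all_exists sel.
exists v => x.
pose T := tcast size_t (in_tuple t).
have TE l : T`_l = t`_l by rewrite val_tcast.
have spanT : j x \in <<T>>%VS by rewrite val_tcast tfull memvf.
pose q l := coord T l (j x).
have Ex : j x = \sum_l q l *: j (v l).
  by rewrite (coord_span spanT); apply: eq_bigr => l _; rewrite vP TE.
pose d := \prod_l denq (q l).
have d0 : d != 0 by apply/prodf_neq0 => l _; apply: denq_neq0.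
have qd l : exists m : int, q l * d%:~R = m%:~R.
  exists (numq (q l) * \prod_(l' | l' != l) denq (q l')).
  by rewrite /d (bigD1 l) //= !rmorphM /= mulrA -numqE.
have [m mP] := fin_all_exists qd.
pose y := x *~ d - \sum_l v l *~ m l.
have jy : j y = 0.
  apply/eqP; rewrite raddfB raddf_sum subr_eq0; apply/eqP.
  rewrite raddfMz Ex -scaler_int scaler_sumr; apply: eq_bigr => l _.
  by rewrite raddfMz scalerA mulrC mP scaler_int.
have [n n0 yn] := tensor_kernel_torsion jy.
have E : x *~ (d * n%:Z) = \sum_l v l *~ (m l * n%:Z).
  apply/eqP; rewrite -subr_eq0; apply/eqP.
  rewrite -[RHS]yn /y mulrnBl mulrzA -pmulrn; congr (_ - _).
  by rewrite -sumrMnl; apply: eq_bigr => l _; rewrite mulrzA -pmulrn.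
case: d d0 {qd mP jy y yn} E => d' d0 E.
  exists (d' * n)%N, (fun l => m l * n%:Z); split; last by rewrite -E pmulrn PoszM.
  by rewrite muln_gt0 n0 andbT lt0n -[d' == 0%N]/(d'%:Z == 0).
exists (d'.+1 * n)%N, (fun l => - (m l * n%:Z)); split; first by rewrite muln_gt0.
rewrite pmulrn PoszM; apply: oppr_inj; rewrite -mulrNz -mulNr -NegzE E.
by rewrite -sumrN; apply: eq_bigr => l _; rewrite mulrNz opprK.
Qed.

End RationalRank.

(** * Factorially graded algebras *)

Section GradedRing.

Variables (k : closedFieldType) (G : zmodType) (R : idomainAlgType k) (Rw : G -> R -> Prop).
Hypothesis (gr : is_grading Rw).

Lemma hom0 w : Rw w 0. Proof. by case: gr => /(_ w)[]. Qed.

Lemma homP w c x y : Rw w x -> Rw w y -> Rw w (c *: x + y).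
Proof. by case: gr => /(_ w)[_ H] _ _ _; apply: H. Qed.

Lemma homZ w c x : Rw w x -> Rw w (c *: x).
Proof. by move=> Rx; rewrite -[_ *: _]addr0; apply/homP/hom0. Qed.

Lemma homD w x y : Rw w x -> Rw w y -> Rw w (x + y).
Proof. by move=> Rx; rewrite -{1}[x]scale1r; apply: homP. Qed.

Lemma homN w x : Rw w x -> Rw w (- x).
Proof. by rewrite -scaleN1r; apply: homZ. Qed.

Lemma homB w x y : Rw w x -> Rw w y -> Rw w (x - y).
Proof. by move=> Rx /homN; apply: homD. Qed.

Lemma homM v w x y : Rw v x -> Rw w y -> Rw (v + w) (x * y).
Proof. by case: gr => _ H _ _; apply: H. Qed.

Lemma hom_sum (I : Type) (s : seq I) (P : pred I) (F : I -> R) w :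
  (forall i, P i -> Rw w (F i)) -> Rw w (\sum_(i <- s | P i) F i).
Proof. by move=> H; elim/big_ind: _ => //; [exact: hom0|exact: homD]. Qed.

Record components (r : R) (c : G -> R) : Prop := Components {
  comp_hom : forall w, Rw w (c w);
  comp_sum : exists s, [/\ uniq s, forall w, w \notin s -> c w = 0 & r = \sum_(w <- s) c w] }.

Lemma components_uniq r c c' : components r c -> components r c' -> c =1 c'.
Proof.
move=> [ch [s [us cs Er]]] [ch' [s' [us' cs' Er']]] w.
have [_ _ _ indep] := gr.
pose t := undup (w :: s ++ s').
have ext (d : G -> R) (u : seq G) : uniq u -> {subset u <= t} -> (forall v, v \notin u -> d v = 0) ->
    \sum_(v <- u) d v = \sum_(v <- t) d v.
  move=> uu ut du; rewrite [RHS](bigID (mem u)) /= [X in _ + X]big1 ?addr0 => [|v]; last exact: du.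
  rewrite -[RHS]big_filter; apply: perm_big; apply: uniq_perm; rewrite ?filter_uniq ?undup_uniq // => v.
  by rewrite mem_filter; have [/ut ->|] := boolP (v \in u).
have E : \sum_(v <- t) (c v - c' v) = 0.
  rewrite sumrB -(ext c s) -?(ext c' s') -?Er -?Er' ?subrr // => v;
    by rewrite mem_undup inE mem_cat => ->; rewrite ?orbT.
apply/eqP; rewrite -subr_eq0; apply/eqP.
apply: (indep t (fun v => c v - c' v) _ _ E); rewrite ?undup_uniq //.
  by move=> v; apply: homB.
by rewrite mem_undup inE eqxx.
Qed.

Lemma components_ex r : exists c, components r c.
Proof.
have [_ _ dec _] := gr; have [s [c [ch ->]]] := dec r.
exists (fun w => if w \in s then c w *+ count_mem w s else 0); split.
  move=> w; case: ifP => _; last exact: hom0.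
  by rewrite -scaler_nat; apply: homZ.
exists (undup s); split; rewrite ?undup_uniq //.
  by move=> w; rewrite mem_undup => /negPf ->.
rewrite -big_undup_iterop_count /=; apply: eq_big_seq => w.
by rewrite mem_undup => ws; rewrite ws.
Qed.

Definition comp : R -> G -> R := projT1 (boolp.choice components_ex).
Lemma compP r : components r (comp r). Proof. exact: (projT2 (boolp.choice components_ex)). Qed.

Lemma comp_homP r w : Rw w (comp r w). Proof. exact: (comp_hom (compP r)). Qed.

Lemma compE r c : components r c -> comp r =1 c.
Proof. exact/components_uniq/compP. Qed.

Lemma comp_homE x v : Rw v x -> comp x =1 (fun w => if w == v then x else 0).
Proof.
move=> Rx; apply: compE; split; first by move=> w; case: eqP => [->//|_]; apply: hom0.
exists [:: v]; split=> // [w|]; first by rewrite inE => /negPf ->.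
by rewrite big_seq1 eqxx.
Qed.

Lemma comp_id x v : Rw v x -> comp x v = x.
Proof. by move=> Rx; rewrite (comp_homE Rx) eqxx. Qed.

Lemma compD r r' w : comp (r + r') w = comp r w + comp r' w.
Proof.
have [ch [s [us cs Er]]] := compP r; have [ch' [s' [us' cs' Er']]] := compP r'.
apply: (compE (c := fun w => comp r w + comp r' w)); split; first by move=> v; apply: homD.
exists (undup (s ++ s')); split; first exact: undup_uniq.
  by move=> v; rewrite mem_undup mem_cat negb_or => /andP[/cs -> /cs' ->]; rewrite addr0.
have ext (d : G -> R) (u : seq G) : uniq u -> {subset u <= s ++ s'} -> (forall v, v \notin u -> d v = 0) ->
    \sum_(v <- u) d v = \sum_(v <- undup (s ++ s')) d v.
  move=> uu ut du; rewrite [RHS](bigID (mem u)) /= [X in _ + X]big1 ?addr0 => [|v]; last exact: du.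
  rewrite -[RHS]big_filter; apply: perm_big; apply: uniq_perm; rewrite ?filter_uniq ?undup_uniq // => v.
  by rewrite mem_filter mem_undup; have [/ut ->|] := boolP (v \in u).
rewrite big_split {1}Er {1}Er' /=; congr (_ + _); apply: ext => // v vs; rewrite mem_cat vs ?orbT //.
Qed.

Lemma compZ c r w : comp (c *: r) w = c *: comp r w.
Proof.
have [ch [s [us cs Er]]] := compP r.
apply: (compE (c := fun w => c *: comp r w)); split; first by move=> v; apply: homZ.
exists s; split=> // [v /cs ->|]; first by rewrite scaler0.
by rewrite {1}Er scaler_sumr.
Qed.

Lemma comp0 w : comp 0 w = 0.
Proof. by rewrite (comp_homE (hom0 0)); case: ifP. Qed.

Lemma comp_sumE (I : Type) (s : seq I) (P : pred I) (F : I -> R) w :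
  comp (\sum_(i <- s | P i) F i) w = \sum_(i <- s | P i) comp (F i) w.
Proof. by apply: (big_morph (comp ^~ w)) => [x y|]; [exact: compD|exact: comp0]. Qed.

Lemma comp_mul x v r w : Rw v x -> comp (x * r) (v + w) = x * comp r w.
Proof.
move=> Rx; have [ch [s [us cs Er]]] := compP r.
have -> : x * comp r w = (fun u => x * comp r (u - v)) (v + w) by rewrite addrC addKr.
apply: (compE (c := fun u => x * comp r (u - v))); split.
  by move=> u; rewrite -{1}(subrK v u) addrC; apply: homM.
exists [seq v + u | u <- s]; split; first by rewrite map_inj_uniq //; apply: addrI.
  move=> u us'; rewrite cs ?mulr0 //; apply: contra us' => h.
  by apply/mapP; exists (u - v) => //; rewrite addrC subrK.
by rewrite big_map {1}Er mulr_sumr; apply: eq_bigr => u _; rewrite addrC addKr.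
Qed.

Lemma comp_all0 r : (forall w, comp r w = 0) -> r = 0.
Proof. by move=> H; have [_ [s [_ _ ->]]] := compP r; rewrite big1. Qed.

(** Every homogeneous x equals x times the degree-zero component of 1; summing over the components
    of 1 shows that this component is 1 itself. *)
Lemma hom_one : Rw 0 1.
Proof.
have E x v : Rw v x -> x = x * comp 1 0.
  by move=> Rx; rewrite -(comp_mul _ _ Rx) mulr1 addr0 comp_id.
have -> : 1 = comp 1 0; last exact: comp_homP.
have [ch [s [us cs Er]]] := compP 1.
rewrite {1}Er (eq_bigr (fun w => comp 1 w * comp 1 0)) => [|w _]; last exact: E.
by rewrite -mulr_suml -Er mul1r.
Qed.

Lemma homC c : Rw 0 (c%:A). Proof. exact/homZ/hom_one. Qed.

Lemma homX w x n : Rw w x -> Rw (w *+ n) (x ^+ n).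
Proof.
move=> Rx; elim: n => [|n IH]; first exact: hom_one.
by rewrite exprS mulrS; apply: homM.
Qed.

Lemma hom_prod (I : Type) (s : seq I) (P : pred I) (F : I -> R) (d : I -> G) :
  (forall i, P i -> Rw (d i) (F i)) -> Rw (\sum_(i <- s | P i) d i) (\prod_(i <- s | P i) F i).
Proof.
by move=> H; elim/big_rec2: _ => [|i w x Pi Rx]; [exact: hom_one|apply: homM => //; exact: H].
Qed.

Lemma hom_degree_uniq v w x : Rw v x -> Rw w x -> x != 0 -> v = w.
Proof.
move=> Rv /comp_id; rewrite (comp_homE Rv); case: eqP => // _ <-.
by rewrite eqxx.
Qed.

(** In a domain, multiplication by x annihilates no non-zero component of y, and only the component
    of degree w - v lands in degree w. *)
Lemma hom_div v w x y : Rw v x -> x != 0 -> Rw w (x * y) -> Rw (w - v) y.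
Proof.
move=> Rx x0 Rxy; have -> : y = comp y (w - v); last exact: comp_homP.
have [ch [s [us cs Er]]] := compP y.
have other u : u != w - v -> comp y u = 0.
  move=> ne; apply: (mulfI x0); rewrite mulr0 -(comp_mul _ _ Rx) (comp_homE Rxy).
  case: eqP => // E; case/eqP: ne; by rewrite -E addrC addKr.
have [ws|ws] := boolP (w - v \in s).
  by rewrite {1}Er (bigD1_seq (w - v)) //= big1 ?addr0 // => u; apply: other.
rewrite cs // {1}Er big_seq big1 // => u us'; apply: other; apply: contraNneq ws => <- //.
Qed.

Lemma divides_hom p x v w : Rw v p -> p != 0 -> Rw w x -> divides p x ->
  exists2 z, Rw (w - v) z & x = p * z.
Proof.
move=> Rp p0 Rx [z Ex]; exists z; last by rewrite Ex mulrC.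
by apply: (hom_div Rp p0); rewrite mulrC -Ex.
Qed.

Hypothesis (units : only_constant_homog_units Rw).

Lemma algC_eq0 (c : k) : (c%:A == 0 :> R) = (c == 0).
Proof. by rewrite -[c%:A]/(in_alg R c) fmorph_eq0. Qed.

Lemma hom_unit w x : Rw w x -> x \is a GRing.unit -> exists2 c : k, c != 0 & x = c%:A.
Proof.
move=> Rx ux; have [c Ex] := units (ex_intro _ w Rx) ux; exists c => //.
by apply: contraTneq ux => c0; rewrite Ex c0 scale0r unitr0.
Qed.

Lemma algC_unit (c : k) : c != 0 -> c%:A \is a (@GRing.unit R).
Proof. by move=> c0; rewrite -[c%:A]/(in_alg R c) rmorph_unit ?unitfE. Qed.

Lemma mul1_unit (x y : R) : y * x = 1 -> x \is a GRing.unit.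
Proof. by move=> yx; apply/unitrP; exists y; split=> //; rewrite mulrC. Qed.

Definition nzhom x := homogeneous Rw x /\ x != 0.
Local Notation gprime := (graded_prime Rw).


Lemma gprime_assoc p q : gprime p -> gprime q -> divides p q -> exists2 c : k, c != 0 & q = c *: p.
Proof.
move=> [[v Rp] p0 np pP] [[w Rq] q0 nq qP] pq.
have [z Rz Ez] := divides_hom Rp p0 Rq pq.
have : divides q (z * p) by exists 1; rewrite mul1r Ez mulrC.
case/(qP _ _ (ex_intro _ _ Rz) (ex_intro _ _ Rp)) => [[y Ey]|[y Ey]].
  case/negP: np; apply: (@mul1_unit _ y).
  by apply: (mulIf q0); rewrite mul1r {2}Ez Ey; ring.
have uz : z \is a GRing.unit.
  apply: (@mul1_unit _ y).
  by apply: (mulIf p0); rewrite mul1r {2}Ey Ez; ring.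
have [c c0 Ec] := hom_unit Rz uz; exists c => //.
by rewrite Ez Ec mulrC mulr_algl.
Qed.

Lemma gprime_dvd_prod p (I : eqType) (s : seq I) (F : I -> R) : gprime p ->
  (forall i, i \in s -> homogeneous Rw (F i)) -> divides p (\prod_(i <- s) F i) ->
  exists2 i, i \in s & divides p (F i).
Proof.
move=> pp; have [_ _ np pP] := pp; elim: s => [|i s IH] Fh.
  by rewrite big_nil => -[z Ez]; case/negP: np; apply: (@mul1_unit _ z).
rewrite big_cons => /pP[||d|].
- by apply: Fh; rewrite inE eqxx.
- have [d dP] : {d : I -> G & forall i, i \in s -> Rw (d i) (F i)}.
    apply: (@boolp.choice _ _ (fun i w => i \in s -> Rw w (F i))) => l.
    have [ls|nl] := boolP (l \in s); last by exists 0.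
    by have [|w Rl] := Fh l; [rewrite inE ls orbT|exists w].
  exists (\sum_(l <- s) d l); rewrite big_seq [X in Rw X _]big_seq; exact: hom_prod.
- by exists i; rewrite ?inE ?eqxx.
- case/IH => [l ls|l ls dl]; first by apply: Fh; rewrite inE ls orbT.
  by exists l; rewrite // inE ls orbT.
Qed.

Lemma gprime_dvd_exp p x n : gprime p -> homogeneous Rw x -> divides p (x ^+ n) -> divides p x.
Proof.
move=> [_ _ np pP] [w Rx]; elim: n => [[z Ez]|n IH].
  by case/negP: np; apply: (@mul1_unit _ z); rewrite -Ez.
rewrite exprS => /pP[|||/IH //]; [by exists w| |by []].
by exists (w *+ n); apply: homX.
Qed.

Hypothesis (fact : factorial_grading Rw).

Lemma hom_factor x : nzhom x -> exists (c : k) (s : seq R),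
  [/\ c != 0, forall p, p \in s -> gprime p & x = c *: \prod_(p <- s) p].
Proof.
move=> [[w Rx] x0]; have [ux|nx] := boolP (x \is a GRing.unit).
  have [c c0 ->] := hom_unit Rx ux; exists c, [::]; split=> //.
  by rewrite big_nil.
have [s [sp ->]] := fact (ex_intro _ w Rx) x0 nx.
by exists 1, s; rewrite scale1r oner_neq0.
Qed.

Lemma gprimeZ p c : gprime p -> c != 0 -> gprime (c *: p).
Proof.
move=> [[w Rp] p0 np pP] c0; have cu := algC_unit c0.
split; first by exists w; apply: homZ.
- by rewrite scaler_eq0 negb_or c0.
- by rewrite -mulr_algl unitrM cu.
have dz y : divides (c *: p) y <-> divides p y.
  split=> [[z ->]|[z ->]]; first by exists (c *: z); rewrite -scalerAr scalerAl.
  by exists (c^-1 *: z); rewrite -scalerAr -scalerAl scalerA mulfV // scale1r.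
by move=> x y hx hy /dz /(pP x y hx hy)[] /dz; [left|right].
Qed.

End GradedRing.

Lemma uniform_multiple (K : zmodType) d (v : 'I_d -> K) N (w : 'I_N -> K) :
  (forall x, exists n (M : 'I_d -> int), (0 < n)%N /\ x *+ n = \sum_l v l *~ M l) ->
  exists n (M : 'I_N -> 'I_d -> int), (0 < n)%N /\ forall i, w i *+ n = \sum_l v l *~ M i l.
Proof.
move=> H; have [n nP] := fin_all_exists (fun i => H (w i)).
have [M MP] := fin_all_exists nP.
exists (\prod_i n i)%N, (fun i l => M i l * (\prod_(j | j != i) n j)%N%:Z); split.
  by rewrite prodn_gt0 // => i; case: (MP i).
move=> i; rewrite (bigD1 i) //= mulrnA (MP i).2 -sumrMnl.
by apply: eq_bigr => l _; rewrite mulrzA pmulrn.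
Qed.

Section GradedAlgebra.

Variables (k : closedFieldType) (G : zmodType) (R : idomainAlgType k) (Rw : G -> R -> Prop).
Hypotheses (gr : is_grading Rw) (units : only_constant_homog_units Rw)
  (fact : factorial_grading Rw).
Local Notation gprime := (graded_prime Rw).

Record subalgebra (A : R -> Prop) : Prop := Subalgebra {
  subalg_ring : subring A;
  subalgC : forall c : k, A c%:A }.

Lemma subalgZ A c x : subalgebra A -> A x -> A (c *: x).
Proof.
by move=> sA Ax; rewrite -mulr_algl; apply: (subringM (subalg_ring sA)) => //; apply: (subalgC sA).
Qed.

Definition generated_by (s : seq R) (r : R) :=
  forall A, subalgebra A -> (forall x, x \in s -> A x) -> A r.

Lemma generated_by_primes r :
  exists s, (forall p, p \in s -> gprime p) /\ generated_by s r.
Proof.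
have hom w x : Rw w x -> exists s, (forall p, p \in s -> gprime p) /\ generated_by s x.
  move=> Rx; have [->|x0] := eqVneq x 0.
    by exists [::]; split=> // A sA _; apply: (subring0 (subalg_ring sA)).
  have [c [s [c0 sp Ex]]] := hom_factor units fact (conj (ex_intro _ w Rx) x0).
  exists s; split=> // A sA sub; rewrite Ex; apply: subalgZ => //.
  rewrite big_seq; elim/big_ind: _ => [|u v|p ps]; last exact: sub.
    exact: (subring1 (subalg_ring sA)).
  exact: (subringM (subalg_ring sA)).
have [ch [s [us cs ->]]] := compP gr r.
elim: s {us cs} => [|w s [t [tp tg]]].
  exists [::]; split=> // A sA _; rewrite big_nil; exact: (subring0 (subalg_ring sA)).
have [t' [t'p t'g]] := hom _ _ (ch w).
exists (t' ++ t); split=> [p|A sA sub].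
  by rewrite mem_cat => /orP[/t'p|/tp].
rewrite big_cons; apply: (subringD (subalg_ring sA)).
  by apply: t'g => // x xt; apply: sub; rewrite mem_cat xt.
by apply: tg => // x xt; apply: sub; rewrite mem_cat xt orbT.
Qed.

Lemma mmap_subalgebra N (x : 'I_N -> R) :
  subalgebra (fun r => exists P : {mpoly k[N]}, r = mmap (in_alg R) x P).
Proof.
split; first split.
- by exists 1; rewrite rmorph1.
- by move=> _ _ [P ->] [Q ->]; exists (P - Q); rewrite rmorphB.
- by move=> _ _ [P ->] [Q ->]; exists (P * Q); rewrite rmorphM.
- by move=> c; exists c%:MP; rewrite mmapC.
Qed.

(** Each generator is replaced by the graded prime factors of its homogeneous components. *)
Lemma prime_generators : fg_algebra R -> exists N (x : 'I_N -> R) (w : 'I_N -> G),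
  (forall i, gprime (x i) /\ Rw (w i) (x i)) /\
  forall r, exists P : {mpoly k[N]}, r = mmap (in_alg R) x P.
Proof.
move=> [N0 [y ygen]].
have [s sP] := fin_all_exists (fun i => generated_by_primes (y i)).
pose t := flatten [seq s i | i <- enum 'I_N0].
have tP p : p \in t -> gprime p.
  by case/flattenP => _ /mapP[i _ ->]; apply: (sP i).1.
have gen A : subalgebra A -> (forall x, x \in t -> A x) -> forall r, A r.
  move=> sA sub r; have [P ->] := ygen r; have rA := subalg_ring sA.
  rewrite /mmap; elim/big_ind: _ => [|u v|m _]; [exact: (subring0 rA)|exact: (subringD rA)|].
  apply: (subringM rA); first exact: (subalgC sA).
  rewrite /mmap1; elim/big_ind: _ => [|u v|i _]; [exact: (subring1 rA)|exact: (subringM rA)|].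
  apply: (subringX rA); apply: (sP i).2 => // x xs; apply: sub.
  by apply/flattenP; exists (s i); rewrite ?map_f ?mem_enum.
pose x (i : 'I_(size t)) := t`_i.
have xP i : gprime (x i) by apply: tP; apply: mem_nth.
have /fin_all_exists[w wP] : forall i, exists w : G, Rw w (x i) by move=> i; case: (xP i).
exists (size t), x, w; split=> //.
apply: gen; first exact: mmap_subalgebra.
move=> _ /(nthP 0)[i it <-]; exists 'X_(Ordinal it); rewrite mmapX mmap1U //.
Qed.

Section Monomials.

Variables (N : nat) (x : 'I_N -> R) (w : 'I_N -> G).
Hypotheses (xw : forall i, Rw (w i) (x i)) (x0 : forall i, x i != 0)
  (xgen : forall r, exists P : {mpoly k[N]}, r = mmap (in_alg R) x P).

Definition mono (m : 'X_{1..N}) : R := mmap1 x m.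

Lemma mono_hom m : Rw (wdeg w m) (mono m).
Proof. by rewrite /mono /mmap1 /wdeg; apply: (hom_prod gr) => i _; apply: (homX gr). Qed.

Lemma mono0 m : mono m != 0.
Proof. by apply/prodf_neq0 => i _; rewrite expf_neq0. Qed.

Lemma monoD m n : mono (m + n)%MM = mono m * mono n.
Proof.
by rewrite /mono /mmap1 -big_split /=; apply: eq_bigr => i _; rewrite mnmDE exprD.
Qed.

Lemma mono_span r : exists (ms : seq 'X_{1..N}) (c : 'X_{1..N} -> k),
  r = \sum_(m <- ms) c m *: mono m.
Proof.
have [P ->] := xgen r; exists (msupp P), (fun m => P@_m).
by apply: eq_bigr => m _; rewrite /mono -mulr_algl.
Qed.

Lemma hom_mono_span v r : Rw v r -> exists (ms : seq 'X_{1..N}) (c : 'X_{1..N} -> k),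
  (forall m, m \in ms -> wdeg w m = v) /\ r = \sum_(m <- ms) c m *: mono m.
Proof.
move=> Rr; have [ms [c Er]] := mono_span r.
exists [seq m <- ms | wdeg w m == v], c; split.
  by move=> m; rewrite mem_filter => /andP[/eqP].
rewrite -{1}(comp_id gr Rr) Er (comp_sumE gr) big_filter [RHS]big_mkcond.
apply: eq_bigr => m _; rewrite (compZ gr) (comp_homE gr (mono_hom m)) eq_sym.
by case: eqP => // _; rewrite scaler0.
Qed.

Lemma exists_mono v r : Rw v r -> r != 0 -> exists m, wdeg w m = v.
Proof.
move=> /hom_mono_span[[|m ms] [c [msv ->]]]; first by rewrite big_nil eqxx.
by move=> _; exists m; apply: msv; rewrite inE eqxx.
Qed.

(** The degree of a monomial is determined by the residues of its exponents modulo n and by d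
    integers that grow linearly with its length. If no degree carries two independent elements,
    polynomials of degree at most a in the generators span a space of dimension O(a^d), too small
    for d + 1 independent elements. *)
Lemma growth_bounded_by_rank d (u : 'I_d -> G) n (M : 'I_N -> 'I_d -> int) :
  (0 < n)%N -> (forall i, w i *+ n = \sum_l u l *~ M i l) ->
  (forall v f g, Rw v f -> Rw v g -> g != 0 -> exists c : k, f = c *: g) ->
  forall phi : {rmorphism iterpoly k d.+1 -> R},
  phi \o iterC k d.+1 =1 in_alg R -> ~ injective phi.
Proof.
move=> n0 wM line.
pose W a r := exists2 P : {mpoly k[N]}, (msize P <= a.+1)%N & r = mmap (in_alg R) x P.
pose Mx := (\sum_i \sum_l `|M i l|)%N.
(* For monomials of length at most a the coordinates are at most a Mx in absolute value; shifted by
   a Mx they lie in the interval from 0 to 2 a Mx, below B (a + 1). *)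
pose B := (2 * Mx).+1.
have W_const c : W 0%N (in_alg R c).
  by exists c%:MP; [rewrite msizeC; case: eqP|rewrite mmapC].
have W_mono a b r : (a <= b)%N -> W a r -> W b r.
  by move=> ab [P sP ->]; exists P => //; apply: leq_trans sP _.
have W_mul a b r s : W a r -> W b s -> W (a + b)%N (r * s).
  move=> [P sP ->] [Q sQ ->]; exists (P * Q); last by rewrite rmorphM.
  have [->|P0] := eqVneq P 0; first by rewrite mul0r msize0.
  have [->|Q0] := eqVneq Q 0; first by rewrite mulr0 msize0.
  rewrite msizeM //; move: (msize P) (msize Q) sP sQ => p q; lia.
have W_exh r : exists a, W a r.
  by have [P ->] := xgen r; exists (msize P), P.
apply: (growth_bound_indep (C := n ^ N * B ^ d) W_const W_mono W_mul W_exh).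
move=> a.
pose T := ({ffun 'I_N -> 'I_n} * {ffun 'I_d -> 'I_(B * a.+1)})%type.
have cT : #|{: T}| = (n ^ N * B ^ d * a.+1 ^ d)%N.
  by rewrite card_prod !card_ffun !card_ord expnMn mulnA.
pose coord (m : 'X_{1..N}) l : int := \sum_i M i l * Posz (m i %/ n)%N.
have B0 : (0 < B * a.+1)%N by rewrite muln_gt0.
pose key (m : 'X_{1..N}) : T := ([ffun i => Ordinal (ltn_pmod (m i) n0)],
   [ffun l => Ordinal (ltn_pmod (absz (coord m l + Posz (a * Mx)%N)) B0)]).
have coord_small m l : (mdeg m <= a)%N -> (`|coord m l| <= a * Mx)%N.
  move=> ma; rewrite /coord.
  rewrite /coord -lez_nat PoszM abszE; apply: Order.POrderTheory.le_trans (Num.Theory.ler_norm_sum _ _ _) _.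
  have mi i : (m i %/ n <= a)%N.
    apply: leq_trans (leq_div _ _) (leq_trans _ ma).
    by rewrite mdegE (bigD1 i) //= leq_addr.
  rewrite /Mx !(big_morph Posz PoszD erefl) mulr_sumr.
  apply: Num.Theory.ler_sum => i _; rewrite Num.Theory.normrM.
  have Hl : (`|M i l| <= (\sum_l0 `|M i l0|)%:Z)%R.
    by rewrite -abszE lez_nat (bigD1 l) //= leq_addr.
  have := mi i; move: Hl; move: (m i %/ n)%N => y; move: (\sum_(l0 < d) _)%N => z; nia.
have keyP m m' : (mdeg m <= a)%N -> (mdeg m' <= a)%N -> key m = key m' -> wdeg w m = wdeg w m'.
  move=> ma ma' [/ffunP K1 /ffunP K2].
  have E1 i : (m i %% n = m' i %% n)%N by have := K1 i; rewrite !ffunE => -[].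
  have E2 l : coord m l = coord m' l.
    have := K2 l; rewrite !ffunE => -[].
    have := coord_small m l ma; have := coord_small m' l ma'; rewrite /B.
    move: (coord m l) (coord m' l) => y z Hz Hy.
    have bd (q : int) : (absz q <= a * Mx)%N -> (absz (q + Posz (a * Mx)%N)%R < (2 * Mx).+1 * a.+1)%N.
      by move: (Mx) => Y; nia.
    by rewrite modn_small ?bd // modn_small ?bd //; move: (a * Mx)%N Hz Hy => Y; lia.
  have E p : wdeg w p = \sum_i w i *+ (p i %% n)%N + \sum_l u l *~ coord p l.
    rewrite /wdeg (eq_bigr (fun i => w i *+ (p i %% n)%N + \sum_l u l *~ M i l *+ (p i %/ n)%N)); last first.
      by move=> i _; rewrite {1}(divn_eq (p i) n) addrC mulrnDr mulnC mulrnA wM -sumrMnl addrC.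
    rewrite big_split /= exchange_big /=; congr (_ + _); apply: eq_bigr => l _.
    rewrite /coord mulrz_sumr; apply: eq_bigr => i _.
    by rewrite mulrzA -pmulrn.
  rewrite !E; congr (_ + _); apply: eq_bigr => i _; first by rewrite E1.
  by rewrite E2.
pose good t m := (mdeg m <= a)%N /\ key m = t.
have [rep repP] : exists rep : T -> R, forall m, (mdeg m <= a)%N -> exists c : k, mono m = c *: rep (key m).
  have /boolp.choice[rep repP] : forall t : T, exists r, forall m, good t m -> exists c : k, mono m = c *: r.
    move=> t; have [[m0 [m0a m0t]]|no] := boolp.EM (exists m, good t m); last first.
      by exists 0 => m gm; case: no; exists m.
    exists (mono m0) => m [ma mt]; apply: (line (wdeg w m)); rewrite ?mono0 //; first exact: mono_hom.
    by rewrite (keyP m m0) // ?mt //; apply: mono_hom.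
  by exists rep => m ma; apply: repP.
exists (fun j => rep (enum_val (cast_ord (esym cT) j))) => r [P sP ->].
have [c cP] : exists c : 'X_{1..N} -> k, forall m, (mdeg m <= a)%N -> mono m = c m *: rep (key m).
  have /boolp.choice[c cP] : forall m, exists c : k, (mdeg m <= a)%N -> mono m = c *: rep (key m).
    move=> m; case: (leqP (mdeg m) a) => [/repP[c]|_]; last by exists 0.
    by exists c.
  by exists c.
exists (fun j => \sum_(m <- msupp P | key m == enum_val (cast_ord (esym cT) j)) P@_m * c m).
have -> : mmap (in_alg R) x P = \sum_(t : T) (\sum_(m <- msupp P | key m == t) P@_m * c m) *: rep t.
  rewrite (eq_bigr (fun t => \sum_(m <- msupp P | key m == t) (P@_m * c m) *: rep (key m))); last first.
    by move=> t _; rewrite scaler_suml; apply: eq_bigr => m /eqP ->.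
  rewrite (exchange_big_dep xpredT) //= /mmap; rewrite big_seq [RHS]big_seq.
  apply: eq_bigr => m ms.
  rewrite (big_pred1 (key m)) => [|t]; last by rewrite eq_sym.
  rewrite -scalerA -cP ?mulr_algl //; have := msize_mdeg_lt ms; move: (mdeg m) sP; lia.
rewrite (reindex (fun j => enum_val (cast_ord (esym cT) j))) //=.
exists (fun t => cast_ord cT (enum_rank t)) => [j _|t _]; first by rewrite enum_valK cast_ordKV.
by rewrite cast_ordK enum_rankK.
Qed.

End Monomials.

End GradedAlgebra.

(** * Consequences of complexity one *)

Section Complexity.

Variables (k : closedFieldType) (k_char0 : [pchar k] =i pred0) (G : zmodType) (R : idomainAlgType k)
  (Rw : G -> R -> Prop).
Hypotheses (gr : is_grading Rw) (units : only_constant_homog_units Rw)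
  (fact : factorial_grading Rw) (G_fg : fg_group G) (R_fg : fg_algebra R)
  (eff : effective_grading Rw) (cplx : complexity_one G R).

(** Otherwise [growth_bounded_by_rank] excludes dim V + 1 independent elements, while a prime chain
    of length dim V + 1 supplies them through [indep_of_chain]. *)
Lemma two_dim_degree : exists w f g, [/\ Rw w f, Rw w g, f != 0 & forall c : k, g <> c *: f].
Proof.
apply: boolp.contrapT => no.
have line v f g : Rw v f -> Rw v g -> g != 0 -> exists c : k, f = c *: g.
  move=> Rf Rg g0; apply: boolp.contrapT => nc; apply: no; exists v, g, f; split=> // c E.
  by apply: nc; exists c.
have [V [jV [tens [[p pP] _]]]] := cplx.
have [v vP] := rational_basis G_fg tens.
have [N [x [w [xP xgen]]]] := prime_generators gr units fact R_fg.
have [n [M [n0 wM]]] := uniform_multiple w vP.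
have xw i : Rw (w i) (x i) by case: (xP i).
have x0 i : x i != 0 by case: (xP i) => -[].
pose q i y := y \in p (inord i).
have qpr i : prime_of (fun _ => True) (q i).
  rewrite /q; set P := p _; split; first split.
  - by [].
  - exact: rpred0.
  - by move=> a b; apply: rpredD.
  - by move=> a b _; apply: idealMr.
  - by rewrite idealr1.
  - by move=> a b _ _; rewrite prime_idealrM => /orP.
have [||phi phik phi0] := indep_of_chain (R := R) (p := q) (t := (\dim {:V}).+1).
- by [].
- move=> i it; have lt : (@inord (\dim {:V}).+1 i < @inord (\dim {:V}).+1 i.+1)%N.
    by rewrite !inordK // ltnS // ltnW.
  have [sub nsub] := pP _ _ lt; split=> //; apply: boolp.contrapT => ny; apply: nsub => y py.
  by apply: boolp.contrapT => npy; apply: ny; exists y.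
apply: (growth_bounded_by_rank gr xw x0 xgen n0 wM line phik).
apply: raddf_inj => y phiy; apply/eqP; apply: boolp.contrapT => /negP y0.
by apply: (phi0 _ y0); rewrite phiy; apply: (ideal0 (prime_ideal (qpr 0%N))).
Qed.

Variables (L : fieldType) (j : {rmorphism R -> L}).
Hypotheses (j_inj : injective j) (j_frac : forall x, exists n d, d != 0 /\ x = j n / j d).
Local Notation iota := (fracC j).
Let j_eq0 x : (j x == 0) = (x == 0). Proof. exact: raddf_eq0. Qed.

Definition deg0 (x : L) := exists v n d, [/\ Rw v n, Rw v d, d != 0 & x = j n / j d].

Lemma deg0_subfield : subfield deg0.
Proof.
split; first split.
- by exists 0, 1, 1; split; rewrite ?oner_eq0 ?rmorph1 ?divr1 //; apply: hom_one.
- move=> _ _ [v [n [d [Rn Rd d0 ->]]]] [v' [n' [d' [Rn' Rd' d'0 ->]]]].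
  exists (v + v'), (n * d' - d * n'), (d * d'); split.
  + by apply: (homB gr); apply: (homM gr).
  + exact: (homM gr).
  + by rewrite mulf_neq0.
  + by rewrite rmorphB !rmorphM -[- (j n' / _)]mulNr addf_div ?j_eq0 // mulNr [j n' * _]mulrC.
- move=> _ _ [v [n [d [Rn Rd d0 ->]]]] [v' [n' [d' [Rn' Rd' d'0 ->]]]].
  exists (v + v'), (n * n'), (d * d'); split; try exact: (homM gr).
  + by rewrite mulf_neq0.
  + by rewrite !rmorphM mulf_div.
- move=> _ [v [n [d [Rn Rd d0 ->]]]]; have [->|n0] := eqVneq n 0.
    exists v, 0, d; split=> //; first exact: hom0.
    by rewrite rmorph0 !mul0r invr0.
  by exists v, d, n; split=> //; rewrite invf_div.
Qed.

Lemma deg0C c : deg0 (iota c).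
Proof. by exists 0, c%:A, 1; split; rewrite ?oner_eq0 ?rmorph1 ?divr1 //; [exact: homC|exact: hom_one]. Qed.

Section Extension.

Variables (V : vectType rat) (jV : {additive G -> V}).

(* [y] is a fraction with homogeneous denominator [b] all of whose numerator degrees lie in *)
(* [deg b + H], where [H] consists of the degrees sent into [U]. *)
Definition frac_over (U : {vspace V}) (b : R) (v : G) (r : R) (y : L) :=
  j b * y = j r /\ forall w, jV (w - v) \notin U -> comp gr r w = 0.

Lemma common_homogeneous_denominator (U : {vspace V}) n (y : 'I_n -> L) :
  (forall i, exists b v r, [/\ Rw v b, b != 0 & frac_over U b v r (y i)]) ->
  exists b v (r : 'I_n -> R), [/\ Rw v b, b != 0 & forall i, frac_over U b v (r i) (y i)].
Proof.
move=> /fin_all_exists[b /fin_all_exists[v /fin_all_exists[r rP]]].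
exists (\prod_i b i), (\sum_i v i), (fun i => \prod_(l | l != i) b l * r i); split.
- by apply: hom_prod => // i _; case: (rP i).
- by apply/prodf_neq0 => i _; case: (rP i).
move=> i; have [_ _ [E H]] := rP i; split.
  by rewrite (bigD1 i) //= [b i * _]mulrC [in LHS]rmorphM -mulrA E -rmorphM.
move=> w; rewrite (bigD1 i) //=; set s := \sum_(l | _) _ => Hw.
have -> : w = s + (w - s) by rewrite addrC subrK.
rewrite (comp_mul gr (v := s)); first by rewrite H ?mulr0 // -addrA -opprD [s + _]addrC.
by apply: hom_prod => // l _; case: (rP l).
Qed.

(** No non-zero multiple of the degree of z lies in U. In a polynomial in z whose coefficients have
    degrees in U, terms of different powers therefore live in different cosets and cannot cancel. *)
Lemma extend_by_homogeneous (U : {vspace V}) (z : R) zeta t (phi : {rmorphism iterpoly k t -> L}) :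
  Rw zeta z -> z != 0 -> jV zeta \notin U ->
  injective phi -> phi \o iterC k t =1 iota ->
  (forall x, exists b v r, [/\ Rw v b, b != 0 & frac_over U b v r (phi x)]) ->
  exists psi : {rmorphism iterpoly k t.+1 -> L}, [/\ injective psi, psi \o iterC k t.+1 =1 iota &
  forall x, exists b v r, [/\ Rw v b, b != 0 & frac_over (U + <[jV zeta]>)%VS b v r (psi x)]].
Proof.
move=> Rz z0 zU phi_inj phik phiU.
have comm : commr_rmorph phi (j z) by move=> x; apply: mulrC.
pose psi : {rmorphism {poly iterpoly k t} -> L} := horner_morph comm.
have psiE p : psi p = \sum_(i < size p) phi p`_i * j z ^+ i.
  by rewrite /psi /= /horner_morph horner_coef (size_map_inj_poly phi_inj (rmorph0 phi)); apply: eq_bigr => i _; rewrite coef_map.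
have num (p : {poly iterpoly k t}) : exists b v (r : 'I_(size p) -> R),
    [/\ Rw v b, b != 0, forall i, frac_over U b v (r i) (phi p`_i)
      & j b * psi p = j (\sum_i r i * z ^+ i)].
  have [|b [v [r [Rb b0 rP]]]] := @common_homogeneous_denominator U _ (fun i : 'I_(size p) => phi p`_i).
    by move=> i; apply: phiU.
  exists b, v, r; split=> //; rewrite psiE mulr_sumr rmorph_sum; apply: eq_bigr => i _.
  by rewrite mulrA (rP i).1 rmorphM rmorphXn.
have compE r i w : comp gr (r * z ^+ i) w = z ^+ i * comp gr r (w - zeta *+ i).
  rewrite mulrC -{1}[w](subrK (zeta *+ i)) addrC (comp_mul gr) //; exact: (homX gr).
exists psi; split.
- apply: raddf_inj => p psi0; have [b [v [r [Rb b0 rP E]]]] := num p.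
  have {E} E : \sum_i r i * z ^+ i = 0 by apply: j_inj; rewrite -E psi0 mulr0 rmorph0.
  suff r0 i : r i = 0.
    apply/eqP; rewrite -size_poly_eq0; apply: contraT => sp.
    have lt : ((size p).-1 < size p)%N by rewrite prednK // lt0n.
    have := (rP (Ordinal lt)).1; rewrite r0 rmorph0 => /eqP.
    rewrite mulf_eq0 j_eq0 (negPf b0) raddf_eq0 //= -/(lead_coef p) lead_coef_eq0 => /eqP p0.
    by move: sp; rewrite p0 size_poly0.
  refine (comp_all0 (gr := gr) _) => w; have [wU|] := boolP (jV (w - v) \in U); last exact: (rP i).2.
  have := congr1 (fun y => comp gr y (w + zeta *+ i)) E; rewrite /= comp0 comp_sumE (bigD1 i) //= big1 ?addr0.
    rewrite compE addrK => /eqP; rewrite mulf_eq0 expf_eq0 (negPf z0) andbF //= => /eqP //.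
  move=> l li; rewrite compE (rP l).2 ?mulr0 //; apply: contra zU => H.
  have {H}H : jV (zeta *+ i - zeta *+ l) \in U.
    rewrite (_ : _ - _ = (w + zeta *+ i - zeta *+ l - v) - (w - v)); first by rewrite raddfB memvB.
    by rewrite -(addrA w) opprB [RHS]addrA subrK addrAC subrr add0r.
  have : (i%:R - l%:R) *: jV zeta \in U.
    by rewrite scalerBl !scaler_nat -!raddfMn -raddfB.
  have c0 : i%:R - l%:R != 0 :> rat.
    by rewrite subr_eq0 Num.Theory.eqr_nat; apply: contra li; rewrite -val_eqE eq_sym.
  by move=> H'; rewrite -[jV zeta](scalerK c0); apply: memvZ.
- move=> c; rewrite -[RHS]phik /=; exact: horner_morphC.
move=> p; have [b [v [r [Rb b0 rP E]]]] := num p.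
exists b, v, (\sum_i r i * z ^+ i); split=> //; split=> // w wU.
rewrite comp_sumE big1 // => i _; rewrite compE (rP i).2 ?mulr0 //; apply: contra wU => H.
have -> : w - v = (w - zeta *+ i - v) + zeta *+ i by rewrite addrAC subrK.
rewrite raddfD; apply: memv_add => //; rewrite raddfMn -scaler_nat; exact/memvZ/memv_line.
Qed.

End Extension.

(** Two independent elements of degree zero, joined with homogeneous elements whose degrees
    successively span V, would be dim V + 2 independent fractions; [chain_of_indep] then contradicts
    the Krull dimension dim V + 1. *)
Lemma algover_deg0 u h : deg0 u -> deg0 h -> transc iota u -> algover iota u h.
Proof.
move=> Du Dh tu; apply: boolp.contrapT => nalg.
have [V [jV [tens [_ nochain]]]] := cplx.
apply: nochain; apply: (chain_of_indep k_char0 j_inj j_frac R_fg).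
have Dring := subfield_ring deg0_subfield.
have eval_deg0 (A : idomainType) (f : {rmorphism A -> L}) y (fy : commr_rmorph f y) :
    (forall a, deg0 (f a)) -> deg0 y -> forall p, deg0 (horner_morph fy p).
  move=> fD yD p; rewrite /horner_morph horner_coef.
  elim/big_ind: _ => [|a b|i _]; [exact: (subring0 Dring)|exact: (subringD Dring)|].
  rewrite coef_map; apply: (subringM Dring); [exact: fD|exact: (subringX Dring)].
have base : exists phi : {rmorphism iterpoly k 2 -> L},
    [/\ injective phi, phi \o iterC k 2 =1 iota & forall x, deg0 (phi x)].
  have comm : commr_rmorph (evalat iota u) h by move=> x; apply: mulrC.
  exists (horner_morph comm); split.
  - apply: raddf_inj => Q Q0; apply/eqP; apply: boolp.contrapT => /negP nQ; apply: nalg.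
    by exists Q => //; apply/rootP.
  - by move=> c; rewrite /= [LHS](horner_morphC comm) evalatC.
  - apply: (eval_deg0) => // a; apply: eval_deg0 => // c; exact: deg0C.
suff [U [_ [phi [phi_inj phik _]]]] : exists U : {vspace V}, \dim U = \dim {:V} /\
    exists phi : {rmorphism iterpoly k (\dim {:V}).+2 -> L},
    [/\ injective phi, phi \o iterC k (\dim {:V}).+2 =1 iota &
    forall x, exists b v r, [/\ Rw v b, b != 0 & frac_over jV U b v r (phi x)]].
  by exists phi.
elim: {-2}(\dim {:V}) (leqnn (\dim {:V})) => [_|i IH it].
  have [phi [phi_inj phik phiD]] := base; exists 0%VS; split; first by rewrite dimv0.
  exists phi; split=> // x; have [v [n [d [Rn Rd d0 ->]]]] := phiD x.
  exists d, v, n; split=> //; split; first by rewrite mulrC divfK ?j_eq0.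
  move=> w wv; rewrite (comp_homE gr Rn); case: eqP => // E.
  by move: wv; rewrite E subrr raddf0 mem0v.
have [U [dU [phi [phi_inj phik phiU]]]] := IH (ltnW it).
have [zeta [z [Rz z0 zU]]] : exists zeta z, [/\ Rw zeta z, z != 0 & jV zeta \notin U].
  apply: boolp.contrapT => no; suff E : U = fullv by move: it; rewrite -dU E ltnn.
  apply: (tensor_span tens); apply: (eff (H := fun g => jV g \in U)).
  - by rewrite raddf0 mem0v.
  - by move=> x y Ux Uy; rewrite raddfB memvB.
  - move=> zeta [z Rz z0]; apply: boolp.contrapT => /negP zU; apply: no.
    by exists zeta, z.
have [psi [psi_inj psik psiU]] := extend_by_homogeneous Rz z0 zU phi_inj phik phiU.
exists (U + <[jV zeta]>)%VS; split; last by exists psi.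
rewrite dimv_disjoint_sum ?dU ?dim_vline.
  by have [E|_] := eqVneq (jV zeta) 0; rewrite ?addn1 //; move: zU; rewrite E mem0v.
apply/eqP; rewrite -subv0; apply/subvP => y; rewrite memv_cap => /andP[yU /vlineP[q Ey]].
have [q0|q0] := eqVneq q 0; first by rewrite Ey q0 scale0r mem0v.
case/negP: zU; rewrite -[jV zeta](scalerK q0) -Ey; exact: memvZ.
Qed.

End Complexity.

(* Simplification would otherwise unfold [evalat] to [horner_morph], out of reach of [evalatC] and [evalatX]. *)
Opaque evalat.

(** * Pencils of primes generating the degree zero field *)

Section RationalField.

Variables (k : closedFieldType) (k_char0 : [pchar k] =i pred0) (G : zmodType) (R : idomainAlgType k)
  (Rw : G -> R -> Prop).
Hypotheses (gr : is_grading Rw) (units : only_constant_homog_units Rw)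
  (fact : factorial_grading Rw) (G_fg : fg_group G) (R_fg : fg_algebra R)
  (eff : effective_grading Rw) (cplx : complexity_one G R).

Variables (L : fieldType) (j : {rmorphism R -> L}).
Hypotheses (j_inj : injective j) (j_frac : forall x, exists n d, d != 0 /\ x = j n / j d).
Local Notation iota := (fracC j).
Local Notation gprime := (graded_prime Rw).
Let j_eq0 x : (j x == 0) = (x == 0). Proof. exact: raddf_eq0. Qed.

Lemma fracZ c x : j (c *: x) = iota c * j x.
Proof. by rewrite -[c *: x]mulr_algl rmorphM. Qed.

Lemma coef_evalat (x : L) (P : {poly {poly k}}) i :
  (map_poly (evalat iota x) P)`_i = evalat iota x P`_i.
Proof. exact: coef_map. Qed.

Lemma gprime_neq0 p : gprime p -> p != 0. Proof. by case. Qed.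

Lemma gprimes_neq0 s : (forall p, p \in s -> gprime p) -> \prod_(p <- s) p != 0.
Proof. by move=> sp; rewrite prodf_seq_neq0; apply/allP => p /sp/gprime_neq0. Qed.

Lemma lowest_terms y : deg0 Rw j y -> exists v n s, [/\ forall p, p \in s -> gprime p,
  Rw v n, Rw v (\prod_(p <- s) p), y = j n / j (\prod_(p <- s) p)
  & forall p, p \in s -> ~ divides p n].
Proof.
move=> [v [n0 [d [Rn Rd d0 ->]]]].
have [c [s [c0 sp Ed]]] := hom_factor units fact (conj (ex_intro _ v Rd) d0).
have : exists n, Rw v n /\ j n0 / j d = j n / j (\prod_(p <- s) p).
  exists (c^-1 *: n0); split; first exact: homZ.
  by rewrite Ed !fracZ fmorphV invfM mulrCA mulrA.
have {Ed} : Rw v (\prod_(p <- s) p).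
  by rewrite -[\prod_(_ <- s) _](scalerK c0) -Ed; apply: homZ.
move=> + [n [{}Rn ->]].
elim: {s}(size s) {-2}s v n (erefl (size s)) sp Rn {Rd c0} => [|t IH] s v n sz sp Rn Rs.
  by move: sz sp Rs => /size0nil -> sp Rs; exists v, n, [::]; split.
have [[p ps [m En]]|no] := boolp.EM (exists2 p, p \in s & divides p n); last first.
  by exists v, n, s; split=> // p ps pn; apply: no; exists p.
have Es := perm_to_rem ps; have pp := sp p ps; have [[w Rp] p0 _ _] := pp.
have Es' : \prod_(q <- s) q = p * \prod_(q <- rem p s) q by rewrite (perm_big _ Es) big_cons.
have Rm : Rw (v - w) m by apply: (hom_div gr Rp p0); rewrite mulrC -En.
have [||||v' [n' [s' H]]] := IH (rem p s) (v - w) m.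
- by rewrite size_rem // sz.
- by move=> q /mem_rem; apply: sp.
- exact: Rm.
- by apply: (hom_div gr Rp p0); rewrite -Es'.
exists v', n', s'; case: H => *; split=> //.
by rewrite En Es' [m * p]mulrC !rmorphM -mulf_div divff ?mul1r // j_eq0.
Qed.

Definition loc (e : R) (x : L) := exists M r, j e ^+ M * x = j r.

Lemma loc_j e r : loc e (j r). Proof. by exists 0%N, r; rewrite mul1r. Qed.

Lemma loc_ring e : subring (loc e).
Proof.
split; first by rewrite -(rmorph1 j); apply: loc_j.
- move=> x y [M [r E]] [M' [r' E']]; exists (M + M')%N, (e ^+ M' * r - e ^+ M * r').
  rewrite mulrBr rmorphB !rmorphM !rmorphXn -E -E' exprD; ring.
- move=> x y [M [r E]] [M' [r' E']]; exists (M + M')%N, (r * r').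
  by rewrite rmorphM -E -E' exprD; ring.
Qed.

Lemma loc_frac e r m : e != 0 -> loc e (j r / j e ^+ m).
Proof. by move=> e0; exists m, r; rewrite mulrC divfK // expf_neq0 // j_eq0. Qed.

Lemma loc_evalat e x c : loc e x -> loc e (evalat iota x c).
Proof.
move=> ex; rewrite evalatE; elim/big_ind: _ => [|a b|i _].
- exact: (subring0 (loc_ring e)).
- exact: (subringD (loc_ring e)).
apply: (subringM (loc_ring e)); first exact: loc_j.
exact: (subringX (loc_ring e)).
Qed.

Lemma nonzero_constant_term (A : idomainType) (f : {rmorphism A -> L}) s (Q : {poly A}) :
  s != 0 -> Q != 0 -> root (map_poly f Q) s -> exists2 Q' : {poly A}, Q'`_0 != 0 & root (map_poly f Q') s.
Proof.
move=> s0; elim/poly_ind: Q => [|Q c IH]; first by rewrite eqxx.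
move=> Q0 rQ; have [c0|c0] := eqVneq c 0; last first.
  by exists (Q * 'X + c%:P); rewrite // coefD coefMX coefC eqxx add0r.
move: Q0 rQ; rewrite c0 addr0 => Q0; rewrite rmorphM /= map_polyX rootM rootX (negPf s0) orbF.
by apply: IH; apply: contra_neq Q0 => ->; rewrite mul0r.
Qed.

Section TwoPrimes.

Variables (w : G) (p p' : R).
Hypotheses (pp : gprime p) (pp' : gprime p') (Rp : Rw w p) (Rp' : Rw w p') (npp' : ~ divides p p').
Let p0 : p != 0. Proof. by case: pp. Qed.
Let p'0 : p' != 0. Proof. by case: pp'. Qed.
Local Notation u := (j p' / j p).
Local Notation integral := (integralOver (evalat iota u)).

Lemma prime_ratio_transc : transc iota u.
Proof.
move=> c E; apply: npp'; exists c%:A; apply: j_inj.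
by rewrite rmorphM -[j c%:A]/(iota c) -E divfK ?j_eq0.
Qed.

Lemma deg0_ratio v a b : Rw v a -> Rw v b -> b != 0 -> deg0 Rw j (j a / j b).
Proof. by exists v, a, b. Qed.

(** For y = n/b in lowest terms, clearing denominators in the monic equation shows that b divides
    p^M n^N. A prime factor of b does not divide n, so it divides p and is associated to it. *)
Lemma integral_denominator y : deg0 Rw j y -> integral y ->
  exists m a, Rw (w *+ m) a /\ y = j a / j p ^+ m.
Proof.
move=> Dy [P Pmon /rootP Py]; have [v [n [s [sp Rn Rs Ey ndiv]]]] := lowest_terms Dy.
have b0 := gprimes_neq0 sp; set b := \prod_(_ <- s) _ in Rs Ey b0.
have jb0 : j b != 0 by rewrite j_eq0.
have [N sP] : exists N, size P = N.+1.
  by exists (size P).-1; rewrite prednK // lt0n size_poly_eq0 monic_neq0.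
have PN : P`_N = 1 by rewrite -(monicP Pmon) lead_coefE sP.
have [M [r Er]] : exists M r, p ^+ M * n ^+ N = b * r.
  have [z lz Ez] : exists2 z, loc p z & j n ^+ N = j b * z.
    exists (- \sum_(i < N) evalat iota u P`_i * (j n ^+ i * j b ^+ (N - i.+1))).
      rewrite -sub0r; apply: (subringB (loc_ring p)); first exact: (subring0 (loc_ring p)).
      elim/big_ind: _ => [|x x'|i _].
      - exact: (subring0 (loc_ring p)).
      - exact: (subringD (loc_ring p)).
      apply: (subringM (loc_ring p)).
        by apply: loc_evalat; rewrite -[j p]expr1; apply: loc_frac.
      by rewrite -!rmorphXn -rmorphM; apply: loc_j.
    move: Py; rewrite horner_coef size_map_poly_id0; last first.
      by rewrite (monicP Pmon) rmorph1 oner_eq0.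
    rewrite sP big_ord_recr /= coef_evalat PN rmorph1 mul1r.
    move/(congr1 (fun x => x * j b ^+ N)); rewrite mul0r mulrDl => /eqP.
    rewrite {2}Ey expr_div_n divfK ?expf_neq0 // addrC addr_eq0 => /eqP ->.
    rewrite mulrN; congr (- _); rewrite mulr_suml mulr_sumr; apply: eq_bigr => i _.
    rewrite coef_evalat /= Ey expr_div_n.
    have -> : j b ^+ N = j b * j b ^+ i * j b ^+ (N - i.+1) by rewrite -exprS -exprD subnKC.
    move: (j b ^+ (_ - _)) (j b ^+ i) (expf_neq0 i jb0) => X Y Y0; move: (j n ^+ i) => Z.
    by move: (evalat _ _ _) => W; field.
  have [M [r Er]] := lz; exists M, r; apply: j_inj.
  by rewrite !rmorphM !rmorphXn /= Ez mulrCA Er.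
have assoc q : q \in s -> exists2 c : k, c != 0 & q = c *: p.
  move=> qs; have qq := sp q qs; have [_ _ _ qP] := qq.
  have : divides q (p ^+ M * n ^+ N).
    by exists (\prod_(q' <- rem q s) q' * r); rewrite Er /b (perm_big _ (perm_to_rem qs)) big_cons /= [q * _]mulrC mulrAC.
  case/qP; [by exists (w *+ M); apply: homX|by exists (v *+ N); apply: homX| |]; last first.
    by move/(gprime_dvd_exp gr qq (ex_intro _ v Rn))/(ndiv q qs).
  move/(gprime_dvd_exp gr qq (ex_intro _ w Rp)) => qp.
  have [c c0 E] := gprime_assoc gr units qq pp qp.
  by exists c^-1; rewrite ?invr_eq0 // E scalerK.
have {assoc} [m [c [c0 Eb]]] : exists m (c : k), c != 0 /\ b = c *: p ^+ m.
  rewrite /b; elim: s assoc {sp Rs Ey ndiv b b0 jb0 Er} => [|q s IH] assoc.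
    by exists 0%N, 1; rewrite oner_eq0 big_nil scale1r.
  have [|m [c [c0 E]]] := IH; first by move=> q' q's; apply: assoc; rewrite inE q's orbT.
  have [c' c'0 E'] := assoc q (mem_head _ _).
  exists m.+1, (c' * c); rewrite mulf_neq0 // big_cons E E' exprS; split=> //.
  by rewrite -scalerAl -scalerAr scalerA.
exists m, (c^-1 *: n).
have Rpm : Rw (w *+ m) (p ^+ m) by apply: homX.
have -> : w *+ m = v.
  apply: (hom_degree_uniq gr (x := b)) => //; rewrite Eb; exact: homZ.
split; first exact: homZ.
by rewrite Ey Eb !fracZ fmorphV rmorphXn invfM mulrCA mulrA.
Qed.

(* a/p'^m is algebraic over k(p/p'); setting p = 0 in its equation leaves a polynomial over k, which splits. *)
Lemma constant_mod_prime m a : Rw (w *+ m) a -> exists c : k, divides p (a - c *: p' ^+ m).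
Proof.
move=> Ra; have Rb : Rw (w *+ m) (p' ^+ m) by apply: homX.
set b := p' ^+ m in Rb *; have b0 : b != 0 by rewrite expf_neq0.
have jb0 : j b != 0 by rewrite j_eq0.
pose t := j a / j b; pose s := j p / j p'.
have [[c Ec]|nt] := boolp.EM (exists c, t = iota c).
  exists c, 0; rewrite mul0r; apply/eqP; rewrite subr_eq0; apply/eqP; apply: j_inj.
  by rewrite fracZ -Ec divfK.
have tt : transc iota t by move=> c E; apply: nt; exists c.
have [Qa Q0 rQ] : algover iota t s.
  by apply: (algover_deg0 k_char0 gr R_fg eff cplx j_inj j_frac) => //; apply: deg0_ratio; eauto.
have s0 : s != 0 by rewrite mulf_neq0 ?invr_eq0 ?j_eq0.
(* With powers of s removed, the constant term of Q is non-zero, and the equation makes its value at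
   t a multiple of s = p/p' in R[1/p']. *)
have [Q q0 /rootP Qs] := nonzero_constant_term s0 Q0 rQ.
have lt : loc p' t by rewrite /t /b rmorphXn; apply: loc_frac.
have [M [r Er]] : exists M r, j p' ^+ M * evalat iota t Q`_0 = j (p * r).
  have [z lz Ez] : exists2 z, loc p' z & evalat iota t Q`_0 = s * z.
    elim/poly_ind: Q Qs {q0} => [|Q c _].
      by exists 0; [exact: (subring0 (loc_ring p'))|rewrite coef0 rmorph0 mulr0].
    rewrite rmorphD rmorphM /= map_polyX map_polyC hornerMXaddC /= => /eqP.
    rewrite addrC addr_eq0 => /eqP E.
    exists (- (map_poly (evalat iota t) Q).[s]); last first.
      by rewrite coefD coefMX coefC eqxx add0r E mulrN mulrC.
    rewrite -sub0r; apply: (subringB (loc_ring p')); first exact: (subring0 (loc_ring p')).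
    rewrite horner_coef; elim/big_ind: _ => [|x x'|i _].
    - exact: (subring0 (loc_ring p')).
    - exact: (subringD (loc_ring p')).
    rewrite coef_evalat; apply: (subringM (loc_ring p')); first exact: loc_evalat.
    by apply: (subringX (loc_ring p')); rewrite /s -[j p']expr1; apply: loc_frac.
  have [M [r Er]] := lz; exists M.+1, r.
  rewrite Ez rmorphM -Er exprS /s; have jp' : j p' != 0 by rewrite j_eq0.
  by move: (j p' ^+ M) => X; field.
have [g Dg] := closed_field_poly_normal Q`_0.
set l := lead_coef _ in Dg; have l0 : l != 0 by rewrite lead_coef_eq0.
have E : p' ^+ M * \prod_(c <- g) (a - c *: b) = p * (l^-1 *: (r * b ^+ size g)).
  have il0 : iota l != 0 by rewrite fmorph_eq0.
  apply: j_inj; apply: (mulfI il0); transitivity (j p * j r * j b ^+ size g); last first.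
    rewrite rmorphM fracZ fmorphV rmorphM rmorphXn.
    by move: (j b ^+ _) (iota l) il0 => X Y Y0; field.
  rewrite -rmorphM -Er Dg -mul_polyC (rmorphM (evalat iota t)) evalatC rmorphM rmorphXn.
  rewrite mulrCA -!mulrA; congr (_ * (_ * _)).
  rewrite !rmorph_prod; elim: g {Dg} => [|c g IH]; first by rewrite !big_nil mul1r.
  rewrite !big_cons IH exprS rmorphB fracZ (rmorphB (evalat iota t)) evalatX evalatC /t.
  have -> : j a - iota c * j b = (j a / j b - iota c) * j b by rewrite mulrBl divfK.
  exact: mulrACA.
have [_ _ _ pP] := pp.
have Rf c : Rw (w *+ m) (a - c *: b) by apply: homB => //; apply: homZ.
case/pP: (ex_intro _ (l^-1 *: (r * b ^+ size g)) (etrans E (mulrC _ _)) : divides p _).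
- by exists (w *+ M); apply: homX.
- by exists (\sum_(c <- g) w *+ m); apply: hom_prod.
- by move/(gprime_dvd_exp gr pp (ex_intro _ w Rp'))/npp'.
case/(gprime_dvd_prod gr pp) => [c _|c _ pc]; first by exists (w *+ m).
by exists c.
Qed.

Hypothesis integral_const : forall h, Rw 0 h -> integral (j h) -> exists c, j h = iota c.

(** Induction on the exponent m of the denominator: subtracting c u^m, with c from
    [constant_mod_prime], makes the numerator divisible by p. For m = 0 the element lies in R_0,
    where integral elements are constant by hypothesis. *)
Lemma integral_polynomial y : deg0 Rw j y -> integral y -> exists c, y = evalat iota u c.
Proof.
move=> Dy inty; have [m [a [Ra Ey]]] := integral_denominator Dy inty.
elim: m a y Ra Ey inty {Dy} => [|m IH] a y Ra Ey inty.
  have [|c Ec] := integral_const Ra; first by rewrite -[j a]divr1 -(expr0 (j p)) -Ey.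
  by exists c%:P; rewrite evalatC -Ec Ey expr0 divr1.
have [c [a' Ea']] := constant_mod_prime Ra.
have jp0 : j p != 0 by rewrite j_eq0.
have E : y = j a' / j p ^+ m + evalat iota u (c%:P * 'X ^+ m.+1).
  rewrite rmorphM rmorphXn evalatC evalatX Ey -(subrK (c *: p' ^+ m.+1) a) Ea'.
  rewrite rmorphD rmorphM fracZ rmorphXn expr_div_n !exprS.
  by move: (j p ^+ m) (expf_neq0 m jp0) (j p' ^+ m) => X X0 Y; field; rewrite X0 jp0.
have [||c' Ec'] := IH a' (j a' / j p ^+ m) _ erefl.
- have -> : w *+ m = w *+ m.+1 - w by rewrite mulrS addrC addrK.
  apply: (hom_div gr Rp p0); rewrite mulrC -Ea'; apply: homB => //; apply: homZ => //; exact: homX.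
- have -> : j a' / j p ^+ m = y - evalat iota u (c%:P * 'X ^+ m.+1) by rewrite E addrK.
  by apply: integral_sub => //; apply: integral_id.
by exists (c' + c%:P * 'X ^+ m.+1); rewrite rmorphD -Ec'.
Qed.

(** h is algebraic over k(u); times the leading coefficient of its equation it is integral over
    k[u], hence a polynomial in u. *)
Lemma rational_degree_zero_field h : deg0 Rw j h ->
  exists A B : {poly k}, B != 0 /\ h = evalat iota u A / evalat iota u B.
Proof.
have tu := prime_ratio_transc.
have Du : deg0 Rw j u by apply: deg0_ratio; eauto.
move=> Dh; have [Q Q0 rQ] := algover_deg0 k_char0 gr R_fg eff cplx j_inj j_frac Du Dh tu.
have inth := integral_lead (evalat_inj tu) Q0 rQ.
have [|A EA] := integral_polynomial _ inth.
  have Dring := subfield_ring (deg0_subfield gr j_inj).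
  apply: (subringM Dring) => //; rewrite evalatE; elim/big_ind: _ => [|x y|i _].
  - exact: (subring0 Dring).
  - exact: (subringD Dring).
  apply: (subringM Dring); [exact: deg0C|exact: (subringX Dring)].
exists A, (lead_coef Q); split; first by rewrite lead_coef_eq0.
rewrite -EA mulrC mulKf // (raddf_eq0 _ (evalat_inj tu)) lead_coef_eq0 //.
Qed.

End TwoPrimes.

End RationalField.

(** * Finite extensions of a rational function field *)

Section FiniteDimension.

Variables (k : closedFieldType) (F : fieldType) (iota : {rmorphism k -> F}) (t : F).
Hypotheses (tt : transc iota t) (alg : forall x, algover iota t x).
Local Notation ev := (evalat iota t).
Let ev_inj := evalat_inj tt.

Definition ratfun y := exists P Q, Q != 0 /\ y = ev P / ev Q.

Let ev0 P : (ev P == 0) = (P == 0). Proof. exact: raddf_eq0. Qed.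

Lemma ratfun_ev P : ratfun (ev P).
Proof. by exists P, 1; rewrite oner_eq0 rmorph1 divr1. Qed.

Lemma ratfun_subfield : subfield ratfun.
Proof.
split; first split.
- by rewrite -(rmorph1 ev); apply: ratfun_ev.
- move=> _ _ [P [Q [Q0 ->]]] [P' [Q' [Q'0 ->]]]; exists (P * Q' - P' * Q), (Q * Q').
  by rewrite mulf_neq0 // rmorphB !rmorphM -[- (ev P' / _)]mulNr addf_div ?ev0 // mulNr.
- move=> _ _ [P [Q [Q0 ->]]] [P' [Q' [Q'0 ->]]]; exists (P * P'), (Q * Q').
  by rewrite mulf_neq0 // !rmorphM mulf_div.
- move=> _ [P [Q [Q0 ->]]]; have [->|P0] := eqVneq P 0.
    by rewrite rmorph0 mul0r invr0 -(rmorph0 ev); apply: ratfun_ev.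
  by exists Q, P; rewrite invf_div.
Qed.
Let Rring := subfield_ring ratfun_subfield.

Record finring (S : F -> Prop) : Prop := Finring {
  finring_ring : subring S;
  finring_ratfun : forall x, ratfun x -> S x;
  finring_span : exists (T : finType) (e : T -> F), forall y, S y ->
    exists a : T -> F, (forall i, ratfun (a i)) /\ y = \sum_i a i * e i }.

Lemma ratfun_finring : finring ratfun.
Proof.
split=> //; exists unit, (fun=> 1) => y ry; exists (fun=> y); split=> //.
by rewrite big_const card_unit /= addr0 mulr1.
Qed.

Lemma monic_relation x : exists D (q : nat -> F), (forall l, ratfun (q l)) /\
  x ^+ D.+1 = \sum_(l < D.+1) q l * x ^+ l.
Proof.
have [Q Q0 /rootP] := alg x.
have sQ : size (map_poly ev Q) = size Q by apply: size_map_inj_poly; rewrite ?rmorph0.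
have cQ i : (map_poly ev Q)`_i = ev Q`_i by apply: coef_map.
case E: (size Q) => [|[|D]]; first by move/eqP: E; rewrite size_poly_eq0 (negPf Q0).
  rewrite horner_coef sQ E big_ord1 expr0 mulr1 cQ => /eqP; rewrite ev0.
  by have := Q0; rewrite -lead_coef_eq0 lead_coefE E => /negPf ->.
rewrite horner_coef sQ E big_ord_recr /= cQ => H.
have l0 : ev Q`_D.+1 != 0 by rewrite ev0; have := Q0; rewrite -lead_coef_eq0 lead_coefE E.
exists D, (fun l => - (ev Q`_l / ev Q`_D.+1)); split.
  move=> l; apply: (subringN Rring); exists Q`_l, Q`_D.+1; split=> //; by rewrite -ev0.
apply: (mulfI l0); move/eqP: H; rewrite addrC addr_eq0 => /eqP ->.
rewrite mulr_sumr -sumrN; apply: eq_bigr => l _.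
rewrite cQ; move: (ev Q`_l) (ev Q`_D.+1) l0 (x ^+ l) => X Y Y0 Z; by field.
Qed.

(* [S'] consists of the combinations of 1, x, ..., x^D over [S], where x^(D+1) is such a combination. *)
Lemma finring_adjoin S x : finring S ->
  exists S', [/\ finring S', forall y, S y -> S' y & S' x].
Proof.
move=> [Sring Srat [T [e espan]]]; have [D [q [qr Eq]]] := monic_relation x.
pose S' y := exists s : nat -> F, (forall l, S (s l)) /\ y = \sum_(l < D.+1) s l * x ^+ l.
have S'D y y' : S' y -> S' y' -> S' (y + y').
  move=> [s [sS ->]] [s' [s'S ->]]; exists (fun l => s l + s' l); split.
    by move=> l; apply: (subringD Sring).
  by rewrite -big_split; apply: eq_bigr => l _; rewrite mulrDl.
have S'M y z : S z -> S' y -> S' (z * y).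
  move=> Sz [s [sS ->]]; exists (fun l => z * s l); split.
    by move=> l; apply: (subringM Sring).
  by rewrite mulr_sumr; apply: eq_bigr => l _; rewrite mulrA.
have S0 := subring0 Sring; have S1 := subring1 Sring.
have S'1 : S' 1.
  exists (fun l => (l == 0%N)%:R); split; first by case.
  rewrite big_ord_recl /= mul1r expr0 big1 ?addr0 // => l _; by rewrite mul0r.
have S'X y : S' y -> S' (x * y).
  move=> [s [sS ->]].
  have -> : x * (\sum_(l < D.+1) s l * x ^+ l) =
      \sum_(l < D.+1) (if (l : nat) is l'.+1 then s l' else 0) * x ^+ l + s D * x ^+ D.+1.
    rewrite [in RHS]big_ord_recl /= mul0r add0r mulr_sumr big_ord_recr /= exprS mulrCA.
    by congr (_ + _); apply: eq_bigr => l _; rewrite /= /bump /= add1n exprS mulrCA.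
  apply: (S'D); first by exists (fun l => if l is l'.+1 then s l' else 0); split=> // -[].
  apply: (S'M) => //; rewrite Eq; exists q; split=> // l; exact: Srat.
have S'mul y y' : S' y -> S' y' -> S' (y * y').
  move=> [s [sS ->]] S'y'; rewrite mulr_suml; elim/big_ind: _ => [|a b|l _]; last first.
  - rewrite -mulrA; apply: (S'M) => //; elim: (l : nat) => [|n IH]; first by rewrite expr0 mul1r.
    by rewrite exprS -mulrA; apply: (S'X).
  - exact: (S'D).
  - by rewrite -(mul0r 1); apply: (S'M).
exists S'; split.
- split; first split=> //.
  + move=> y y' Sy Sy'; apply: (S'D) => //; rewrite -mulN1r; apply: (S'M) => //; exact: (subringN Sring).
  + by move=> y /Srat Sy; rewrite -[y]mulr1; apply: (S'M).
  exists ('I_D.+1 * T)%type, (fun i : 'I_D.+1 * T => e i.2 * x ^+ i.1) => y [s [sS ->]].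
  have /fin_all_exists[a aP] : forall l : 'I_D.+1, exists a : T -> F,
      (forall i, ratfun (a i)) /\ s l = \sum_i a i * e i by move=> l; apply: espan.
  exists (fun i : 'I_D.+1 * T => a i.1 i.2); split; first by move=> i; apply: (aP i.1).1.
  rewrite -(pair_bigA _ (fun l i => a l i * (e i * x ^+ l))) /=; apply: eq_bigr => l _.
  by rewrite (aP l).2 mulr_suml; apply: eq_bigr => i _; rewrite mulrA.
- by move=> y Sy; rewrite -[y]mulr1; apply: (S'M).
- by rewrite -[x]mulr1; apply: (S'X).
Qed.

(** The monic equation of 1/x, of degree D + 1, becomes after multiplication by x^D an expression of
    1/x as a polynomial in x. *)
Lemma finring_subfield S : finring S -> subfield S.
Proof.
move=> fS; have Sring := finring_ring fS; split=> // x Sx.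
have [->|x0] := eqVneq x 0; first by rewrite invr0; apply: (subring0 Sring).
have [D [q [qr Eq]]] := monic_relation x^-1.
have -> : x^-1 = \sum_(l < D.+1) q l * x ^+ (D - l).
  have -> : x^-1 = x ^+ D * x^-1 ^+ D.+1 by rewrite exprSr exprVn mulrA mulfV ?mul1r ?expf_neq0.
  rewrite Eq mulr_sumr; apply: eq_bigr => l _; rewrite mulrCA; congr (_ * _).
  by rewrite -{1}(subnK (ltn_ord l : (l <= D)%N)) exprD exprVn mulfK ?expf_neq0.
elim/big_ind: _ => [|a b|l _]; [exact: (subring0 Sring)|exact: (subringD Sring)|].
by apply: (subringM Sring); [apply: (finring_ratfun fS)|apply: (subringX Sring)].
Qed.

(** Adjoining the field generators [mus] one at a time reaches a finite-dimensional k(t)-algebra,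
    which is a field and therefore all of F. A linear relation over k(t) is finally multiplied by
    the product of its denominators. *)
Lemma finite_dimension (mus : seq F) :
  (forall S, subfield S -> (forall c, S (iota c)) -> (forall x, x \in mus -> S x) -> forall y, S y) ->
  exists D, forall m (e : 'I_m -> F), (D < m)%N ->
    exists2 c : 'I_m -> {poly k}, (exists i, c i != 0) & \sum_i ev (c i) * e i = 0.
Proof.
move=> gen.
have [S [fS Smus]] : exists S, finring S /\ forall x, x \in mus -> S x.
  elim: mus {gen} => [|x mus [S [fS Smus]]]; first by exists ratfun; split=> //; apply: ratfun_finring.
  have [S' [fS' SS' S'x]] := finring_adjoin x fS; exists S'; split=> // y.
  by rewrite inE => /orP[/eqP ->|/Smus/SS'].
have Sall : forall y, S y.
  apply: gen Smus; first exact: finring_subfield.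
  by move=> c; apply: (finring_ratfun fS); rewrite -(evalatC iota t); apply: ratfun_ev.
have [T [b bspan]] := finring_span fS; exists #|T| => m e lt.
have /fin_all_exists[a aP] : forall i, exists a : T -> F, (forall j, ratfun (a j)) /\ e i = \sum_j a j * b j.
  by move=> i; apply: bspan.
have /fin_all_exists[a' a'P] : forall i, exists a' : T -> subfield_type ratfun_subfield,
    forall j, a i j = subfield_inj _ (a' j).
  move=> i; have /fin_all_exists[z zP] : forall j, exists z : subfield_type ratfun_subfield,
      a i j = subfield_inj _ z by move=> j; apply: subfield_injE; apply: (aP i).1.
  by exists z.
have [|c c0 cE] := @linear_dependence (subfield_type ratfun_subfield) 'rV_#|T| _ _
    (fun i => \row_j a' i (enum_val j)) (fun j => delta_mx 0 j) lt.
  by move=> i; exists (fun j => a' i (enum_val j)); rewrite [LHS]row_sum_delta; apply: eq_bigr => j _; rewrite mxE.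
have sum0 : \sum_i subfield_inj ratfun_subfield (c 0 i) * e i = 0.
  rewrite (eq_bigr (fun i => \sum_j subfield_inj ratfun_subfield (c 0 i * a' i j) * b j)); last first.
    move=> i _; rewrite (aP i).2 mulr_sumr; apply: eq_bigr => j _.
    by rewrite a'P rmorphM mulrA.
  rewrite exchange_big big1 // => j _; rewrite -mulr_suml -rmorph_sum.
  have := congr1 (fun r : 'rV_#|T| => r 0 (enum_rank j)) cE; rewrite summxE mxE.
  under eq_bigr do rewrite !mxE enum_rankK.
  by move=> ->; rewrite rmorph0 mul0r.
have /fin_all_exists[P /fin_all_exists[Q PQ]] : forall i, exists P Q,
    Q != 0 /\ subfield_inj ratfun_subfield (c 0 i) = ev P / ev Q.
  by move=> i; exact: (subfield_injP (c 0 i)).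
exists (fun i => P i * \prod_(l | l != i) Q l).
  have [i ci] : exists i, c 0 i != 0.
    apply/existsP; apply: contraNT c0 => /existsPn H; apply/eqP/rowP => i.
    by have := H i; rewrite negbK mxE => /eqP.
  exists i; rewrite mulf_neq0 //; last by apply/prodf_neq0 => l _; case: (PQ l).
  have : subfield_inj ratfun_subfield (c 0 i) != 0 by rewrite fmorph_eq0.
  by rewrite (PQ i).2 mulf_eq0 negb_or ev0 => /andP[].
transitivity (ev (\prod_l Q l) * \sum_i subfield_inj ratfun_subfield (c 0 i) * e i); last first.
  by rewrite sum0 mulr0.
rewrite mulr_sumr; apply: eq_bigr => i _; rewrite (PQ i).2 [in RHS](bigD1 i) //= !rmorphM.
have : ev (Q i) != 0 by rewrite ev0; case: (PQ i).
by move: (ev (Q i)) (ev (P i)) (ev (\prod_(l | _) _)) => x y z x0; field.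
Qed.

End FiniteDimension.

Section Corestriction.

Variables (L : fieldType) (S : L -> Prop) (S_field : subfield S) (A : nzRingType)
  (g : {rmorphism A -> L}) (gS : forall a, S (g a)).

Definition corestrict (a : A) : subfield_type S_field :=
  SubfieldType (S_field := S_field) (introT (boolp.asboolP (S (g a))) (gS a)).

Lemma corestrict_additive : zmod_morphism corestrict.
Proof. by move=> x y; apply: val_inj; rewrite /= rmorphB. Qed.

Lemma corestrict_multiplicative : monoid_morphism corestrict.
Proof. by split=> [|x y]; apply: val_inj; rewrite /= ?rmorph1 ?rmorphM. Qed.

HB.instance Definition _ := GRing.isZmodMorphism.Build A (subfield_type S_field) corestrict corestrict_additive.
HB.instance Definition _ :=
  GRing.isMonoidMorphism.Build A (subfield_type S_field) corestrict corestrict_multiplicative.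

End Corestriction.

(** * Two primes of equal degree when R_0 = k *)

Section PrimePencil.

Variables (k : closedFieldType) (k_char0 : [pchar k] =i pred0) (G : zmodType) (R : idomainAlgType k)
  (Rw : G -> R -> Prop).
Hypotheses (gr : is_grading Rw) (units : only_constant_homog_units Rw)
  (fact : factorial_grading Rw) (G_fg : fg_group G) (R_fg : fg_algebra R)
  (eff : effective_grading Rw) (cplx : complexity_one G R).

Local Notation gprime := (graded_prime Rw).

Lemma uniq_constants n : exists s : seq k, uniq s /\ size s = n.
Proof.
exists [seq i%:R | i <- iota 0 n]; rewrite size_map size_iota; split=> //.
rewrite map_inj_uniq ?iota_uniq // => a b.
wlog ab : a b / (a <= b)%N => [W E|].
  by case/orP: (leq_total a b) => H; [exact: W|apply/esym/W].
move/eqP; rewrite eq_sym -subr_eq0 -natrB // => /eqP E; apply/eqP; rewrite eqn_leq ab /=.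
by rewrite -subn_eq0 -leqn0 leqNgt; apply/negP => /(natr_neq0 k_char0); rewrite E eqxx.
Qed.

Definition pencil w p p' := [/\ gprime p, gprime p', Rw w p, Rw w p' & ~ divides p p'].

Section Pointed.

Variables (N : nat) (x : 'I_N -> R) (w : 'I_N -> G).
Hypotheses (xp : forall i, gprime (x i)) (xw : forall i, Rw (w i) (x i))
  (xgen : forall r, exists P : {mpoly k[N]}, r = mmap (in_alg R) x P).

Let x0 i : x i != 0. Proof. by case: (xp i). Qed.

Lemma mono_const m (c : k) : mono x m = c%:A -> m = 0%MM.
Proof.
move=> E; apply/eqP; apply: contraT => m0.
have [i mi] : exists i, m i != 0%N.
  apply/existsP; apply: contraNT m0 => /existsPn H; apply/eqP/mnmP => i.
  by rewrite mnm0E; apply/eqP; rewrite -[_ == _]negbK; apply: H.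
have c0 : c != 0 by rewrite -(algC_eq0 R) -E (mono0 x0).
have := algC_unit R c0; rewrite -E /mono /mmap1 (bigD1 i) //= unitrM.
by rewrite unitrX_pos ?lt0n // => /andP[ui _]; case: (xp i) => _ _ /negP.
Qed.

Hypothesis R0 : forall h, Rw 0 h -> exists c : k, h = c%:A.

Definition two_dim v := exists f g, [/\ Rw v f, Rw v g, f != 0 & forall c : k, g <> c *: f].

Lemma zero_degree_mono m : wdeg w m = 0 -> m = 0%MM.
Proof.
move=> m0; have [|c] := R0 (h := mono x m); last exact: mono_const.
by rewrite -m0; apply: mono_hom.
Qed.

(* Monomials of equal degree form an antichain, as no non-trivial monomial has degree zero. *)
Lemma mono_bounded v : exists n, forall m, wdeg w m = v -> (mdeg m <= n)%N.
Proof.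
have [s [sv sP]] := dickson (fun m => wdeg w m = v).
exists (\max_(m <- s) mdeg m)%N => m mv; have [m' ms' m'm] := sP m mv.
suff -> : m = m' by rewrite (bigmax_sup_seq m').
rewrite -(submK m'm) [X in (X + _)%MM]zero_degree_mono ?add0m //.
by rewrite (wdegB _ m'm) mv sv // subrr.
Qed.

(* In a two-dimensional degree of minimal monomial length every reducible element is a multiple of a monomial. *)
Lemma pencil_of_pointed : exists w p p', pencil w p p'.
Proof.
pose P n := exists2 v, two_dim v & forall m, wdeg w m = v -> (mdeg m <= n)%N.
have [n [v tv vn] nmin] : exists2 n, P n & forall n', (n' < n)%N -> ~ P n'.
  have [v0 [f [g Hfg]]] := two_dim_degree gr units fact G_fg R_fg cplx.
  have [n0 Hn0] := mono_bounded v0.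
  have : P n0 by exists v0 => //; exists f, g.
  elim/ltn_ind: n0 {Hn0} => n IH Pn.
  have [[n' [lt Pn']]|no] := boolp.EM (exists n', (n' < n)%N /\ P n'); first exact: IH Pn'.
  by exists n => // n' lt Pn'; apply: no; exists n'.
have v0 : v <> 0.
  move=> E; have [f [g [Rf Rg f0 ng]]] := tv; move: Rf Rg; rewrite E => /R0[c Ec] /R0[d Ed].
  have c0 : c != 0 by rewrite -(algC_eq0 R) -Ec.
  by apply: (ng (d / c)); rewrite Ec Ed scalerA divfK.
(* Monomials of degree a times a fixed non-trivial monomial of degree b have degree v, so those of
   degree a are shorter than n; by minimality of n, degree a is not two-dimensional. *)
have line a b (f g : R) : Rw a f -> Rw b g -> f != 0 -> g != 0 -> g \isn't a GRing.unit -> a + b = v ->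
    exists2 m, wdeg w m = a & exists c : k, f = c *: mono x m.
  move=> Rf Rg f0 g0 ng ab.
  have [m ma] := exists_mono gr xw xgen Rf f0; exists m => //.
  apply: boolp.contrapT => no; have [m' m'b] := exists_mono gr xw xgen Rg g0.
  have m'0 : (0 < mdeg m')%N.
    rewrite lt0n mdeg_eq0; apply: contraNneq ng => E.
    have [c Ec] : exists c : k, g = c%:A by apply: R0; rewrite -(wdeg0 w) -E m'b.
    by rewrite Ec algC_unit // -(algC_eq0 R) -Ec.
  have nP : (n.-1 < n)%N.
    rewrite ltn_predL; apply: leq_trans (vn (m + m')%MM _); last by rewrite wdegD ma m'b.
    by rewrite mdegD addn_gt0 m'0 orbT.
  apply: (nmin _ nP); exists a.
    exists (mono x m), f; split=> //; [by rewrite -ma; apply: mono_hom|exact: mono0|].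
    by move=> c E; apply: no; exists c.
  move=> m2 m2a; have := vn (m2 + m')%MM; rewrite wdegD m2a m'b mdegD => /(_ ab).
  by move: m'0 nP; move: (mdeg m2) (mdeg m') => A B; lia.
have reducible f : Rw v f -> f != 0 -> ~ gprime f ->
    exists2 m, wdeg w m = v & exists c : k, f = c *: mono x m.
  move=> Rf f0 npf; have [c [s [c0 sp Ef]]] := hom_factor units fact (conj (ex_intro _ v Rf) f0).
  case: s sp Ef => [|p [|q s]] sp Ef.
  - case: v0; apply: (hom_degree_uniq gr Rf _ f0).
    by rewrite Ef big_nil; apply: homC.
  - case: npf; rewrite Ef big_seq1; apply: gprimeZ c0 => //; apply: sp; exact: mem_head.
  have pp := sp p (mem_head _ _); have [[a Ra] p0 np _] := pp.
  have qq : gprime q by apply: sp; rewrite !inE eqxx orbT.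
  pose r := \prod_(l <- q :: s) l.
  have r0 : r != 0 by apply: (gprimes_neq0 (Rw := Rw)) => l ls; apply: sp; rewrite inE ls orbT.
  have Ef' : f = p * (c *: r) by rewrite Ef big_cons -scalerAr.
  have Rr : Rw (v - a) (c *: r) by apply: (hom_div gr Ra p0); rewrite -Ef'.
  have cr0 : c *: r != 0 by rewrite scaler_eq0 negb_or c0.
  have nr : c *: r \isn't a GRing.unit.
    rewrite -mulr_algl unitrM algC_unit //= /r big_cons unitrM; by case: qq => _ _ /negPf ->.
  have [m ma [e Ee]] := line _ _ _ _ Ra Rr p0 cr0 nr (subrKC _ _).
  have [m' m'b [e' Ee']] := line _ _ _ _ Rr Ra cr0 p0 np (subrK _ _).
  exists (m + m')%MM; first by rewrite wdegD ma m'b subrKC.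
  by exists (e * e'); rewrite Ef' Ee Ee' monoD -scalerAl -scalerAr scalerA.
have [f [g [Rf Rg f0 ng]]] := tv.
have g0 : g != 0 by apply/eqP => E; apply: (ng 0); rewrite scale0r.
pose mbr c := g + c *: f.
have memv c : Rw v (mbr c) by apply: homD => //; apply: homZ.
have mem_neq0 c : mbr c != 0.
  by apply/eqP => /eqP; rewrite addr_eq0 => /eqP E; apply: (ng (- c)); rewrite scaleNr.
have mem_inj c c' (e : k) : mbr c' = e *: mbr c -> c' = c.
  have [->|e1] := eqVneq e 1; rewrite /mbr.
    by rewrite scale1r => /addrI/eqP; rewrite -subr_eq0 -scalerBl scaler_eq0 (negPf f0) orbF subr_eq0 => /eqP.
  move=> E; case: (ng ((e * c - c') / (1 - e))).
  have e1' : 1 - e != 0 by rewrite subr_eq0 eq_sym.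
  apply: (@scalerI _ _ (1 - e) e1'); rewrite scalerA mulrC divfK //.
  have Eg : g = e *: g + (e * c) *: f - c' *: f by rewrite -scalerA -scalerDr -E addrK.
  by rewrite scalerBl scale1r {1}Eg addrC !addrA addNr add0r -scalerBl.
(* Non-prime members are multiples of the finitely many monomials of length at most n, and distinct
   members are not proportional. *)
have good (s : seq k) : uniq s -> (#|{: 'X_{1..N < n.+1}}| < size s)%N ->
    exists2 c, c \in s & gprime (mbr c).
  move=> us lt; apply: boolp.contrapT => no.
  have [mu muP] : exists mu : k -> 'X_{1..N < n.+1}, forall c, c \in s -> exists e : k, mbr c = e *: mono x (mu c).
    have /boolp.choice[mu muP] : forall c, exists mu : 'X_{1..N < n.+1}, c \in s -> exists e : k, mbr c = e *: mono x mu.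
      move=> c; case: (boolP (c \in s)) => [cs|_]; last by exists bm0.
      have [|m mv [e Ee]] := reducible _ (memv c) (mem_neq0 c); first by move=> pc; apply: no; exists c.
      have lt_m : (mdeg m < n.+1)%N by rewrite ltnS; apply: vn.
      by exists (BMultinom lt_m) => _; exists e.
    by exists mu.
  have us' : uniq (map mu s).
    rewrite map_inj_in_uniq // => c c' cs cs' E.
    have [e Ee] := muP c cs; have [e' Ee'] := muP c' cs'.
    have e0 : e != 0 by apply: contraNneq (mem_neq0 c) => e0; rewrite Ee e0 scale0r.
    by apply/esym/(mem_inj _ _ (e' / e)); rewrite Ee Ee' scalerA divfK // E.
  by have := card_uniqP us'; rewrite size_map => E; have := max_card (mem (map mu s)); rewrite E leqNgt lt.
(* Two constants more than there are monomials: one prime member is found and removed, and enough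
   remain to find a second. *)
have [s [us ss]] := uniq_constants #|{: 'X_{1..N < n.+1}}|.+2.
have [|c cs pc] := good s us; first by rewrite ss ltnW.
have [||c' c's pc'] := good (rem c s); first exact: rem_uniq.
  by rewrite size_rem // ss.
exists v, (mbr c), (mbr c'); split=> // dv.
have [e e0 E] := gprime_assoc gr units pc pc' dv.
by have := mem_inj _ _ _ E => Ec; move: c's; rewrite Ec mem_rem_uniqF.
Qed.

End Pointed.

End PrimePencil.

(** * Semilinear automorphisms and primes of equal degree when R_0 is larger than k *)

Lemma map_mpoly_surj (k : nzRingType) N (sigma : {rmorphism k -> k}) (Q : {mpoly k[N]}) :
  (forall y, exists x, sigma x = y) -> exists P, map_mpoly sigma P = Q.
Proof.
move=> /boolp.choice[tau tauK]; exists (\sum_(m <- msupp Q) tau Q@_m *: 'X_[m]).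
rewrite raddf_sum [RHS]mpolyE; apply: eq_bigr => m _.
by rewrite /= map_mpolyZ map_mpolyX tauK.
Qed.

(** Phi lists the coefficients of the finitely many relations between the generators given by
    [hilbert_basis]. Hence sigma, acting on coefficients, maps the ideal of relations into itself,
    and surjectivity of sigma makes the ideal equal to its preimage. *)
Lemma semilinear_automorphism (k : closedFieldType) (R : idomainAlgType k) N (x : 'I_N -> R) :
  (forall r, exists P : {mpoly k[N]}, r = mmap (in_alg R) x P) ->
  exists Phi : seq k, forall sigma : {rmorphism k -> k},
  (forall y, exists x, sigma x = y) -> (forall c, c \in Phi -> sigma c = c) ->
  exists s : {rmorphism R -> R}, [/\ injective s, forall y, exists z, s z = y,
    forall c, s c%:A = (sigma c)%:A & forall i, s (x i) = x i].
Proof.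
move=> xgen; pose ev : {rmorphism {mpoly k[N]} -> R} := mmap (in_alg R) x.
have evC c : ev c%:MP = c%:A by apply: mmapC.
have evX i : ev 'X_i = x i by rewrite /ev /= mmapX mmap1U.
have [|||hs [hsI hsP]] := hilbert_basis (I := fun P => ev P = 0).
- exact: rmorph0.
- by move=> f g ef eg; rewrite rmorphD ef eg addr0.
- by move=> c f ef; rewrite rmorphM ef mulr0.
exists (flatten [seq [seq h@_m | m <- msupp h] | h <- hs]) => sigma sigma_surj fixPhi.
pose sp : {rmorphism {mpoly k[N]} -> {mpoly k[N]}} := map_mpoly sigma.
have spC c : sp c%:MP = (sigma c)%:MP by apply: map_mpolyC.
have spX i : sp 'X_i = 'X_i by apply: map_mpolyX.
have spM a b : sp (a * b) = sp a * sp b by apply: rmorphM.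
have evM a b : ev (a * b) = ev a * ev b by apply: rmorphM.
have spB a b : sp (a - b) = sp a - sp b by apply: rmorphB.
have evB a b : ev (a - b) = ev a - ev b by apply: rmorphB.
have sp_sum n (H : 'I_n -> {mpoly k[N]}) : sp (\sum_i H i) = \sum_i sp (H i) by apply: raddf_sum.
have ev_sum n (H : 'I_n -> {mpoly k[N]}) : ev (\sum_i H i) = \sum_i ev (H i) by apply: raddf_sum.
have sph h : h \in hs -> sp h = h.
  move=> hin; apply/mpolyP => m; rewrite /sp /= mcoeff_map_mpoly.
  have [mh|mh] := boolP (m \in msupp h); last by rewrite (memN_msupp_eq0 mh) raddf0.
  by apply: fixPhi; apply/flatten_mapP; exists h => //; apply: map_f.
have sp_inj : injective sp.
  apply: raddf_inj => P /mpolyP E; apply/mpolyP => m; have := E m.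
  by rewrite /sp /= mcoeff_map_mpoly !mcoeff0 => /eqP; rewrite fmorph_eq0 => /eqP.
have hs_nth i : (i < size hs)%N -> sp hs`_i = hs`_i by move=> lt; apply/sph/mem_nth.
have spI P : ev P = 0 <-> ev (sp P) = 0.
  split=> [/hsP[c ->]|/hsP[c Ec]].
    rewrite sp_sum ev_sum big1 // => i _.
    by rewrite spM evM hs_nth // (hsI _ (mem_nth 0 (ltn_ord i))) mulr0.
  have /boolp.choice[d dP] : forall i, exists d, sp d = c i by move=> i; apply: map_mpoly_surj.
  have -> : P = \sum_(i < size hs) d i * hs`_i.
    apply: sp_inj; rewrite sp_sum Ec; apply: eq_bigr => i _.
    by rewrite spM dP hs_nth.
  by rewrite ev_sum big1 // => i _; rewrite evM (hsI _ (mem_nth 0 (ltn_ord i))) mulr0.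
have /boolp.choice[rep repP] : forall r, exists P, ev P = r by move=> r; have [P ->] := xgen r; exists P.
pose s0 r := ev (sp (rep r)).
have s0E P : s0 (ev P) = ev (sp P).
  by apply/eqP; rewrite -subr_eq0 -evB -spB; apply/eqP; apply: (spI _).1; rewrite evB repP subrr.
have sadd : zmod_morphism s0.
  by move=> a b; rewrite -(repP a) -(repP b) -evB !s0E spB evB.
have smul : monoid_morphism s0.
  split; first by rewrite -(rmorph1 ev) s0E !rmorph1.
  by move=> a b; rewrite -(repP a) -(repP b) -evM !s0E spM evM.
pose sA := GRing.isZmodMorphism.Build R R s0 sadd.
pose sM := GRing.isMonoidMorphism.Build R R s0 smul.
pose s : {rmorphism R -> R} := HB.pack s0 sA sM.
have sE P : s (ev P) = ev (sp P) by apply: s0E.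
exists s; split.
- move=> a b; rewrite -(repP a) -(repP b) !sE => /eqP; rewrite -subr_eq0 -evB -spB => /eqP /(spI _).2.
  by rewrite evB => /eqP; rewrite subr_eq0 => /eqP.
- move=> y; have [P EP] := map_mpoly_surj (rep y) sigma_surj.
  by exists (ev P); rewrite sE -[sp P]/(map_mpoly sigma P) EP repP.
- by move=> c; rewrite -evC sE spC evC.
- by move=> i; rewrite -evX sE spX.
Qed.

Section SubfieldTransfer.

Variables (k : closedFieldType) (L : fieldType) (iota : {rmorphism k -> L}) (S : L -> Prop)
  (S_field : subfield S) (SC : forall c, S (iota c)).
Local Notation F := (subfield_type S_field).
Local Notation inj := (subfield_inj S_field).

Definition subfield_const : {rmorphism k -> F} := corestrict S_field SC.
Local Notation iotaF := subfield_const.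

Lemma evalat_subfield u P : inj (evalat iotaF u P) = evalat iota (inj u) P.
Proof.
by rewrite !evalatE rmorph_sum; apply: eq_bigr => i _; rewrite rmorphM rmorphXn.
Qed.

Lemma root_subfield u Q h :
  root (map_poly (evalat iotaF u) Q) h = root (map_poly (evalat iota (inj u)) Q) (inj h).
Proof.
rewrite -(fmorph_root inj) -map_poly_comp; congr (root _ _).
by apply: eq_map_poly => P; apply: evalat_subfield.
Qed.

Lemma transc_subfield u : transc iotaF u <-> transc iota (inj u).
Proof.
split=> tu c E; apply: (tu c); last by rewrite E.
by apply: (fmorph_inj inj); rewrite E.
Qed.

End SubfieldTransfer.

Lemma iter_rmorphism (A : nzRingType) (s : {rmorphism A -> A}) n :
  exists rho : {rmorphism A -> A}, forall x, rho x = iter n s x.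
Proof.
elim: n => [|n [rho rhoE]]; first by exists idfun.
by exists (s \o rho) => x; rewrite /= rhoE.
Qed.

Section PrimePencil.

Variables (k : closedFieldType) (k_char0 : [pchar k] =i pred0) (G : zmodType) (R : idomainAlgType k)
  (Rw : G -> R -> Prop).
Hypotheses (gr : is_grading Rw) (units : only_constant_homog_units Rw)
  (fact : factorial_grading Rw) (G_fg : fg_group G) (R_fg : fg_algebra R)
  (eff : effective_grading Rw) (cplx : complexity_one G R).
Variables (L : fieldType) (j : {rmorphism R -> L}).
Hypotheses (j_inj : injective j) (j_frac : forall x, exists n d, d != 0 /\ x = j n / j d).
Local Notation iota := (fracC j).
Local Notation gprime := (graded_prime Rw).
Let j_eq0 x : (j x == 0) = (x == 0). Proof. exact: raddf_eq0. Qed.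

Variables (N : nat) (x : 'I_N -> R) (w : 'I_N -> G).
Hypotheses (xp : forall i, gprime (x i)) (xw : forall i, Rw (w i) (x i))
  (xgen : forall r, exists P : {mpoly k[N]}, r = mmap (in_alg R) x P).
Let x0 i : x i != 0. Proof. by case: (xp i). Qed.
Let Fs := deg0_subfield gr j_inj.
Local Notation F := (subfield_type Fs).
Local Notation inj := (subfield_inj Fs).
Let iotaF : {rmorphism k -> F} := subfield_const Fs (deg0C gr j).

Lemma algover_degree_zero (u h : F) : transc iotaF u -> algover iotaF u h.
Proof.
move=> /transc_subfield tu.
have [Q Q0 rQ] := algover_deg0 k_char0 gr R_fg eff cplx j_inj j_frac (subfield_injP u) (subfield_injP h) tu.
by exists Q => //; rewrite root_subfield.
Qed.

Section Ratios.

Let num (M : 'X_{1..N + N}) : 'X_{1..N} := [multinom M (lshift N i) | i < N].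
Let den (M : 'X_{1..N + N}) : 'X_{1..N} := [multinom M (rshift N i) | i < N].
Let w2 (i : 'I_(N + N)) : G := match split i with inl l => w l | inr l => - w l end.
Let ratio M := j (mono x (num M)) / j (mono x (den M)).

(* Ratios of monomials of equal degree form a finitely generated monoid: give the variables the weights (w, -w). *)
Lemma degree_zero_field_fg : exists mus : seq F, forall S : F -> Prop, subfield S ->
  (forall c, S (iotaF c)) -> (forall y, y \in mus -> S y) -> forall y, S y.
Proof.
have w2E M : wdeg w2 M = wdeg w (num M) - wdeg w (den M).
  rewrite /wdeg big_split_ord /= -sumrN; congr (_ + _); apply: eq_bigr => i _.
    by rewrite /w2 (unsplitK (inl _)) mnmE.
  by rewrite /w2 (unsplitK (inr _)) mnmE mulNrn.
have numD M M' : num (M + M')%MM = (num M + num M')%MM by apply/mnmP => i; rewrite !(mnmE, mnmDE).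
have denD M M' : den (M + M')%MM = (den M + den M')%MM by apply/mnmP => i; rewrite !(mnmE, mnmDE).
have [s [s0 sP]] := zero_monoid_fg w2.
have /boolp.choice[mu muP] : forall M, exists y : F, wdeg w2 M = 0 -> inj y = ratio M.
  move=> M; have [E|nE] := boolp.EM (wdeg w2 M = 0); last by exists 0.
  have [|y Ey] := @subfield_injE _ _ Fs (ratio M); last by exists y.
  exists (wdeg w (num M)), (mono x (num M)), (mono x (den M)); split=> //.
  - exact: mono_hom.
  - have -> : wdeg w (num M) = wdeg w (den M) by apply/eqP; rewrite -subr_eq0 -w2E E.
    exact: mono_hom.
  - exact: mono0.
exists [seq mu M | M <- s] => S Sf SC Smu y; have Sr := subfield_ring Sf.
have Sratio M : wdeg w2 M = 0 -> S (mu M).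
  have mu1 M' M'' : wdeg w2 M' = 0 -> wdeg w2 M'' = 0 -> mu (M' + M'')%MM = mu M' * mu M''.
    move=> E E'; apply: (fmorph_inj inj); rewrite rmorphM !muP ?wdegD ?E ?E' ?addr0 //.
    by rewrite /ratio numD denD !monoD !rmorphM mulf_div.
  move=> E; suff [] : S (mu M) /\ wdeg w2 M = 0 by [].
  apply: (sP (fun M => S (mu M) /\ wdeg w2 M = 0)) E.
  - split; last exact: wdeg0.
    have -> : mu 0%MM = 1; last exact: (subring1 Sr).
    apply: (fmorph_inj inj); rewrite rmorph1 muP ?wdeg0 // /ratio.
    have -> : num 0%MM = den 0%MM by apply/mnmP => i; rewrite !mnmE.
    by rewrite divff // j_eq0 mono0.
  - move=> M' M'' M's E'' [SM'' _]; have [E' _] := s0 M' M's.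
    split; last by rewrite wdegD E' E'' addr0.
    rewrite mu1 //; apply: (subringM Sr) => //; apply: Smu; exact: map_f.
have [v [n [d [Rn Rd d0 Ey]]]] := subfield_injP y.
(* Numerator and denominator are both divided by one monomial of their common degree; each becomes a
   combination of ratios of monomials. *)
have [m0 m0v] := exists_mono gr xw xgen Rd d0.
have part r : Rw v r -> exists2 z, S z & inj z = j r / j (mono x m0).
  move=> Rr; have [ms [c [msv ->]]] := hom_mono_span gr xw xgen Rr.
  elim: ms msv => [|m ms IH] msv.
    by exists 0; [exact: (subring0 Sr)|rewrite big_nil !rmorph0 mul0r].
  have [|z Sz Ez] := IH; first by move=> m' m's; apply: msv; rewrite inE m's orbT.
  have mv := msv m (mem_head _ _).
  pose M : 'X_{1..N + N} := [multinom match split i with inl l => m l | inr l => m0 l end | i < N + N].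
  have numM : num M = m by apply/mnmP => i; rewrite !mnmE (unsplitK (inl _)).
  have denM : den M = m0 by apply/mnmP => i; rewrite !mnmE (unsplitK (inr _)).
  have EM : wdeg w2 M = 0 by rewrite w2E numM denM mv m0v subrr.
  exists (iotaF (c m) * mu M + z).
    by apply: (subringD Sr) => //; apply: (subringM Sr) => //; apply: Sratio.
  rewrite rmorphD Ez rmorphM muP // /ratio numM denM big_cons rmorphD mulrDl; congr (_ + _).
  by rewrite fracZ mulrA.
have [z Sz Ez] := part n Rn; have [z' Sz' Ez'] := part d Rd.
have -> : y = z / z'; last by apply: (subringM Sr) => //; apply: (subfieldV Sf).
apply: (fmorph_inj inj); rewrite rmorphM fmorphV Ez Ez' Ey.
by rewrite invf_div mulrA divfK // j_eq0 mono0.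
Qed.

End Ratios.

Section Semilinear.

Variables (sigma : {rmorphism k -> k}) (s : {rmorphism R -> R}).
Hypotheses (s_inj : injective s) (s_surj : forall y, exists z, s z = y)
  (sC : forall c, s c%:A = (sigma c)%:A) (sx : forall i, s (x i) = x i).

Lemma semilinear_mono m : s (mono x m) = mono x m.
Proof. by rewrite rmorph_prod; apply: eq_bigr => i _; rewrite rmorphXn sx. Qed.

Lemma semilinear_hom v r : Rw v r -> Rw v (s r).
Proof.
move=> Rr; have [ms [c [msv ->]]] := hom_mono_span gr xw xgen Rr.
rewrite rmorph_sum big_seq; apply: hom_sum => // m /msv mv.
rewrite -mulr_algl rmorphM sC semilinear_mono mulr_algl; apply: homZ => //.
by rewrite -mv; apply: mono_hom.
Qed.

Lemma semilinear_hom_inv v r : Rw v (s r) -> Rw v r.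
Proof.
move=> Rsr; have -> : r = comp gr r v; last exact: comp_homP.
have [ch [t [ut ct Er]]] := compP gr r.
apply: s_inj; rewrite -(comp_id gr Rsr) {1}Er rmorph_sum comp_sumE.
have E u : comp gr (s (comp gr r u)) v = if u == v then s (comp gr r v) else 0.
  rewrite (comp_homE gr (semilinear_hom (ch u))) eq_sym; by case: eqP => [->|].
rewrite (eq_bigr _ (fun u _ => E u)); have [vt|vt] := boolP (v \in t).
  by rewrite (bigD1_seq v) //= eqxx big1 ?addr0 // => u /negPf ->.
rewrite ct // rmorph0 big_seq big1 // => u ut'; case: eqP => // uv; by rewrite uv (negPf vt) in ut'.
Qed.

Lemma semilinear_prime p : gprime p -> gprime (s p).
Proof.
move=> [[v Rp] p0 np pP]; split.
- by exists v; apply: semilinear_hom.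
- by rewrite raddf_eq0.
- apply: contra np => /unitrP[y [ysp _]]; have [z Ez] := s_surj y.
  apply: (mul1_unit (y := z)); apply: s_inj; by rewrite rmorphM Ez ysp rmorph1.
move=> y y' [v' Ry] [v'' Ry']; have [z Ez] := s_surj y; have [z' Ez'] := s_surj y'.
move=> [q Eq]; have [q' Eq'] := s_surj q.
have : divides p (z * z').
  by exists q'; apply: s_inj; rewrite !rmorphM Ez Ez' Eq Eq'.
case/pP; first by exists v'; apply: semilinear_hom_inv; rewrite Ez.
- by exists v''; apply: semilinear_hom_inv; rewrite Ez'.
- by move=> [t Et]; left; exists (s t); rewrite -Ez Et rmorphM.
- by move=> [t Et]; right; exists (s t); rewrite -Ez' Et rmorphM.
Qed.

End Semilinear.

End PrimePencil.

Lemma common_exponent (T : eqType) (s : seq T) (P : T -> nat -> Prop) :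
  (forall t n l, P t n -> P t (n * l)%N) ->
  (forall t, t \in s -> exists2 n, (0 < n)%N & P t n) ->
  exists2 n, (0 < n)%N & forall t, t \in s -> P t n.
Proof.
move=> PM; elim: s => [|t s IH] H; first by exists 1%N.
have [n n0 Pn] := H t (mem_head _ _).
have [|n' n'0 Pn'] := IH; first by move=> t' t's; apply: H; rewrite inE t's orbT.
exists (n * n')%N; first by rewrite muln_gt0 n0.
move=> t'; rewrite inE => /orP[/eqP ->|/Pn' P']; first exact: PM.
by rewrite mulnC; apply: PM.
Qed.

Section PrimePencil.

Variables (k : closedFieldType) (k_char0 : [pchar k] =i pred0) (G : zmodType) (R : idomainAlgType k)
  (Rw : G -> R -> Prop).
Hypotheses (gr : is_grading Rw) (units : only_constant_homog_units Rw)
  (fact : factorial_grading Rw) (G_fg : fg_group G) (R_fg : fg_algebra R)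
  (eff : effective_grading Rw) (cplx : complexity_one G R).
Variables (L : fieldType) (j : {rmorphism R -> L}).
Hypotheses (j_inj : injective j) (j_frac : forall x, exists n d, d != 0 /\ x = j n / j d).
Local Notation iota := (fracC j).
Local Notation gprime := (graded_prime Rw).
Let j_eq0 x : (j x == 0) = (x == 0). Proof. exact: raddf_eq0. Qed.

Variables (N : nat) (x : 'I_N -> R) (w : 'I_N -> G).
Hypotheses (xp : forall i, gprime (x i)) (xw : forall i, Rw (w i) (x i))
  (xgen : forall r, exists P : {mpoly k[N]}, r = mmap (in_alg R) x P).
Let x0 i : x i != 0. Proof. by case: (xp i). Qed.
Local Notation Fs := (deg0_subfield gr j_inj).
Local Notation F := (subfield_type Fs).
Local Notation inj := (subfield_inj Fs).
Local Notation iotaF := (subfield_const Fs (deg0C gr j)).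

(** p is a prime factor of f1 - c for a non-constant monomial f1 of degree zero, and p' = s^n(p)
    divides f1 - sigma^n(c); since sigma^n moves c, p does not divide p'. The power n is chosen so
    that every valuation ring at which a generator of the degree-zero monomials has a pole is fixed.
    A ring where some h in R_0 has a pole is of this kind, as h is a polynomial in these
    generators. *)
Lemma pencil_of_nonpointed : (exists2 h, Rw 0 h & forall c : k, h <> c%:A) ->
  exists v p p', pencil Rw v p p' /\
  forall h, Rw 0 h -> integralOver (evalat iota (j p' / j p)) (j h) -> exists c, j h = iota c.
Proof.
move=> [h0 Rh0 nh0].
have [Phi HPhi] := semilinear_automorphism xgen.
have [sigma [sigma_surj fixPhi inf]] := exists_automorphism k_char0 Phi.
have [s [s_inj s_surj sC sx]] := HPhi sigma sigma_surj fixPhi.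
have js_inj : injective (j \o s) by apply: inj_comp.
have [sL sLE] := frac_lift (g := j \o s) j_inj j_frac js_inj.
have sL0 y : deg0 Rw j y -> deg0 Rw j (sL y).
  move=> [v [n [d [Rn Rd d0 ->]]]]; exists v, (s n), (s d); split.
  - exact: (semilinear_hom gr xw xgen sC sx).
  - exact: (semilinear_hom gr xw xgen sC sx).
  - by rewrite raddf_eq0.
  - by rewrite rmorphM fmorphV !sLE.
have sF0 (y : F) : deg0 Rw j ((sL \o inj) y).
  by apply: sL0; apply: subfield_injP.
pose sF : {rmorphism F -> F} := corestrict Fs sF0.
have sFE y : inj (sF y) = sL (inj y) by [].
have iterE n y : inj (iter n sF y) = iter n sL (inj y) by elim: n => //= n <-.
have iterL n r : iter n sL (j r) = j (iter n s r) by elim: n => //= n ->; rewrite sLE.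
have iterC n c : iter n s c%:A = (iter n sigma c)%:A by elim: n => //= n ->; rewrite sC.
have iterm n m : iter n s (mono x m) = mono x m.
  by elim: n => //= n ->; apply: semilinear_mono.
have itergp n p : gprime p -> gprime (iter n s p).
  by move=> pp; elim: n => //= n; apply: (semilinear_prime gr xw xgen s_inj s_surj sC sx).
have iterh n v r : Rw v r -> Rw v (iter n s r).
  by move=> Rr; elim: n => //= n; apply: (semilinear_hom gr xw xgen sC sx).
have sF_surj y : exists z, sF z = y.
  have [v [n [d [Rn Rd d0 Ey]]]] := subfield_injP y.
  have [n' En] := s_surj n; have [d' Ed] := s_surj d.
  have Rn' : Rw v n' by apply: (semilinear_hom_inv gr xw xgen s_inj sC sx); rewrite En.
  have Rd' : Rw v d' by apply: (semilinear_hom_inv gr xw xgen s_inj sC sx); rewrite Ed.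
  have d'0 : d' != 0 by apply: contraNneq d0 => d'0; rewrite -Ed d'0 rmorph0.
  have [|z Ez] := @subfield_injE _ _ Fs (j n' / j d'); first by exists v, n', d'.
  exists z; apply: (fmorph_inj inj).
  by rewrite sFE -Ez rmorphM fmorphV !sLE /= En Ed -Ey.
have [gens [gens0 gensP]] := zero_monoid_fg w.
have /boolp.choice[fe feP] : forall m, exists y : F, wdeg w m = 0 -> inj y = j (mono x m).
  move=> m; have [E|nE] := boolp.EM (wdeg w m = 0); last by exists 0.
  have [|y Ey] := @subfield_injE _ _ Fs (j (mono x m)); last by exists y.
  exists 0, (mono x m), 1; split; rewrite ?oner_eq0 ?rmorph1 ?divr1 //; last exact: hom_one.
  by rewrite -E; apply: mono_hom.
have fe_transc m : m \in gens -> transc iotaF (fe m).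
  move=> /gens0[E m0] c Ec; case/eqP: m0; apply: (mono_const xp (c := c)).
  by apply: j_inj; rewrite -feP // Ec.
have fe_fix n m : m \in gens -> iter n sF (fe m) = fe m.
  by move=> /gens0[E _]; apply: (fmorph_inj inj); rewrite iterE feP // iterL iterm.
have algF (u h : F) : transc iotaF u -> algover iotaF u h.
  exact: (algover_degree_zero k_char0 R_fg eff cplx j_frac).
have [mus musP] := degree_zero_field_fg gr j_inj xp xw xgen.
pose perm m n := forall O, valring iotaF O -> ~ O (fe m) -> forall y, O (iter n sF y) <-> O y.
(* Each generator comes with its own power, and multiples of that power work as well, so one n
   serves all of them. *)
have [n n0 nP] : exists2 n, (0 < n)%N & forall m, m \in gens -> perm m n.
  apply: common_exponent => [m n l H O Oval nO y|m mg].
    elim: l y => [|l IH] y; first by rewrite muln0.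
    by rewrite mulnS iterD; apply: iff_trans (IH y); apply: H.
  have tv : transc iotaF (fe m)^-1.
    by move=> c E; apply: (fe_transc m mg c^-1); rewrite fmorphV -E invrK.
  have [D HD] := finite_dimension tv (fun h => algF _ h tv) musP.
  apply: (valrings_permuted k_char0 (fun h => algF _ h (fe_transc m mg)) HD sF_surj).
    move=> c; exists (sigma c); apply: (fmorph_inj inj).
    by rewrite sFE -[inj _]/(j c%:A) sLE /= sC.
  exact: (fe_fix 1%N).
have [c nc] := inf n n0.
(* Without any generator the only monomial of degree zero would be 1 and R_0 would be k, against the
   choice of h0. *)
have [m1 m1g] : exists m, m \in gens.
  apply: boolp.contrapT => no.
  have [ms [e [ms0 Eh]]] := hom_mono_span gr xw xgen Rh0.
  have all0 m : wdeg w m = 0 -> m = 0%MM.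
    by apply: (gensP (fun m => m = 0%MM)) => // m' m'' m'g; case: no; exists m'.
  apply: (nh0 (\sum_(m <- ms) e m)); rewrite Eh scaler_suml big_seq [RHS]big_seq.
  apply: eq_bigr => m /ms0/all0 ->; congr (_ *: _).
  by rewrite /mono /mmap1 big1 // => i _; rewrite mnm0E expr0.
have [m10 m1nz] := gens0 m1 m1g.
pose f1 := mono x m1; have Rf1 : Rw 0 f1 by rewrite -m10; apply: mono_hom.
have nf1 d : f1 <> d%:A by move=> E; case/eqP: m1nz; apply: (mono_const xp E).
have [p pp [q pf]] : exists2 p, gprime p & divides p (f1 - c%:A).
  have nz : nzhom Rw (f1 - c%:A).
    split; first by exists 0; apply: homB => //; apply: homC.
    by rewrite subr_eq0; apply/eqP/nf1.
  have [d [t [d0 tp Et]]] := hom_factor units fact nz.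
  case: t tp Et => [_|p t tp Et].
    rewrite big_nil => /eqP; rewrite subr_eq => /eqP E; case: (nf1 (d + c)).
    by rewrite E scalerDl.
  exists p; first by apply: tp; rewrite mem_head.
  by exists (d *: \prod_(q <- t) q); rewrite Et big_cons -scalerAl [p * _]mulrC.
have [[v Rp] p0 np _] := pp; pose p' := iter n s p.
have np' : ~ divides p p'.
  move=> [z Ez]; have [rho rhoE] := iter_rmorphism s n.
  have Ef : f1 - (iter n sigma c)%:A = rho q * p'.
    have Ef1 : f1 = rho f1 by rewrite rhoE iterm.
    by rewrite {1}Ef1 -iterC /p' -!rhoE -rmorphB pf rmorphM.
  have E : (iter n sigma c - c)%:A = (q - rho q * z) * p.
    by rewrite mulrBl -pf -mulrA -Ez -Ef scalerBl opprB [RHS]addrC [RHS]addrA subrK.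
  have := algC_unit R (c := iter n sigma c - c); rewrite subr_eq0 E unitrM (negPf np) andbF.
  by move=> H; have := H (introN eqP nc).
exists v, p, p'; split; first by split=> //; [exact: itergp|exact: iterh].
move=> h Rh inth; apply: boolp.contrapT => nh.
have [|y Ey] := @subfield_injE _ _ Fs (j h).
  by exists 0, h, 1; split; rewrite ?oner_eq0 ?rmorph1 ?divr1 //; apply: hom_one.
have ty : transc iotaF y by move=> d E; apply: nh; exists d; rewrite Ey E.
have [O Oval nOy] := exists_valring ty; have Oring := valring_ring Oval.
have [m mg nOm] : exists2 m, m \in gens & ~ O (fe m).
  apply: boolp.contrapT => no; apply: nOy.
  have Ogen m : m \in gens -> O (fe m).
    by move=> mg; apply: boolp.contrapT => nOm; apply: no; exists m.
  have [ms [e [ms0 Eh]]] := hom_mono_span gr xw xgen Rh.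
  have Ofe m : wdeg w m = 0 -> O (fe m).
    have one : fe 0%MM = 1.
      apply: (fmorph_inj inj); rewrite rmorph1 feP ?wdeg0 // /mono /mmap1 big1 ?rmorph1 // => i _.
      by rewrite mnm0E expr0.
    apply: (gensP (fun m => O (fe m))) => [|m' m'' m'g m''0 Om'']; first by rewrite one; apply: (subring1 Oring).
    have [m'0 _] := gens0 m' m'g.
    have -> : fe (m' + m'')%MM = fe m' * fe m''.
      by apply: (fmorph_inj inj); rewrite rmorphM !feP ?wdegD ?m'0 ?m''0 ?addr0 // monoD rmorphM.
    by apply: (subringM Oring) => //; apply: Ogen.
  have -> : y = \sum_(m <- ms) iotaF (e m) * fe m.
    apply: (fmorph_inj inj); rewrite -Ey Eh !rmorph_sum big_seq [RHS]big_seq.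
    by apply: eq_bigr => m' /ms0 m'0; rewrite rmorphM feP // fracZ.
  rewrite big_seq; elim/big_ind: _ => [|a b|m' /ms0 m'0].
  - exact: (subring0 Oring).
  - exact: (subringD Oring).
  - by apply: (subringM Oring); [apply: (valring_const Oval)|apply: Ofe].
(* s fixes monomials, so z = p/m0, with a monomial m0 of the degree of p, is an element of F with
   rho(z)/z = p'/p, and [vunit_ratio] applies to it. *)
have [m0 m0v] := exists_mono gr xw xgen Rp p0.
have m0n0 : mono x m0 != 0 by apply: mono0.
have [|z Ez] := @subfield_injE _ _ Fs (j p / j (mono x m0)).
  by exists v, p, (mono x m0); split=> //; rewrite -m0v; apply: mono_hom.
have [rho rhoE] := iter_rmorphism sF n.
have z0 : z != 0 by rewrite -(fmorph_eq0 inj) -Ez mulf_neq0 ?invr_eq0 ?j_eq0.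
have Eu : inj (rho z / z) = j p' / j p.
  rewrite rmorphM fmorphV rhoE iterE -Ez.
  have [rhoL rhoLE] := iter_rmorphism sL n.
  rewrite -rhoLE rmorphM fmorphV !rhoLE !iterL iterm invf_div mulrA divfK // j_eq0 //.
have [_ Ou _] : vunit O (rho z / z).
  apply: (vunit_ratio (iota := iotaF) (f := fe m)) => //.
  - by move=> a; rewrite rhoE; apply: (nP m mg).
  - by rewrite rhoE fe_fix.
  - by apply: algF; apply: fe_transc.
apply: nOy; apply: (valring_integral Oval Ou).
have [P Pmon rP] := inth; exists P => //.
by rewrite root_subfield Eu -Ey.
Qed.

End PrimePencil.

Section RationalPencil.

Variables (k : closedFieldType) (k_char0 : [pchar k] =i pred0) (G : zmodType) (R : idomainAlgType k)
  (Rw : G -> R -> Prop).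
Hypotheses (gr : is_grading Rw) (units : only_constant_homog_units Rw)
  (fact : factorial_grading Rw) (G_fg : fg_group G) (R_fg : fg_algebra R)
  (eff : effective_grading Rw) (cplx : complexity_one G R).
Variables (L : fieldType) (j : {rmorphism R -> L}).
Hypotheses (j_inj : injective j) (j_frac : forall x, exists n d, d != 0 /\ x = j n / j d).
Local Notation iota := (fracC j).

Lemma exists_rational_pencil : exists w p p', pencil Rw w p p' /\
  forall h, deg0 Rw j h -> exists A B : {poly k},
    B != 0 /\ h = evalat iota (j p' / j p) A / evalat iota (j p' / j p) B.
Proof.
have [N [x [w [xP xgen]]]] := prime_generators gr units fact R_fg.
have xp i : graded_prime Rw (x i) by case: (xP i).
have xw i : Rw (w i) (x i) by case: (xP i).
suff [v [p [p' [pc ic]]]] : exists v p p', pencil Rw v p p' /\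
    forall h, Rw 0 h -> integralOver (evalat iota (j p' / j p)) (j h) -> exists c, j h = iota c.
  exists v, p, p'; split=> // h Dh; have [pp pp' Rp Rp' npp'] := pc.
  exact: (rational_degree_zero_field k_char0 gr units fact R_fg eff cplx j_inj j_frac pp pp' Rp Rp' npp' ic Dh).
have [np|pt] := boolp.EM (exists2 h, Rw 0 h & forall c : k, h <> c%:A).
  exact: (pencil_of_nonpointed k_char0 gr units fact R_fg eff cplx j_inj j_frac xp xw xgen np).
have R0 h : Rw 0 h -> exists c : k, h = c%:A.
  move=> Rh; apply: boolp.contrapT => nc; apply: pt; exists h => // c E; apply: nc; by exists c.
have [v [p [p' pc]]] := pencil_of_pointed k_char0 gr units fact G_fg R_fg cplx xp xw xgen R0.
by exists v, p, p'; split=> // h /R0[c ->] _; exists c.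
Qed.

End RationalPencil.

Local Open Scope quotient_scope.

(** * The presentation by members of a pencil *)

Section Presentation.

Variables (k : closedFieldType) (G : zmodType) (R : idomainAlgType k) (Rw : G -> R -> Prop).
Hypotheses (gr : is_grading Rw) (eff : effective_grading Rw).
Variables (N : nat) (x : 'I_N -> R) (w : 'I_N -> G).
Hypotheses (xw : forall i, Rw (w i) (x i)) (xgen : forall r, exists P : {mpoly k[N]}, r = mmap (in_alg R) x P).
Variables (r : nat) (P : 'M[int]_(r, N)).
Hypothesis deg_kernel : forall v : 'cV[int]_N, \sum_c w c *~ v c 0 = 0 <-> v \in im_tr P.
Variables (B : comAlgType k) (pi : {rmorphism {mpoly k[N]} -> B}).
Hypotheses (piC : forall c, pi c%:MP = c%:A) (pi_surj : forall b, exists Q, pi Q = b)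
  (pi_kernel : forall Q, mmap (in_alg R) x Q = 0 <-> pi Q = 0).
Local Notation ev := (mmap (in_alg R) x).

Definition degv (v : 'cV[int]_N) : G := \sum_c w c *~ v c 0.

Lemma degvB v v' : degv (v - v') = degv v - degv v'.
Proof.
by rewrite /degv -sumrB; apply: eq_bigr => c _; rewrite !mxE mulrzBr.
Qed.

Definition class_map : {additive 'cV[int]_N -> K0 P} := Q P.

Lemma class_eq v v' : Q P v = Q P v' <-> v - v' \in im_tr P.
Proof.
by rewrite Quotient.idealrBE; split=> [E|/eqP //]; apply/eqP.
Qed.

Lemma degv_eq v v' : degv v = degv v' <-> Q P v = Q P v'.
Proof.
split=> [E|/class_eq /deg_kernel E]; first by apply/class_eq/deg_kernel; rewrite -/(degv _) degvB E subrr.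
by apply/eqP; rewrite -subr_eq0 -degvB; apply/eqP.
Qed.

Definition mvec (t : 'X_{1..N}) : 'cV[int]_N := \col_c (t c)%:Z.

Lemma degv_mvec t : degv (mvec t) = wdeg w t.
Proof. by apply: eq_bigr => c _; rewrite mxE pmulrn. Qed.

Lemma mdegK_mvec t : mdegK P t = Q P (mvec t).
Proof.
rewrite /mdegK -[Q P (mvec t)]/(class_map (mvec t)) (_ : mvec t = \sum_c delta_mx c 0 *+ t c).
  by rewrite raddf_sum; apply: eq_bigr => c _; rewrite raddfMn.
apply/colP => c; rewrite !mxE summxE (bigD1 c) //= big1 ?addr0.
  by rewrite mulmxnE !mxE !eqxx pmulrn mulrzz mul1r.
by move=> c' c'c; rewrite mulmxnE mxE eq_sym (negPf c'c) mul0rn.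
Qed.

Lemma degv_surj g : exists v, degv v = g.
Proof.
apply: (eff (H := fun g => exists v, degv v = g)).
- by exists 0; rewrite /degv big1 // => c _; rewrite mxE mulr0z.
- by move=> _ _ [v <-] [v' <-]; exists (v - v'); rewrite degvB.
move=> u [y Ry y0]; have [m <-] := exists_mono gr xw xgen Ry y0.
by exists (mvec m); apply: degv_mvec.
Qed.

(** Evaluation and pi have the same kernel, which identifies R with B. On degrees, the map from the
    exponent lattice to G has kernel im(P^T) and is onto because the grading is effective. *)
Theorem graded_iso_of_presentation (Bw : K0 P -> B -> Prop) :
  (forall u b, Bw u b <-> exists2 f : {mpoly k[N]}, mhomog u f & b = pi f) -> graded_iso Rw Bw.
Proof.
move=> BwE.
pose evr : {rmorphism {mpoly k[N]} -> R} := ev.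
have evC c : evr c%:MP = c%:A by apply: mmapC.
have evB a b : evr (a - b) = evr a - evr b by apply: rmorphB.
have evM a b : evr (a * b) = evr a * evr b by apply: rmorphM.
have evX m : evr 'X_[m] = mono x m by apply: mmapX.
have pi_eq a b : evr a = evr b <-> pi a = pi b.
  split=> E; apply/eqP; rewrite -subr_eq0.
    by rewrite -rmorphB; apply/eqP/pi_kernel; rewrite -[LHS]/(evr _) evB E subrr.
  by rewrite -evB; apply/eqP/pi_kernel; rewrite rmorphB E subrr.
have /boolp.choice[rep repP] : forall y, exists a, evr a = y by move=> y; have [a ->] := xgen y; exists a.
pose psi0 y := pi (rep y).
have psiE a : psi0 (evr a) = pi a by apply/pi_eq; rewrite repP.
have psiA : zmod_morphism psi0.
  by move=> a b; rewrite -(repP a) -(repP b) -evB !psiE rmorphB.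
have psiM : monoid_morphism psi0.
  split; first by rewrite -(rmorph1 evr) psiE rmorph1.
  by move=> a b; rewrite -(repP a) -(repP b) -evM !psiE rmorphM.
have psiZ : scalable psi0.
  move=> c a; rewrite -(repP a) -[c *: _]mulr_algl -evC -evM !psiE rmorphM piC.
  exact: mulr_algl.
pose iA := GRing.isZmodMorphism.Build R B psi0 psiA.
pose iM := GRing.isMonoidMorphism.Build R B psi0 psiM.
pose iZ := GRing.isScalable.Build k R B *:%R psi0 psiZ.
pose psi : {lrmorphism R -> B} := HB.pack psi0 iA iM iZ.
have {}psiE a : psi (evr a) = pi a by apply: psiE.
have /boolp.choice[vec vecP] : forall g, exists v, degv v = g by apply: degv_surj.
pose t0 g := Q P (vec g).
have tE v : t0 (degv v) = Q P v by apply/degv_eq; rewrite vecP.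
have tA : zmod_morphism t0.
  by move=> a b; rewrite -(vecP a) -(vecP b) -degvB !tE; apply: (raddfB class_map).
pose jA := GRing.isZmodMorphism.Build G (K0 P) t0 tA.
pose tpsi : {additive G -> K0 P} := HB.pack t0 jA.
have {}tE v : tpsi (degv v) = Q P v by apply: tE.
have tinj : injective tpsi.
  by move=> a b; rewrite -(vecP a) -(vecP b) !tE => /degv_eq.
have psi_inj : injective psi.
  by move=> a b; rewrite -(repP a) -(repP b) !psiE => /pi_eq.
have mdegE t u : mdegK P t = tpsi u <-> wdeg w t = u.
  by rewrite mdegK_mvec -degv_mvec -tE; split=> [/tinj|->].
exists psi, tpsi; split.
- have /boolp.choice[q qP] : forall b, exists a, pi a = b by apply: pi_surj.
  by exists (fun b => evr (q b)) => y; [apply: psi_inj|]; rewrite psiE qP.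
- by exists (fun z => degv (generic_quotient.repr z)) => y; [apply: tinj|]; rewrite tE /Q reprK.
move=> u b; split=> [/BwE[f fh ->]|[y Ry <-]].
  exists (evr f); last exact: psiE.
  rewrite /evr /= /mmap big_seq; apply: hom_sum => // m /fh /mdegE <-.
  by rewrite mulr_algl; apply: homZ => //; apply: (mono_hom gr xw).
apply/BwE; have [ms [c [msu ->]]] := hom_mono_span gr xw xgen Ry.
exists (\sum_(m <- ms) c m *: 'X_[m]).
  move=> t; rewrite mcoeff_msupp => tne; apply/mdegE; apply: msu; apply: contraR tne => tms.
  rewrite raddf_sum big_seq big1 // => m mms /=; rewrite mcoeffZ mcoeffX.
  by case: eqP => [E|]; [rewrite -E mms in tms|rewrite mulr0].
rewrite -psiE; congr (psi _); rewrite [RHS]raddf_sum; apply: eq_bigr => m _ /=.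
by rewrite -mul_mpolyC [RHS]evM evC evX mulr_algl.
Qed.

End Presentation.

(* Hiding [{fraction A}] behind an existential keeps unification from unfolding it. *)
Lemma fraction_field (A : idomainType) : exists (E : fieldType) (emb : {rmorphism A -> E}),
  injective emb /\ forall x, exists n d, d != 0 /\ x = emb n / emb d.
Proof.
exists {fraction A}, (@tofrac A); split; last exact: frac_repr.
by apply: raddf_inj => a /eqP; rewrite tofrac_eq0 => /eqP.
Qed.

Section PencilPresentation.

Variables (k : closedFieldType) (G : zmodType) (R : idomainAlgType k) (Rw : G -> R -> Prop).
Hypotheses (gr : is_grading Rw) (units : only_constant_homog_units Rw)
  (fact : factorial_grading Rw).
Local Notation gprime := (graded_prime Rw).
Variables (L : fieldType) (j : {rmorphism R -> L}).
Hypotheses (j_inj : injective j).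
Local Notation iota := (fracC j).
Let j_eq0 x : (j x == 0) = (x == 0). Proof. exact: raddf_eq0. Qed.

Variables (w0 : G) (f g : R).
Hypotheses (Rf : Rw w0 f) (Rg : Rw w0 g) (g0 : g != 0).

(* [Some a] and [None] are the points a and infinity of the projective line. *)
Definition member (o : option k) : R := if o is Some a then f - a *: g else g.

Hypotheses (member_neq0 : forall o, member o != 0)
  (member_coprime : forall p o o', gprime p -> divides p (member o) -> divides p (member o') -> o = o')
  (rational : forall h, deg0 Rw j h -> exists A B : {poly k},
    B != 0 /\ h = evalat iota (j f / j g) A / evalat iota (j f / j g) B).

Lemma member_hom o : Rw w0 (member o).
Proof. by case: o => [a|] //=; apply: homB => //; apply: homZ. Qed.

Variables (N : nat) (y : 'I_N -> R) (d : 'I_N -> G).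
Hypotheses (yp : forall c, gprime (y c)) (yd : forall c, Rw (d c) (y c))
  (y_sep : forall c c', divides (y c) (y c') -> c = c').
Let y0 c : y c != 0. Proof. by case: (yp c). Qed.

Variables (q : nat) (pt : 'I_q -> option k) (lm : 'I_q -> 'X_{1..N}).
Hypotheses (lm_member : forall i, mono y (lm i) = member (pt i))
  (y_special : forall c o, divides (y c) (member o) -> exists i, pt i = o).
Definition no_unit_member := forall o, member o \isn't a GRing.unit.

Lemma divides_mono p m : gprime p -> divides p (mono y m) -> exists2 c, (0 < m c)%N & divides p (y c).
Proof.
move=> pp; rewrite /mono /mmap1 => H.
case: (gprime_dvd_prod gr pp _ H) => [c _|c _].
  by exists (d c *+ m c); apply: homX.
case E: (m c) => [|n].
  move=> [z Ez]; case: pp => _ _ /negP[]; apply: (mul1_unit (y := z)); by rewrite -Ez expr0.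
move/(gprime_dvd_exp gr pp (ex_intro _ _ (yd c))) => H'; exists c => //; by rewrite E.
Qed.

Lemma divides_monoD p (m : 'X_{1..N}) c : (0 < m c)%N -> divides p (y c) -> divides p (mono y m).
Proof.
case E: (m c) => [//|n] _ [z Ez].
exists (z * y c ^+ n * \prod_(c' | c' != c) y c' ^+ m c').
by rewrite /mono /mmap1 (bigD1 c) //= E exprS {1}Ez; ring.
Qed.

(** A variable dividing the left side divides a variable on the right, which is the same one because
    distinct variables are not associated; it is cancelled on both sides. *)
Lemma unique_exponents m m' (c : k) : mono y m = c *: mono y m' -> m = m'.
Proof.
elim: {m}(mdeg m) {-2}m m' (erefl (mdeg m)) c => [|n IH] m m' mn c E.
  have m0 : m = 0%MM by apply/eqP; rewrite -mdeg_eq0 mn.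
  have c0 : c != 0 by apply: contraNneq (mono0 y0 m) => c0; rewrite E c0 scale0r.
  rewrite m0; apply/esym/(mono_const yp (c := c^-1)).
  rewrite -[mono y m'](scalerK c0) -E m0 /mono /mmap1 big1 // => i _; by rewrite mnm0E expr0.
have [b mb] : exists b, (0 < m b)%N.
  apply/existsP; apply: contraPT mn => /existsPn H; rewrite mdegE big1 // => i _.
  by apply/eqP; rewrite -leqn0 leqNgt; apply: H.
have bm' : (0 < m' b)%N.
  have [t Et] := divides_monoD mb (ex_intro _ 1 (esym (mul1r (y b)))).
  have c0 : c != 0 by apply: contraNneq (mono0 y0 m) => c0; rewrite E c0 scale0r.
  have [|b' b'm' /y_sep Eb] := divides_mono (p := y b) (m := m') (yp b); last by rewrite Eb.
  by exists (c^-1 *: t); rewrite -scalerAl -Et E scalerK.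
have sub (n' : 'X_{1..N}) : (0 < n' b)%N -> n' = (U_(b) + (n' - U_(b)))%MM.
  by move=> H; rewrite addmC submK // lep1mP -lt0n.
have Em := sub m mb; have Em' := sub m' bm'.
rewrite Em Em'; congr (_ + _)%MM; apply: (IH _ _ _ c).
  by apply/eqP; rewrite -(eqn_add2l 1) -{1}(mdeg1 b) -mdegD -Em mn.
apply: (mulfI (mono0 y0 U_(b)%MM)); rewrite -scalerAr -!monoD -Em -Em' //.
Qed.

Definition expo (e : 'I_q -> nat) : 'X_{1..N} := [multinom (\sum_i lm i c * e i)%N | c < N].

Lemma mono_expo e : mono y (expo e) = \prod_i member (pt i) ^+ e i.
Proof.
under [RHS]eq_bigr do rewrite -lm_member /mono /mmap1 -prodrXl.
rewrite exchange_big; apply: eq_bigr => c _ /=; rewrite mnmE -prodrXr.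
by apply: eq_bigr => i _; rewrite exprM.
Qed.

(** Unit members are absorbed into the constant; so the exponents count all the factors only when no
    member is a unit. *)
Lemma special_product s : (forall o, o \in s -> (exists i, pt i = o) \/ member o \is a GRing.unit) ->
  exists (c : k) e, [/\ c != 0, \prod_(o <- s) member o = c *: \prod_i member (pt i) ^+ e i
    & no_unit_member -> (\sum_i e i = size s)%N].
Proof.
elim: s => [|o s IH] H.
  exists 1, (fun=> 0%N); split; [exact: oner_neq0| |by rewrite sum_nat_const muln0].
  by rewrite big_nil big1 ?scale1r // => i _; rewrite expr0.
have [|c [e [c0 E S]]] := IH; first by move=> o' o's; apply: H; rewrite inE o's orbT.
case: (H o (mem_head _ _)) => [[i Ei]|uo].
  exists c, (fun l => (e l + (l == i))%N); split=> //.
    rewrite big_cons E -scalerAr; congr (_ *: _).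
    rewrite [in RHS](eq_bigr (fun l => member (pt l) ^+ e l * member (pt l) ^+ (l == i))); last first.
      by move=> l _; rewrite exprD.
    rewrite big_split /= mulrC; congr (_ * _); rewrite (bigD1 i) //= eqxx expr1 -Ei big1 ?mulr1 //.
    by move=> l /negPf ->; rewrite expr0.
  by move=> /S E'; rewrite big_split /= E' (bigD1 i) //= eqxx big1 ?addn0 ?addn1 // => l /negPf ->.
have [c' c'0 Ec'] := hom_unit units (member_hom o) uo.
exists (c' * c), e; split; first by rewrite mulf_neq0.
  by rewrite big_cons E Ec' mulr_algl scalerA.
by move=> nu; case/negP: (nu o).
Qed.

(** A prime factor of a non-special member is associated to no variable. On the other side it must
    therefore divide a member, and distinct members are coprime. *)
Lemma bad_member m m' (c c' : k) s s' o : c' != 0 ->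
  c *: (mono y m * \prod_(o <- s) member o) = c' *: (mono y m' * \prod_(o <- s') member o) ->
  o \in s -> ~ (exists i, pt i = o) -> member o \isn't a GRing.unit -> o \in s'.
Proof.
move=> c'0 E os nspec nu.
have [e [t [e0 tp Et]]] := hom_factor units fact (conj (ex_intro _ _ (member_hom o)) (member_neq0 o)).
case: t tp Et => [_|p t tp Et].
  by rewrite big_nil => Et; case/negP: nu; rewrite Et algC_unit.
have pp := tp p (mem_head _ _); have [_ _ _ pP] := pp.
have po : divides p (member o).
  by exists (e *: \prod_(q <- t) q); rewrite Et big_cons -scalerAl mulrC.
have : divides p (mono y m' * \prod_(o <- s') member o).
  have [z Ez] := po.
  exists (c'^-1 *: (c *: (mono y m * (\prod_(o <- rem o s) member o * z)))).
  rewrite -[LHS](scalerK c'0) -E (perm_big _ (perm_to_rem os)) big_cons /= Ez.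
  by rewrite -!scalerAl; congr (_ *: (_ *: _)); ring.
case/pP.
- by exists (wdeg d m'); apply: (mono_hom gr yd).
- by exists (\sum_(o <- s') w0); apply: (hom_prod gr) => o' _; apply: member_hom.
- case/(divides_mono pp) => b _ pb; case: nspec; apply: (y_special (c := b)).
  have [e' e'0 Ee] := gprime_assoc gr units pp (yp b) pb.
  have [z Ez] := po; exists (e'^-1 *: z).
  by rewrite Ez Ee -scalerAl -scalerAr scalerA mulVf // scale1r.
case/(gprime_dvd_prod gr pp) => [o' _|o' o's' po']; first by exists w0; apply: member_hom.
by rewrite (member_coprime pp po po').
Qed.

Lemma remove_bad_members n m m' (c c' : k) s s' : size s = n -> size s = size s' -> c != 0 -> c' != 0 ->
  c *: (mono y m * \prod_(o <- s) member o) = c' *: (mono y m' * \prod_(o <- s') member o) ->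
  exists t t', [/\ size t = size t',
    forall o, o \in t ++ t' -> (exists i, pt i = o) \/ member o \is a GRing.unit
    & c *: (mono y m * \prod_(o <- t) member o) = c' *: (mono y m' * \prod_(o <- t') member o)].
Proof.
elim: n s s' => [|n IH] s s' sn ss' c0 c'0 E.
  exists s, s'; split=> // o; rewrite (size0nil sn) /=.
  by move: ss'; rewrite sn => /esym/size0nil ->.
have [ok|nok] := boolp.EM (forall o, o \in s ++ s' -> (exists i, pt i = o) \/ member o \is a GRing.unit).
  by exists s, s'.
have [o [os os']] : exists o, o \in s /\ o \in s'.
  apply: boolp.contrapT => no; apply: nok => o; rewrite mem_cat => H.
  apply: boolp.contrapT => /boolp.not_orP[nspec nu]; apply: no; exists o.
  case/orP: H => H; split=> //; last by apply: (bad_member c0 (esym E) H nspec); apply/negP.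
  by apply: (bad_member c'0 E H nspec); apply/negP.
apply: (IH (rem o s) (rem o s')) => //; rewrite ?size_rem ?sn ?ss' //; first by rewrite -ss' sn.
move: E; rewrite (perm_big _ (perm_to_rem os)) (perm_big _ (perm_to_rem os')) !big_cons /=.
by rewrite !(mulrCA (mono _ _)) !(scalerAr _ (member o)); apply: mulfI.
Qed.

(** A polynomial in f/g, homogenised by a power of g, is a constant times a product of members f - a
    g. *)
Lemma evalat_split (A : {poly k}) : A != 0 -> exists (c : k) (s : seq k), c != 0 /\
  iota c * \prod_(a <- s) j (member (Some a)) = evalat iota (j f / j g) A * j g ^+ size s.
Proof.
move=> A0; have [s Ds] := closed_field_poly_normal A.
exists (lead_coef A), s; rewrite lead_coef_eq0; split=> //.
have jg0 : j g != 0 by rewrite j_eq0.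
rewrite [in RHS]Ds -mul_polyC rmorphM evalatC -mulrA; congr (_ * _).
rewrite rmorph_prod; elim: s {Ds} => [|a s IH]; first by rewrite !big_nil mulr1.
rewrite !big_cons IH exprS (rmorphB (evalat iota _)) evalatX evalatC [member _]/= (rmorphB j) fracZ.
have -> : j f - iota a * j g = (j f / j g - iota a) * j g by rewrite mulrBl divfK.
exact: mulrACA.
Qed.

(** The ratio of two monomials of equal degree lies in k(f/g), hence is a ratio of products of
    members. Non-special members that are not units cancel, special ones are monomials, and unique
    factorisation compares exponents. The two products have equally many factors, so without unit
    members the z sum to zero. *)
Lemma degree_kernel m m' : wdeg d m = wdeg d m' -> exists z : 'I_q -> int,
  (forall c, (m c)%:Z = (m' c)%:Z + \sum_i z i * (lm i c)%:Z) /\ (no_unit_member -> \sum_i z i = 0).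
Proof.
move=> E; have jm'0 : j (mono y m') != 0 by rewrite j_eq0; apply: mono0.
have jm0 : j (mono y m) != 0 by rewrite j_eq0; apply: mono0.
have [|A [B [B0 EAB]]] := rational (h := j (mono y m) / j (mono y m')).
  exists (wdeg d m), (mono y m), (mono y m'); split=> //; last exact: mono0.
    exact: mono_hom.
  by rewrite E; apply: mono_hom.
have A0 : A != 0.
  apply: contraNneq jm0 => A0; move: EAB; rewrite A0 rmorph0 mul0r => /eqP.
  by rewrite mulf_eq0 invr_eq0 (negPf jm'0) orbF.
have [a [ra [a0 Ea]]] := evalat_split A0; have [b [rb [b0 Eb]]] := evalat_split B0.
have B0' : evalat iota (j f / j g) B != 0.
  have : j (mono y m) / j (mono y m') != 0 by rewrite mulf_neq0 ?invr_eq0.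
  by rewrite EAB mulf_eq0 negb_or invr_eq0 => /andP[].
have pn n : \prod_(o <- nseq n None) member o = g ^+ n.
  by elim: n => [|n IH]; rewrite ?big_nil // big_cons IH exprS.
(* Copies of g, the member at infinity, clear the powers of g and bring both lists to the same
   length. *)
have [||||t [t' [tt' tspec Et]]] := @remove_bad_members _ m m' b a
    ([seq Some c | c <- rb] ++ nseq (size ra) None) ([seq Some c | c <- ra] ++ nseq (size rb) None) erefl.
- by rewrite !size_cat !size_map !size_nseq addnC.
- by [].
- by [].
- clear jm0; move: EAB jm'0; move: (mono y m) (mono y m') => Y1 Y2 EAB jm'0.
  apply: j_inj; rewrite !big_cat !big_map !pn !fracZ !rmorphM !rmorph_prod !rmorphXn.
  move: Ea Eb EAB; set PA := \prod_(_ <- ra) _; set PB := \prod_(_ <- rb) _.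
  move=> Ea Eb /(canRL (divfK jm'0)) ->.
  rewrite [LHS](_ : _ = (iota b * PB) * (evalat iota (j f / j g) A / evalat iota (j f / j g) B * j Y2) * j g ^+ size ra); last by rewrite /=; ring.
  rewrite [RHS](_ : _ = (iota a * PA) * j Y2 * j g ^+ size rb); last by rewrite /=; ring.
  rewrite Ea Eb; move: (evalat _ _ B) B0' (evalat _ _ A) (j Y2) (j g ^+ _) (j g ^+ _) => X X0 Y Z U V; by field.
have [|c [e [c0 Ep S]]] := special_product (s := t).
  by move=> o ot; apply: tspec; rewrite mem_cat ot.
have [|c' [e' [c'0 Ep' S']]] := special_product (s := t').
  by move=> o ot; apply: tspec; rewrite mem_cat ot orbT.
move: Et; rewrite Ep Ep' -!mono_expo -!scalerAr !scalerA -!monoD => Et.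
have bc0 : b * c != 0 by rewrite mulf_neq0.
have /mnmP Em : (m + expo e = m' + expo e')%MM.
  apply: (unique_exponents (c := (b * c)^-1 * (a * c'))).
  by rewrite -scalerA -Et scalerK.
exists (fun i => (e' i)%:Z - (e i)%:Z); split=> [c1|nu].
  have := Em c1; rewrite !mnmDE !mnmE => Em1.
  under eq_bigr do rewrite mulrBl -!PoszM ![(_ * lm _ _)%N]mulnC.
  rewrite sumrB -!(big_morph Posz PoszD erefl); move: Em1.
  by move: (\sum_i _)%N (\sum_i _)%N => X Y; lia.
by rewrite sumrB -!(big_morph Posz PoszD erefl) S // S' // tt' subrr.
Qed.

End PencilPresentation.

(** * Binary forms and the ideal of relations *)

Lemma binary_form_eval (k : closedFieldType) (E : fieldType) (iota : {rmorphism k -> E}) (F F' : E)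
  (I : eqType) (ms : seq I) q (lam mu : 'I_q -> k) (c : I -> k) (e : I -> 'I_q -> nat) (C : E) :
  F' != 0 -> (forall m, m \in ms -> F' ^+ (\sum_i e m i) = C) ->
  \sum_(m <- ms) iota (c m) * \prod_i (iota (lam i) * F + iota (mu i) * F') ^+ e m i =
  C * evalat iota (F / F') (\sum_(m <- ms) (c m)%:P * \prod_i ((lam i)%:P * 'X + (mu i)%:P) ^+ e m i).
Proof.
move=> F'0 HC; rewrite (raddf_sum (evalat iota (F / F'))) mulr_sumr big_seq [RHS]big_seq.
apply: eq_bigr => m /HC <-; rewrite /= (rmorphM (evalat iota (F / F'))) evalatC mulrCA; congr (_ * _).
rewrite (rmorph_prod (evalat iota (F / F'))) -prodrXr -big_split /=; apply: eq_bigr => i _.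
rewrite (rmorphXn (evalat iota (F / F'))) -exprMn_comm; last exact: mulrC.
rewrite (rmorphD (evalat iota (F / F'))) (rmorphM (evalat iota (F / F'))) !evalatC evalatX; congr (_ ^+ _).
by field.
Qed.

Section EvaluationKernel.

Variables (k : closedFieldType) (G : zmodType) (R : idomainAlgType k) (Rw : G -> R -> Prop).
Hypotheses (gr : is_grading Rw).
Variables (L : fieldType) (j : {rmorphism R -> L}).
Hypotheses (j_inj : injective j).
Local Notation iota := (fracC j).
Let j_eq0 x : (j x == 0) = (x == 0). Proof. exact: raddf_eq0. Qed.

Variables (N : nat) (y : 'I_N -> R) (d : 'I_N -> G).
Hypotheses (yd : forall c, Rw (d c) (y c)) (y0 : forall c, y c != 0).
Local Notation ev := (mmap (in_alg R) y).

Variables (q : nat) (lm : 'I_q -> 'X_{1..N}) (f g : R) (lam mu : 'I_q -> k).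
Hypotheses (g0 : g != 0) (tu : transc iota (j f / j g))
  (lm_mono : forall i, mono y (lm i) = lam i *: f + mu i *: g)
  (lm_disjoint : forall i i' c, lm i c != 0%N -> lm i' c != 0%N -> i = i').
Variables (B : comNzRingType) (pi : {rmorphism {mpoly k[N]} -> B}) (f' g' : {mpoly k[N]}).
Hypotheses (evg : ev g' = g)
  (pi_lm : forall i, pi 'X_[lm i] = pi (lam i *: f' + mu i *: g')).
(** Treats both types at once: under [balanced] the products of special members in one degree have
    equally many factors; otherwise g' = 1 and their number is immaterial. *)
Variable (balanced : Prop).
Hypotheses (unbalanced : balanced \/ g' = 1)
  (deg_kernel : forall m m', wdeg d m = wdeg d m' -> exists z : 'I_q -> int,
    (forall c, (m c)%:Z = (m' c)%:Z + \sum_i z i * (lm i c)%:Z) /\ (balanced -> \sum_i z i = 0)).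

Lemma seq_min (I : eqType) (s : seq I) (z : I -> int) m : m \in s ->
  exists2 m0, m0 \in s & forall m, m \in s -> z m0 <= z m.
Proof.
elim: s m => [//|a s IH] m _; case: s IH => [|b s] IH.
  by exists a; rewrite ?mem_head // => m'; rewrite inE => /eqP ->.
have [m0 m0s H] := IH b (mem_head _ _).
have [le|nle] := boolP (z a <= z m0).
  exists a; first exact: mem_head.
  by move=> m'; rewrite inE => /orP[/eqP ->|/H] //; move: le; lia.
exists m0; first by rewrite inE m0s orbT.
by move=> m'; rewrite inE => /orP[/eqP ->|/H //]; move: nle; lia.
Qed.

(** Monomials of one degree differ by integer powers of the special members. For each i the least
    power that occurs is moved into the common factor n, and non-negative exponents remain. *)
Lemma common_monomial (ms : seq 'X_{1..N}) v m1 : m1 \in ms -> (forall m, m \in ms -> wdeg d m = v) ->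
  exists (n : 'X_{1..N}) (e : 'X_{1..N} -> 'I_q -> nat) (t : nat),
  forall m, m \in ms -> m = (n + expo lm (e m))%MM /\ (balanced -> \sum_i e m i = t)%N.
Proof.
move=> m1s msv.
have /boolp.choice[z zP] : forall m, exists z : 'I_q -> int, m \in ms ->
    (forall c, (m c)%:Z = (m1 c)%:Z + \sum_i z i * (lm i c)%:Z) /\ (balanced -> \sum_i z i = 0).
  move=> m; case: (boolP (m \in ms)) => [mms|_]; last by exists (fun=> 0).
  by have [|z Hz] := deg_kernel (m := m) (m' := m1); [rewrite !msv|exists z].
have /fin_all_exists[b bP] : forall i, exists b, b \in ms /\ forall m, m \in ms -> z b i <= z m i.
  by move=> i; have [b bs H] := seq_min (fun m => z m i) m1s; exists b.
have sum1 c i (a : 'I_q -> int) : lm i c != 0%N -> \sum_l a l * (lm l c)%:Z = a i * (lm i c)%:Z.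
  move=> ic; rewrite (bigD1 i) //= big1 ?addr0 // => l li.
  have [lc|/negPn/eqP ->] := boolP (lm l c != 0%N); last by rewrite mulr0.
  by rewrite (lm_disjoint ic lc) eqxx in li.
have sum0 c (a : 'I_q -> int) : ~ (exists i, lm i c != 0%N) -> \sum_l a l * (lm l c)%:Z = 0.
  move=> no; rewrite big1 // => l _; have [lc|/negPn/eqP ->] := boolP (lm l c != 0%N); last by rewrite mulr0.
  by case: no; exists l.
have zb0 m i : m \in ms -> z m i - z (b i) i = `|z m i - z (b i) i|%N.
  by move=> mms; have := (bP i).2 m mms; lia.
(* A variable occurs in at most one special member i, so its exponent in n is its exponent in the
   monomial [b i], where the minimum is attained. *)
have n_ge0 c : 0 <= (m1 c)%:Z + \sum_i z (b i) i * (lm i c)%:Z.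
  have [[i ic]|no] := boolp.EM (exists i, lm i c != 0%N); last by rewrite sum0 // addr0.
  have [bs _] := bP i; have [/(_ c) H _] := zP (b i) bs.
  by rewrite (sum1 _ i) // -(sum1 _ _ (z (b i))) // -H.
exists [multinom `|((m1 c)%:Z + \sum_i z (b i) i * (lm i c)%:Z)%R|%N | c < N].
exists (fun m i => `|z m i - z (b i) i|%N), `|(\sum_i z (b i) i)%R|%N => m mms.
have [Hm bal] := zP m mms; split.
  apply/mnmP => c; apply/eqP; rewrite -eqz_nat Hm mnmDE !mnmE PoszD; apply/eqP.
  rewrite gez0_abs ?n_ge0 // -addrA; congr (_ + _).
  rewrite (big_morph Posz PoszD erefl) -big_split /=; apply: eq_bigr => i _.
  by rewrite PoszM -zb0 // mulrBr [z m i * _]mulrC [z (b i) i * _]mulrC addrC subrK.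
move=> /bal S; apply/eqP; rewrite -eqz_nat (big_morph Posz PoszD erefl).
under eq_bigr do rewrite -zb0 //.
have H : \sum_i z (b i) i <= 0.
  have : \sum_i z (b i) i <= \sum_i z m i by apply: Num.Theory.ler_sum => i _; exact: (bP i).2.
  by rewrite S.
rewrite sumrB S; apply/eqP; move: H; move: (\sum_i z (b i) i) => X; lia.
Qed.

(* The relation is a form in f, g, given by a polynomial [h] vanishing at f/g, so h = 0.
   The same form in [f'], [g'] therefore vanishes already among polynomials. *)
Lemma homogeneous_kernel (ms : seq 'X_{1..N}) v (c : 'X_{1..N} -> k) :
  (forall m, m \in ms -> wdeg d m = v) -> \sum_(m <- ms) c m *: mono y m = 0 ->
  pi (\sum_(m <- ms) c m *: 'X_[m]) = 0.
Proof.
case: ms => [|m1 ms0]; first by rewrite !big_nil rmorph0.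
move: (m1 :: ms0) (mem_head m1 ms0) => ms m1s msv E0.
have [n [e [t Hm]]] := common_monomial m1s msv.
pose evr : {rmorphism {mpoly k[N]} -> R} := ev.
have g'0 : g' != 0 by apply: contraNneq g0 => g'0; rewrite -evg -/(evr _) g'0 rmorph0.
have ge m : m \in ms -> g' ^+ (\sum_i e m i) = g' ^+ t.
  by case: unbalanced => [bal|->]; [move=> /Hm[_ ->]|rewrite !expr1n].
pose h := \sum_(m <- ms) (c m)%:P * \prod_i ((lam i)%:P * 'X + (mu i)%:P) ^+ e m i.
have h0 : h = 0.
  have E1 : \sum_(m <- ms) c m *: \prod_i (lam i *: f + mu i *: g) ^+ e m i = 0.
    apply: (mulfI (mono0 y0 n)); rewrite mulr0 mulr_sumr -[RHS]E0 big_seq [RHS]big_seq.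
    apply: eq_bigr => m /Hm[Em _]; rewrite [mono y m](congr1 (mono y) Em) monoD -scalerAr; congr (_ *: (_ * _)).
    rewrite /mono /mmap1; under [RHS]eq_bigr do rewrite mnmE -prodrXr.
    rewrite exchange_big; apply: eq_bigr => i _ /=; rewrite -lm_mono /mono /mmap1 -prodrXl.
    by apply: eq_bigr => l _; rewrite exprM.
  apply: (evalat_inj tu); rewrite rmorph0; apply: (mulfI (expf_neq0 t (_ : j g != 0))).
    by rewrite j_eq0.
  rewrite mulr0 -binary_form_eval ?j_eq0 //; last first.
    move=> m mms; rewrite -!rmorphXn; congr (j _); rewrite -evg -/(evr g').
    by rewrite -!rmorphXn ge.
  rewrite -[RHS](rmorph0 j) -[in RHS]E1 rmorph_sum; apply: eq_bigr => m _.
  rewrite fracZ; congr (_ * _); rewrite rmorph_prod; apply: eq_bigr => i _.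
  by rewrite rmorphXn rmorphD !fracZ.
have H0 : \sum_(m <- ms) c m *: \prod_i (lam i *: f' + mu i *: g') ^+ e m i = 0.
  have [E [emb [emb_inj _]]] := fraction_field {mpoly k[N]}.
  pose iotaE : {rmorphism k -> E} := emb \o @mpolyC N k.
  have embZ a P : emb (a *: P) = iotaE a * emb P by rewrite -mul_mpolyC rmorphM.
  have eg0 : emb g' != 0 by rewrite raddf_eq0.
  apply: emb_inj; rewrite rmorph0.
  have := binary_form_eval iotaE (emb f') lam mu c (C := emb g' ^+ t) eg0 (ms := ms) (e := e).
  rewrite -/h h0 rmorph0 mulr0 => <-; last by move=> m mms; rewrite -!rmorphXn ge.
  rewrite rmorph_sum; apply: eq_bigr => m _.
  rewrite embZ; congr (_ * _); rewrite rmorph_prod; apply: eq_bigr => i _.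
  by rewrite rmorphXn rmorphD !embZ.
rewrite -[RHS](mulr0 (pi 'X_[n])) -(rmorph0 pi) -[in RHS]H0 -rmorphM mulr_sumr !rmorph_sum.
rewrite big_seq [RHS]big_seq; apply: eq_bigr => m /Hm[Em _].
rewrite ['X_[m]](congr1 (fun m => 'X_[k, m]) Em) -!mul_mpolyC mpolyXD [in RHS]mulrCA !rmorphM; congr (_ * (_ * _)).
have -> : 'X_[expo lm (e m)] = \prod_i 'X_[lm i] ^+ e m i :> {mpoly k[N]}.
  rewrite [LHS]mpolyXE_id; under [LHS]eq_bigr do rewrite mnmE -prodrXr.
  rewrite exchange_big; apply: eq_bigr => i _ /=; rewrite [in RHS]mpolyXE_id -prodrXl.
  by apply: eq_bigr => l _; rewrite exprM.
by rewrite !rmorph_prod; apply: eq_bigr => i _; rewrite !rmorphXn pi_lm.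
Qed.

(** Monomials are homogeneous in R, so a relation splits into relations between monomials of one
    degree, to which [homogeneous_kernel] applies. *)
Lemma evaluation_kernel P : ev P = 0 -> pi P = 0.
Proof.
move=> EP; pose vs := undup [seq wdeg d m | m <- msupp P].
have split (T : zmodType) (H : 'X_{1..N} -> T) :
    \sum_(m <- msupp P) H m = \sum_(v <- vs) \sum_(m <- [seq m <- msupp P | wdeg d m == v]) H m.
  under [RHS]eq_bigr do rewrite big_filter.
  rewrite (exchange_big_dep xpredT) //= big_seq [RHS]big_seq; apply: eq_bigr => m mP.
  rewrite -big_filter (eq_filter (a2 := pred1 (wdeg d m))) ?filter_pred1_uniq ?undup_uniq ?big_seq1 //.
    by rewrite mem_undup map_f.
rewrite [P]mpolyE split rmorph_sum big1 // => v _.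
apply: (homogeneous_kernel (v := v)); first by move=> m; rewrite mem_filter => /andP[/eqP].
rewrite -[RHS](comp0 gr v) -[in RHS]EP.
have -> : ev P = \sum_(m <- msupp P) P@_m *: mono y m.
  by apply: eq_bigr => m _; rewrite mulr_algl.
rewrite comp_sumE big_filter [LHS]big_mkcond; apply: eq_bigr => m _.
by rewrite compZ (comp_homE gr (mono_hom gr yd m)) eq_sym; case: eqP => // _; rewrite scaler0.
Qed.

End EvaluationKernel.

(** * Variables, exponents and normalised pencils *)

Section Assembly.

Variables (A : Type) (q : nat) (n_ : 'I_q -> nat) (m : nat) (T : forall i, 'I_(n_ i) -> A) (S : 'I_m -> A).

Definition assemble (c : 'I_(\sum_i n_ i + m)) : A := match split c with
  | inl s => let t := tagnat.sig s in T (tagged t)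
  | inr l => S l end.

Lemma assemble_T i (t : 'I_(n_ i)) : assemble (Tpos m t) = T t.
Proof. by rewrite /assemble /Tpos (unsplitK (inl _)) tagnat.rankK. Qed.

Lemma assemble_S l : assemble (rshift _ l) = S l.
Proof. by rewrite /assemble (unsplitK (inr _)). Qed.

Lemma position_cases (c : 'I_(\sum_i n_ i + m)) :
  (exists i (t : 'I_(n_ i)), c = Tpos m t) \/ exists l, c = rshift _ l.
Proof.
case: (splitP c) => [s Es|l El]; last by right; exists l; apply: val_inj.
have -> : c = lshift m s by apply: val_inj.
left; exists (tagnat.sig1 s), (tagnat.sig2 s).
by rewrite /Tpos tagnat.sig2K.
Qed.

End Assembly.

Lemma nth_root (k : closedFieldType) (c : k) n : (0 < n)%N -> exists z, z ^+ n = c.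
Proof.
move=> n0; have [z zP] := solve_monicpoly (fun d => if d == 0%N then c else 0) n0.
exists z; rewrite zP; case: n n0 {zP} => // n _.
by rewrite big_ord_recl /= mulr1 big1 ?addr0 // => e _; rewrite mul0r.
Qed.

Section PencilData.

Variables (k : closedFieldType) (G : zmodType) (R : idomainAlgType k) (Rw : G -> R -> Prop).
Hypotheses (gr : is_grading Rw) (units : only_constant_homog_units Rw)
  (fact : factorial_grading Rw).
Local Notation gprime := (graded_prime Rw).

Lemma gprime_divides_sym p p' : gprime p -> gprime p' -> divides p p' -> divides p' p.
Proof.
move=> pp pp' /(gprime_assoc gr units pp pp')[c c0 ->]; exists (c^-1)%:A.
by rewrite mulr_algl scalerA mulVf // scale1r.
Qed.

Lemma divides_trans (a b c : R) : divides a b -> divides b c -> divides a c.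
Proof. by move=> [z ->] [z' ->]; exists (z' * z); rewrite mulrA. Qed.

Lemma prime_representatives (s : seq R) : (forall p, p \in s -> gprime p) ->
  exists t : seq R, [/\ uniq t, {subset t <= s}, forall p, p \in s -> exists2 p', p' \in t & divides p' p
    & forall a b, a \in t -> b \in t -> divides a b -> a = b].
Proof.
elim: s => [|p s IH] sp; first by exists [::].
have [|t [ut ts tr tsep]] := IH; first by move=> p' p's; apply: sp; rewrite inE p's orbT.
have [[p' p't p'p]|no] := boolp.EM (exists2 p', p' \in t & divides p' p).
  exists t; split=> // [a /ts|a]; first by rewrite inE => ->; rewrite orbT.
  by rewrite inE => /orP[/eqP ->|/tr //]; exists p'.
have pp := sp p (mem_head _ _).
have nsym a : a \in t -> ~ divides p a.
  move=> a_t pa; apply: no; exists a => //; apply: gprime_divides_sym pa => //.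
  by apply: sp; rewrite inE ts ?orbT.
exists (p :: t); split.
- rewrite /= ut andbT; apply/negP => pt; apply: no; exists p => //; exists 1; by rewrite mul1r.
- by move=> a; rewrite !inE => /orP[->//|/ts ->]; rewrite orbT.
- move=> a; rewrite inE => /orP[/eqP ->|/tr[p' p't H]].
    by exists p; rewrite ?mem_head //; exists 1; rewrite mul1r.
  by exists p'; rewrite // inE p't orbT.
move=> a b; rewrite !inE => /orP[/eqP ->|a_t] /orP[/eqP ->|b_t] // H; last exact: tsep.
  by case: (nsym b b_t).
by case: no; exists a.
Qed.

(** No constant is left in front of the product: since k is algebraically closed, the first prime
    can be rescaled by a root of that constant whose order is the exponent of this prime. *)
Lemma distinct_factorization v x : Rw v x -> x != 0 -> x \isn't a GRing.unit ->
  exists n (T : 'I_n -> R) (l : 'I_n -> nat), [/\ (0 < n)%N, forall i, gprime (T i), forall i, (0 < l i)%N,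
    forall i i', divides (T i) (T i') -> i = i' & x = \prod_i T i ^+ l i].
Proof.
move=> Rx x0 nx; have [c [s [c0 sp Ex]]] := hom_factor units fact (conj (ex_intro _ v Rx) x0).
have [t [ut ts tr tsep]] := prime_representatives sp.
have tgp p : p \in t -> gprime p by move=> /ts/sp.
have [e [c' [c'0 ep Es]]] : exists (e : R -> nat) (c' : k), [/\ c' != 0,
    forall p, p \in t -> p \in s -> (0 < e p)%N & \prod_(p <- s) p = c' *: \prod_(p <- t) p ^+ e p].
  elim: s sp tr {ts Ex} => [|p s IH] sp tr.
    exists (fun=> 0%N), 1; split; rewrite ?oner_neq0 //.
    by rewrite big_nil big1 ?scale1r // => p _; rewrite expr0.
  have [||e [c' [c'0 ep Es]]] := IH; [by move=> a a_s; apply: sp; rewrite inE a_s orbT| |].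
    by move=> a a_s; apply: tr; rewrite inE a_s orbT.
  have [p' p't [z Ez]] := tr p (mem_head _ _).
  have pp := sp p (mem_head _ _).
  have pp' : gprime p' by apply: tgp.
  have [c1 c10 Ep] := gprime_assoc gr units pp' pp (ex_intro _ z Ez).
  exists (fun a => (e a + (a == p'))%N), (c1 * c'); split; first by rewrite mulf_neq0.
    move=> a a_t; rewrite inE => /orP[/eqP Ea|/(ep a a_t)]; last by rewrite addn_gt0 => ->.
    have -> : a = p' by apply/esym/tsep => //; rewrite Ea; exists z.
    by rewrite eqxx addn1.
  rewrite big_cons Es Ep -scalerAl -scalerAr scalerA; congr (_ *: _).
  rewrite (bigD1_seq p') //= [in RHS](bigD1_seq p') //= eqxx addn1 exprS -mulrA; congr (_ * (_ * _)).
  by apply: eq_bigr => a /negPf ->; rewrite addn0.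
have t0 : (0 < size t)%N.
  case: s sp Ex tr {ts ep Es} => [_|p s sp _ tr]; last by have [p' + _] := tr p (mem_head _ _); case: (t).
  by rewrite big_nil => Ex; move: nx; rewrite Ex algC_unit.
have [z Ez] := nth_root (c * c') (ep _ (mem_nth 0 t0) (ts _ (mem_nth 0 t0))).
have z0 : z != 0.
  apply/eqP => z0; move: Ez; rewrite z0 expr0n; have := ep _ (mem_nth 0 t0) (ts _ (mem_nth 0 t0)).
  by rewrite lt0n => /negPf -> /esym/eqP; rewrite mulf_eq0 (negPf c0) (negPf c'0).
pose zz (i : 'I_(size t)) : k := if i == Ordinal t0 then z else 1.
have zz0 i : zz i != 0 by rewrite /zz; case: ifP; rewrite ?oner_neq0.
exists (size t), (fun i => zz i *: t`_i), (fun i => e t`_i); split=> //.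
- by move=> i; apply: (gprimeZ gr) => //; apply/sp/ts/mem_nth.
- by move=> i; apply: ep; [|apply: ts]; apply: mem_nth.
- move=> i i' [b Eb]; apply/val_inj/eqP; rewrite -(nth_uniq 0 (ltn_ord i) (ltn_ord i') ut); apply/eqP.
  apply: (tsep); rewrite ?mem_nth //.
  exists ((zz i')^-1 *: (zz i *: b)).
  by rewrite -!scalerAl scalerAr -Eb scalerK.
rewrite Ex Es scalerA (big_nth 0) big_mkord -Ez.
rewrite (bigD1 (Ordinal t0)) //= [in RHS](bigD1 (Ordinal t0)) //= /zz eqxx exprZn -scalerAl; congr (_ *: (_ * _)).
by apply: eq_bigr => i /negPf ->; rewrite scale1r.
Qed.

Lemma subalgebra_mmap N (x : 'I_N -> R) (A : R -> Prop) P :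
  subalgebra A -> (forall i, A (x i)) -> A (mmap (in_alg R) x P).
Proof.
move=> sA Ax; have rA := subalg_ring sA.
rewrite /mmap; elim/big_ind: _ => [|u v|m _]; [exact: (subring0 rA)|exact: (subringD rA)|].
apply: (subringM rA); first exact: (subalgC sA).
rewrite /mmap1; elim/big_ind: _ => [|u v|i _]; [exact: (subring1 rA)|exact: (subringM rA)|].
exact: (subringX rA).
Qed.

Variables (w0 : G) (f g : R).
Hypotheses (Rf : Rw w0 f) (Rg : Rw w0 g).
Local Notation member := (member f g).
Hypotheses (member_neq0 : forall o, member o != 0)
  (member_coprime : forall p o o', gprime p -> divides p (member o) -> divides p (member o') -> o = o').
Variables (N0 : nat) (x : 'I_N0 -> R).
Hypotheses (xp : forall i, gprime (x i)) (xgen : forall r, exists P : {mpoly k[N0]}, r = mmap (in_alg R) x P).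

(** Members being coprime, each generator divides at most one of them, so finitely many points
    suffice besides those prescribed in [pad]. *)
Lemma special_points pad : uniq pad -> (forall o, o \in pad -> member o \isn't a GRing.unit) ->
  exists rest, [/\ uniq (pad ++ rest), forall o, o \in pad ++ rest -> member o \isn't a GRing.unit
    & forall i o, divides (x i) (member o) -> o \in pad ++ rest].
Proof.
move=> up padn.
have /fin_all_exists[s sP] : forall i, exists s : seq (option k), forall o, divides (x i) (member o) <-> o \in s.
  move=> i; have [[o Ho]|no] := boolp.EM (exists o, divides (x i) (member o)).
    exists [:: o] => o'; rewrite inE; split=> [H|/eqP -> //].
    by rewrite (member_coprime (xp i) H Ho).
  by exists [::] => o; split=> // H; case: no; exists o.
pose t := flatten [seq s i | i <- enum 'I_N0].
have tP i o : divides (x i) (member o) -> o \in t.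
  by move=> /sP H; apply/flatten_mapP; exists i; rewrite ?mem_enum.
exists (undup [seq o <- t | o \notin pad]); split.
- rewrite cat_uniq up undup_uniq andbT /=; apply/hasPn => o.
  by rewrite mem_undup mem_filter => /andP[].
- move=> o; rewrite mem_cat mem_undup mem_filter => /orP[/padn //|/andP[_ /flatten_mapP[i _ /sP[z Ez]]]].
  by case: (xp i) => _ _ ni _; rewrite Ez unitrM (negPf ni) andbF.
move=> i o /tP H; rewrite mem_cat mem_undup mem_filter H andbT; by case: (o \in pad).
Qed.

Variables (q : nat) (pt : 'I_q -> option k).
Hypotheses (pt_inj : injective pt) (pt_nonunit : forall i, member (pt i) \isn't a GRing.unit)
  (pt_special : forall i o, divides (x i) (member o) -> exists l, pt l = o).

(** The T_ij are the prime factors of the chosen members, and the S_k represent the generators that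
    divide no member. A generator dividing a member is associated to some T_ij, so these elements
    generate R. *)
Lemma pencil_data : exists (n : 'I_q -> nat) (l : forall i, 'I_(n i) -> nat) (m : nat)
    (y : 'I_(\sum_i n i + m) -> R), [/\ forall i, (0 < n i)%N, forall i (t : 'I_(n i)), (0 < l i t)%N,
  forall i, \prod_t y (Tpos m t) ^+ l i t = member (pt i),
  (forall r, exists P : {mpoly k[\sum_i n i + m]}, r = mmap (in_alg R) y P) &
  [/\ forall c, gprime (y c), forall c c', divides (y c) (y c') -> c = c'
    & forall c o, divides (y c) (member o) -> exists i, pt i = o]].
Proof.
have /fin_all_exists[n /fin_all_exists[T /fin_all_exists[l TP]]] i :=
  distinct_factorization (member_hom gr Rf Rg (pt i)) (member_neq0 (pt i)) (pt_nonunit i).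
pose free i := boolp.asbool (forall o, ~ divides (x i) (member o)).
have [S [uS Ss Sr Ssep]] := prime_representatives (s := [seq x i | i <- enum 'I_N0 & free i])
  (fun p => ltac:(by case/mapP => i _ ->)).
have Tm i (t : 'I_(n i)) : divides (T i t) (member (pt i)).
  have [_ _ l0 _ E] := TP i; rewrite E (bigD1 t) //=; have := l0 t; case: (l i t) => // e _.
  by rewrite exprS; exists (T i t ^+ e * \prod_(t' | t' != t) T i t' ^+ l i t'); ring.
have Sfree p o : p \in S -> ~ divides p (member o).
  by move=> /Ss/mapP[i]; rewrite mem_filter => /andP[/boolp.asboolP H _] ->.
have Sp p : p \in S -> gprime p by move=> /Ss/mapP[i _ ->].
have Tp i t : gprime (T i t) by case: (TP i).
pose y := assemble T (fun l : 'I_(size S) => S`_l).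
have yT i (t : 'I_(n i)) : y (Tpos _ t) = T i t by apply: assemble_T.
have yS c : y (rshift _ c) = S`_c by apply: assemble_S.
have y_prime c : gprime (y c).
  case: (position_cases c) => [[i [t ->]]|[c' ->]]; rewrite ?yT ?yS //.
  exact/Sp/mem_nth.
exists n, l, (size S), y; split.
- by move=> i; case: (TP i).
- by move=> i; case: (TP i).
- by move=> i; have [_ _ _ _ ->] := TP i; apply: eq_bigr => t _; rewrite yT.
- move=> r; have [P ->] := xgen r.
  apply: (subalgebra_mmap (A := fun r => exists P : {mpoly k[_]}, r = mmap (in_alg R) y P)).
    exact: mmap_subalgebra.
  move=> i; suff [c [e ->]] : exists c (e : k), x i = e *: y c.
    by exists (e *: 'X_c); rewrite mmapZ mmapX mmap1U mulr_algl.
  have [[o Ho]|no] := boolp.EM (exists o, divides (x i) (member o)).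
    have [b Eb] := pt_special Ho; move: Ho; rewrite -Eb; have [_ _ _ _ ->] := TP b.
    case/(gprime_dvd_prod gr (xp i)) => [t _|t _].
      by have [[v RT] _ _ _] := Tp b t; exists (v *+ l b t); apply: homX.
    have [[v RT] _ _ _] := Tp b t.
    move/(gprime_dvd_exp gr (xp i) (ex_intro _ v RT)) => H.
    exists (Tpos _ t); rewrite yT.
    by have [c c0 E] := gprime_assoc gr units (xp i) (Tp b t) H; exists c^-1; rewrite E scalerK.
  have [|p pS pd] := Sr (x i).
    apply: map_f; rewrite mem_filter mem_enum andbT; apply/boolp.asboolP => o H; by apply: no; exists o.
  have [c c0 E] := gprime_assoc gr units (Sp p pS) (xp i) pd.
  have lt : (index p S < size S)%N by rewrite index_mem.
  by exists (rshift _ (Ordinal lt)), c; rewrite yS nth_index.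
split=> //.
- move=> c c'; case: (position_cases c) => [[i [t ->]]|[e ->]]; rewrite ?yT ?yS.
    case: (position_cases c') => [[i' [t' ->]]|[e' ->]]; rewrite ?yT ?yS => H.
      have Ei : i = i'.
        by apply/pt_inj/(member_coprime (Tp i t)) => //; apply: divides_trans H (Tm _ _).
      by move: t' H; rewrite -Ei => t' H; have [_ _ _ sep _] := TP i; rewrite (sep t t' H).
    case: (Sfree S`_e' (pt i)); first exact: mem_nth.
    by apply: divides_trans (Tm i t); apply: gprime_divides_sym H => //; apply/Sp/mem_nth.
  case: (position_cases c') => [[i' [t' ->]]|[e' ->]]; rewrite ?yT ?yS => H.
    by case: (Sfree S`_e (pt i')); [exact: mem_nth|exact: divides_trans H (Tm _ _)].
  have /eqP := Ssep _ _ (mem_nth 0 (ltn_ord e)) (mem_nth 0 (ltn_ord e')) H.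
  by rewrite nth_uniq // => /eqP/val_inj ->.
move=> c o; case: (position_cases c) => [[i [t ->]]|[e ->]]; rewrite ?yT ?yS => H.
  by exists i; apply: (member_coprime (Tp i t)).
by case: (Sfree S`_e o) => //; apply: mem_nth.
Qed.

End PencilData.

Section NormalPencil.

Variables (k : closedFieldType) (G : zmodType) (R : idomainAlgType k) (Rw : G -> R -> Prop).
Hypotheses (gr : is_grading Rw) (units : only_constant_homog_units Rw).
Local Notation gprime := (graded_prime Rw).
Variables (L : fieldType) (j : {rmorphism R -> L}).
Hypotheses (j_inj : injective j).
Local Notation iota := (fracC j).
Let j_eq0 x : (j x == 0) = (x == 0). Proof. exact: raddf_eq0. Qed.

Record normal_pencil (w : G) (f g : R) : Prop := NormalPencil {
  np_f : Rw w f;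
  np_g : Rw w g;
  np_g0 : g != 0;
  np_transc : transc iota (j f / j g);
  np_coprime : forall p, gprime p -> divides p f -> ~ divides p g;
  np_rational : forall h, deg0 Rw j h -> exists A B : {poly k},
    B != 0 /\ h = evalat iota (j f / j g) A / evalat iota (j f / j g) B }.

Lemma member_nonzero w f g o : normal_pencil w f g -> member f g o != 0.
Proof.
move=> np; case: o => [a|] /=; last exact: (np_g0 np).
rewrite subr_eq0; apply/eqP => E; apply: (np_transc np (c := a)).
by rewrite E fracZ mulfK // j_eq0 (np_g0 np).
Qed.

Lemma members_coprime w f g p o o' : normal_pencil w f g -> gprime p ->
  divides p (member f g o) -> divides p (member f g o') -> o = o'.
Proof.
move=> np pp.
have dvdD x x' : divides p x -> divides p x' -> divides p (x + x').
  by move=> [z ->] [z' ->]; exists (z + z'); rewrite mulrDl.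
have dvdZ c x : divides p x -> divides p (c *: x).
  by move=> [z ->]; exists (c *: z); rewrite scalerAl.
have noboth : ~ (divides p f /\ divides p g) by move=> [pf pg]; apply: (np_coprime np pp pf).
have base a : divides p (f - a *: g) -> ~ divides p g.
  by move=> H pg; apply: noboth; split=> //; rewrite -(subrK (a *: g) f); apply/dvdD/dvdZ.
case: o => [a|]; case: o' => [b|] //=; last by move=> H /base.
  move=> pa pb; have [->//|ab] := eqVneq a b; case: (base a pa).
  have ba0 : b - a != 0 by rewrite subr_eq0 eq_sym.
  have -> : g = (b - a)^-1 *: ((f - a *: g) + (-1) *: (f - b *: g)); last by apply/dvdZ/dvdD/dvdZ.
  apply: (canRL (scalerK ba0)); rewrite scaleN1r opprB scalerBl.
  by rewrite [RHS]addrC [RHS]addrA subrK.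
by move=> /base.
Qed.

(** A unit member p' - a p is a constant e; hence the degree is zero, and p'/p = a + e/p generates
    the same field as p. In the pencil of p and 1 no member p - b is a unit, since it would be
    constant and so would p. A unit p is excluded because p is prime. *)
Lemma normalize_pencil : (exists w p p', pencil Rw w p p' /\
    forall h, deg0 Rw j h -> exists A B : {poly k},
    B != 0 /\ h = evalat iota (j p' / j p) A / evalat iota (j p' / j p) B) ->
  exists w f g, normal_pencil w f g /\
  (no_unit_member f g \/ w = 0 /\ g = 1 /\ forall a, member f g (Some a) \isn't a GRing.unit).
Proof.
move=> [w [p [p' [[pp pp' Rp Rp' npp'] rat]]]].
have p0 : p != 0 by case: pp.
have np : p \isn't a GRing.unit by case: pp.
have tr : transc iota (j p' / j p) := prime_ratio_transc j_inj pp npp'.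
have [nu|un] := boolp.EM (no_unit_member p' p).
  exists w, p', p; split; last by left.
  split=> // q qq qp' qp; apply: npp'.
  have [c c0 E] := gprime_assoc gr units qq pp qp.
  have [z Ez] := qp'; exists (c^-1 *: z).
  by rewrite Ez E -scalerAl -scalerAr scalerA mulVf // scale1r.
have [a ua] : exists a, p' - a *: p \is a GRing.unit.
  apply: boolp.contrapT => no; apply: un => -[a|] //=.
  by apply/negP => ua; apply: no; exists a.
have Ra : Rw w (p' - a *: p) by apply: homB => //; apply: homZ.
have [e e0 Ee] := hom_unit units Ra ua.
have w0 : w = 0.
  apply: (hom_degree_uniq gr Ra); last by apply: contraTneq ua => ->; rewrite unitr0.
  by rewrite Ee; apply: homC.
have np1 c : p <> c%:A.
  by move=> E; case/negP: np; rewrite E algC_unit // -(algC_eq0 R) -E.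
have tp : transc iota (j p) by move=> c E; apply: (np1 c); apply: j_inj.
have rp h : deg0 Rw j h -> ratfun iota (j p) h.
  move=> /rat[A [B [B0 ->]]]; have Rs := ratfun_subfield tp; have Rr := subfield_ring Rs.
  have ru : ratfun iota (j p) (j p' / j p).
    have -> : j p' = iota e + iota a * j p by rewrite -fracZ -[iota e]/(j e%:A) -Ee -rmorphD subrK.
    rewrite mulrDl mulfK ?j_eq0 //; have rC c : ratfun iota (j p) (iota c).
      by rewrite -(evalatC iota (j p)); apply: ratfun_ev.
    apply: (subringD Rr) => //; apply: (subringM Rr) => //; apply: (subfieldV Rs).
    by rewrite -{2}(evalatX iota (j p)); apply: ratfun_ev.
  have rev P : ratfun iota (j p) (evalat iota (j p' / j p) P).
    rewrite evalatE; elim/big_ind: _ => [|x y|i _]; [exact: (subring0 Rr)|exact: (subringD Rr)|].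
    apply: (subringM Rr); last exact: (subringX Rr).
    by rewrite -(evalatC iota (j p)); apply: ratfun_ev.
  by apply: (subringM Rr) => //; apply: (subfieldV Rs).
exists 0, p, 1; split.
  split; rewrite ?oner_neq0 ?rmorph1 ?divr1 -?w0 //.
  - rewrite w0; exact: hom_one.
  - move=> q [_ _ nq _] _ [z Ez]; case/negP: nq; apply: (mul1_unit (y := z)); exact/esym.
right; split=> //; split=> // b; apply/negP => ub.
have Rb : Rw 0 (member p 1 (Some b)).
  by rewrite /=; apply: homB => //; [rewrite -w0|apply: homZ => //; apply: hom_one].
have [c _ Ec] := hom_unit units Rb ub; apply: (np1 (c + b)).
by rewrite scalerDl -Ec /= subrK.
Qed.

End NormalPencil.

(** * The algebras of the two types *)

Lemma det_mx33 (A : comNzRingType) (M : 'M[A]_3) :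
  let i0 := @Ordinal 3 0 isT in let i1 := @Ordinal 3 1 isT in let i2 := @Ordinal 3 2 isT in
  \det M = M i0 i0 * (M i1 i1 * M i2 i2 - M i1 i2 * M i2 i1)
    - M i0 i1 * (M i1 i0 * M i2 i2 - M i1 i2 * M i2 i0)
    + M i0 i2 * (M i1 i0 * M i2 i1 - M i1 i1 * M i2 i0).
Proof.
move=> i0 i1 i2; pose F r c := M (inord r) (inord c).
have nE i i' : M i i' = F i i' by rewrite /F !inord_val.
rewrite (expand_det_row _ ord0) !big_ord_recl big_ord0 /cofactor.
rewrite !(expand_det_row _ ord0) !big_ord_recl !big_ord0 /cofactor !det_mx11 !mxE !nE.
by move: F {nE} => F; rewrite /= /bump /=; ring.
Qed.

Section Instance.

Variables (k : closedFieldType) (q : nat) (n : 'I_q -> nat) (l : forall i, 'I_(n i) -> nat) (m : nat).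
Local Notation N := (\sum_i n i + m)%N.

Definition lmon (i : 'I_q) : 'X_{1..N} := (\sum_(t < n i) U_(Tpos m t) *+ l t)%MM.

Lemma lmonE i c : lmon i c = (\sum_(t < n i) l t * (Tpos m t == c))%N.
Proof. by rewrite mnm_sumE; apply: eq_bigr => t _; rewrite mulmnE mnm1E mulnC. Qed.

Lemma lrow_lmon i c : lrow l m i 0 c = (lmon i c)%:Z.
Proof.
rewrite mxE lmonE (big_morph Posz PoszD erefl); apply: eq_bigr => t _.
by rewrite eq_sym PoszM pmulrn mulrzz; case: eqP.
Qed.

Lemma Tmon_lmon i : Tmon l m k i = 'X_[lmon i].
Proof.
rewrite /Tmon /lmon (big_morph (fun m => 'X_[k, m]) (@mpolyXD _ k) (mpolyX0 _ k)).
by apply: eq_bigr => t _; rewrite mpolyXn.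
Qed.

Lemma mmap1_Mn (R : comNzRingType) M (y : 'I_M -> R) u e : mmap1 y (u *+ e)%MM = mmap1 y u ^+ e.
Proof. by rewrite /mmap1 -prodrXl; apply: eq_bigr => c _; rewrite mulmnE exprM. Qed.

Lemma mono_lmon (R : idomainAlgType k) (y : 'I_N -> R) i :
  mono y (lmon i) = \prod_(t < n i) y (Tpos m t) ^+ l t.
Proof.
rewrite (big_morph (mono y) (@monoD _ _ _ y) (_ : mono y 0%MM = 1)).
  by apply: eq_bigr => t _; rewrite /mono mmap1_Mn mmap1U.
by rewrite /mono /mmap1 big1 // => c _; rewrite mnm0E expr0.
Qed.

End Instance.

Lemma gen_ideal_mem (A : comNzRingType) (I : finType) (g : I -> A) i : g i \in gen_ideal g.
Proof.
apply/boolp.asboolP; exists (fun i' => (i' == i)%:R).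
by rewrite (bigD1 i) //= eqxx mul1r big1 ?addr0 // => i' /negPf ->; rewrite mul0r.
Qed.

Lemma gen_ideal_vanish (A B : comNzRingType) (I : finType) (g : I -> A) (e : {rmorphism A -> B}) x :
  (forall i, e (g i) = 0) -> x \in gen_ideal g -> e x = 0.
Proof.
move=> eg /boolp.asboolP[c ->]; rewrite rmorph_sum big1 // => i _.
by rewrite rmorphM eg mulr0.
Qed.

Lemma quot_eq0 (A : comNzRingType) (I : idealr A) x : \pi_({ideal_quot I}) x = 0 <-> x \in I.
Proof.
rewrite -{2}[x]subr0 Quotient.idealrBE -(rmorph0 \pi_({ideal_quot I})).
by split=> [->|/eqP].
Qed.

Section QuotientProjection.

Variables (k : comNzRingType) (A : comAlgType k) (I : idealr A).

Definition quot_pi : {rmorphism A -> {ideal_quot I}} := \pi_({ideal_quot I}).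

Lemma quot_piZ (c : k) : quot_pi c%:A = c%:A.
Proof. exact/esym/mulr1. Qed.

End QuotientProjection.

Section DegreeVectors.

Variables (G : zmodType) (N q : nat) (d : 'I_N -> G) (lm : 'I_q -> 'X_{1..N}).

Lemma split_vector (v : 'cV[int]_N) : exists m m' : 'X_{1..N},
  (forall c, v c 0 = (m c)%:Z - (m' c)%:Z) /\ degv d v = wdeg d m - wdeg d m'.
Proof.
pose a c : int := v c 0; pose b c := (0 <= a c)%R.
pose m : 'X_{1..N} := [multinom (if b c then absz (a c) else 0%N) | c < N].
pose m' : 'X_{1..N} := [multinom (if b c then 0%N else absz (a c)) | c < N].
have E c : v c 0 = (m c)%:Z - (m' c)%:Z by rewrite !mnmE -/(a c) /b; case: ifP; lia.
exists m, m'; split=> //; rewrite /wdeg -sumrB; apply: eq_bigr => c _.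
by rewrite E mulrzBr !pmulrn.
Qed.

Lemma degv_combination (u : 'I_q -> int) (v : 'cV[int]_N) :
  (forall c, v c 0 = \sum_i u i * (lm i c)%:Z) -> degv d v = \sum_i wdeg d (lm i) *~ u i.
Proof.
move=> vE; rewrite /degv; under eq_bigr do rewrite vE mulrz_sumr.
rewrite exchange_big; apply: eq_bigr => i _; rewrite /wdeg mulrz_suml.
by apply: eq_bigr => c _; rewrite pmulrn mulrzA_C.
Qed.

End DegreeVectors.

Lemma lmon_disjoint q (n : 'I_q -> nat) (l : forall i, 'I_(n i) -> nat) m i i' c :
  lmon l m i c != 0%N -> lmon l m i' c != 0%N -> i = i'.
Proof.
have pos b : lmon l m b c != 0%N -> exists t : 'I_(n b), c = Tpos m t.
  rewrite lmonE sum_nat_eq0 negb_forall => /existsP[t]; rewrite /= muln_eq0 negb_or => /andP[_].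
  by rewrite eqb0 negbK => /eqP <-; exists t.
move=> /pos[t Et] /pos[t' Et'].
have /lshift_inj E : Tpos m t = Tpos m t' by rewrite -Et -Et'.
by rewrite -(tagnat.Rank1K t) E tagnat.Rank1K.
Qed.

(** Cramer's rule: if the 3 x 3 determinant vanishes and the minor of the first two columns is
    invertible, the third entry is the same linear form in F and F' as its column prescribes. *)
Lemma det_solve (A : comNzRingType) (X0 X1 X2 F F' a0 a1 a2 b0 b1 b2 e : A) :
  e * (a0 * b1 - a1 * b0) = 1 -> X0 = a0 * F + b0 * F' -> X1 = a1 * F + b1 * F' ->
  X0 * (a1 * b2 - a2 * b1) - X1 * (a0 * b2 - a2 * b0) + X2 * (a0 * b1 - a1 * b0) = 0 ->
  X2 = a2 * F + b2 * F'.
Proof.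
move=> inv -> -> E; rewrite -[LHS]mul1r -[RHS]mul1r -inv -!mulrA; congr (_ * _).
by apply/eqP; rewrite -subr_eq0 -[X in _ == X]E; apply/eqP; ring.
Qed.

Section Types.

Variables (k : closedFieldType) (G : zmodType) (R : idomainAlgType k) (Rw : G -> R -> Prop).
Hypotheses (gr : is_grading Rw) (units : only_constant_homog_units Rw)
  (fact : factorial_grading Rw) (eff : effective_grading Rw).
Local Notation gprime := (graded_prime Rw).
Variables (L : fieldType) (j : {rmorphism R -> L}).
Hypotheses (j_inj : injective j).

Section TypeOneIso.

Variables (D : type1 k) (f : R).
Hypotheses (np : normal_pencil Rw j 0 f 1).
Local Notation N := (\sum_i n1 D i + m1 D)%N.
Variable (y : 'I_N -> R).
Hypotheses (A0 : A1 D ord0 = 0)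
  (yT : forall i, \prod_t y (Tpos (m1 D) t) ^+ l1 D i t = member f 1 (Some (A1 D i)))
  (ygen : forall r, exists P : {mpoly k[N]}, r = mmap (in_alg R) y P)
  (yp : forall c, gprime (y c)) (y_sep : forall c c', divides (y c) (y c') -> c = c')
  (y_special : forall c o, divides (y c) (member f 1 o) -> exists i, Some (A1 D i) = o).

Let pi : {rmorphism {mpoly k[N]} -> RAP1 D} := quot_pi (ideal1 (D := D)).

Lemma pi1_eq0 Q : pi Q = 0 <-> Q \in ideal1 (D := D).
Proof.
exact: quot_eq0.
Qed.

Lemma pi1C c : pi c%:MP = c%:A.
Proof. by rewrite -[c%:MP]mulr1 mul_mpolyC; apply: quot_piZ. Qed.

Theorem type1_iso : graded_iso Rw (RAP1_homog (D := D)).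
Proof.
have /fin_all_exists[d yd] : forall c, exists w, Rw w (y c) by move=> c; case: (yp c).
have y0 c : y c != 0 by case: (yp c).
pose lm := lmon (l1 D) (m1 D).
have lmE i : mono y (lm i) = member f 1 (Some (A1 D i)) by rewrite mono_lmon yT.
pose pt i := Some (A1 D i).
have dlm i : wdeg d (lm i) = 0.
  apply: (hom_degree_uniq gr (mono_hom gr yd (lm i))); last exact: mono0.
  rewrite lmE; exact: (member_hom gr (np_f np) (np_g np)).
have dk := degree_kernel gr units fact j_inj (np_f np) (np_g np) (np_g0 np)
  (fun o => member_nonzero j_inj o np) (fun p o o' => members_coprime np) (np_rational np)
  yp yd y_sep (pt := pt) lmE y_special.
pose evr : {rmorphism {mpoly k[N]} -> R} := mmap (in_alg R) y.
have evX m : evr 'X_[m] = mono y m by apply: mmapX.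
have evC c : evr c%:MP = c%:A by apply: mmapC.
have evB a b : evr (a - b) = evr a - evr b by apply: rmorphB.
(* The relations telescope: modulo the ideal the i-th monomial is the first one minus a_i, as the
   first point is 0. Thus the first monomial stands for f, and 1 for g. *)
have piT (i : nat) : (i <= r1' D)%N ->
    pi 'X_[lm (inord i)] = pi ('X_[lm ord0] - (A1 D (inord i))%:MP).
  elim: i => [_|i IH lt].
    have -> : inord 0 = ord0 :> 'I_(r1' D).+1 by apply: val_inj; rewrite /= inordK.
    by rewrite A0 mpolyC0 subr0.
  have /pi1_eq0 : g1 (Ordinal lt) \in ideal1 (D := D) by apply: gen_ideal_mem.
  rewrite /g1 !Tmon_lmon -/lm !rmorphB /= => /eqP.
  rewrite -[\pi _]/(pi _) => /eqP.
  rewrite IH ?(ltnW lt) // !rmorphB => E.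
  have -> : pi 'X_[lm (inord i.+1)] = pi 'X_[lm ord0] - pi (A1 D (inord i))%:MP
     - (pi (A1 D (inord i.+1))%:MP - pi (A1 D (inord i))%:MP).
    by apply/esym/eqP; rewrite -subr_eq0 -E; apply/eqP; ring.
  by ring.
have P01E i c : P01 D i c = (lm i c)%:Z by rewrite mxE lrow_lmon.
apply: (@graded_iso_of_presentation _ _ _ _ gr eff _ _ _ yd ygen _ (P01 D) _ (RAP1 D) pi).
- move=> v; split=> [|/boolp.asboolP[u Ev]].
    have [m [m' [Em Ed]]] := split_vector d v.
    rewrite -/(degv d v) Ed => /eqP; rewrite subr_eq0 => /eqP /dk[z [zE _]].
    apply/boolp.asboolP; exists (\col_i z i); apply/colP => c.
    rewrite Em zE addrAC subrr add0r mxE; apply: eq_bigr => i _.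
    by rewrite [_^T _ _]mxE P01E mxE mulrC.
  rewrite -/(degv d v) (@degv_combination _ _ _ d lm (fun i => u i 0) v).
    by rewrite big1 // => i _; rewrite dlm mul0rz.
  move=> c; rewrite Ev mxE; apply: eq_bigr => i _.
  by rewrite mxE P01E mulrC.
- exact: pi1C.
- by move=> b; exists (generic_quotient.repr b); rewrite -[RHS]reprK.
- move=> Q; split=> [|/pi1_eq0]; last first.
    apply: (gen_ideal_vanish (e := evr)) => i; rewrite /g1 !Tmon_lmon -/lm.
    by rewrite !evB !evX !lmE evC /= scalerBl; ring.
  apply: (@evaluation_kernel _ _ _ _ gr _ _ j_inj _ _ _ yd y0 _ lm f 1 (fun=> 1) (fun i => - A1 D i)
    (np_g0 np) (np_transc np) _ _ _ pi 'X_[lm ord0] 1 _ _ (no_unit_member f 1) _ dk).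
  + by move=> i; rewrite lmE /= scale1r scaleNr.
  + by move=> i i' c; apply: lmon_disjoint.
  + exact: (rmorph1 evr).
  + move=> i; have := piT i; rewrite inord_val -ltnS => /(_ (ltn_ord i)) ->.
    by rewrite scale1r scaleNr -mul_mpolyC mulr1.
  + by right.
- by [].
Qed.

End TypeOneIso.

Section TypeTwoIso.

Variables (D : type2 k) (w0 : G) (f g : R).
Hypotheses (np : normal_pencil Rw j w0 f g) (nonunit : no_unit_member f g).
Local Notation N := (\sum_i n2 D i + m2 D)%N.
Variables (pt : 'I_(r2' D).+2 -> option k) (y : 'I_N -> R).

(** Coefficients of f and g in a member: (1, -a) at a finite point a, (0, 1) at infinity. These
    pairs are the columns of the matrix A of Type 2. *)
Definition point_lam (o : option k) : k := if o is Some _ then 1 else 0.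
Definition point_mu (o : option k) : k := if o is Some a then - a else 1.

Lemma memberE o : member f g o = point_lam o *: f + point_mu o *: g.
Proof. by case: o => [a|] /=; rewrite ?scale1r ?scaleNr // scale0r add0r. Qed.

Lemma point_det o o' : o != o' -> point_lam o * point_mu o' - point_lam o' * point_mu o != 0.
Proof.
case: o o' => [a|] [b|] //=; rewrite ?mul1r ?mul0r ?mulr1 ?subr0 ?sub0r ?oppr_eq0 ?oner_eq0 //.
by rewrite opprK addrC subr_eq0; apply: contra => /eqP ->.
Qed.

Hypotheses (pt_inj : injective pt) (pt0 : pt ord0 = None) (pt1 : pt (lift ord0 ord0) = Some 0)
  (A_lam : forall i, A2 D 0 i = point_lam (pt i)) (A_mu : forall i, A2 D 1 i = point_mu (pt i))
  (yT : forall i, \prod_t y (Tpos (m2 D) t) ^+ l2 D i t = member f g (pt i))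
  (ygen : forall r, exists P : {mpoly k[N]}, r = mmap (in_alg R) y P)
  (yp : forall c, gprime (y c)) (y_sep : forall c c', divides (y c) (y c') -> c = c')
  (y_special : forall c o, divides (y c) (member f g o) -> exists i, pt i = o).

Let pi : {rmorphism {mpoly k[N]} -> RAP2 D} := quot_pi (ideal2 (D := D)).

Lemma pi2_eq0 Q : pi Q = 0 <-> Q \in ideal2 (D := D).
Proof. exact: quot_eq0. Qed.

Lemma pi2C c : pi c%:MP = c%:A.
Proof. by rewrite -[c%:MP]mulr1 mul_mpolyC; apply: quot_piZ. Qed.

Lemma g2E (i : 'I_(r2' D)) :
  let T (c : nat) : {mpoly k[N]} := 'X_[lmon (l2 D) (m2 D) (inord (i + c))] in
  let a (c : nat) : {mpoly k[N]} := (point_lam (pt (inord (i + c))))%:MP in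
  let b (c : nat) : {mpoly k[N]} := (point_mu (pt (inord (i + c))))%:MP in
  g2 i = T 0 * (a 1 * b 2 - a 2 * b 1) - T 1 * (a 0 * b 2 - a 2 * b 0) + T 2 * (a 0 * b 1 - a 1 * b 0).
Proof.
move=> T a b; rewrite /g2 det_mx33; set M := col_mx _ _.
have M0 c : M (@Ordinal 3 0 isT) c = T c.
  rewrite !mxE; case: splitP => // s _; by rewrite mxE Tmon_lmon.
have M1 c : M (@Ordinal 3 1 isT) c = a c.
  rewrite !mxE; case: splitP => [[[]//]|s /= Es]; rewrite !mxE.
  have -> : s = 0 by apply: val_inj; move: Es => /= [].
  by rewrite A_lam.
have M2 c : M (@Ordinal 3 2 isT) c = b c.
  rewrite !mxE; case: splitP => [[[]//]|s /= Es]; rewrite !mxE.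
  have -> : s = 1 by apply: val_inj; move: Es => /= [].
  by rewrite A_mu.
by rewrite !M0 !M1 !M2.
Qed.

Theorem type2_iso : graded_iso Rw (RAP2_homog (D := D)).
Proof.
have /fin_all_exists[d yd] : forall c, exists w, Rw w (y c) by move=> c; case: (yp c).
have y0 c : y c != 0 by case: (yp c).
pose lm := lmon (l2 D) (m2 D).
have lmE i : mono y (lm i) = member f g (pt i) by rewrite mono_lmon yT.
have dlm i : wdeg d (lm i) = w0.
  apply: (hom_degree_uniq gr (mono_hom gr yd (lm i))); last exact: mono0.
  rewrite lmE; exact: (member_hom gr (np_f np) (np_g np)).
have dk := degree_kernel gr units fact j_inj (np_f np) (np_g np) (np_g0 np)
  (fun o => member_nonzero j_inj o np) (fun p o o' => members_coprime np) (np_rational np)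
  yp yd y_sep (pt := pt) lmE y_special.
pose evr : {rmorphism {mpoly k[N]} -> R} := mmap (in_alg R) y.
have evX m : evr 'X_[m] = mono y m by apply: mmapX.
have evC c : evr c%:MP = c%:A by apply: mmapC.
have evB a b : evr (a - b) = evr a - evr b by apply: rmorphB.
have evD a b : evr (a + b) = evr a + evr b by apply: rmorphD.
have evM a b : evr (a * b) = evr a * evr b by apply: rmorphM.
pose F := 'X_[lm (lift ord0 ord0)] : {mpoly k[N]}; pose F' := 'X_[lm ord0] : {mpoly k[N]}.
(* The points infinity and 0 make the first two monomials stand for g and f. Each relation then
   determines the next monomial from the two before it, whose columns are independent. *)
have piT (i : nat) : (i < (r2' D).+2)%N -> pi 'X_[lm (inord i)] =
    pi (point_lam (pt (inord i)) *: F + point_mu (pt (inord i)) *: F').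
  elim/ltn_ind: i => -[|[|i]] IH lt.
  - have -> : inord 0 = ord0 :> 'I_(r2' D).+2 by apply: val_inj; rewrite /= inordK.
    by rewrite pt0 scale0r add0r scale1r.
  - have -> : inord 1 = lift ord0 ord0 :> 'I_(r2' D).+2 by apply: val_inj; rewrite /= inordK.
    by rewrite pt1 /= scale1r oppr0 scale0r addr0.
  have lt' : (i < r2' D)%N by [].
  have /pi2_eq0 E : g2 (Ordinal lt') \in ideal2 (D := D) by apply: gen_ideal_mem.
  have qM a b : pi (a * b) = pi a * pi b by apply: rmorphM.
  have qB a b : pi (a - b) = pi a - pi b by apply: rmorphB.
  have qD a b : pi (a + b) = pi a + pi b by apply: rmorphD.
  rewrite g2E in E; cbv zeta in E; rewrite -/lm addn0 addn1 addn2 !(qB, qD, qM) in E.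
  have H0 := IH i (ltnW (ltnSn _)) (ltnW (ltnW lt)); have H1 := IH i.+1 (ltnSn _) (ltnW lt).
  have ne : pt (inord i) != pt (inord i.+1).
    apply/eqP => /pt_inj/(congr1 val); rewrite /= !inordK // ?(ltnW lt) ?(ltnW (ltnW lt)) //.
    by move/eqP; rewrite eqn_leq ltnn andbF.
  have det0 := point_det ne.
  have piL a b : pi (a *: F + b *: F') = pi a%:MP * pi F + pi b%:MP * pi F'.
    by rewrite rmorphD -!mul_mpolyC !rmorphM.
  move: H0 H1; rewrite !piL.
  set a0 := point_lam (pt (inord i)) in det0 *; set b0 := point_mu (pt (inord i)) in det0 *.
  set a1 := point_lam (pt (inord i.+1)) in det0 *; set b1 := point_mu (pt (inord i.+1)) in det0 *.
  set a2 := point_lam (pt (inord i.+2)); set b2 := point_mu (pt (inord i.+2)).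
  have inv : pi (a0 * b1 - a1 * b0)^-1%:MP * (pi a0%:MP * pi b1%:MP - pi a1%:MP * pi b0%:MP) = 1.
    have pM a b : pi a%:MP * pi b%:MP = pi (a * b)%:MP by rewrite mpolyCM rmorphM.
    have pB a b : pi a%:MP - pi b%:MP = pi (a - b)%:MP by rewrite mpolyCB rmorphB.
    by rewrite !pM pB pM mulVf // rmorph1.
  by move=> H0 H1; apply: (det_solve inv H0 H1 E).
have P02E i c : P02 D i c = (lm (lift ord0 i) c)%:Z - (lm ord0 c)%:Z by rewrite !mxE -!lrow_lmon !mxE.
apply: (@graded_iso_of_presentation _ _ _ _ gr eff _ _ _ yd ygen _ (P02 D) _ (RAP2 D) pi).
- move=> v; split=> [|/boolp.asboolP[u Ev]].
    have [m [m' [Em Ed]]] := split_vector d v.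
    rewrite -/(degv d v) Ed => /eqP; rewrite subr_eq0 => /eqP /dk[z [zE /(_ nonunit) z0]].
    (* The z sum to zero, so the coefficient of block 0 is minus the sum of the others; this matches
       the rows l_i - l_0 of the matrix. *)
    apply/boolp.asboolP; exists (\col_i z (lift ord0 i)); apply/colP => c.
    rewrite Em zE addrAC subrr add0r mxE big_ord_recl.
    have -> : z ord0 = - \sum_i z (lift ord0 i) by apply/eqP; rewrite -addr_eq0; move: z0; rewrite big_ord_recl => ->.
    rewrite mulNr mulr_suml -sumrN -big_split /=; apply: eq_bigr => i _.
    by rewrite [_^T _ _]mxE P02E mxE; ring.
  pose u' i := if unlift ord0 i is Some i' then u i' 0 else - \sum_i u i 0.
  rewrite -/(degv d v) (@degv_combination _ _ _ d lm u' v).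
    rewrite (eq_bigr (fun i => w0 *~ u' i)) => [|i _]; last by rewrite dlm.
    rewrite -mulrz_sumr big_ord_recl {1}/u' unlift_none [X in _ + X](eq_bigr (fun i => u i 0)) => [|i _].
      by rewrite addNr mulr0z.
    by rewrite /u' liftK.
  move=> c; rewrite Ev mxE [RHS]big_ord_recl {1}/u' unlift_none mulNr mulr_suml -sumrN -big_split /=.
  by apply: eq_bigr => i _; rewrite mxE P02E /u' liftK; ring.
- exact: pi2C.
- by move=> b; exists (generic_quotient.repr b); rewrite -[RHS]reprK.
- move=> Q; split=> [|/pi2_eq0]; last first.
    apply: (gen_ideal_vanish (e := evr)) => i; rewrite g2E /= -/lm.
    rewrite !(evB, evD, evM) !evX !lmE !evC !memberE.
    by rewrite -!(mulr_algl _ f) -!(mulr_algl _ g); ring.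
  apply: (@evaluation_kernel _ _ _ _ gr _ _ j_inj _ _ _ yd y0 _ lm f g (fun i => point_lam (pt i))
    (fun i => point_mu (pt i)) (np_g0 np) (np_transc np) _ _ _ pi F F' _ _ (no_unit_member f g) _ dk).
  + by move=> i; rewrite lmE memberE.
  + by move=> i i' c; apply: lmon_disjoint.
  + by rewrite -/(evr _) evX lmE pt0.
  + by move=> i; have := piT i; rewrite inord_val => /(_ (ltn_ord i)).
  + by left.
- by [].
Qed.

End TypeTwoIso.

End Types.

Lemma point_columns_free (k : closedFieldType) q (pt : 'I_q -> option k) (A : 'M[k]_(2, q)) i i' :
  injective pt -> (forall b, A 0 b = point_lam (pt b)) -> (forall b, A 1 b = point_mu (pt b)) ->
  i != i' -> free [:: col i A; col i' A].
Proof.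
move=> pt_inj A0 A1 ne; have := point_det (o := pt i) (o' := pt i').
rewrite (inj_eq pt_inj) -!A0 -!A1 => /(_ ne) det0.
rewrite free_cons span_seq1 seq1_free; apply/andP; split; apply: contraNN det0.
  case/vlineP => c /matrixP E; have := E 0 0; have := E 1 0; rewrite !mxE => -> ->.
  by apply/eqP; ring.
by move=> /eqP/matrixP E; have := E 0 0; have := E 1 0; rewrite !mxE => -> ->; rewrite mulr0 mul0r subrr.
Qed.

Theorem theorem1p3 (k : closedFieldType) (k_char0 : [pchar k] =i pred0)
  (K : zmodType) (K_fg : fg_group K)
  (R : idomainAlgType k) (R_fg : fg_algebra R) (R_normal : normal_domain R)
  (Rw : K -> R -> Prop) (R_graded : is_grading Rw)
  (R_effective : effective_grading Rw) (R_factorial : factorial_grading Rw)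
  (R_complexity : complexity_one K R)
  (R_units : only_constant_homog_units Rw) :
  (exists D : type1 k, graded_iso Rw (RAP1_homog (D := D))) \/
  (exists D : type2 k, graded_iso Rw (RAP2_homog (D := D))).
Proof.
have [L [j [j_inj j_frac]]] := fraction_field R.
have pen := exists_rational_pencil k_char0 R_graded R_units R_factorial K_fg R_fg R_effective
  R_complexity j_inj j_frac.
have [w [f [g [np type]]]] := normalize_pencil R_graded R_units j_inj pen.
have [N0 [x [wx [xP xgen]]]] := prime_generators R_graded R_units R_factorial R_fg.
have xp i : graded_prime Rw (x i) by case: (xP i).
have m0 o := member_nonzero j_inj o np.
have mc p o o' : graded_prime Rw p ->
    divides p (member f g o) -> divides p (member f g o') -> o = o' by apply: members_coprime np.
case: type => [nu|[w0 [g1 some_nu]]]; [right|left].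
  (* Infinity and 0 are prescribed so that g and f are themselves monomials in the T_ij and the
     matrix A has at least two columns. *)
  have [//|//|rest [ur _ xspec]] := special_points mc xp (pad := [:: None; Some 0]).
  pose pts := [:: None; Some 0] ++ rest.
  pose pt (i : 'I_(size rest).+2) := nth None pts i.
  have pt_inj : injective pt by move=> a b /eqP; rewrite nth_uniq // => /eqP/val_inj.
  have pt_spec i o : divides (x i) (member f g o) -> exists b, pt b = o.
    move=> /xspec H; have lt : (index o pts < (size rest).+2)%N by rewrite -[(size rest).+2]/(size pts) index_mem.
    by exists (Ordinal lt); apply: nth_index.
  have [n [l [m [y [n0 l0 yT ygen [yp ysep yspec]]]]]] :=
    pencil_data R_graded R_units R_factorial (np_f np) (np_g np) m0 mc xp xgen pt_inj (fun i => nu _) pt_spec.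
  pose A := \matrix_(r < 2, i < (size rest).+2) if r == 0 then point_lam (pt i) else point_mu (pt i).
  have A0 i : A 0 i = point_lam (pt i) by rewrite mxE eqxx.
  have A1 i : A 1 i = point_mu (pt i) by rewrite mxE.
  pose D := @Type2 k (size rest) n n0 l l0 m A (fun i i' => point_columns_free pt_inj A0 A1).
  exists D; have iso := type2_iso R_graded R_units R_factorial R_effective j_inj (D := D) np nu
    pt_inj erefl erefl A0 A1 yT ygen yp ysep yspec.
  exact iso.
move: np m0 mc some_nu; rewrite w0 g1 => np m0 mc some_nu.
(* The point 0 is prescribed so that f is a monomial and at least one block exists; infinity never
   occurs in the list, because g = 1 is a unit. *)
have [//|o|rest [ur nus xspec]] := special_points mc xp (pad := [:: Some 0]).
  by rewrite inE => /eqP ->.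
pose pts := Some 0 :: rest.
have ptsN : None \notin pts by apply/negP => /nus; rewrite /= unitr1.
pose pt (i : 'I_(size rest).+1) := nth None pts i.
have pt_inj : injective pt by move=> a b /eqP; rewrite nth_uniq // => /eqP/val_inj.
have pt_spec i o : divides (x i) (member f 1 o) -> exists b, pt b = o.
  move=> /xspec H; have lt : (index o pts < (size rest).+1)%N by rewrite -[(size rest).+1]/(size pts) index_mem.
  by exists (Ordinal lt); apply: nth_index.
have pt_in i : pt i \in pts by apply: mem_nth.
pose a i := odflt 0 (pt i).
have ptE i : pt i = Some (a i).
  by rewrite /a; move: (pt_in i); case: (pt i) => //; rewrite (negPf ptsN).
have a_inj : injective a by move=> i i' E; apply: pt_inj; rewrite !ptE E.
have pt_nu i : member f 1 (pt i) \isn't a GRing.unit by rewrite ptE.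
have [n [l [m [y [n0 l0 yT ygen [yp ysep yspec]]]]]] :=
  pencil_data R_graded R_units R_factorial (np_f np) (np_g np) m0 mc xp xgen pt_inj pt_nu pt_spec.
pose D := @Type1 k (size rest) n n0 l l0 m a a_inj.
have yT' i : \prod_t y (Tpos m t) ^+ l i t = member f 1 (Some (a i)) by rewrite -ptE.
have yspec' c o : divides (y c) (member f 1 o) -> exists i, Some (a i) = o.
  by move=> /yspec[i <-]; exists i; rewrite -ptE.
exists D; have iso := type1_iso R_graded R_units R_factorial R_effective j_inj (D := D) np erefl
  yT' ygen yp ysep yspec'.
exact iso.
Qed.
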